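(* The stabilizer of $o\in\mathcal{B}$ in $G_{\mathbb{F}}$ is $G_{\mathbb{F}}(O)=G_{\mathbb{F}}\cap O^{n\times n}$.
   Context: Let $\mathbb{K},\mathbb{F}$ be real closed fields with $\mathbb{K}\subseteq\mathbb{R}\cap\mathbb{F}$. Let $O\subsetneq\mathbb{F}$ be an order convex subring ($a,b\in O$ and $a\le c\le b$ imply $c\in O$); it is a valuation ring. Let $\Lambda=\mathbb{F}^\times/O^\times$, written additively, and let $v:\mathbb{F}\to\Lambda\cup\{\infty\}$ be the associated valuation, with $\Lambda$ ordered so that $(-v)(a)\ge(-v)(b)$ whenever $a\ge b>0$; thus $O=\{a:(-v)(a)\le 0\}$. For a semialgebraic set $V$ defined over $\mathbb{K}$, $V_{\mathbb{F}}$ denotes its $\mathbb{F}$-extension. $G<\operatorname{SL}_n$ is a connected semisimple algebraic group over $\mathbb{K}$, self-adjoint ($g\in G$ implies $g^{\mathsf T}\in G$). $S<G$ is a maximal $\mathbb{K}$-split torus with $s=s^{\mathsf T}$ for all $s\in S$; $A_{\mathbb{F}}$ is the $\mathbb{F}$-extension of the semialgebraic connected component of $S_{\mathbb{K}}$ containing $\operatorname{Id}$; $K_{\mathbb{F}}=G_{\mathbb{F}}\cap\operatorname{SO}_n(\mathbb{F})$. Let $\mathfrak{a}=\operatorname{Lie}(A_{\mathbb{R}})$; $\Sigma\subseteq\mathfrak{a}^\star$ is the root system of $\operatorname{Lie}(G_{\mathbb{R}})$ with respect to $\mathfrak{a}$. For $\alpha\in\Sigma$, $\chi_\alpha:A_{\mathbb{F}}\to\mathbb{F}_{>0}$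 is the restriction of the algebraic character of $S$ over $\mathbb{K}$ which over $\mathbb{R}$ satisfies $\chi_\alpha(\exp H)=e^{\alpha(H)}$, $H\in\mathfrak{a}$. Fix a basis $\Delta$ of $\Sigma$ and let $A^+_{\mathbb{F}}=\{a\in A_{\mathbb{F}}:\chi_\alpha(a)\ge1\ \forall\alpha\in\Delta\}$. $G_{\mathbb{F}}$ acts on symmetric positive definite matrices of determinant $1$ over $\mathbb{F}$ by $g.x=gxg^{\mathsf T}$, and $\mathcal{X}_{\mathbb{F}}=G_{\mathbb{F}}.\operatorname{Id}$. For $x=g.\operatorname{Id}$, $y=h.\operatorname{Id}$, $\delta_{\mathbb{F}}(x,y)$ is the unique $a\in A^+_{\mathbb{F}}$ with $g^{-1}h\in K_{\mathbb{F}}aK_{\mathbb{F}}$. For $a\in A_{\mathbb{F}}$, $N_{\mathbb{F}}(a)=\prod_{\alpha\in\Sigma}\max\{\chi_\alpha(a),\chi_\alpha(a)^{-1}\}$, and $d(x,y)=(-v)(N_{\mathbb{F}}(\delta_{\mathbb{F}}(x,y)))\in\Lambda$, a $G_{\mathbb{F}}$-invariant pseudo-distance. $\mathcal{B}=\mathcal{X}_{\mathbb{F}}/\!\sim$ with $x\sim y$ iff $d(x,y)=0$, with the induced $G_{\mathbb{F}}$-action; $o\in\mathcal{B}$ is the class of $\operatorname{Id}$. *)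

(* Defs.v *)
From HB Require Import structures.
From mathcomp Require Import all_boot all_order all_algebra.
From mathcomp Require Import all_classical all_reals all_analysis.
From mathcomp Require Import complex.
(* The notations of mpoly clash with those of mathcomp-analysis. *)
From mathcomp Require Import -(notations) mpoly.
Set Implicit Arguments.
Unset Strict Implicit.
Unset Printing Implicit Defensive.
Import Order.TTheory GRing.Theory Num.Theory numFieldNormedType.Exports.
Local Open Scope classical_set_scope.
Local Open Scope ring_scope.

Notation "'MPoly[' K ]_ m" := (mpoly m K)
  (at level 8, m at level 2, format "'MPoly[' K ]_ m") : type_scope.

(* The value at v of a polynomial p with coefficients in K, where v has
   coordinates in an extension iota : K -> E. *)
Definition evalp (K E : comNzRingType) (iota : {rmorphism K -> E}) (m : nat)
    (p : MPoly[K]_m) (v : 'rV[E]_m) : E :=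
  mmap iota (v 0) p.

(* A polynomial in the entries of an n x n matrix is a polynomial in n * n
   variables, the entries being listed by mxvec. *)
Definition mxeval (K E : comNzRingType) (iota : {rmorphism K -> E}) (n : nat)
    (p : MPoly[K]_(n * n)) (x : 'M[E]_n) : E :=
  evalp iota p (mxvec x).

Section MatrixGroups.
Variables (E : fieldType) (n : nat).
Implicit Types H N D : set 'M[E]_n.

Definition subgroup H : Prop :=
  [/\ H 1%:M,
      forall x y, H x -> H y -> H (x *m y) &
      forall x, H x -> x \in unitmx /\ H (invmx x)].

Definition SL : set 'M[E]_n := [set x | \det x = 1].

Definition SO : set 'M[E]_n := [set x | x *m x^T = 1%:M /\ \det x = 1].

Definition normal_in N H : Prop :=
  [/\ subgroup N, N `<=` H &
      forall h x, H h -> N x -> N (h *m x *m invmx h)].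

Definition derived H : set 'M[E]_n :=
  [set z | forall D, subgroup D ->
     (forall x y, H x -> H y -> D (x *m y *m invmx x *m invmx y)) -> D z].

Definition solvable_set H : Prop :=
  exists k : nat, iter k derived H = [set 1%:M].

Definition zariski_closed (V : set 'M[E]_n) : Prop :=
  exists P : set (MPoly[E]_(n * n)),
    V = [set x | forall p, P p -> mxeval idfun p x = 0].

Definition zariski_connected (V : set 'M[E]_n) : Prop :=
  forall U W, zariski_closed U -> zariski_closed W ->
    V `<=` U `|` W -> V `&` U `&` W = set0 -> V `<=` U \/ V `<=` W.

End MatrixGroups.

(* A linear algebraic group over a real closed field K is given by finitely many
   polynomials over K; the group itself is their zero locus over the algebraic
   closure K[i], and its E-points are their zeros in 'M[E]_n. *)
Section AlgebraicGroups.
Variables (K : rcfType) (n : nat).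
Implicit Types G S T : seq (MPoly[K]_(n * n)).

Definition points (E : comNzRingType) (iota : {rmorphism K -> E}) G :
    set 'M[E]_n :=
  [set x | forall p, p \in G -> mxeval iota p x = 0].

Definition toC : {rmorphism K -> K[i]%C} := @real_complex_def K (Phant K).

Definition Cpoints G : set 'M[K[i]%C]_n := points toC G.

Definition alg_subgroup_SL G : Prop :=
  subgroup (Cpoints G) /\ Cpoints G `<=` @SL _ n.

(* Trivial radical: no nontrivial closed connected solvable normal subgroup. *)
Definition connected_semisimple G : Prop :=
  [/\ alg_subgroup_SL G,
      zariski_connected (Cpoints G) &
      forall N, zariski_closed N -> zariski_connected N -> solvable_set N ->
        normal_in N (Cpoints G) -> N = [set 1%:M]].

Definition self_adjoint G : Prop :=
  forall g, Cpoints G g -> Cpoints G g^T.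

(* K-isomorphic to a power (G_m)^r of the multiplicative group: the isomorphism
   has entries f i j in the 2r variables (t, t^-1), hence is given by Laurent
   polynomials over K in t, and its inverse is regular, given by p. *)
Definition split_torus T : Prop :=
  alg_subgroup_SL T /\
  exists r : nat,
  exists f : 'M[MPoly[K]_(r + r)]_n,
  exists p : 'I_r -> MPoly[K]_(n * n),
  let Gm (t : 'rV[K[i]%C]_r) := forall i, t 0 i != 0 in
  let phi (t : 'rV[K[i]%C]_r) : 'M[K[i]%C]_n :=
    \matrix_(i, j)
      evalp toC (f i j) (row_mx t (map_mx (fun c => c^-1) t)) in
  let psi (x : 'M[K[i]%C]_n) : 'rV[K[i]%C]_r :=
    \row_i mxeval toC (p i) x in
  [/\ forall t, Gm t -> Cpoints T (phi t),
      forall t u, Gm t -> Gm u ->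
        phi (\row_i (t 0 i * u 0 i)) = phi t *m phi u,
      forall t, Gm t -> psi (phi t) = t &
      forall x, Cpoints T x -> Gm (psi x) /\ phi (psi x) = x].

Definition maximal_split_torus G S : Prop :=
  [/\ split_torus S, Cpoints S `<=` Cpoints G &
      forall T, split_torus T -> Cpoints T `<=` Cpoints G ->
        Cpoints S `<=` Cpoints T -> Cpoints T = Cpoints S].

(* A homomorphism S -> G_m of algebraic groups over K; as S is closed in SL_n,
   it is the restriction to S of a polynomial in the matrix entries. *)
Definition alg_character S (p : MPoly[K]_(n * n)) : Prop :=
  mxeval toC p 1%:M = 1 /\
  forall s t, Cpoints S s -> Cpoints S t ->
    mxeval toC p (s *m t) = mxeval toC p s * mxeval toC p t.

End AlgebraicGroups.

Section Semialgebraic.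
Variables (K : rcfType) (n : nat).

(* A finite disjunction of pairs (eqs, poss), each of which stands for the
   conjunction of p = 0 for p in eqs and 0 < q for q in poss. *)
Definition sa_formula : Type :=
  seq (seq (MPoly[K]_(n * n)) * seq (MPoly[K]_(n * n))).

(* The E-extension of the semialgebraic set over K that A describes. *)
Definition sa_ext (E : rcfType) (iota : {rmorphism K -> E}) (A : sa_formula) :
    set 'M[E]_n :=
  [set x | exists c, [/\ c \in A,
     forall p, p \in c.1 -> mxeval iota p x = 0 &
     forall q, q \in c.2 -> 0 < mxeval iota q x]].

Definition semialgebraic (V : set 'M[K]_n) : Prop :=
  exists A : sa_formula, V = sa_ext idfun A.

Definition closed_in (V U : set 'M[K]_n) : Prop :=
  exists2 Z : set 'M[K]_n, closed Z & U = V `&` Z.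

Definition sa_connected (V : set 'M[K]_n) : Prop :=
  semialgebraic V /\
  forall U W, semialgebraic U -> semialgebraic W ->
    closed_in V U -> closed_in V W -> U `|` W = V -> U `&` W = set0 ->
    U = V \/ W = V.

Definition sa_component (V : set 'M[K]_n) (x : 'M[K]_n) (C : set 'M[K]_n) :
    Prop :=
  [/\ C x, C `<=` V, sa_connected C &
      forall D, D x -> D `<=` V -> sa_connected D -> D `<=` C].

End Semialgebraic.

Section LieTheory.
Variables (R : realType) (n : nat).

Definition expmx (X : 'M[R]_n) : 'M[R]_n :=
  \matrix_(i, j)
    limn (fun m => (\sum_(k < m) (k`!%:R)^-1 *: X ^+ k) i j).

Definition Lie (H : set 'M[R]_n) : set 'M[R]_n :=
  [set X | forall t : R, H (expmx (t *: X))].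

Variable a : {vspace 'M[R]_n}.

Definition dual : vectType R := 'Hom(subvs_of a, R^o).

(* alpha is a root of the Lie algebra g with respect to a. *)
Definition is_root (g : set 'M[R]_n) (alpha : dual) : Prop :=
  alpha != 0 /\
  exists X, [/\ X != 0, g X &
    forall H : subvs_of a, vsval H *m X - X *m vsval H = alpha H *: X].

Definition nat_comb (Delta : seq dual) (alpha : dual) : Prop :=
  exists c : 'I_(size Delta) -> nat, alpha = \sum_(i < size Delta) Delta`_i *+ c i.

Definition root_basis (Sigma Delta : seq dual) : Prop :=
  [/\ {subset Delta <= Sigma}, free Delta &
      forall alpha, alpha \in Sigma ->
        nat_comb Delta alpha \/ nat_comb Delta (- alpha)].

End LieTheory.

Section Valuation.
Variables (F : rcfType) (O : set F).

Definition subring_of : Prop :=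
  [/\ O 1, forall x y, O x -> O y -> O (x - y) &
      forall x y, O x -> O y -> O (x * y)].

Definition order_convex : Prop :=
  forall x y c, O x -> O y -> x <= c -> c <= y -> O c.

Definition unit_of (u : F) : Prop := [/\ u != 0, O u & O u^-1].

(* The value group F^* / O^* is written additively; its elements are the cosets
   of O^*, so that its zero is O^* itself, and v 0 = {0} plays the role of
   infinity. *)
Definition valuation (x : F) : set F := [set x * u | u in unit_of].

Definition val0 : set F := unit_of.

(* (-v) x, the inverse of the coset of x. *)
Definition negval (x : F) : set F := valuation x^-1.

End Valuation.

Section Building.
Variables (F : rcfType) (O : set F) (n : nat).
(* G and A are the F-points of the group and of the split part; I indexes the
   roots, listed in Sigma, and chi gives the associated characters. *)
Variables (G A : set 'M[F]_n).
Variables (I : eqType) (Sigma Delta : seq I) (chi : I -> 'M[F]_n -> F).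

Definition Kgroup : set 'M[F]_n := G `&` @SO F n.

Definition Aplus : set 'M[F]_n :=
  [set x | A x /\ forall alpha, alpha \in Delta -> 1 <= chi alpha x].

Definition act (g x : 'M[F]_n) : 'M[F]_n := g *m x *m g^T.

Definition Xspace : set 'M[F]_n := [set act g 1%:M | g in G].

Definition delta_spec (x y a : 'M[F]_n) : Prop :=
  Aplus a /\
  exists g h, [/\ G g, G h, x = act g 1%:M, y = act h 1%:M &
    exists k l, [/\ Kgroup k, Kgroup l & invmx g *m h = k *m a *m l]].

(* By the Cartan decomposition, a with delta_spec x y a exists and is unique for
   x and y in Xspace; 1%:M is a junk value. *)
Definition delta (x y : 'M[F]_n) : 'M[F]_n := xget 1%:M (delta_spec x y).

Definition mult_norm (a : 'M[F]_n) : F :=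
  \prod_(alpha <- Sigma) Num.max (chi alpha a) (chi alpha a)^-1.

Definition bdist (x y : 'M[F]_n) : set F := negval O (mult_norm (delta x y)).

(* The points of the building are the classes of the relation bdist x y = 0. *)
Definition bclass (x : 'M[F]_n) : set 'M[F]_n :=
  [set y | Xspace y /\ bdist x y = val0 O].

Definition building : set (set 'M[F]_n) := [set bclass x | x in Xspace].

Definition bact (g : 'M[F]_n) (b : set 'M[F]_n) : set 'M[F]_n :=
  [set act g x | x in b].

Definition stabilizer (b : set 'M[F]_n) : set 'M[F]_n :=
  [set g | G g /\ bact g b = b].

End Building.

(* Main.v *)
(* The stabilizer of o consists of the g with d(Id, g.Id) = 0.  Write g = k a l with
   a in A^+_F and k, l orthogonal.  Orthogonal matrices have entries in [-1, 1], so
   the entries of g lie in O iff those of a do.  If they do, then so do the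
   chi_alpha(a) and chi_alpha(a^-1), which are polynomials in them over K, and K is
   contained in O because K is archimedean and O is order convex.  Conversely
   tr (a a^T) <= n (1 + sum_alpha (chi_alpha(a) + chi_alpha(a)^-1))^m for some m,
   and d(Id, g.Id) = 0 means that the right-hand side is in O.

   The decomposition g = k a l and this inequality are first-order over K, so by
   quantifier elimination it is enough to prove them over K or over R.  Over R,
   A = exp(a), and the inequality holds because the roots separate the points of a:
   if all roots vanish at H, then exp H commutes with the positive part of every
   element of G over R[i]; transferring back to K, some h in A of infinite order
   commutes with all these positive parts, its conjugates commute with it and have
   constant trace product with it by connectedness, so h is central and the
   Zariski closure of its powers contradicts semisimplicity.

   For the decomposition, take q in A with chi_alpha(q) > 1 for alpha in Delta and
   with the same centralizer as A.  Over R, k g l may be chosen to maximize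
   tr (k g l q), by compactness; the polar decomposition shows that it is then positive
   and commutes with q.  Over K it centralizes A, and the diagonal torus defined by
   the multiplicative relations among its eigenvalues and those of A is split, so by
   maximality of S it lies in A.  If chi_alpha(k g l) < 1 for some alpha in Delta, a
   rotation tangent to X - X^T, for a root vector X, would increase the trace. *)
Require Import Defs.
From HB Require Import structures.
From mathcomp Require Import all_boot all_order all_algebra.
From mathcomp Require Import all_classical all_reals all_analysis.
From mathcomp Require Import complex.
From mathcomp Require Import -(notations) mpoly.
From mathcomp Require qe_rcf_th qe_rcf.
From mathcomp Require Import ring lra zify.
Set Implicit Arguments.
Unset Strict Implicit.
Unset Printing Implicit Defensive.
Import Order.TTheory GRing.Theory Num.Theory numFieldNormedType.Exports.
Local Open Scope classical_set_scope.
Local Open Scope ring_scope.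

(** * Quantifier elimination commutes with embeddings *)

(** The data live over different fields: semisimplicity and maximality of [S] are statements over
    [K] and [K[i]], exponentials, roots and compactness belong to [R], and the conclusion concerns
    [F]. As [R] and [F] are related only through [K], whatever passes between them must be a
    sentence over [K]: a root vector or an element of [Lie] cannot be transferred, only the
    existence of a matrix with first-order properties can. The set [A], a connected component over
    [K], becomes manageable because it is the set of squares of [S], a description valid over every
    extension. Lie theory is kept to a minimum: root vectors are obtained as limits of rescaled
    conjugates, which stay in [Lie]. Membership in [G] comes from one principle: by independence of
    characters, the Zariski closure of a monoid of diagonal matrices is defined by equalities of
    monomials, so [G] contains the square roots and the real and imaginary powers of its positive
    elements, and the torus that such an element generates together with [S]. *)

Module QE := mathcomp.real_closed.qe_rcf.

Fixpoint tmap (K E : Type) (f : K -> E) (t : QE.term K) : QE.term E :=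
  match t with
  | QE.Var x => QE.Var E x
  | QE.Const x => QE.Const (f x)
  | QE.NatConst n => QE.NatConst E n
  | QE.Add u v => QE.Add (tmap f u) (tmap f v)
  | QE.Opp u => QE.Opp (tmap f u)
  | QE.NatMul u n => QE.NatMul (tmap f u) n
  | QE.Mul u v => QE.Mul (tmap f u) (tmap f v)
  | QE.Exp u n => QE.Exp (tmap f u) n
  end.

Fixpoint fmap (K E : Type) (f : K -> E) (p : QE.formula K) : QE.formula E :=
  match p with
  | QE.Bool b => QE.Bool b
  | QE.Equal x y => QE.Equal (tmap f x) (tmap f y)
  | QE.Lt x y => QE.Lt (tmap f x) (tmap f y)
  | QE.Le x y => QE.Le (tmap f x) (tmap f y)
  | QE.And p q => QE.And (fmap f p) (fmap f q)
  | QE.Or p q => QE.Or (fmap f p) (fmap f q)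
  | QE.Implies p q => QE.Implies (fmap f p) (fmap f q)
  | QE.Not p => QE.Not (fmap f p)
  end.

(* The elimination procedure is written in continuation-passing style, so each stage
   commutes with f provided its continuations do. *)
Section MapElimination.
Variables (K E : rcfType) (f : {rmorphism K -> E}).
Local Notation tm := (tmap f).
Local Notation fm := (fmap f).
Local Notation pm := (map (tmap f)).
Implicit Types (p q : QE.polyF K).

Lemma fmap_Size p k k' : (forall n, fm (k n) = k' n) ->
  fm (QE.Size p k) = QE.Size (pm p) k'.
Proof.
elim: p k k' => [|c p IH] k k' Hk /=; first exact: Hk.
by apply: IH => -[|m]; rewrite /= ?Hk.
Qed.

Lemma fmap_Isnull p k k' : (forall n, fm (k n) = k' n) ->
  fm (QE.Isnull p k) = QE.Isnull (pm p) k'.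
Proof. by move=> Hk; apply: fmap_Size. Qed.

Lemma fmap_LtSize p q k k' : (forall n, fm (k n) = k' n) ->
  fm (QE.LtSize p q k) = QE.LtSize (pm p) (pm q) k'.
Proof. by move=> Hk; apply: fmap_Size => n; apply: fmap_Size. Qed.

Lemma fmap_LeadCoef p k k' : (forall t, fm (k t) = k' (tm t)) ->
  fm (QE.LeadCoef p k) = QE.LeadCoef (pm p) k'.
Proof.
elim: p k k' => [|c p IH] k k' Hk /=; first by rewrite Hk /= rmorph0.
by apply: IH => l /=; rewrite !Hk.
Qed.

Lemma pmap_AmulXn a n : pm (QE.AmulXn a n) = QE.AmulXn (tm a) n.
Proof. by elim: n => //= n ->; rewrite rmorph0. Qed.

Lemma pmap_AddPoly p q : pm (QE.AddPoly p q) = QE.AddPoly (pm p) (pm q).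
Proof. by elim: p q => [|a p IH] [|b q] //=; rewrite IH. Qed.

Lemma pmap_ScalPoly c p : pm (QE.ScalPoly c p) = QE.ScalPoly (tm c) (pm p).
Proof. by rewrite /QE.ScalPoly -!map_comp. Qed.

Lemma pmap_MulPoly p q : pm (QE.MulPoly p q) = QE.MulPoly (pm p) (pm q).
Proof.
by elim: p q => [|a p IH] q //=; rewrite pmap_AddPoly pmap_ScalPoly /= IH.
Qed.

Lemma pmap_ExpPoly p n : pm (QE.ExpPoly p n) = QE.ExpPoly (pm p) n.
Proof.
case: n => [|n] //; rewrite /QE.ExpPoly !iteropS.
by elim: n => //= n IH; rewrite pmap_MulPoly IH.
Qed.

Lemma pmap_OppPoly p : pm (QE.OppPoly p) = QE.OppPoly (pm p).
Proof. by rewrite /QE.OppPoly pmap_ScalPoly /= rmorphN1. Qed.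

Lemma pmap_NatMulPoly n p : pm (QE.NatMulPoly n p) = QE.NatMulPoly n (pm p).
Proof. by rewrite /QE.NatMulPoly pmap_ScalPoly. Qed.

Lemma pmap_Deriv p : pm (QE.Deriv p) = QE.Deriv (pm p).
Proof. by elim: p => //= a p IH; rewrite pmap_AddPoly /= IH. Qed.

Definition pmapE := (pmap_AmulXn, pmap_AddPoly, pmap_ScalPoly, pmap_MulPoly,
  pmap_ExpPoly, pmap_OppPoly, pmap_NatMulPoly, pmap_Deriv).

Lemma fmap_Rediv_rec_loop q sq cq c qq r n k k' :
  (forall c qq r, fm (k (c, qq, r)) = k' (c, pm qq, pm r)) ->
  fm (QE.Rediv_rec_loop q sq cq c qq r n k) =
  QE.Rediv_rec_loop (pm q) sq (tm cq) c (pm qq) (pm r) n k'.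
Proof.
move=> Hk; elim: n c qq r => [|n IH] c qq r /=; apply: fmap_Size => m;
  case: ifP => _; rewrite ?Hk //; apply: fmap_LeadCoef => t.
  by rewrite Hk !pmapE.
by rewrite IH !pmapE.
Qed.

Lemma fmap_Rediv p q k k' :
  (forall c qq r, fm (k (c, qq, r)) = k' (c, pm qq, pm r)) ->
  fm (QE.Rediv p q k) = QE.Rediv (pm p) (pm q) k'.
Proof.
move=> Hk; apply: fmap_Isnull => -[]; first by rewrite Hk /= rmorph0.
apply: fmap_Size => n; apply: fmap_Size => m; apply: fmap_LeadCoef => t.
by rewrite (fmap_Rediv_rec_loop _ _ _ _ _ _ _ Hk) /= rmorph0.
Qed.

Lemma fmap_Rgcd_loop n p q k k' :
  (forall p, fm (k p) = k' (pm p)) ->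
  fm (QE.Rgcd_loop n p q k) = QE.Rgcd_loop n (pm p) (pm q) k'.
Proof.
move=> Hk; elim: n p q => [|n IH] p q /=; apply: fmap_Rediv => _ _ r /=;
  by apply: fmap_Isnull => -[]; rewrite ?Hk ?IH.
Qed.

Lemma fmap_Rgcd p q k k' : (forall p, fm (k p) = k' (pm p)) ->
  fm (QE.Rgcd p q k) = QE.Rgcd (pm p) (pm q) k'.
Proof.
move=> Hk; apply: fmap_LtSize => -[]; apply: fmap_Isnull => -[]; rewrite ?Hk //;
  by apply: fmap_Size => n; apply: fmap_Rgcd_loop.
Qed.

Lemma fmap_BigRgcd ps k k' : (forall p, fm (k p) = k' (pm p)) ->
  fm (QE.BigRgcd ps k) = QE.BigRgcd (map pm ps) k'.
Proof.
elim: ps k k' => [|p ps IH] k k' Hk /=; first by rewrite Hk /= rmorph0.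
by apply: IH => r; apply: fmap_Rgcd.
Qed.

Lemma fmap_Changes s k k' : (forall n, fm (k n) = k' n) ->
  fm (QE.Changes s k) = QE.Changes (pm s) k'.
Proof.
elim: s k k' => [|a s IH] k k' Hk /=; first exact: Hk.
by apply: IH => v; case: (s) => [|b s'] /=; rewrite !Hk.
Qed.

Lemma fmap_SeqPInfty ps k k' : (forall s, fm (k s) = k' (pm s)) ->
  fm (QE.SeqPInfty ps k) = QE.SeqPInfty (map pm ps) k'.
Proof.
elim: ps k k' => [|p ps IH] k k' Hk /=; first exact: Hk.
by apply: fmap_LeadCoef => t; apply: IH => s; rewrite Hk.
Qed.

Lemma fmap_SeqMInfty ps k k' : (forall s, fm (k s) = k' (pm s)) ->
  fm (QE.SeqMInfty ps k) = QE.SeqMInfty (map pm ps) k'.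
Proof.
elim: ps k k' => [|p ps IH] k k' Hk /=; first exact: Hk.
apply: fmap_LeadCoef => t; apply: fmap_Size => n; apply: IH => s.
by rewrite Hk /= rmorphN1.
Qed.

Lemma fmap_ChangesPoly ps k k' : (forall n, fm (k n) = k' n) ->
  fm (QE.ChangesPoly ps k) = QE.ChangesPoly (map pm ps) k'.
Proof.
move=> Hk; apply: fmap_SeqMInfty => s; apply: fmap_SeqPInfty => u.
by apply: fmap_Changes => n; apply: fmap_Changes => m.
Qed.

Lemma fmap_NextMod p q k k' : (forall s, fm (k s) = k' (pm s)) ->
  fm (QE.NextMod p q k) = QE.NextMod (pm p) (pm q) k'.
Proof.
move=> Hk; apply: fmap_LeadCoef => t; apply: fmap_Rediv => c _ _ /=.
by apply: fmap_Rediv => _ _ r /=; rewrite Hk !pmapE.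
Qed.

Lemma fmap_ModsAux n p q k k' : (forall s, fm (k s) = k' (map pm s)) ->
  fm (QE.ModsAux p q n k) = QE.ModsAux (pm p) (pm q) n k'.
Proof.
elim: n p q k k' => [|n IH] p q k k' Hk /=; first exact: Hk.
apply: fmap_Isnull => -[]; rewrite ?Hk //.
by apply: fmap_NextMod => r; apply: IH => s; rewrite Hk.
Qed.

Lemma fmap_Mods p q k k' : (forall s, fm (k s) = k' (map pm s)) ->
  fm (QE.Mods p q k) = QE.Mods (pm p) (pm q) k'.
Proof.
by move=> Hk; apply: fmap_Size => n; apply: fmap_Size => m; apply: fmap_ModsAux.
Qed.

Lemma pmap_PolyComb sq sc : pm (QE.PolyComb sq sc) = QE.PolyComb (map pm sq) sc.
Proof.
rewrite /QE.PolyComb size_map /reducebig.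
elim: (iota _ _) => //= i s IH; rewrite pmap_MulPoly IH pmap_ExpPoly.
by congr (QE.MulPoly (QE.ExpPoly _ _) _); elim: sq i {IH} => [|x sq IH] [|i] /=.
Qed.

Lemma pmap_Pcq sq i : pm (QE.Pcq sq i) = QE.Pcq (map pm sq) i.
Proof.
rewrite /QE.Pcq size_map; elim: (qe_rcf_th.sg_tab _) i => [|x s IH] [|i] //=.
exact: pmap_PolyComb.
Qed.

Lemma fmap_TaqsR p sq i k k' : (forall s, fm (k s) = k' (tm s)) ->
  fm (QE.TaqsR p sq i k) = QE.TaqsR (pm p) (map pm sq) i k'.
Proof.
move=> Hk; rewrite /QE.TaqsR /QE.bind_def /QE.TaqR -pmap_Pcq -!pmapE.
apply: fmap_Mods => s; apply: fmap_ChangesPoly => n.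
by rewrite Hk /= rmorph_int.
Qed.

Lemma nth_map_rmorph (s : seq K) i : (map f s)`_i = f s`_i.
Proof.
have [lti|gei] := ltnP i (size s); first exact: nth_map.
by rewrite !nth_default ?size_map ?rmorph0.
Qed.

(** These constants are entries of the inverse of an integer matrix, the one that recovers sign
    counts from Tarski queries; being rational, they are fixed by every embedding. *)
Lemma tmap_Coefs n i : tm (QE.Coefs K n i) = QE.Coefs E n i.
Proof.
case: n => [|[|n]] /=; congr QE.Const.
- by rewrite rmorph_nat.
- by rewrite -nth_map_rmorph /= fmorphV rmorph_nat rmorph0.
rewrite /qe_rcf_th.coefs -nth_map_rmorph -map_comp; congr (_`_i).
apply: eq_map => j /=.
rewrite !castmxE !cast_ord_id; set M := invmx _.
have -> u v : f (M u v) = map_mx f M u v by rewrite mxE.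
rewrite map_invmx -map_mx_comp.
by congr ((invmx _) _ _); apply/matrixP => a b; rewrite !mxE /= rmorph_int.
Qed.

Lemma fmap_CcountWeak p sq k k' : (forall s, fm (k s) = k' (tm s)) ->
  fm (QE.CcountWeak p sq k) = QE.CcountWeak (pm p) (map pm sq) k'.
Proof.
move=> Hk; rewrite /QE.CcountWeak size_map.
set aux := (fix aux s i k := match i with 0 => _ | _ => _ end).
set aux' := (fix aux s i k := match i with 0 => _ | _ => _ end).
suff H m s : fm (aux s m k) = aux' (tm s) m k' by rewrite H.
elim: m s => [|m IH] s /=; first exact: Hk.
by apply: fmap_TaqsR => t; rewrite IH /= -tmap_Coefs.
Qed.

Lemma pmap_BoundingPoly sq :
  pm (QE.BoundingPoly sq) = QE.BoundingPoly (map pm sq).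
Proof.
rewrite /QE.BoundingPoly pmap_Deriv /reducebig; congr QE.Deriv.
by elim: sq => //= p sq IH; rewrite pmap_MulPoly IH.
Qed.

Lemma fmap_CcountGt0 sp sq :
  fm (QE.CcountGt0 sp sq) = QE.CcountGt0 (map pm sp) (map pm sq).
Proof.
apply: fmap_BigRgcd => p; apply: fmap_Isnull => -[] /=; last first.
  exact: fmap_CcountWeak.
rewrite -pmap_BoundingPoly; apply: fmap_CcountWeak => c /=.
congr (QE.Or _ (QE.Or _ _)); rewrite /reducebig.
  elim: sq => //= q sq IH; congr (QE.And _ _); last exact: IH.
  exact: fmap_LeadCoef.
elim: sq => //= q sq IH; congr (QE.And _ _); last exact: IH.
by apply: fmap_Size => m; apply: fmap_LeadCoef.
Qed.

Lemma pmap_abstrX i t : pm (QE.abstrX i t) = QE.abstrX i (tm t).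
Proof.
elim: t => //= [m|u IHu v IHv|u IHu|u IHu m|u IHu v IHv|u IHu m];
  rewrite ?pmapE ?IHu ?IHv /= ?rmorphN1 //.
by case: ifP.
Qed.

End MapElimination.

(** * Clauses, and elimination of one existential quantifier *)

Definition clause (K : Type) := (seq (QE.term K) * seq (QE.term K))%type.

Section Clauses.
Variable K : rcfType.
Implicit Types (c : clause K) (s : seq (clause K)) (p : QE.formula K).

Definition clause_holds (E : rcfType) (f : K -> E) (e : seq E) c : bool :=
  all (fun t => QE.eval e (tmap f t) == 0) c.1 &&
  all (fun t => 0 < QE.eval e (tmap f t)) c.2.

(** The list is chosen before [E] and [f]: uniformity in the extension is what later makes transfer
    possible. *)
Definition has_clauses p := exists s, forall (E : rcfType) (f : {rmorphism K -> E}) e,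
  QE.qf_eval e (fmap f p) = has (clause_holds f e) s.

Lemma has_clauses_and p q : has_clauses p -> has_clauses q ->
  has_clauses (QE.And p q).
Proof.
move=> [s Hs] [t Ht].
exists [seq (c.1 ++ d.1, c.2 ++ d.2) | c <- s, d <- t] => E f e /=.
rewrite Hs Ht; elim: s {Hs} => //= c s IH.
rewrite has_cat -IH andb_orl; congr (_ || _).
rewrite has_map; elim: (t) => /= [|d t' <-]; first by rewrite andbF.
rewrite andb_orr; congr (_ || _).
by rewrite /clause_holds !all_cat andbACA.
Qed.

Lemma has_clauses_or p q : has_clauses p -> has_clauses q ->
  has_clauses (QE.Or p q).
Proof.
move=> [s Hs] [t Ht]; exists (s ++ t) => E f e /=.
by rewrite has_cat Hs Ht.
Qed.

Lemma has_clauses_ext p q :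
  (forall (E : rcfType) (f : {rmorphism K -> E}) e,
     QE.qf_eval e (fmap f p) = QE.qf_eval e (fmap f q)) ->
  has_clauses p -> has_clauses q.
Proof. by move=> pq [s Hs]; exists s => E f e; rewrite -pq. Qed.

(** A formula and its negation are treated together, because [Not] and [Implies] call for the
    clauses of a negated subformula. *)
Lemma has_clauses_all p : has_clauses p /\ has_clauses (QE.Not p).
Proof.
have lt t u : has_clauses (QE.Lt t u).
  by exists [:: ([::], [:: QE.Add u (QE.Opp t)])] => E f e /=;
    rewrite /clause_holds /= andbT orbF subr_gt0.
have eq t u : has_clauses (QE.Equal t u).
  by exists [:: ([:: QE.Add u (QE.Opp t)], [::])] => E f e /=;
    rewrite /clause_holds /= !andbT orbF subr_eq0 eq_sym.
elim: p => [b|t u|t u|t u|p [P NP] q [Q NQ]|p [P NP] q [Q NQ]|p [P NP] q [Q NQ]|p [P NP]].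
- by split; [exists (nseq b ([::], [::]))|exists (nseq (~~ b) ([::], [::]))] => E f e;
    case: b.
- split; first exact: eq.
  apply: has_clauses_ext (has_clauses_or (lt t u) (lt u t)) => E f e /=.
  by case: ltgtP.
- split; first exact: lt.
  apply: has_clauses_ext (has_clauses_or (lt u t) (eq t u)) => E f e /=.
  by case: ltgtP.
- split; last first.
    apply: has_clauses_ext (lt u t) => E f e /=.
    by case: ltgtP.
  apply: has_clauses_ext (has_clauses_or (lt t u) (eq t u)) => E f e /=.
  by case: ltgtP.
- split; first exact: has_clauses_and.
  by apply: has_clauses_ext (has_clauses_or NP NQ) => E f e /=; rewrite negb_and.
- split; first exact: has_clauses_or.
  by apply: has_clauses_ext (has_clauses_and NP NQ) => E f e /=; rewrite negb_or.
- split.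
    by apply: has_clauses_ext (has_clauses_or NP Q) => E f e /=; rewrite implybE.
  by apply: has_clauses_ext (has_clauses_and P NQ) => E f e /=; rewrite negb_imply.
- by split=> //; apply: has_clauses_ext P => E f e /=; rewrite negbK.
Qed.

(** An existential quantifier distributes over the clauses. In one clause the atoms are polynomial
    conditions on the variable [i], and [CcountGt0] decides whether they have a common solution; its
    output commutes with [f] by [fmap_CcountGt0], so one formula serves all extensions. *)
Lemma exists_eliminates i p : exists q : QE.formula K,
  forall (E : rcfType) (f : {rmorphism K -> E}) e,
  QE.qf_eval e (fmap f q) <-> exists x, QE.qf_eval (set_nth 0 e i x) (fmap f p).
Proof.
have [[s Hs] _] := has_clauses_all p.
exists (foldr (fun c => QE.Or (QE.CcountGt0 (map (QE.abstrX i) c.1)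
                                             (map (QE.abstrX i) c.2))) (QE.Bool false) s).
move=> E f e.
transitivity (exists x, has (clause_holds f (set_nth 0 e i x)) s); last first.
  by split=> -[x Hx]; exists x; rewrite ?Hs // -Hs.
elim: s {Hs} => /= [|c s IH]; first by split=> // -[].
rewrite fmap_CcountGt0 QE.eval_CcountGt0.
have HC : qe_rcf_th.ccount_gt0
    (map (QE.eval_poly e) (map (map (tmap f)) (map (QE.abstrX i) c.1)))
    (map (QE.eval_poly e) (map (map (tmap f)) (map (QE.abstrX i) c.2))) <->
    exists x, clause_holds f (set_nth 0 e i x) c.
  have Ex x : \big[andb/true]_(p0 <- map (QE.eval_poly e)
        (map (map (tmap f)) (map (QE.abstrX i) c.1))) (p0.[x] == 0) &&
      \big[andb/true]_(q <- map (QE.eval_poly e)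
        (map (map (tmap f)) (map (QE.abstrX i) c.2))) (0 < q.[x])
      = clause_holds f (set_nth 0 e i x) c.
    rewrite /clause_holds !big_map !big_all.
    by congr (_ && _); apply: eq_all => t /=; rewrite pmap_abstrX QE.abstrXP.
  split=> [/qe_rcf_th.ccount_gt0P[x]|[x Hx]]; first by rewrite Ex; exists x.
  by apply/qe_rcf_th.ccount_gt0P; exists x; rewrite Ex.
split=> [/orP[/HC[x Hx]|/IH[x Hx]]|[x /orP[Hx|Hx]]].
- by exists x; rewrite Hx.
- by exists x; rewrite Hx orbT.
- by apply/orP; left; apply/HC; exists x.
- by apply/orP; right; apply/IH; exists x.
Qed.

End Clauses.

(** * Sentences about matrices *)

(** Nonnegative elements of a real closed field are squares, so every ring morphism between such
    fields respects the order. *)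
Lemma rmorph_rcf_ge0 (K E : rcfType) (f : {rmorphism K -> E}) x :
  (0 <= f x) = (0 <= x).
Proof.
have H y : 0 <= y -> 0 <= f y.
  by move=> y0; rewrite -(sqr_sqrtr y0) rmorphXn /= sqr_ge0.
apply/idP/idP => [fx|/H //]; rewrite leNgt; apply/negP => xn.
have : 0 <= f (- x) by apply: H; rewrite oppr_ge0 ltW.
rewrite rmorphN oppr_ge0 => fx'.
have : f x = 0 by apply/le_anti; rewrite fx fx'.
by move/eqP; rewrite fmorph_eq0 => /eqP x0; rewrite x0 ltxx in xn.
Qed.

Lemma rmorph_rcf_le (K E : rcfType) (f : {rmorphism K -> E}) x y :
  (f x <= f y) = (x <= y).
Proof. by rewrite -subr_ge0 -rmorphB rmorph_rcf_ge0 subr_ge0. Qed.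

Lemma rmorph_rcf_lt (K E : rcfType) (f : {rmorphism K -> E}) x y :
  (f x < f y) = (x < y).
Proof. by rewrite !ltNge rmorph_rcf_le. Qed.

Lemma eval_tmap (K E : rcfType) (f : {rmorphism K -> E}) e t :
  QE.eval (map f e) (tmap f t) = f (QE.eval e (tmap idfun t)).
Proof.
elim: t => /= [i|c|m|t IHt u IHu|t IH|t IH m|t IHt u IHu|t IH m].
- exact: nth_map_rmorph.
- by [].
- by rewrite rmorph_nat.
- by rewrite rmorphD IHt IHu.
- by rewrite rmorphN IH.
- by rewrite rmorphMn /= IH.
- by rewrite rmorphM IHt IHu.
- by rewrite rmorphXn /= IH.
Qed.

Lemma qf_eval_fmap (K E : rcfType) (f : {rmorphism K -> E}) e p :
  QE.qf_eval (map f e) (fmap f p) = QE.qf_eval e (fmap idfun p).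
Proof.
elim: p => //= [t u|t u|t u|p -> q ->|p -> q ->|p -> q ->|p ->] //;
  rewrite !eval_tmap ?rmorph_rcf_le ?rmorph_rcf_lt //.
exact: (inj_eq (fmorph_inj _)).
Qed.

Definition complexmx (E : rcfType) m n (x y : 'M[E]_(m, n)) : 'M[E[i]%C]_(m, n) :=
  \matrix_(i, j) (x i j +i* y i j)%C.

Section Sentences.
Variables (K : rcfType) (n : nat).

Inductive mterm : Type :=
| MVar of nat
| MCst of 'M[K]_n
| MMul of mterm & mterm
| MAdd of mterm & mterm
| MOpp of mterm
| MTr of mterm.

(** A complex matrix is coded by its real and imaginary parts; [SRe] and [SIm] give the two parts of
    the value there of a polynomial over [K]. Statements over the algebraic closure thus become
    statements over the real closed field. *)
Inductive sterm : Type :=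
| SPoly of MPoly[K]_(n * n) & mterm
| SRe of MPoly[K]_(n * n) & mterm & mterm
| SIm of MPoly[K]_(n * n) & mterm & mterm
| STrace of mterm
| SNat of nat
| SAdd of sterm & sterm
| SMul of sterm & sterm
| SExp of sterm & nat.

Inductive mform : Type :=
| FTrue
| FEq of sterm & sterm
| FLt of sterm & sterm
| FMEq of mterm & mterm
| FPoints of seq (MPoly[K]_(n * n)) & mterm
| FCPoints of seq (MPoly[K]_(n * n)) & mterm & mterm
| FSa of sa_formula K n & mterm
| FAnd of mform & mform
| FOr of mform & mform
| FImp of mform & mform
| FNot of mform
| FEx of nat & mform
| FAll of nat & mform.

Section Interpretation.
Variables (E : rcfType) (f : {rmorphism K -> E}).

Fixpoint minterp (rho : nat -> 'M[E]_n) (t : mterm) : 'M[E]_n :=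
  match t with
  | MVar b => rho b
  | MCst c => map_mx f c
  | MMul t u => minterp rho t *m minterp rho u
  | MAdd t u => minterp rho t + minterp rho u
  | MOpp t => - minterp rho t
  | MTr t => (minterp rho t)^T
  end.

Fixpoint sinterp (rho : nat -> 'M[E]_n) (s : sterm) : E :=
  match s with
  | SPoly p t => mxeval f p (minterp rho t)
  | SRe p t u => complex.Re (mxeval (toC E \o f) p
                   (complexmx (minterp rho t) (minterp rho u)))
  | SIm p t u => complex.Im (mxeval (toC E \o f) p
                   (complexmx (minterp rho t) (minterp rho u)))
  | STrace t => \tr (minterp rho t)
  | SNat k => k%:R
  | SAdd s u => sinterp rho s + sinterp rho u
  | SMul s u => sinterp rho s * sinterp rho u
  | SExp s k => sinterp rho s ^+ k
  end.

Definition upd (rho : nat -> 'M[E]_n) b X : nat -> 'M[E]_n :=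
  fun k => if k == b then X else rho k.

Fixpoint finterp (rho : nat -> 'M[E]_n) (p : mform) : Prop :=
  match p with
  | FTrue => True
  | FEq s u => sinterp rho s = sinterp rho u
  | FLt s u => sinterp rho s < sinterp rho u
  | FMEq t u => minterp rho t = minterp rho u
  | FPoints G t => points f G (minterp rho t)
  | FCPoints G t u =>
      points (toC E \o f) G (complexmx (minterp rho t) (minterp rho u))
  | FSa A t => sa_ext f A (minterp rho t)
  | FAnd p q => finterp rho p /\ finterp rho q
  | FOr p q => finterp rho p \/ finterp rho q
  | FImp p q => finterp rho p -> finterp rho q
  | FNot p => ~ finterp rho p
  | FEx b p => exists X, finterp (upd rho b X) p
  | FAll b p => forall X, finterp (upd rho b X) p
  end.

(* The matrix variable b occupies the scalar variables b * n^2, ..., (b + 1) * n^2 - 1. *)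
Definition menv (e : seq E) (b : nat) : 'M[E]_n :=
  \matrix_(i, j) e`_(b * (n * n) + mxvec_index i j).

End Interpretation.

(** As in [cdef] and [pdef] below, a single term or formula over [K] must work for all [E], [f] and
    [e] at once. *)
Definition sdef (v : forall (E : rcfType), {rmorphism K -> E} -> seq E -> E) :=
  exists t : QE.term K, forall (E : rcfType) (f : {rmorphism K -> E}) e,
    QE.eval e (tmap f t) = v E f e.

Lemma sdefD v w : sdef v -> sdef w -> sdef (fun E f e => v E f e + w E f e).
Proof. by move=> [t Ht] [u Hu]; exists (QE.Add t u) => E f e /=; rewrite Ht Hu. Qed.

Lemma sdefM v w : sdef v -> sdef w -> sdef (fun E f e => v E f e * w E f e).
Proof. by move=> [t Ht] [u Hu]; exists (QE.Mul t u) => E f e /=; rewrite Ht Hu. Qed.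

Lemma sdefN v : sdef v -> sdef (fun E f e => - v E f e).
Proof. by move=> [t Ht]; exists (QE.Opp t) => E f e /=; rewrite Ht. Qed.

Lemma sdefX v k : sdef v -> sdef (fun E f e => v E f e ^+ k).
Proof. by move=> [t Ht]; exists (QE.Exp t k) => E f e /=; rewrite Ht. Qed.

Lemma sdefC c : sdef (fun E f e => f c).
Proof. by exists (QE.Const c). Qed.

Lemma sdef_nat k : sdef (fun E f e => k%:R).
Proof. by exists (QE.NatConst K k). Qed.

Lemma sdef_ext v w : (forall E f e, v E f e = w E f e) -> sdef v -> sdef w.
Proof. by move=> vw [t Ht]; exists t => E f e; rewrite Ht vw. Qed.

Lemma sdef_sum (I : Type) (r : seq I) (v : I -> forall (E : rcfType), {rmorphism K -> E} -> seq E -> E) :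
  (forall i, sdef (v i)) -> sdef (fun E f e => \sum_(i <- r) v i E f e).
Proof.
move=> Hv; elim: r => [|i r IH].
  by apply: sdef_ext (sdef_nat 0) => E f e; rewrite big_nil.
by apply: sdef_ext (sdefD (Hv i) IH) => E f e; rewrite big_cons.
Qed.

Lemma sdef_prod (I : Type) (r : seq I) (v : I -> forall (E : rcfType), {rmorphism K -> E} -> seq E -> E) :
  (forall i, sdef (v i)) -> sdef (fun E f e => \prod_(i <- r) v i E f e).
Proof.
move=> Hv; elim: r => [|i r IH].
  by apply: sdef_ext (sdef_nat 1) => E f e; rewrite big_nil.
by apply: sdef_ext (sdefM (Hv i) IH) => E f e; rewrite big_cons.
Qed.

Definition cdef (v : forall (E : rcfType), {rmorphism K -> E} -> seq E -> E[i]%C) :=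
  sdef (fun E f e => complex.Re (v E f e)) /\ sdef (fun E f e => complex.Im (v E f e)).

Lemma cdef_ext v w : (forall E f e, v E f e = w E f e) -> cdef v -> cdef w.
Proof.
by move=> vw [H1 H2]; split; [apply: sdef_ext H1|apply: sdef_ext H2] => E f e; rewrite vw.
Qed.

Lemma cdefD v w : cdef v -> cdef w -> cdef (fun E f e => v E f e + w E f e).
Proof.
move=> [v1 v2] [w1 w2]; split.
  by apply: sdef_ext (sdefD v1 w1) => E f e; case: (v E f e) (w E f e) => [? ?] [? ?].
by apply: sdef_ext (sdefD v2 w2) => E f e; case: (v E f e) (w E f e) => [? ?] [? ?].
Qed.

Lemma cdefM v w : cdef v -> cdef w -> cdef (fun E f e => v E f e * w E f e).
Proof.
move=> [v1 v2] [w1 w2]; split.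
  by apply: sdef_ext (sdefD (sdefM v1 w1) (sdefN (sdefM v2 w2))) => E f e;
    case: (v E f e) (w E f e) => [? ?] [? ?].
by apply: sdef_ext (sdefD (sdefM v1 w2) (sdefM v2 w1)) => E f e;
    case: (v E f e) (w E f e) => [? ?] [? ?].
Qed.

Lemma cdefC c : cdef (fun E f e => toC E (f c)).
Proof. by split; [apply: sdefC|apply: sdef_nat 0%N]. Qed.

Lemma cdef_nat k : cdef (fun E f e => k%:R).
Proof.
by apply: cdef_ext (cdefC k%:R) => E f e; rewrite !rmorph_nat.
Qed.

Lemma cdef_sum (I : Type) (r : seq I) (v : I -> forall (E : rcfType), {rmorphism K -> E} -> seq E -> E[i]%C) :
  (forall i, cdef (v i)) -> cdef (fun E f e => \sum_(i <- r) v i E f e).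
Proof.
move=> Hv; elim: r => [|i r IH].
  by apply: cdef_ext (cdef_nat 0) => E f e; rewrite big_nil.
by apply: cdef_ext (cdefD (Hv i) IH) => E f e; rewrite big_cons.
Qed.

Lemma cdef_prod (I : Type) (r : seq I) (v : I -> forall (E : rcfType), {rmorphism K -> E} -> seq E -> E[i]%C) :
  (forall i, cdef (v i)) -> cdef (fun E f e => \prod_(i <- r) v i E f e).
Proof.
move=> Hv; elim: r => [|i r IH].
  by apply: cdef_ext (cdef_nat 1) => E f e; rewrite big_nil.
by apply: cdef_ext (cdefM (Hv i) IH) => E f e; rewrite big_cons.
Qed.

Lemma cdefX v k : cdef v -> cdef (fun E f e => v E f e ^+ k).
Proof.
move=> Hv; apply: cdef_ext (cdef_prod (iota 0 k) (fun _ => Hv)) => E f e.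
by rewrite prodr_const_nat_ord || rewrite big_const_seq count_predT size_iota iter_mulr_1.
Qed.

Lemma sdef_minterp t i j : sdef (fun E f e => minterp f (menv e) t i j).
Proof.
elim: t i j => [b|c|t IHt u IHu|t IHt u IHu|t IH|t IH] i j.
- exists (QE.Var K (b * (n * n) + mxvec_index i j)) => E f e /=.
  by rewrite mxE.
- by apply: sdef_ext (sdefC (c i j)) => E f e; rewrite mxE.
- apply: sdef_ext (sdef_sum (index_enum 'I_n) (fun k => sdefM (IHt i k) (IHu k j))).
  by move=> E f e; rewrite mxE.
- by apply: sdef_ext (sdefD (IHt i j) (IHu i j)) => E f e; rewrite mxE.
- by apply: sdef_ext (sdefN (IH i j)) => E f e; rewrite mxE.
- by apply: sdef_ext (IH j i) => E f e; rewrite mxE.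
Qed.

Lemma cdef_complex p t u : cdef (fun E f e => mxeval (toC E \o f) p
                   (complexmx (minterp f (menv e) t) (minterp f (menv e) u))).
Proof.
apply: (@cdef_ext (fun E f e => \sum_(m <- msupp p) (toC E (f (mcoeff m p)) *
   \prod_(k < n * n) (mxvec (complexmx (minterp f (menv e) t) (minterp f (menv e) u)) 0 k) ^+ m k))%R).
  by [].
apply: cdef_sum => m; apply: cdefM; first exact: cdefC.
apply: cdef_prod => k; apply: cdefX.
case/mxvec_indexP: k => i j; split.
  by apply: sdef_ext (sdef_minterp t i j) => E f e; rewrite mxvecE mxE.
by apply: sdef_ext (sdef_minterp u i j) => E f e; rewrite mxvecE mxE.
Qed.

Lemma sdef_sinterp s : sdef (fun E f e => sinterp f (menv e) s).
Proof.
elim: s => [p t|p t u|p t u|t|k|s IHs u IHu|s IHs u IHu|s IH k] /=.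
- apply: (@sdef_ext (fun E f e => \sum_(m <- msupp p) (f (mcoeff m p) *
     \prod_(k < n * n) (mxvec (minterp f (menv e) t) 0 k) ^+ m k))%R).
    by [].
  apply: sdef_sum => m; apply: sdefM; first exact: sdefC.
  apply: sdef_prod => k; apply: sdefX.
  case/mxvec_indexP: k => i j.
  by apply: sdef_ext (sdef_minterp t i j) => E f e; rewrite mxvecE.
- exact: (cdef_complex p t u).1.
- exact: (cdef_complex p t u).2.
- exact: (sdef_sum (index_enum 'I_n) (fun i => sdef_minterp t i i)).
- exact: sdef_nat.
- exact: sdefD.
- exact: sdefM.
- exact: sdefX.
Qed.

Definition pdef (P : forall (E : rcfType), {rmorphism K -> E} -> seq E -> Prop) :=
  exists q : QE.formula K, forall (E : rcfType) (f : {rmorphism K -> E}) e,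
    QE.qf_eval e (fmap f q) <-> P E f e.

Lemma pdef_ext P Q : (forall E f e, P E f e <-> Q E f e) -> pdef P -> pdef Q.
Proof. by move=> PQ [q Hq]; exists q => E f e; rewrite Hq. Qed.

Lemma pdef_ex i P : pdef P -> pdef (fun E f e => exists x, P E f (set_nth 0 e i x)).
Proof.
move=> [q Hq]; have [q' Hq'] := exists_eliminates i q.
by exists q' => E f e; rewrite Hq'; split=> -[x Hx]; exists x; apply/Hq.
Qed.

Definition set_nths (E : rcfType) (e : seq E) (s : seq nat) (xs : seq E) :=
  foldr (fun ix e => set_nth 0 e ix.1 ix.2) e (zip s xs).

Lemma pdef_exs s P : pdef P ->
  pdef (fun E f e => exists2 xs, size xs = size s & P E f (set_nths e s xs)).
Proof.
elim: s P => [|i s IH] P HP.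
  apply: pdef_ext HP => E f e; split=> [H|[xs /size0nil -> //]].
  by exists [::].
apply: pdef_ext (IH _ (pdef_ex i HP)) => E f e; split.
  by move=> [xs sxs [x Hx]]; exists (x :: xs) => //=; rewrite sxs.
by move=> [[|x xs] //= [sxs] H]; exists xs => //; exists x.
Qed.

Lemma nth_set_nths (E : rcfType) (e : seq E) a m xs k : size xs = m ->
  (set_nths e (iota a m) xs)`_k =
  if (a <= k < a + m)%N then xs`_(k - a) else e`_k.
Proof.
elim: m a xs => [|m IH] a [|x xs] //=.
  by rewrite addn0; case: leqP => //= ak; rewrite ltnNge ak.
move=> [sxs]; rewrite nth_set_nth /= IH //.
have [->|nka] := eqVneq k a; first by rewrite leqnn subnn addnS ltnS leq_addr.
rewrite addSnnS; case: (ltngtP a k) nka => //= ak _.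
by case: ifP => // _; rewrite -[in RHS](subnSK ak).
Qed.

Lemma menv_set_nths (E : rcfType) (e : seq E) b xs : size xs = (n * n)%N ->
  menv (set_nths e (iota (b * (n * n)) (n * n)) xs) =
  upd (menv e) b (\matrix_(i, j) xs`_(mxvec_index i j)).
Proof.
move=> sxs; apply: funext => c; rewrite /upd; apply/matrixP => i j.
rewrite !mxE nth_set_nths //; case: eqP => [->|/eqP cb]; rewrite mxE.
  by rewrite leq_addr ltn_add2l ltn_ord addKn.
case: ifP => // /andP[]; move: (ltn_ord (mxvec_index i j)).
set N := (n * n)%N; set k := val _ => kN lo hi; exfalso.
(* A scalar variable of the matrix [c] inside the block of [b] forces [c = b]: its offset [k] is
   below [N], so neither [c > b] nor [c < b] is possible. *)
have : (c < b.+1)%N.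
  rewrite -(ltn_pmul2r (m := N)) ?(leq_ltn_trans _ kN) //.
  by rewrite mulSn addnC; apply: leq_ltn_trans hi; apply: leq_addr.
rewrite ltnS leq_eqVlt (negPf cb) /= => cb'.
have : (c.+1 * N <= b * N)%N by rewrite leq_mul2r cb' orbT.
rewrite mulSn => /(leq_trans); move/(_ _ lo); rewrite addnC leq_add2l.
by rewrite leqNgt kN.
Qed.

Lemma pdef_and P Q : pdef P -> pdef Q -> pdef (fun E f e => P E f e /\ Q E f e).
Proof.
move=> [p HP] [q HQ]; exists (QE.And p q) => E f e /=.
by rewrite -HP -HQ; split=> [/andP|[-> ->]].
Qed.

Lemma pdef_or P Q : pdef P -> pdef Q -> pdef (fun E f e => P E f e \/ Q E f e).
Proof.
move=> [p HP] [q HQ]; exists (QE.Or p q) => E f e /=.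
by rewrite -HP -HQ; split=> [/orP|] //; move/orP.
Qed.

Lemma pdef_eq v w : sdef v -> sdef w -> pdef (fun E f e => v E f e = w E f e).
Proof.
by move=> [t Ht] [u Hu]; exists (QE.Equal t u) => E f e /=; rewrite Ht Hu; split=> /eqP.
Qed.

Lemma pdef_lt v w : sdef v -> sdef w -> pdef (fun E f e => v E f e < w E f e).
Proof. by move=> [t Ht] [u Hu]; exists (QE.Lt t u) => E f e /=; rewrite Ht Hu. Qed.

Lemma pdef_all (T : eqType) (s : seq T) (P : T -> forall (E : rcfType), {rmorphism K -> E} -> seq E -> Prop) :
  (forall x, pdef (P x)) -> pdef (fun E f e => forall x, x \in s -> P x E f e).
Proof.
move=> HP; elim: s => [|x s IH]; first by exists (QE.Bool true).
apply: pdef_ext (pdef_and (HP x) IH) => E f e; split=> [[Hx Hs] y|H].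
  by rewrite inE => /predU1P[->|/Hs].
by split=> [|y ys]; apply: H; rewrite inE ?eqxx ?ys ?orbT.
Qed.

Lemma pdef_has (T : eqType) (s : seq T) (P : T -> forall (E : rcfType), {rmorphism K -> E} -> seq E -> Prop) :
  (forall x, pdef (P x)) -> pdef (fun E f e => exists2 x, x \in s & P x E f e).
Proof.
move=> HP; elim: s => [|x s IH].
  by exists (QE.Bool false) => E f e; split=> // -[].
apply: pdef_ext (pdef_or (HP x) IH) => E f e; split.
  by move=> [Hx|[y ys Hy]]; [exists x|exists y]; rewrite ?inE ?eqxx ?ys ?orbT.
by move=> [y]; rewrite inE => /predU1P[->|ys] Hy; [left|right; exists y].
Qed.

Lemma mx_of_seq (E : rcfType) (X : 'M[E]_n) : exists2 xs : seq E,
  size xs = (n * n)%N & \matrix_(i, j) xs`_(mxvec_index i j) = X.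
Proof.
exists [seq mxvec X 0 k | k <- enum 'I_(n * n)].
  by rewrite size_map size_enum_ord.
apply/matrixP => i j; rewrite mxE (nth_map (mxvec_index i j)) ?size_enum_ord //.
by rewrite nth_ord_enum mxvecE.
Qed.

Lemma pdef_exmx b P : pdef (fun E f e => P E f (menv e)) ->
  pdef (fun E f e => exists X, P E f (upd (menv e) b X)).
Proof.
move=> HP; apply: pdef_ext (pdef_exs (iota (b * (n * n)) (n * n)) HP) => E f e.
rewrite size_iota; split=> [[xs sxs]|[X HX]].
  by rewrite menv_set_nths //; exists (\matrix_(i, j) xs`_(mxvec_index i j)).
have [xs sxs Xxs] := mx_of_seq X.
by exists xs => //; rewrite menv_set_nths // Xxs.
Qed.

Lemma pdef_finterp p : pdef (fun E f e => finterp f (menv e) p).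
Proof.
elim: p => [|s u|s u|t u|G t|G t u|A t|p HP q HQ|p HP q HQ|p [P HP] q [Q HQ]
           |p [P HP]|b p HP|b p HP] /=.
- by exists (QE.Bool true).
- by apply: pdef_eq; apply: sdef_sinterp.
- by apply: pdef_lt; apply: sdef_sinterp.
- have H (r : seq ('I_n * 'I_n)) : exists q : QE.formula K,
     forall (E : rcfType) (f : {rmorphism K -> E}) e, QE.qf_eval e (fmap f q) =
       all (fun ij => minterp f (menv e) t ij.1 ij.2 == minterp f (menv e) u ij.1 ij.2) r.
    elim: r => [|[i j] r [q Hq]]; first by exists (QE.Bool true).
    have [[v Hv] [w Hw]] := (sdef_minterp t i j, sdef_minterp u i j).
    by exists (QE.And (QE.Equal v w) q) => E f e /=; rewrite Hv Hw Hq.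
  have [q Hq] := H (enum {: 'I_n * 'I_n}).
  exists q => E f e; rewrite Hq; split=> [/allP H1|->]; last by apply/allP.
  by apply/matrixP => i j; apply/eqP/(H1 (i, j)); rewrite mem_enum.
- by apply: pdef_all => p; apply: pdef_eq (sdef_sinterp (SPoly p t)) (sdef_nat 0).
- apply: pdef_all => p.
  apply: pdef_ext (pdef_and (pdef_eq (cdef_complex p t u).1 (sdef_nat 0))
                            (pdef_eq (cdef_complex p t u).2 (sdef_nat 0))) => E f e.
  by case: (mxeval _ _ _) => a b /=; split=> [[-> ->]|[-> ->]].
- apply: pdef_ext (pdef_has A (fun c => pdef_and
     (pdef_all c.1 (fun p => pdef_eq (sdef_sinterp (SPoly p t)) (sdef_nat 0)))
     (pdef_all c.2 (fun p => pdef_lt (sdef_nat 0) (sdef_sinterp (SPoly p t)))))) => E f e.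
  by split=> [[c cA [H1 H2]]|[c [cA H1 H2]]]; exists c.
- exact: pdef_and.
- exact: pdef_or.
- exists (QE.Implies P Q) => E f e /=; rewrite -HP -HQ; split; first by move/implyP.
  by move=> H; apply/implyP.
- exists (QE.Not P) => E f e /=; rewrite -HP; split; first by move/negP.
  by move=> H; apply/negP.
- exact: (pdef_exmx b (P := fun E f r => finterp f r p) HP).
- have [P HP'] := HP.
  have HN : pdef (fun E f e => ~ finterp f (menv e) p).
    exists (QE.Not P) => E f e /=; rewrite -HP'; split; first by move/negP.
    by move=> H; apply/negP.
  have [Q HQ] := pdef_exmx b (P := fun E f r => ~ finterp f r p) HN.
  exists (QE.Not Q) => E f e /=; split.
    move/negP; rewrite HQ => H X; apply: contrapT => HX; apply: H; by exists X.
  by move=> H; apply/negP; rewrite HQ => -[X]; apply.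
Qed.

(** Elimination yields one quantifier-free formula for all extensions; at the empty environment it
    involves only constants from [K], whose order relations [f] preserves. Variables left free are
    read as zero matrices. Used in both directions, the theorem takes a sentence from [R] to [K] and
    from there to [F]. *)
Theorem tarski_transfer (E : rcfType) (f : {rmorphism K -> E}) p :
  finterp (idfun : {rmorphism K -> K}) (fun=> 0) p <-> finterp f (fun=> 0) p.
Proof.
have [q Hq] := pdef_finterp p.
have H0 (L : rcfType) : (fun=> 0 : 'M[L]_n) = menv [::].
  by apply: funext => b; apply/matrixP => i j; rewrite !mxE nth_nil.
by rewrite !H0 -!Hq -(qf_eval_fmap f).
Qed.

End Sentences.

Arguments upd {n E} rho b X k /.

(** * Polynomial relations between characters *)

Definition mon (L : comNzRingType) n (m : multinom n) (x : 'rV[L]_n) : L :=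
  \prod_i x 0 i ^+ m i.

Definition had (L : pzSemiRingType) n (x y : 'rV[L]_n) : 'rV[L]_n :=
  \row_i (x 0 i * y 0 i).

Lemma monM (L : comNzRingType) n m (x y : 'rV[L]_n) :
  mon m (had x y) = mon m x * mon m y.
Proof.
by rewrite /mon -big_split; apply: eq_bigr => i _; rewrite mxE exprMn.
Qed.

Lemma mon1 (L : comNzRingType) n m : mon m (const_mx 1 : 'rV[L]_n) = 1.
Proof. by rewrite /mon big1 // => i _; rewrite mxE expr1n. Qed.

Lemma mevalE_mon (L : comNzRingType) n (Q : MPoly[L]_n) (x : 'rV[L]_n) :
  meval (x 0) Q = \sum_(m <- msupp Q) mcoeff m Q * mon m x.
Proof. by rewrite mevalE. Qed.

(* Independence of characters, in the form: a relation between characters of a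
   monoid persists when their values are replaced by any values that identify at
   least the equal characters. *)
Lemma dedekind (L : fieldType) (I : choiceType) (T : Type) (G : set T)
    (op : T -> T -> T) (e : T) (chi : I -> T -> L) (psi : I -> L) (c : I -> L)
    (r : seq I) :
  G e -> (forall x y, G x -> G y -> G (op x y)) ->
  (forall i, chi i e = 1) ->
  (forall i x y, G x -> G y -> chi i (op x y) = chi i x * chi i y) ->
  (forall i j, (forall x, G x -> chi i x = chi j x) -> psi i = psi j) ->
  (forall x, G x -> \sum_(i <- r) c i * chi i x = 0) ->
  \sum_(i <- r) c i * psi i = 0.
Proof.
move=> Ge GM chi1 chiM Hpsi.
pose same i j := `[< forall x, G x -> chi i x = chi j x >].
have [k] := ubnP (size r); elim: k r => // k IH [|h r]; first by rewrite !big_nil.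
rewrite ltnS => sr Hr.
pose s := seq.filter (fun i => ~~ same i h) (h :: r).
have /choice[g Hg] : forall j, exists x, ~~ same j h -> G x /\ chi j x != chi h x.
  move=> j; have [?|/asboolPn/existsNP[x /not_implyP[Gx /eqP xj]]] := boolP (same j h).
    by exists e.
  by exists x.
(* The relation translated by [g j], minus [chi j (g j)] times the relation itself, has lost the
   term [j], and its other terms are multiplied by [chi i (g j) - chi j (g j)]. *)
have step (l : seq I) : {subset l <= s} -> forall x, G x ->
    \sum_(i <- h :: r) c i * (\prod_(j <- l) (chi i (g j) - chi j (g j))) * chi i x = 0.
  elim: l => [|j l IHl] sl x Gx.
    by rewrite -[RHS](Hr x Gx); apply: eq_bigr => i _; rewrite big_nil mulr1.
  have js : j \in s by apply: sl; rewrite mem_head.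
  have Gj : G (g j) by move: js; rewrite mem_filter => /andP[/Hg[]].
  have {}IHl y : G y -> _ := IHl (fun z zl => sl z (mem_behead (s := j :: l) zl)) y.
  transitivity (\sum_(i <- h :: r) c i * (\prod_(j <- l) (chi i (g j) - chi j (g j))) * chi i (op (g j) x)
     - chi j (g j) * \sum_(i <- h :: r) c i * (\prod_(j <- l) (chi i (g j) - chi j (g j))) * chi i x).
    rewrite mulr_sumr -sumrB; apply: eq_bigr => i _; rewrite big_cons chiM //.
    by ring.
  by rewrite !IHl // ?mulr0 ?subr0 //; apply: GM.
have hs : ~~ (h \in s) by rewrite mem_filter negb_and negbK; apply/orP; left; apply/asboolP.
(* For [l = s] only the indices with the same character as [h] survive, all with the common factor
   [D], which is nonzero by the choice of [g]. This class therefore contributes nothing, and the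
   induction goes on with [s]. *)
have sumA : \sum_(i <- h :: r | same i h) c i = 0.
  have := step s (fun _ => id) e Ge.
  rewrite (bigID (same ^~ h)) /= [X in _ + X]big1_seq ?addr0; last first.
    move=> i /andP[ih ir]; rewrite (_ : \prod_(j <- s) _ = 0) ?mulr0 ?mul0r //.
    have : i \in s by rewrite mem_filter ih.
    by move=> si; rewrite (big_rem i) //= subrr mul0r.
  pose D := \prod_(j <- s) (chi h (g j) - chi j (g j)).
  rewrite (eq_bigr (fun i => c i * D)); last first.
    move=> i /asboolP ih; rewrite chi1 mulr1; congr (_ * _).
    apply: eq_big_seq => j; rewrite mem_filter => /andP[/Hg[Gj _] _].
    by rewrite ih.
  rewrite -mulr_suml => /eqP; rewrite mulf_eq0 => /orP[/eqP //|].
  rewrite prodf_seq_eq0 => /hasP[j]; rewrite mem_filter => /andP[/Hg[Gj jh] _] /=.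
  by rewrite subr_eq0 eq_sym (negPf jh).
have cut (f : I -> L) : (forall i, same i h -> f i = f h) ->
    \sum_(i <- h :: r) c i * f i = \sum_(i <- s) c i * f i.
  move=> Hf; rewrite big_filter (bigID (same ^~ h)) /=.
  rewrite (eq_bigr (fun i => c i * f h)) => [|i /Hf -> //].
  by rewrite -mulr_suml sumA mul0r add0r.
rewrite (cut psi) => [|i /asboolP]; last exact: Hpsi.
apply: IH.
  rewrite /s /= ifF; first by rewrite (leq_ltn_trans _ sr) // size_filter count_size.
  by apply/negbTE; rewrite negbK; apply/asboolP.
move=> x Gx; rewrite -(cut (chi ^~ x)) ?Hr // => i /asboolP; exact.
Qed.

(** Monomials are characters of the monoid [G], so by [dedekind] the Zariski closure of [G] is
    defined by the equalities between monomials that hold on [G]. *)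
Lemma monoid_closure (L : fieldType) n (G : set 'rV[L]_n) (Q : MPoly[L]_n) x :
  G (const_mx 1) -> (forall y z, G y -> G z -> G (had y z)) ->
  (forall y, G y -> meval (y 0) Q = 0) ->
  (forall m m', (forall y, G y -> mon m y = mon m' y) -> mon m x = mon m' x) ->
  meval (x 0) Q = 0.
Proof.
move=> G1 GM GQ Hx; rewrite mevalE_mon.
apply: (@dedekind L _ _ G (@had L n) (const_mx 1) (fun m => mon m)
  (fun m => mon m x) (fun m => mcoeff m Q)) => //.
- by move=> m; rewrite mon1.
- by move=> m y z _ _; rewrite monM.
Qed.

Definition polyfun (L : comNzRingType) n (v : 'rV[L]_n -> L) :=
  exists Q : MPoly[L]_n, forall x : 'rV[L]_n, meval (x 0) Q = v x.

Section Polyfun.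
Variables (L : comNzRingType) (n : nat).
Implicit Types v w : 'rV[L]_n -> L.

Lemma polyfunC c : polyfun (fun _ : 'rV[L]_n => c).
Proof. by exists (mpolyC n c) => x; rewrite mevalC. Qed.

Lemma polyfunX i : polyfun (fun x : 'rV[L]_n => x 0 i).
Proof. by exists (mpolyX L (mnm1 i)) => x; rewrite mevalXU. Qed.

Lemma polyfunD v w : polyfun v -> polyfun w -> polyfun (fun x => v x + w x).
Proof. by move=> [P HP] [Q HQ]; exists (P + Q) => x; rewrite mevalD HP HQ. Qed.

Lemma polyfunM v w : polyfun v -> polyfun w -> polyfun (fun x => v x * w x).
Proof. by move=> [P HP] [Q HQ]; exists (P * Q) => x; rewrite mevalM HP HQ. Qed.

Lemma polyfun_ext v w : v =1 w -> polyfun v -> polyfun w.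
Proof. by move=> vw [P HP]; exists P => x; rewrite HP vw. Qed.

Lemma polyfun_sum I (r : seq I) (v : I -> 'rV[L]_n -> L) :
  (forall i, polyfun (v i)) -> polyfun (fun x => \sum_(i <- r) v i x).
Proof.
move=> Hv; elim: r => [|i r IH].
  by apply: polyfun_ext (polyfunC 0) => x; rewrite big_nil.
by apply: polyfun_ext (polyfunD (Hv i) IH) => x; rewrite big_cons.
Qed.

Lemma polyfun_prod I (r : seq I) (v : I -> 'rV[L]_n -> L) :
  (forall i, polyfun (v i)) -> polyfun (fun x => \prod_(i <- r) v i x).
Proof.
move=> Hv; elim: r => [|i r IH].
  by apply: polyfun_ext (polyfunC 1) => x; rewrite big_nil.
by apply: polyfun_ext (polyfunM (Hv i) IH) => x; rewrite big_cons.
Qed.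

Lemma polyfun_exp v k : polyfun v -> polyfun (fun x => v x ^+ k).
Proof. by move=> [P HP]; exists (P ^+ k) => x; rewrite rmorphXn /= HP. Qed.

Lemma polyfun_evalp (K : comNzRingType) (f : {rmorphism K -> L}) m (p : MPoly[K]_m)
    (v : 'I_m -> 'rV[L]_n -> L) :
  (forall i, polyfun (v i)) -> polyfun (fun x => mmap f (fun i => v i x) p).
Proof.
move=> Hv; apply: polyfun_sum => u; apply: polyfunM; first exact: polyfunC.
by apply: polyfun_prod => i; apply: polyfun_exp.
Qed.

Lemma polyfun_mxeval (K : comNzRingType) (f : {rmorphism K -> L}) k
    (p : MPoly[K]_(k * k)) (v : 'rV[L]_n -> 'M[L]_k) :
  (forall i j, polyfun (fun x => v x i j)) -> polyfun (fun x => mxeval f p (v x)).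
Proof.
move=> Hv; apply: polyfun_evalp => l; case/mxvec_indexP: l => i j.
by apply: polyfun_ext (Hv i j) => x; exact: (esym (mxvecE _ _ _)).
Qed.

End Polyfun.

Lemma conj_diagE (L : comNzRingType) n (P P' : 'M[L]_n) d i j :
  (P' *m diag_mx d *m P) i j = \sum_k P' i k * d 0 k * P k j.
Proof.
rewrite mxE; apply: eq_bigr => k _; congr (_ * _).
rewrite mxE (bigD1 k) //= !mxE eqxx mulr1n big1 ?addr0 // => l lk.
by rewrite !mxE (negPf lk) mulr0n mulr0.
Qed.

Lemma polyfun_conj_diag (L : comNzRingType) n (P P' : 'M[L]_n) i j :
  polyfun (fun d => (P' *m diag_mx d *m P) i j).
Proof.
apply: polyfun_ext (fun d => esym (conj_diagE P P' d i j)) _.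
by apply: polyfun_sum => k; do 2?[apply: polyfunM]; try exact: polyfunC;
   exact: polyfunX.
Qed.

Definition zeros (K L : comNzRingType) (f : {rmorphism K -> L}) n
    (G : set (MPoly[K]_(n * n))) : set 'M[L]_n :=
  [set x | forall p, G p -> mxeval f p x = 0].

Lemma zeros_monoid_closure (K : comNzRingType) (L : fieldType) (f : {rmorphism K -> L}) n
    (V : set (MPoly[K]_(n * n))) (G : set 'rV[L]_n) (P P' : 'M[L]_n) x :
  G (const_mx 1) -> (forall y z, G y -> G z -> G (had y z)) ->
  (forall y, G y -> zeros f V (P' *m diag_mx y *m P)) ->
  (forall m m', (forall y, G y -> mon m y = mon m' y) -> mon m x = mon m' x) ->
  zeros f V (P' *m diag_mx x *m P).
Proof.
move=> G1 GM GV Hx p Vp.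
have [Q HQ] := polyfun_mxeval f p (polyfun_conj_diag P P').
rewrite -HQ; apply: monoid_closure G1 GM _ Hx => y Gy.
by rewrite HQ; apply: GV.
Qed.

Definition row_exp (L : pzSemiRingType) n (mu : 'rV[L]_n) k := map_mx (fun x => x ^+ k) mu.

(* A group defined by polynomial equations that contains a diagonalizable matrix
   contains its image under every function that is multiplicative on the
   spectrum. *)
Lemma zeros_multiplicative (K : comNzRingType) (L : fieldType) (f : {rmorphism K -> L}) n
    (V : set (MPoly[K]_(n * n))) (P P' : 'M[L]_n) (mu : 'rV[L]_n) (D : set L) (phi : L -> L) :
  D 1 -> (forall x y, D x -> D y -> D (x * y)) -> (forall i, D (mu 0 i)) ->
  phi 1 = 1 -> (forall x y, D x -> D y -> phi (x * y) = phi x * phi y) ->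
  (forall k, zeros f V (P' *m diag_mx (row_exp mu k) *m P)) ->
  zeros f V (P' *m diag_mx (map_mx phi mu) *m P).
Proof.
move=> D1 DM Dmu phi1 phiM H.
apply: (@zeros_monoid_closure _ _ _ _ _ [set y | exists k, y = row_exp mu k]).
- by exists 0%N; apply/rowP => i; rewrite !mxE expr0.
- move=> _ _ [k ->] [l ->]; exists (k + l)%N.
  by apply/rowP => i; rewrite !mxE exprD.
- by move=> _ [k ->].
move=> m m' Hm.
have Dexp x k : D x -> D (x ^+ k).
  by move=> Dx; elim: k => [|k IH]; rewrite ?expr0 // exprS; apply: DM.
have phiX x k : D x -> phi (x ^+ k) = phi x ^+ k.
  by move=> Dx; elim: k => [|k IH]; rewrite ?expr0 // !exprS phiM ?IH //; apply: Dexp.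
have phimon u : mon u (map_mx phi mu) = phi (mon u mu).
  have : D (mon u mu) /\ mon u (map_mx phi mu) = phi (mon u mu); last by case.
  rewrite /mon; elim: (index_enum _) => [|i r [IH1 IH2]]; first by rewrite !big_nil.
  by rewrite !big_cons IH2 mxE -phiX // -phiM //; try split; auto.
have /(_ mu) := Hm; rewrite !phimon => -> //.
by exists 1%N; apply/rowP => i; rewrite mxE expr1.
Qed.

(** * Spectral calculus *)

(** The carrier of a functional calculus: for [x = spec P d] the matrix [spec P (map_mx phi d)] is
    phi(x), which does not depend on the choice of [P] and [d] by [spec_uniq]. *)
Definition spec (L : comUnitRingType) n (P : 'M[L]_n) (d : 'rV[L]_n) : 'M[L]_n :=
  invmx P *m diag_mx d *m P.

Section Spec.
Variables (L : fieldType) (n : nat).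
Implicit Types (P Q X : 'M[L]_n) (a b : 'rV[L]_n).

Lemma specM P a b : P \in unitmx -> spec P a *m spec P b = spec P (had a b).
Proof.
move=> Pu; rewrite /spec !mulmxA mulmxK //; congr (_ *m _).
rewrite -mulmxA mulmx_diag; congr (_ *m diag_mx _); apply/rowP => i; rewrite !mxE.
Qed.

Lemma spec1 P : P \in unitmx -> spec P (const_mx 1) = 1%:M.
Proof. by move=> Pu; rewrite /spec diag_const_mx mulmx1 mulVmx. Qed.

Lemma spec_tr P a : P \in unitmx -> (spec P a)^T = spec (invmx P^T) a.
Proof. by move=> Pu; rewrite /spec !trmx_mul tr_diag_mx trmx_inv invmxK mulmxA. Qed.

(** Written in the two eigenbases, [X] has nonzero entries only where the eigenvalues coincide, and
    there their images under [phi] coincide too. The function [phi] is arbitrary: a root, a power or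
    an indicator. *)
Lemma spec_intertwine P Q X a b (phi : L -> L) : P \in unitmx -> Q \in unitmx ->
  X *m spec P a = spec Q b *m X ->
  X *m spec P (map_mx phi a) = spec Q (map_mx phi b) *m X.
Proof.
move=> Pu Qu; rewrite /spec !mulmxA => H.
pose M := Q *m X *m invmx P.
have HM : M *m diag_mx a = diag_mx b *m M.
  have := congr1 (fun Y => Q *m Y *m invmx P) H.
  by rewrite !mulmxA mulmxK // mulmxV // mul1mx -!mulmxA.
have HM' : M *m diag_mx (map_mx phi a) = diag_mx (map_mx phi b) *m M.
  apply/matrixP => i j; have /matrixP/(_ i j) := HM.
  rewrite !mul_mx_diag !mul_diag_mx !mxE [in b 0 i * _]mulrC => /eqP.
  rewrite -subr_eq0 -mulrBr mulf_eq0 => /orP[/eqP ->|]; first by rewrite mul0r mulr0.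
  by rewrite subr_eq0 => /eqP ->; rewrite mulrC.
have -> : X = invmx Q *m M *m P by rewrite /M !mulmxA mulVmx // mul1mx mulmxKV.
clearbody M.
by rewrite !mulmxA !mulmxK //; congr (_ *m _); rewrite -!mulmxA HM'.
Qed.

Lemma spec_uniq P Q a b (phi : L -> L) : P \in unitmx -> Q \in unitmx ->
  spec P a = spec Q b -> spec P (map_mx phi a) = spec Q (map_mx phi b).
Proof.
move=> Pu Qu H; have := @spec_intertwine P Q 1%:M a b phi Pu Qu.
by rewrite !mul1mx !mulmx1; apply.
Qed.

Lemma spec_comm P X a (phi : L -> L) : P \in unitmx ->
  X *m spec P a = spec P a *m X ->
  X *m spec P (map_mx phi a) = spec P (map_mx phi a) *m X.
Proof. by move=> Pu; apply: spec_intertwine. Qed.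

Lemma spec_sym P a (phi : L -> L) : P \in unitmx ->
  (spec P a)^T = spec P a ->
  (spec P (map_mx phi a))^T = spec P (map_mx phi a).
Proof.
move=> Pu; rewrite !spec_tr // => H; apply: spec_uniq => //.
by rewrite unitmx_inv unitmx_tr.
Qed.

Lemma map_map_mx (R S T : Type) m k (f : S -> T) (g : R -> S) (A : 'M[R]_(m, k)) :
  map_mx f (map_mx g A) = map_mx (fun x => f (g x)) A.
Proof. by apply/matrixP => i j; rewrite !mxE. Qed.

Lemma spec_unit P a : P \in unitmx -> (forall i, a 0 i != 0) -> spec P a \in unitmx.
Proof.
move=> Pu a0; rewrite /spec !unitmx_mul unitmx_inv Pu /= andbT.
by rewrite unitmxE det_diag unitfE; apply/prodf_neq0 => i _.
Qed.

Lemma spec_inv P a : P \in unitmx -> (forall i, a 0 i != 0) ->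
  invmx (spec P a) = spec P (map_mx (fun x => x^-1) a).
Proof.
move=> Pu a0; 
have H : spec P a *m spec P (map_mx (fun x => x^-1) a) = 1%:M.
  rewrite specM // -(spec1 Pu); congr spec; apply/rowP => i.
  by rewrite !mxE mulfV.
by rewrite -[RHS]mul1mx -(mulVmx (spec_unit Pu a0)) -mulmxA H mulmx1.
Qed.

Lemma spec_row_exp P a k : P \in unitmx ->
  spec P (row_exp a k) = iter k (mulmx (spec P a)) 1%:M.
Proof.
move=> Pu; elim: k => [|k IH] /=.
  by rewrite -(spec1 Pu); congr spec; apply/rowP => i; rewrite !mxE.
by rewrite -IH specM //; congr spec; apply/rowP => i; rewrite !mxE exprS.
Qed.

Lemma spec_trace P a : P \in unitmx -> \tr (spec P a) = \sum_i a 0 i.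
Proof. by move=> Pu; rewrite /spec -mulmxA mxtrace_mulC mulmxK // mxtrace_diag. Qed.

Lemma spec_det P a : P \in unitmx -> \det (spec P a) = \prod_i a 0 i.
Proof.
move=> Pu; rewrite /spec !det_mulmx det_inv det_diag mulrAC mulVr ?mul1r //.
Qed.

Lemma map_spec (M : fieldType) (f : {rmorphism L -> M}) P a :
  map_mx f (spec P a) = spec (map_mx f P) (map_mx f a).
Proof. by rewrite /spec !map_mxM map_invmx map_diag_mx. Qed.

End Spec.

Lemma spec_inj (L : fieldType) n (P : 'M[L]_n) (a b : 'rV[L]_n) : P \in unitmx ->
  spec P a = spec P b -> a = b.
Proof.
move=> Pu /(congr1 (fun X => P *m X *m invmx P)).
rewrite /spec !mulmxA mulmxV // !mul1mx !mulmxK // => /matrixP E; apply/rowP => i.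
by have := E i i; rewrite !mxE eqxx !mulr1n.
Qed.

Definition ctr (E : rcfType) m n (A : 'M[E[i]%C]_(m, n)) : 'M[E[i]%C]_(n, m) :=
  map_mx (@conjc E) A^T.

Section Conjugation.
Variable E : rcfType.
Local Notation C := (E[i]%C).
Local Notation toCm := (map_mx (toC E)).

Lemma ctrM m n p (A : 'M[C]_(m, n)) (B : 'M[C]_(n, p)) :
  ctr (A *m B) = ctr B *m ctr A.
Proof. by rewrite /ctr trmx_mul map_mxM. Qed.

Lemma ctrK m n (A : 'M[C]_(m, n)) : ctr (ctr A) = A.
Proof. by apply/matrixP => i j; rewrite !mxE conjcK. Qed.

Lemma ctr_toC m n (A : 'M[E]_(m, n)) : ctr (toCm A) = toCm A^T.
Proof. by apply/matrixP => i j; rewrite !mxE conjc_real. Qed.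

Lemma conj_toCm m n (A : 'M[E]_(m, n)) : map_mx (@conjc E) (toCm A) = toCm A.
Proof. by apply/matrixP => i j; rewrite !mxE conjc_real. Qed.

Lemma ctr_unit n (A : 'M[C]_n) : (ctr A \in unitmx) = (A \in unitmx).
Proof. by rewrite /ctr map_unitmx unitmx_tr. Qed.

Lemma ctr_inv n (A : 'M[C]_n) : ctr (invmx A) = invmx (ctr A).
Proof. by rewrite /ctr trmx_inv map_invmx. Qed.

Lemma ctr_diag n (d : 'rV[C]_n) : ctr (diag_mx d) = diag_mx (map_mx (@conjc E) d).
Proof. by rewrite /ctr tr_diag_mx map_diag_mx. Qed.

Lemma toCm_inj m n : injective (toCm : 'M[E]_(m, n) -> 'M[C]_(m, n)).
Proof.
move=> A B /matrixP H; apply/matrixP => i j; have := H i j; rewrite !mxE.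
exact: complexI.
Qed.

Lemma conj_toCmP m n (A : 'M[C]_(m, n)) : map_mx (@conjc E) A = A ->
  A = toCm (map_mx (@complex.Re E) A).
Proof.
move=> /matrixP H; apply/matrixP => i j; have := H i j; rewrite !mxE.
by case: (A i j) => x y [] /eqP; rewrite eq_sym -addr_eq0 -mulr2n mulrn_eq0 /= => /eqP ->.
Qed.

Lemma herm_spectral n (A : 'M[C]_n) : ctr A = A ->
  exists u d, [/\ u \in unitmx, invmx u = ctr u & A = spec u (toCm d)].
Proof.
move=> HA.
have conjE (x : C) : Num.conj x = conjc x by [].
have Aherm : A \is hermsymmx.
  apply/is_hermitianmxP; rewrite expr0 scale1r -[LHS]HA.
  by apply/matrixP => i j; rewrite !mxE.
have /orthomx_spectralP AE := hermitian_normalmx Aherm.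
have /mxOverP dreal := hermitian_spectral_diag_real Aherm.
exists (spectralmx A), (map_mx (@complex.Re E) (spectral_diag A)); split.
- exact: spectral_unit.
- rewrite invmx_unitary ?spectral_unitarymx //.
- have -> : toCm (map_mx (@complex.Re E) (spectral_diag A)) = spectral_diag A.
    by apply/rowP => j; rewrite !mxE; apply: RRe_real.
  exact: AE.
Qed.

(** The spectral theorem holds over [E[i]]; [real_similar] replaces the complex similarity between
    two real matrices by a real one. The resulting [P] is only invertible, so later bounds on
    eigenvalues or entries pass through traces instead of orthonormal bases. *)
Lemma real_spectral n (A : 'M[E]_n) : A^T = A ->
  exists P d, P \in unitmx /\ A = spec P d.
Proof.
move=> HA; have := @herm_spectral _ (toCm A); rewrite ctr_toC HA => /(_ erefl).
move=> [u [d [uu _ Aud]]].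
have sim : similar_in unitmx (toCm A) (diag_mx (toCm d)).
  by exists u => //; apply/(similarP uu); rewrite Aud /spec !mulmxA mulmxV // mul1mx.
have rl (m k : nat) (B : 'M[E]_(m, k)) : toCm B \is a mxOver Num.real.
  by apply/mxOverP => i j; rewrite mxE; apply/complex_realP; exists (B i j).
have [|P /andP[/= Preal Pu] PAD] := real_similar sim (rl _ _ A).
  by rewrite -map_diag_mx; apply: rl.
pose P0 := map_mx (@complex.Re E) P.
have PP0 : P = toCm P0.
  apply/matrixP => i j; rewrite !mxE; symmetry; apply: RRe_real.
  by move/mxOverP: Preal.
have P0u : P0 \in unitmx by rewrite -(map_unitmx (toC E)) -PP0.
exists P0, d; split=> //; apply: toCm_inj.
rewrite map_spec -PP0 /spec -mulmxA; move/(similarP Pu): PAD => <-.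
by rewrite mulmxA mulVmx // mul1mx.
Qed.

End Conjugation.

Section Positive.
Variables (E : rcfType) (n : nat).
Local Notation C := (E[i]%C).
Local Notation toCm := (map_mx (toC E)).

Lemma mulmxtr_diag_ge0 m k (M : 'M[E]_(m, k)) i : 0 <= (M *m M^T) i i.
Proof. by rewrite mxE sumr_ge0 // => j _; rewrite mxE -expr2 sqr_ge0. Qed.

Lemma mulmxtr_diag_eq0 m k (M : 'M[E]_(m, k)) i : (M *m M^T) i i = 0 -> row i M = 0.
Proof.
rewrite mxE => /eqP; rewrite psumr_eq0; last by move=> j _; rewrite mxE -expr2 sqr_ge0.
move=> /allP H; apply/rowP => j; rewrite !mxE; have := H j (mem_index_enum _).
by rewrite /= mxE -expr2 sqrf_eq0 => /eqP.
Qed.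

Lemma row_unit_neq0 (L : fieldType) (M : 'M[L]_n) i : M \in unitmx -> row i M != 0.
Proof.
move=> Mu; apply/eqP => r0.
have : row i (M *m invmx M) = 0 by rewrite row_mul r0 mul0mx.
rewrite mulmxV // => /rowP/(_ i); rewrite !mxE eqxx => /eqP.
by rewrite oner_eq0.
Qed.

Lemma mulmxtr_diag_gt0 (M : 'M[E]_n) i : M \in unitmx -> 0 < (M *m M^T) i i.
Proof.
move=> Mu; rewrite lt_def mulmxtr_diag_ge0 andbT; apply/eqP => /mulmxtr_diag_eq0 r0.
by have := row_unit_neq0 i Mu; rewrite r0 eqxx.
Qed.

Definition rpd (A : 'M[E]_n) : Prop :=
  A^T = A /\ exists (P : 'M[E]_n) (d : 'rV[E]_n), [/\ P \in unitmx, forall i, 0 < d 0 i & A = spec P d].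

Lemma spec_rowE (L : fieldType) (P : 'M[L]_n) d (Y : 'M[L]_n) i : P \in unitmx ->
  (P *m spec P d *m Y) i i = d 0 i * (P *m Y) i i.
Proof.
move=> Pu; rewrite /spec !mulmxA mulmxV // mul1mx -mulmxA mul_diag_mx mxE.
by [].
Qed.

(** Row [i] of [P] is an eigenvector: the diagonal entry [i] of [(P y) (P y)^T] is [d 0 i] times
    that of [P P^T], and both are positive. *)
Lemma rpd_mulmxtr y : y \in unitmx -> rpd (y *m y^T).
Proof.
move=> yu; have sy : (y *m y^T)^T = y *m y^T by rewrite trmx_mul trmxK.
split=> //; have [P [d [Pu Hd]]] := real_spectral sy; exists P, d; split=> // i.
have := spec_rowE d P^T i Pu; rewrite -Hd.
have -> : P *m (y *m y^T) *m P^T = (P *m y) *m (P *m y)^T by rewrite trmx_mul !mulmxA.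
move=> H; have := @mulmxtr_diag_gt0 (P *m y) i; rewrite H unitmx_mul Pu yu => /(_ isT).
by rewrite pmulr_lgt0 // mulmxtr_diag_gt0.
Qed.

Lemma rpd_fun P d phi : P \in unitmx -> (spec P d)^T = spec P d ->
  (forall i, 0 < phi (d 0 i)) -> rpd (spec P (map_mx phi d)).
Proof.
move=> Pu sP phi0; split; first exact: spec_sym.
by exists P, (map_mx phi d); split=> // i; rewrite mxE.
Qed.

Lemma rpd_sqrt A : rpd A -> exists B, [/\ rpd B, B *m B = A &
  forall X, X *m A = A *m X -> X *m B = B *m X].
Proof.
move=> [sA [P [d [Pu d0 AE]]]]; subst A.
exists (spec P (map_mx Num.sqrt d)); split.
- by apply: rpd_fun => // i; rewrite sqrtr_gt0.
- rewrite specM //; congr spec; apply/rowP => i; rewrite !mxE -expr2 sqr_sqrtr //.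
  exact: ltW.
- by move=> X; apply: spec_comm.
Qed.

Lemma rpd_sqr_inj A B : rpd A -> rpd B -> A *m A = B *m B -> A = B.
Proof.
move=> [_ [P [a [Pu a0 ->]]]] [_ [Q [b [Qu b0 ->]]]].
rewrite !specM // => H; have := spec_uniq Num.sqrt Pu Qu H.
have sq (x : 'rV[E]_n) : (forall i, 0 < x 0 i) -> map_mx Num.sqrt (had x x) = x.
  by move=> x0; apply/rowP => i; rewrite !mxE -expr2 sqrtr_sqr gtr0_norm.
by rewrite !sq.
Qed.

Lemma rpd_unit A : rpd A -> A \in unitmx.
Proof. by move=> [_ [P [d [Pu d0 ->]]]]; apply: spec_unit => // i; rewrite gt_eqF. Qed.

Lemma rpd_inv A : rpd A -> rpd (invmx A).
Proof.
move=> [sA [P [d [Pu d0 AE]]]]; subst A.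
rewrite spec_inv //; last by move=> i; rewrite gt_eqF.
by apply: rpd_fun => // i; rewrite invr_gt0.
Qed.

Definition hpd (A : 'M[C]_n) : Prop :=
  ctr A = A /\ exists (u : 'M[C]_n) (d : 'rV[E]_n), [/\ u \in unitmx, invmx u = ctr u,
     forall i, 0 < d 0 i & A = spec u (toCm d)].

Lemma hpd_mulmxctr z : z \in unitmx -> hpd (z *m ctr z).
Proof.
move=> zu; have sz : ctr (z *m ctr z) = z *m ctr z by rewrite ctrM ctrK.
split=> //; have [u [d [uu u1 Hd]]] := herm_spectral sz; exists u, d; split=> // i.
have := spec_rowE (toCm d) (ctr u) i uu; rewrite -Hd -u1 mulmxV //.
rewrite (_ : 1%:M i i = 1) ?mulr1; last by rewrite mxE eqxx.
have -> : u *m (z *m ctr z) *m invmx u = (u *m z) *m ctr (u *m z).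
  by rewrite ctrM u1 !mulmxA.
rewrite mxE [RHS]mxE => H; rewrite -ltcR -[X in _ < X]H.
rewrite lt_def sumr_ge0 ?andbT; last by move=> j _; rewrite !mxE mulcJ_ge0.
rewrite psumr_neq0; last by move=> j _; rewrite !mxE mulcJ_ge0.
have /matrix0Pn[k [j]] : row i (u *m z) != 0.
  by apply: row_unit_neq0; rewrite unitmx_mul uu.
rewrite ord1 mxE => nz; apply/hasP; exists j; first exact: mem_index_enum.
rewrite !mxE /= lt_def mulcJ_ge0 andbT mulf_neq0 //.
  by move: nz; rewrite mxE.
by rewrite conjc_eq0; move: nz; rewrite mxE.
Qed.

Lemma ctr_spec (u : 'M[C]_n) d : invmx u = ctr u -> u \in unitmx ->
  ctr (spec u d) = spec u (map_mx (@conjc E) d).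
Proof.
move=> u1 uu; rewrite /spec !ctrM ctr_diag u1 ctrK mulmxA //.
Qed.

Lemma hpd_fun (u : 'M[C]_n) (d : 'rV[E]_n) (phi : E -> E) : u \in unitmx -> invmx u = ctr u ->
  (forall i, 0 < phi (d 0 i)) -> hpd (spec u (toCm (map_mx phi d))).
Proof.
move=> uu u1 phi0; split.
  by rewrite (ctr_spec _ u1 uu) conj_toCm.
by exists u, (map_mx phi d); split=> // i; rewrite mxE.
Qed.

Lemma hpd_sqr_inj A B : hpd A -> hpd B -> A *m A = B *m B -> A = B.
Proof.
move=> [_ [P [a [Pu _ a0 ->]]]] [_ [Q [b [Qu _ b0 ->]]]].
rewrite (specM _ _ Pu) (specM _ _ Qu) => H.
have {H} := spec_uniq (fun z => toC E (Num.sqrt (complex.Re z))) Pu Qu H.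
have sq (x : 'rV[E]_n) : (forall i, 0 < x 0 i) ->
    map_mx (fun z => toC E (Num.sqrt (complex.Re z))) (had (toCm x) (toCm x)) = toCm x.
  move=> x0; apply/rowP => i; rewrite !mxE /= mul0r subr0.
  by rewrite -expr2 sqrtr_sqr gtr0_norm.
by rewrite !sq.
Qed.

Lemma hpd_unit A : hpd A -> A \in unitmx.
Proof.
move=> [_ [P [d [Pu _ d0 ->]]]]; apply: spec_unit => // i.
by rewrite mxE fmorph_eq0 gt_eqF.
Qed.

End Positive.

(** * The matrix exponential *)

Section MatrixExponential.
Variables (R : realType) (n : nat).
Implicit Types (X Y : 'M[R]_n).

Definition mbound (B : R) X := forall i j, `|X i j| <= B.

Lemma mbound_exists X : exists2 B, 1 <= B & mbound B X.
Proof.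
exists (1 + \sum_i \sum_j `|X i j|).
  by rewrite lerDl sumr_ge0 // => i _; rewrite sumr_ge0.
move=> i j; rewrite (bigD1 i) //= (bigD1 j) //=.
have : 0 <= \sum_(k < n | k != j) `|X i k| by rewrite sumr_ge0.
have : 0 <= \sum_(k < n | k != i) \sum_(l < n) `|X k l|.
  by rewrite sumr_ge0 // => k _; rewrite sumr_ge0.
by lra.
Qed.

Lemma mbound_mul B C X Y : mbound B X -> mbound C Y ->
  mbound (n%:R * (B * C)) (X *m Y).
Proof.
move=> HX HY i j; rewrite mxE (le_trans (ler_norm_sum _ _ _)) //.
rewrite mulr_natl -[X in _ *+ X](card_ord n) -sumr_const ler_sum // => k _.
by rewrite normrM ler_pM.
Qed.

Lemma expmx_pow_bound B X k : 1 <= B -> mbound B X ->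
  mbound ((n%:R * B) ^+ k) (X ^+ k).
Proof.
move=> B1 HX; elim: k => [|k IH] i j.
  by rewrite !expr0 mxE; case: (i == j); rewrite ?normr1 ?normr0.
rewrite exprS; apply: le_trans (mbound_mul HX IH i j) _.
by rewrite mulrA -exprS.
Qed.

Lemma expmx_pow_lipschitz B e X Y k : 1 <= B -> mbound B X -> mbound B Y ->
  mbound e (X - Y) -> mbound (k%:R * (n%:R * B) ^+ k * e) (X ^+ k - Y ^+ k).
Proof.
move=> B1 HX HY He; elim: k => [|k IH] i j.
  by rewrite !expr0 subrr mxE normr0 mulr0n !mul0r.
have n0 : (0 < n)%N by case: n i => [[]|].
have e0 : 0 <= e by apply: le_trans (He i j).
have -> : X ^+ k.+1 - Y ^+ k.+1 = X ^+ k *m (X - Y) + (X ^+ k - Y ^+ k) *m Y.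
  by rewrite mulmxBr mulmxBl !exprSr addrA subrK.
rewrite mxE (le_trans (ler_normD _ _)) //.
have H1 := mbound_mul (expmx_pow_bound k B1 HX) He i j.
have H2 := mbound_mul IH HY i j.
apply: le_trans (lerD H1 H2) _.
have nB : n%:R <= n%:R * B by rewrite ler_peMr.
have c0 : 0 <= (n%:R * B) ^+ k by rewrite exprn_ge0 // mulr_ge0 // (le_trans _ B1).
rewrite exprS (_ : k.+1%:R = k%:R + 1 :> R); last by rewrite -natr1.
have : n%:R * ((n%:R * B) ^+ k * e) <= n%:R * B * ((n%:R * B) ^+ k * e).
  by rewrite ler_wpM2r // mulr_ge0.
set c := (n%:R * B) ^+ k; set N := n%:R : R; set kk := k%:R : R.
by move=> H; rewrite [leRHS](_ : _ = N * B * (c * e) + N * (kk * c * e * B)) ?lerD2r //; ring.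
Qed.

Lemma scalemx_exp (t : R) X k : (t *: X) ^+ k = t ^+ k *: X ^+ k.
Proof.
elim: k => [|k IH]; first by rewrite !expr0 scale1r.
by rewrite !exprS IH -[_ * _]/(_ *m _) -scalemxAl -scalemxAr scalerA.
Qed.

Definition exp_psum X m : 'M[R]_n := \sum_(k < m) (k`!%:R)^-1 *: X ^+ k.

Lemma exp_psumE X m i j :
  exp_psum X m i j = series (fun k => (k`!%:R)^-1 * (X ^+ k) i j) m.
Proof.
rewrite /exp_psum /series /= big_mkord summxE.
by apply: eq_bigr => k _; rewrite mxE.
Qed.

Lemma exp_series_le (c : R) m : 0 <= c -> series (exp_coeff c) m <= expR c.
Proof.
move=> c0; apply: nondecreasing_cvgn_le; last exact: is_cvg_series_exp_coeff.
by apply: nondecreasing_series => k _ _; rewrite exp_coeffE mulr_ge0 ?invr_ge0 ?exprn_ge0.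
Qed.

Lemma expmx_cvg X i j : (fun m => exp_psum X m i j) @ \oo --> expmx X i j.
Proof.
have -> : (fun m => exp_psum X m i j) = series (fun k => (k`!%:R)^-1 * (X ^+ k) i j).
  by apply: funext => m; rewrite exp_psumE.
rewrite /expmx mxE.
have -> : (fun m => (\sum_(k < m) (k`!%:R)^-1 *: X ^+ k) i j) =
     series (fun k => (k`!%:R)^-1 * (X ^+ k) i j).
  by apply: funext => m; rewrite -exp_psumE.
suff : cvgn (series (fun k => (k`!%:R)^-1 * (X ^+ k) i j)) by [].
have [B B1 HX] := mbound_exists X.
apply: normed_cvg; apply: series_le_cvg (is_cvg_series_exp_coeff (n%:R * B)).
- by move=> k; rewrite normr_ge0.
- by move=> k; rewrite exp_coeffE mulr_ge0 ?invr_ge0 ?exprn_ge0 // mulr_ge0 // (le_trans _ B1).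
move=> k /=; rewrite exp_coeffE normrM ger0_norm ?invr_ge0 //.
by rewrite ler_wpM2l ?invr_ge0 // expmx_pow_bound.
Qed.

Arguments expmx_cvg : clear implicits.

Lemma cvg_dist_le (u : nat -> R) (l c b : R) N : u @ \oo --> l ->
  (forall m, (N <= m)%N -> `|u m - c| <= b) -> `|l - c| <= b.
Proof.
move=> ul H.
have /ler_cvg_to : (fun m => `|u m - c|) @ \oo --> `|l - c|.
  by apply: cvg_norm; apply: cvgB => //; apply: cvg_cst.
apply; first exact: (cvg_cst b).
by exists N => // m /= Nm; apply: H.
Qed.

Lemma expmx_lipschitz B e X Y : 1 <= B -> mbound B X -> mbound B Y ->
  mbound e (X - Y) -> mbound (e * expR (2 * (n%:R * B))) (expmx X - expmx Y).
Proof.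
move=> B1 HX HY He i j; rewrite !mxE -/(expmx X) -/(expmx Y).
have -> : limn (fun m => (\sum_(k < m) k`!%:R^-1 *: X ^+ k) i j) = expmx X i j by rewrite mxE.
have -> : limn (fun m => (\sum_(k < m) k`!%:R^-1 *: Y ^+ k) i j) = expmx Y i j by rewrite mxE.
have e0 : 0 <= e by apply: le_trans (He i j).
have cv : (fun m => exp_psum X m i j - exp_psum Y m i j) @ \oo -->
    expmx X i j - expmx Y i j by apply: cvgB; apply: expmx_cvg.
rewrite -[X in `|X|]subr0; apply: (cvg_dist_le (N := 0%N) cv) => m _.
rewrite subr0 /= !exp_psumE /series /= -sumrB (le_trans (ler_norm_sum _ _ _)) //.
have c0 : 0 <= n%:R * B by rewrite mulr_ge0 // (le_trans _ B1).
(* The factor [k] of [expmx_pow_lipschitz] is absorbed by [k <= 2 ^ k], whence the doubled argument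
   of the series. *)
apply: le_trans (_ : e * series (exp_coeff (2 * (n%:R * B))) m <= _); last first.
  by rewrite ler_wpM2l // exp_series_le // mulr_ge0.
rewrite /series /= mulr_sumr ler_sum // => k _.
rewrite -mulrBr normrM ger0_norm ?invr_ge0 // exp_coeffE mulrCA.
rewrite ler_wpM2l ?invr_ge0 //.
have := expmx_pow_lipschitz k B1 HX HY He i j; rewrite !mxE => /le_trans; apply.
rewrite mulrC; apply: ler_wpM2l => //; rewrite [leRHS]exprMn; apply: ler_wpM2r; rewrite ?exprn_ge0 //.
by rewrite -natrX ler_nat ltnW // ltn_expl.
Qed.

Lemma expmx_taylor1 X : exists2 C, 0 <= C & forall t, 0 <= t <= 1 ->
  mbound (C * t ^+ 2) (expmx (t *: X) - (1%:M + t *: X)).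
Proof.
have [B B1 HX] := mbound_exists X.
have c0 : 0 <= n%:R * B by rewrite mulr_ge0 // (le_trans _ B1).
exists (expR (n%:R * B)); first exact: expR_ge0.
move=> t /andP[t0 t1] i j.
rewrite [X in `|X|](_ : _ = expmx (t *: X) i j - (1%:M + t *: X) i j); last by rewrite !mxE.
apply: (cvg_dist_le (N := 2%N) (expmx_cvg (t *: X) i j)) => m m2.
rewrite exp_psumE /series /= (big_cat_nat (n := 2)) //= 2?big_nat_recr //= big_geq //.
rewrite add0r !fact0 !invr1 !mul1r !expr0 expr1.
rewrite [X in `|X|](_ : _ = \sum_(2 <= k < m) (k`!%:R)^-1 * ((t *: X) ^+ k) i j); last first.
  rewrite (_ : (1%:M + t *: X) i j = (1 : 'M[R]_n) i j + (t *: X) i j); last by rewrite mxE.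
  by ring.
rewrite (le_trans (ler_norm_sum _ _ _)) //.
(* For [0 <= t <= 1] and [k >= 2] one has [t ^+ k <= t ^+ 2], so the remainder is at most [t ^+ 2]
   times the scalar exponential series. *)
apply: le_trans (_ : t ^+ 2 * series (exp_coeff (n%:R * B)) m <= _); last first.
  by rewrite mulrC ler_wpM2r ?sqr_ge0 // exp_series_le.
rewrite /series /= [in leRHS](big_cat_nat (n := 2)) //= mulrDr ler_wpDl //.
  rewrite mulr_ge0 ?sqr_ge0 // sumr_ge0 // => k _.
  by rewrite exp_coeffE mulr_ge0 ?invr_ge0 ?exprn_ge0.
rewrite mulr_sumr !big_nat ler_sum // => k /andP[k2 _].
rewrite normrM ger0_norm ?invr_ge0 // exp_coeffE mulrCA ler_wpM2l ?invr_ge0 //.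
rewrite scalemx_exp mxE normrM normrX (ger0_norm t0) ler_pM ?exprn_ge0 //.
  by rewrite -(subnKC k2) exprD ler_piMr ?exprn_ge0 // exprn_ile1.
exact: expmx_pow_bound.
Qed.

Lemma cvg_sumr (I : Type) (r : seq I) (u : I -> nat -> R) (l : I -> R) :
  (forall i, u i @ \oo --> l i) ->
  (fun m => \sum_(i <- r) u i m) @ \oo --> \sum_(i <- r) l i.
Proof.
move=> H; elim: r => [|i r IH].
  rewrite big_nil; under eq_fun do rewrite big_nil; exact: cvg_cst.
rewrite big_cons; under eq_fun do rewrite big_cons.
by apply: cvgD.
Qed.

Lemma expmx_uniq X Y : (forall i j, (fun m => exp_psum X m i j) @ \oo --> Y i j) ->
  expmx X = Y.
Proof.
move=> H; apply/matrixP => i j.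
have H1 := cvg_lim (@norm_hausdorff _ _) (expmx_cvg X i j).
have H2 := cvg_lim (@norm_hausdorff _ _) (H i j).
by rewrite -H1 -H2.
Qed.

Lemma expmx_conj P X : P \in unitmx ->
  expmx (invmx P *m X *m P) = invmx P *m expmx X *m P.
Proof.
move=> Pu; apply: expmx_uniq => i j.
have -> : (fun m => exp_psum (invmx P *m X *m P) m i j) =
    (fun m => \sum_l (\sum_k invmx P i k * exp_psum X m k l) * P l j).
  apply: funext => m.
  have -> : exp_psum (invmx P *m X *m P) m = invmx P *m exp_psum X m *m P.
    rewrite /exp_psum mulmx_sumr mulmx_suml; apply: eq_bigr => k _.
    rewrite -scalemxAr -scalemxAl; congr (_ *: _).
    elim: (k : nat) => [|l IH]; first by rewrite !expr0 mulmx1 mulVmx.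
    rewrite !exprS IH -[_ * _]/(_ *m _) -[X * _]/(_ *m _).
    by rewrite !mulmxA mulmxK.
  by rewrite mxE; apply: eq_bigr => l _; rewrite mxE.
rewrite mxE; apply: cvg_sumr => l; apply: cvgM; last exact: cvg_cst.
rewrite mxE; apply: cvg_sumr => k; apply: cvgM; first exact: cvg_cst.
exact: expmx_cvg.
Qed.

Lemma expmx_diag (d : 'rV[R]_n) : expmx (diag_mx d) = diag_mx (map_mx expR d).
Proof.
apply: expmx_uniq => i j.
have diagX k : (diag_mx d) ^+ k = diag_mx (row_exp d k).
  elim: k => [|k IH]; first by apply/matrixP => a b; rewrite !mxE expr0; case: (a == b).
  rewrite exprS IH -[_ * _]/(_ *m _) mulmx_diag; congr diag_mx.
  by apply/rowP => a; rewrite !mxE exprS.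
have [->|ij] := eqVneq i j.
  have -> : (fun m => exp_psum (diag_mx d) m j j) = series (exp_coeff (d 0 j)).
    apply: funext => m; rewrite exp_psumE; apply: eq_bigr => k _.
    by rewrite diagX !mxE exp_coeffE eqxx mulr1n.
  rewrite !mxE eqxx mulr1n; exact: is_cvg_series_exp_coeff.
have -> : (fun m => exp_psum (diag_mx d) m i j) = (fun _ => 0).
  apply: funext => m; rewrite exp_psumE /series /= big1 // => k _.
  by rewrite diagX !mxE (negPf ij) mulr0n mulr0.
rewrite !mxE (negPf ij) mulr0n; exact: cvg_cst.
Qed.

Lemma expmx_spec P (d : 'rV[R]_n) (t : R) : P \in unitmx ->
  expmx (t *: spec P d) = spec P (map_mx (fun x => expR (t * x)) d).
Proof.
move=> Pu; rewrite /spec scalemxAl scalemxAr.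
have -> : t *: diag_mx d = diag_mx (t *: d).
  by apply/matrixP => i j; rewrite !mxE mulrnAr.
rewrite (expmx_conj _ Pu) expmx_diag; congr (_ *m diag_mx _ *m _).
by apply/rowP => i; rewrite !mxE.
Qed.

End MatrixExponential.

(** * Points over extensions of the ground field *)

Lemma evalp_map (K E E' : comNzRingType) (f : {rmorphism K -> E})
    (g : {rmorphism E -> E'}) m (p : MPoly[K]_m) (v : 'rV[E]_m) :
  evalp (g \o f) p (map_mx g v) = g (evalp f p v).
Proof.
rewrite /evalp /mmap rmorph_sum; apply: eq_bigr => u _ /=.
rewrite rmorphM rmorph_prod; congr (_ * _); apply: eq_bigr => i _.
by rewrite mxE rmorphXn.
Qed.

Lemma mxeval_map (K E E' : comNzRingType) (f : {rmorphism K -> E})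
    (g : {rmorphism E -> E'}) n (p : MPoly[K]_(n * n)) (x : 'M[E]_n) :
  mxeval (g \o f) p (map_mx g x) = g (mxeval f p x).
Proof. by rewrite /mxeval -evalp_map map_mxvec. Qed.

Lemma points_map (K : rcfType) (E E' : comNzRingType) (f : {rmorphism K -> E})
    (g : {rmorphism E -> E'}) n (G : seq (MPoly[K]_(n * n))) (x : 'M[E]_n) :
  injective g -> points (g \o f) G (map_mx g x) <-> points f G x.
Proof.
move=> gI; split=> H p pG; have := H p pG; rewrite mxeval_map.
  by move=> /eqP; rewrite -(rmorph0 g) (inj_eq gI) => /eqP.
by move=> ->; rewrite rmorph0.
Qed.

Lemma points_toC (K E : rcfType) (f : {rmorphism K -> E}) n
    (G : seq (MPoly[K]_(n * n))) (x : 'M[E]_n) :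
  points (toC E \o f) G (map_mx (toC E) x) <-> points f G x.
Proof. by apply: points_map; exact: complexI. Qed.

Lemma points_zeros (K : rcfType) (E : comNzRingType) (f : {rmorphism K -> E})
    n (G : seq (MPoly[K]_(n * n))) : points f G = zeros f [set p | p \in G].
Proof. by []. Qed.

Lemma points_conj (K E : rcfType) (f : {rmorphism K -> E}) n
    (G : seq (MPoly[K]_(n * n))) (x : 'M[E[i]%C]_n) :
  points (toC E \o f) G x -> points (toC E \o f) G (map_mx (@conjc E) x).
Proof.
move=> H p pG; have := H p pG.
move=> /(congr1 (@conjc E)); rewrite -(mxeval_map (toC E \o f) (@conjc E)) rmorph0 => <-.
rewrite /mxeval /evalp /mmap; apply: eq_bigr => u _; congr (_ * _).
by rewrite /= oppr0.
Qed.

Definition Xmx (K : comNzRingType) n : 'M[MPoly[K]_(n * n)]_n :=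
  \matrix_(i, j) mpolyX K (mnm1 (mxvec_index i j)).

Lemma mxeval_is_rmorphism (K E : comNzRingType) (f : {rmorphism K -> E}) n (x : 'M[E]_n) :
  exists g : {rmorphism MPoly[K]_(n * n) -> E}, forall p, g p = mxeval f p x.
Proof. by exists (mmap f (mxvec x 0)). Qed.

Lemma mxeval_Xmx (K E : comNzRingType) (f : {rmorphism K -> E}) n (x : 'M[E]_n) i j :
  mxeval f (Xmx K n i j) x = x i j.
Proof. by rewrite mxE /mxeval /evalp mmapX mmap1U mxvecE. Qed.

Definition detp (K : comNzRingType) n : MPoly[K]_(n * n) := \det (Xmx K n).

Lemma mxeval_detp (K E : comNzRingType) (f : {rmorphism K -> E}) n (x : 'M[E]_n) :
  mxeval f (detp K n) x = \det x.
Proof.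
have [g Hg] := mxeval_is_rmorphism f x.
rewrite -Hg /detp -det_map_mx; congr (\det _); apply/matrixP => i j.
by rewrite mxE Hg mxeval_Xmx.
Qed.

Section ComplexMatrix.
Variables (E : rcfType).

Lemma complexmxE m n (z : 'M[E[i]%C]_(m, n)) :
  z = complexmx (map_mx (@complex.Re E) z) (map_mx (@complex.Im E) z).
Proof. by apply/matrixP => i j; rewrite !mxE; case: (z i j). Qed.

Lemma complexmxM m n p (x y : 'M[E]_(m, n)) (u v : 'M[E]_(n, p)) :
  complexmx x y *m complexmx u v = complexmx (x *m u - y *m v) (x *m v + y *m u).
Proof.
apply/matrixP => i j; rewrite !mxE.
transitivity (\sum_k ((x i k * u k j - y i k * v k j) +i* (x i k * v k j + y i k * u k j))%C).
  by apply: eq_bigr => k _; rewrite !mxE.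
rewrite -!sumrN -!big_split /=.
elim: (index_enum _) => [|k r IH]; first by rewrite !big_nil.
by rewrite !big_cons IH.
Qed.

Lemma complexmx_inj m n (x y u v : 'M[E]_(m, n)) :
  complexmx x y = complexmx u v -> x = u /\ y = v.
Proof.
by move=> /matrixP H; split; apply/matrixP => i j; have := H i j; rewrite !mxE => -[].
Qed.

Lemma complexmx_tr m n (x y : 'M[E]_(m, n)) : (complexmx x y)^T = complexmx x^T y^T.
Proof. by apply/matrixP => i j; rewrite !mxE. Qed.

Lemma complexmx_ctr m n (x y : 'M[E]_(m, n)) : ctr (complexmx x y) = complexmx x^T (- y^T).
Proof. by apply/matrixP => i j; rewrite !mxE. Qed.

Lemma complexmx_real m n (x : 'M[E]_(m, n)) : complexmx x 0 = map_mx (toC E) x.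
Proof. by apply/matrixP => i j; rewrite !mxE. Qed.

Lemma complexmx1 n : complexmx 1%:M 0 = 1%:M :> 'M[E[i]%C]_n.
Proof. by rewrite complexmx_real map_mx1. Qed.

End ComplexMatrix.

Section GroupTransfer.
Variables (K : rcfType) (n : nat) (G : seq (MPoly[K]_(n * n))).
Local Notation V b := (MVar K n b).
Local Notation C1 := (MCst (1%:M : 'M[K]_n)).
Local Notation C0 := (MCst (0 : 'M[K]_n)).

Variables (E : rcfType) (f : {rmorphism K -> E}).
Local Notation CE := (points (toC E \o f) G).
Local Notation Kholds p := (finterp (idfun : {rmorphism K -> K}) (fun=> 0) p).

Lemma points_from_K x : points idfun G x -> points f G (map_mx f x).
Proof. by move=> Gx; apply/(points_map idfun G x (fmorph_inj f)). Qed.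

Lemma points_KC x : points idfun G x <-> Cpoints G (map_mx (toC K) x).
Proof. by rewrite -(points_toC (idfun : {rmorphism K -> K})). Qed.

(** The group axioms are assumed for the points over [K[i]] only; each is a sentence in real and
    imaginary parts and so passes to [E[i]]. The inverse enters through an existential quantifier,
    since [mterm] has no inversion. *)
Lemma Cpoints_group : alg_subgroup_SL G -> subgroup CE /\ CE `<=` @SL _ n.
Proof.
move=> [[G1 GM GV] GS].
have E1 : CE 1%:M.
  rewrite -(map_mx1 (toC E)); apply/points_toC; rewrite -(map_mx1 f).
  by apply: points_from_K; apply/points_KC; rewrite map_mx1.
have EM x y u v : CE (complexmx x y) -> CE (complexmx u v) ->
    CE (complexmx x y *m complexmx u v).
  have /(tarski_transfer f) /= H : Kholds (FAll 0 (FAll 1 (FAll 2 (FAll 3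
     (FImp (FCPoints G (V 0) (V 1)) (FImp (FCPoints G (V 2) (V 3))
       (FCPoints G (MAdd (MMul (V 0) (V 2)) (MOpp (MMul (V 1) (V 3))))
                   (MAdd (MMul (V 0) (V 3)) (MMul (V 1) (V 2)))))))))).
    move=> /= a b c d; rewrite /= -complexmxM; exact: GM.
  have {}H := H x y u v; rewrite /= in H.
  by rewrite complexmxM.
have ES x y : CE (complexmx x y) -> \det (complexmx x y) = 1.
  have /(tarski_transfer f) /= H : Kholds (FAll 0 (FAll 1
     (FImp (FCPoints G (V 0) (V 1)) (FAnd (FEq (SRe (detp K n) (V 0) (V 1)) (SNat K n 1))
        (FEq (SIm (detp K n) (V 0) (V 1)) (SNat K n 0)))))).
    move=> /= a b; rewrite /= mxeval_detp => /GS ->.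
    by [].
  have {}H := H x y; rewrite /= mxeval_detp in H.
  by move=> /H; case: (\det _) => p q /= [-> ->].
have EV x y : CE (complexmx x y) -> exists2 z, CE z & complexmx x y *m z = 1%:M.
  have /(tarski_transfer f) /= H : Kholds (FAll 0 (FAll 1
     (FImp (FCPoints G (V 0) (V 1)) (FEx 2 (FEx 3 (FAnd (FCPoints G (V 2) (V 3))
       (FAnd (FMEq (MAdd (MMul (V 0) (V 2)) (MOpp (MMul (V 1) (V 3)))) C1)
                   (FMEq (MAdd (MMul (V 0) (V 3)) (MMul (V 1) (V 2))) C0)))))))).
    move=> /= a b; rewrite /= => Gab.
    have [abu Gi] := GV _ Gab; move: (complexmxE (invmx (complexmx a b))).
    set c := map_mx _ _; set d := map_mx _ _ => iE; exists c, d.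
    rewrite /= !map_mx_id //; split; first by rewrite -iE.
    apply: complexmx_inj; rewrite -complexmxM -iE complexmx1; exact: mulmxV.
  have {}H := H x y; rewrite /= in H.
  move=> /H[u [v]]; rewrite /= map_mx1 map_mx0 => -[Guv [e1 e2]].
  by exists (complexmx u v) => //; rewrite complexmxM e1 e2 complexmx1.
split; [split; first exact: E1|].
- by move=> x y; rewrite (complexmxE x) (complexmxE y); exact: EM.
- move=> x; rewrite (complexmxE x) => Gx.
  have xu : complexmx (map_mx (@complex.Re E) x) (map_mx (@complex.Im E) x) \in unitmx.
    by rewrite unitmxE ES // unitr1.
  split=> //; have [z Gz xz] := EV _ _ Gx.
  by rewrite -[invmx _]mulmx1 -xz mulmxA mulVmx // mul1mx.
- by move=> x; rewrite (complexmxE x); exact: ES.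
Qed.

Lemma points_group : alg_subgroup_SL G ->
  subgroup (points f G) /\ points f G `<=` @SL _ n.
Proof.
move=> /Cpoints_group[[C1 CM CV] CS]; split; [split|].
- by apply/points_toC; rewrite map_mx1.
- by move=> x y /points_toC Gx /points_toC Gy; apply/points_toC; rewrite map_mxM; apply: CM.
- move=> x /points_toC/CV[]; rewrite map_unitmx => xu Gx; split=> //.
  by apply/points_toC; rewrite map_invmx.
- move=> x /points_toC/CS; rewrite /SL /= det_map_mx => /eqP.
  by rewrite -(rmorph1 (toC E)) (inj_eq (@complexI _)) => /eqP.
Qed.

Lemma Cpoints_tr : self_adjoint G -> forall x, CE x -> CE x^T.
Proof.
move=> GT x; rewrite (complexmxE x) complexmx_tr.
have /(tarski_transfer f) /= H : Kholds (FAll 0 (FAll 1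
     (FImp (FCPoints G (V 0) (V 1)) (FCPoints G (MTr (V 0)) (MTr (V 1)))))).
  by move=> /= a b; rewrite /= -complexmx_tr; exact: GT.
have {}H := H (map_mx (@complex.Re E) x) (map_mx (@complex.Im E) x).
by rewrite /= in H.
Qed.

Lemma Cpoints_ctr : self_adjoint G -> forall x, CE x -> CE (ctr x).
Proof. by move=> GT x Gx; apply: points_conj; apply: Cpoints_tr. Qed.

Lemma points_tr : self_adjoint G -> forall x, points f G x -> points f G x^T.
Proof.
move=> GT x /points_toC Gx; apply/points_toC; rewrite -map_trmx.
exact: Cpoints_tr.
Qed.

Lemma points_sym : (forall s, Cpoints G s -> s = s^T) ->
  forall x, points f G x -> x^T = x.
Proof.
move=> Gsym x.
have /(tarski_transfer f) /= H : Kholds (FAll 0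
     (FImp (FPoints G (V 0)) (FMEq (MTr (V 0)) (V 0)))).
  move=> /= a; rewrite /= => /points_KC/Gsym.
  by rewrite map_trmx => /(@toCm_inj K) <-.
by have {}H := H x; rewrite /= in H.
Qed.

Lemma points_comm : (forall s t, points idfun G s -> points idfun G t -> s *m t = t *m s) ->
  forall x y, points f G x -> points f G y -> x *m y = y *m x.
Proof.
move=> Gcomm x y.
have /(tarski_transfer f) /= H : Kholds (FAll 0 (FAll 1
     (FImp (FPoints G (V 0)) (FImp (FPoints G (V 1)) (FMEq (MMul (V 0) (V 1)) (MMul (V 1) (V 0))))))).
  by move=> /= a b; rewrite /=; exact: Gcomm.
by have {}H := H x y; rewrite /= in H.
Qed.

End GroupTransfer.

Lemma points_sub (K E : rcfType) (f : {rmorphism K -> E}) n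
    (G S : seq (MPoly[K]_(n * n))) :
  Cpoints S `<=` Cpoints G -> points f S `<=` points f G.
Proof.
move=> SG x.
have /(tarski_transfer f) /= H : finterp (idfun : {rmorphism K -> K}) (fun=> 0) (FAll 0
     (FImp (FPoints S (MVar K n 0)) (FPoints G (MVar K n 0)))).
  by move=> /= a; rewrite /= !points_KC; exact: SG.
by have {}H := H x; rewrite /= in H.
Qed.

(** * The identity component of a split torus *)

Section Continuity.
Variables (K : numFieldType) (T : topologicalType).
Implicit Types u v : T -> K.

Lemma continuous_sumr I (r : seq I) (u : I -> T -> K) :
  (forall i, continuous (u i)) -> continuous (fun x => \sum_(i <- r) u i x).
Proof.
move=> Hu; elim: r => [|i r IH] x.
  under eq_fun do rewrite big_nil; exact: cvg_cst.
by under eq_fun do rewrite big_cons; apply: cvgD; [apply: Hu|apply: IH].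
Qed.

Lemma continuous_prodr I (r : seq I) (u : I -> T -> K) :
  (forall i, continuous (u i)) -> continuous (fun x => \prod_(i <- r) u i x).
Proof.
move=> Hu; elim: r => [|i r IH] x.
  under eq_fun do rewrite big_nil; exact: cvg_cst.
by under eq_fun do rewrite big_cons; apply: cvgM; [apply: Hu|apply: IH].
Qed.

Lemma continuous_expr u k : continuous u -> continuous (fun x => u x ^+ k).
Proof.
move=> Hu; elim: k => [|k IH] x.
  under eq_fun do rewrite expr0; exact: cvg_cst.
by under eq_fun do rewrite exprS; apply: cvgM; [apply: Hu|apply: IH].
Qed.

Lemma continuous_mxeval_comp (K0 : comNzRingType) (f : {rmorphism K0 -> K}) n
    (p : MPoly[K0]_(n * n)) (g : T -> 'M[K]_n) :
  (forall i j, continuous (fun x => g x i j)) ->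
  continuous (fun x => mxeval f p (g x)).
Proof.
move=> Hg; apply: continuous_sumr => m x; apply: cvgM; first exact: cvg_cst.
apply: continuous_prodr => k; apply: continuous_expr.
case/mxvec_indexP: k => i j.
have -> : (fun x => mxvec (g x) 0 (mxvec_index i j)) = (fun x => g x i j).
  by apply: funext => y; rewrite mxvecE.
exact: Hg.
Qed.

End Continuity.

Lemma continuous_mxeval (K0 : comNzRingType) (K : numFieldType)
    (f : {rmorphism K0 -> K}) n (p : MPoly[K0]_(n * n)) :
  continuous (fun x : 'M[K]_n => mxeval f p x).
Proof.
by apply: (@continuous_mxeval_comp _ _ _ _ _ _ id) => i j; apply: coord_continuous.
Qed.

Lemma map_had (L M : pzRingType) (g : {rmorphism L -> M}) m (x y : 'rV[L]_m) :
  map_mx g (had x y) = had (map_mx g x) (map_mx g y).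
Proof. by apply/rowP => i; rewrite !mxE rmorphM. Qed.

Lemma hadC (L : comPzRingType) m (x y : 'rV[L]_m) : had x y = had y x.
Proof. by apply/rowP => i; rewrite !mxE mulrC. Qed.

(** Applied to the points of a split torus over a real closed field, this is the semialgebraic
    identity component, in a form that makes sense over every extension. *)
Definition sqset (L : pzSemiRingType) n (S : set 'M[L]_n) : set 'M[L]_n :=
  [set x | exists2 y, S y & x = y *m y].

Section RealTorus.
Variables (K : rcfType) (n r : nat) (f : 'M[MPoly[K]_(r + r)]_n).

Definition torus_param (E : rcfType) (g : {rmorphism K -> E}) (t : 'rV[E]_r) : 'M[E]_n :=
  \matrix_(i, j) evalp g (f i j) (row_mx t (map_mx (fun c => c^-1) t)).

Definition torus_paramC (t : 'rV[K[i]%C]_r) : 'M[K[i]%C]_n :=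
  \matrix_(i, j) evalp (toC K) (f i j) (row_mx t (map_mx (fun c => c^-1) t)).

Lemma torus_param_toC t :
  torus_paramC (map_mx (toC K) t) = map_mx (toC K) (torus_param idfun t).
Proof.
apply/matrixP => i j; rewrite !mxE -evalp_map; congr (evalp _ _ _).
rewrite map_row_mx; congr row_mx.
by apply/rowP => k; rewrite !mxE -(fmorphV (toC K)).
Qed.

End RealTorus.

Lemma torus_paramC_inv (K : rcfType) n (T : seq (MPoly[K]_(n * n))) :
  split_torus T -> exists r (f : 'M[MPoly[K]_(r + r)]_n) (p : 'I_r -> MPoly[K]_(n * n)),
  [/\ forall t : 'rV[K[i]%C]_r, (forall i, t 0 i != 0) -> Cpoints T (torus_paramC f t),
      forall t u : 'rV[K[i]%C]_r, (forall i, t 0 i != 0) -> (forall i, u 0 i != 0) ->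
        torus_paramC f (had t u) = torus_paramC f t *m torus_paramC f u,
      forall t : 'rV[K[i]%C]_r, (forall i, t 0 i != 0) ->
        \row_i mxeval (toC K) (p i) (torus_paramC f t) = t &
      forall x, Cpoints T x -> (forall i, mxeval (toC K) (p i) x != 0) /\
        torus_paramC f (\row_i mxeval (toC K) (p i) x) = x].
Proof.
move=> [_ [r [f [p [H1 H2 H3 H4]]]]]; exists r, f, p; split=> //.
by move=> x /H4[Hx ?]; split=> // i; have := Hx i; rewrite mxE.
Qed.

Lemma torus_param_inv (K : rcfType) n (T : seq (MPoly[K]_(n * n))) :
  split_torus T -> exists r (f : 'M[MPoly[K]_(r + r)]_n) (p : 'I_r -> MPoly[K]_(n * n)),
  [/\ forall t : 'rV[K]_r, (forall i, t 0 i != 0) -> points idfun T (torus_param f idfun t),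
      forall t u : 'rV[K]_r, (forall i, t 0 i != 0) -> (forall i, u 0 i != 0) ->
        torus_param f idfun (had t u) = torus_param f idfun t *m torus_param f idfun u,
      forall t : 'rV[K]_r, (forall i, t 0 i != 0) ->
        \row_i mxeval idfun (p i) (torus_param f idfun t) = t &
      forall x, points idfun T x -> (forall i, mxeval idfun (p i) x != 0) /\
        torus_param f idfun (\row_i mxeval idfun (p i) x) = x].
Proof.
move=> /torus_paramC_inv[r [f [p [H1 H2 H3 H4]]]]; exists r, f, p.
have nz (t : 'rV[K]_r) : (forall i, t 0 i != 0) -> forall i, map_mx (toC K) t 0 i != 0.
  by move=> t0 i; rewrite mxE fmorph_eq0.
have ev (q : MPoly[K]_(n * n)) x : mxeval (toC K) q (map_mx (toC K) x) = toC K (mxeval idfun q x).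
  by rewrite -mxeval_map.
have rw x : \row_i mxeval (toC K) (p i) (map_mx (toC K) x) =
    map_mx (toC K) (\row_i mxeval idfun (p i) x).
  by apply/rowP => i; rewrite !mxE ev.
split.
- by move=> t /nz t0; apply/points_KC; rewrite -torus_param_toC; apply: H1.
- move=> t u /nz t0 /nz u0; apply: (@toCm_inj K).
  rewrite map_mxM -!torus_param_toC -(H2 _ _ t0 u0) map_had //.
- by move=> t /nz t0; apply: (@toCm_inj K); rewrite -rw -torus_param_toC H3.
- move=> x /points_KC/H4[nzx]; rewrite rw torus_param_toC => /(@toCm_inj K) ->; split=> // i.
  by have := nzx i; rewrite ev fmorph_eq0.
Qed.

Lemma comm_of_param (L : fieldType) n r (phi : 'rV[L]_r -> 'M[L]_n) t u x y :
  phi (had t u) = x *m y -> phi (had u t) = y *m x -> x *m y = y *m x.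
Proof. by move=> <- <-; rewrite hadC. Qed.

Lemma split_torus_comm (K : rcfType) n (T : seq (MPoly[K]_(n * n))) :
  split_torus T -> forall x y, Cpoints T x -> Cpoints T y -> x *m y = y *m x.
Proof.
move=> /torus_paramC_inv[r [f [p [_ H2 _ H4]]]] x y /H4[xn <-] /H4[yn <-].
have nz z : (forall i, mxeval (toC K) (p i) z != 0) -> forall i : 'I_r, (\row_i mxeval (toC K) (p i) z) 0 i != 0.
  by move=> H i; rewrite mxE.
have e1 := H2 _ _ (nz x xn) (nz y yn); have e2 := H2 _ _ (nz y yn) (nz x xn).
exact: comm_of_param e1 e2.
Qed.

(** In the coordinates [p] the points over [K] are the vectors with nonzero entries; as positive
    elements of [K] are squares, the squares are the points with positive coordinates. *)
Lemma split_torus_squares (K : rcfType) n (T : seq (MPoly[K]_(n * n))) :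
  split_torus T -> exists r (p : 'I_r -> MPoly[K]_(n * n)),
  [/\ forall x, sqset (points idfun T) x <->
        points idfun T x /\ forall i, 0 < mxeval idfun (p i) x,
      forall x i, points idfun T x -> mxeval idfun (p i) x != 0 &
      forall i, mxeval idfun (p i) 1%:M = 1].
Proof.
move=> Ts; have [r [f [p [H1 H2 H3 H4]]]] := torus_param_inv Ts.
have [[G1 GM _] _] := points_group (idfun : {rmorphism K -> K}) Ts.1.
exists r, p.
have pM x y i : points idfun T x -> points idfun T y ->
    mxeval idfun (p i) (x *m y) = mxeval idfun (p i) x * mxeval idfun (p i) y.
  move=> /H4[xn ex] /H4[yn ey].
  pose t := \row_i mxeval idfun (p i) x; pose u := \row_i mxeval idfun (p i) y.
  have tn j : t 0 j != 0 by rewrite mxE.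
  have un j : u 0 j != 0 by rewrite mxE.
  have tun j : (had t u) 0 j != 0 by rewrite mxE mulf_neq0.
  have /rowP/(_ i) := H3 _ tun; rewrite H2 // ex ey !mxE; exact.
have p1 i : mxeval idfun (p i) 1%:M = 1.
  have := pM _ _ i G1 G1; rewrite mulmx1 => /eqP; rewrite -subr_eq0 -{1}[mxeval _ _ _]mulr1 -mulrBr.
  have [/(_ i) nz _] := H4 _ G1.
  by rewrite mulf_eq0 (negPf nz) /= subr_eq0 => /eqP.
split=> //.
- move=> x; split=> [[y Sy ->]|[Sx px]].
    split=> [|i]; first exact: GM.
    by rewrite pM // -expr2 lt_def sqr_ge0 andbT sqrf_eq0; have [] := H4 _ Sy.
  have [xn xe] := H4 _ Sx.
  pose t := \row_i Num.sqrt (mxeval idfun (p i) x).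
  have tn j : t 0 j != 0 by rewrite mxE gt_eqF // sqrtr_gt0.
  exists (torus_param f idfun t); first exact: H1.
  rewrite -H2 // -[LHS]xe; congr torus_param; apply/rowP => i.
  by rewrite !mxE -expr2 sqr_sqrtr // ltW.
- by move=> x i /H4[].
Qed.

Section Component.
Variables (K : rcfType) (R : realType) (iotaR : {rmorphism K -> R}) (n : nat).
Variable S : seq (MPoly[K]_(n * n)).
Hypotheses (hS : split_torus S) (hSsym : forall s, Cpoints S s -> s = s^T).

Lemma mxeval1 (E : comNzRingType) (f : {rmorphism K -> E}) (x : 'M[E]_n) p q :
  mxeval f (p + q) x = mxeval f p x + mxeval f q x /\ mxeval f (- p) x = - mxeval f p x.
Proof. by rewrite /mxeval /evalp raddfD raddfN. Qed.

(** A coordinate [p i] has no zero on [S], so its two signs cut [A] into two relatively closed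
    semialgebraic pieces; connectedness leaves the one that contains the identity. *)
Lemma component_sub_squares A :
  sa_component (points idfun S) 1%:M (sa_ext idfun A) ->
  sa_ext idfun A `<=` sqset (points idfun S).
Proof.
move=> [A1 AS [_ Aconn] _]; have [r [p [Hsq Hnz Hp1]]] := split_torus_squares hS.
suff H i : sa_ext idfun A `<=` [set x | 0 < mxeval idfun (p i) x].
  by move=> x Ax; apply/Hsq; split; [exact: AS|move=> i; exact: H].
pose cut q : sa_formula K n := [seq (c.1, q :: c.2) | c <- A].
have cutP q x : sa_ext idfun (cut q) x <-> sa_ext idfun A x /\ 0 < mxeval idfun q x.
  split.
    move=> [_ [/mapP[c cA ->] /= H1 H2]]; split; last by apply: H2; rewrite mem_head.
    by exists c; split=> // s sc; apply: H2; rewrite inE sc orbT.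
  move=> [[c [cA H1 H2]] q0]; exists (c.1, q :: c.2); split=> //=.
    by apply/mapP; exists c.
  by move=> s; rewrite inE => /predU1P[->|/H2].
have evN x : mxeval idfun (- p i) x = - mxeval idfun (p i) x by have [] := mxeval1 idfun x (p i) (p i).
have cl q : closed [set x : 'M[K]_n | 0 <= mxeval idfun q x].
  apply: (@closed_comp _ _ (fun x : 'M[K]_n => mxeval idfun q x) [set y | 0 <= y]).
    by move=> x _; apply: continuous_mxeval.
  exact: closed_ge.
have nz x : sa_ext idfun A x -> mxeval idfun (p i) x != 0 by move=> /AS; exact: Hnz.
have := Aconn (sa_ext idfun (cut (p i))) (sa_ext idfun (cut (- p i))).
case.
- by exists (cut (p i)).
- by exists (cut (- p i)).
- exists [set x | 0 <= mxeval idfun (p i) x]; first exact: cl.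
  apply/seteqP; split=> x /=; rewrite cutP => -[Ax H]; split=> //; first exact: ltW.
  by rewrite lt_def nz.
- exists [set x | 0 <= mxeval idfun (- p i) x]; first exact: cl.
  apply/seteqP; split=> x /=; rewrite cutP => -[Ax H]; split=> //; first exact: ltW.
  by rewrite lt_def H andbT evN oppr_eq0 nz.
- apply/seteqP; split=> x /=; first by rewrite !cutP => -[[]|[]].
  move=> Ax; rewrite !cutP evN oppr_gt0.
  by case: (ltgtP (mxeval idfun (p i) x) 0) (nz x Ax) => // H _; [right|left].
- rewrite -subset0 => x [] /=; rewrite !cutP evN oppr_gt0 => -[_ H1] [_ H2].
  by have := lt_trans H1 H2; rewrite ltxx.
- move=> UA x; rewrite -UA => /cutP[_ H]; exact: H.
move=> WA; have : sa_ext idfun (cut (- p i)) 1%:M by rewrite WA.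
by move=> /cutP[_]; rewrite evN Hp1 oppr_gt0 ltr10.
Qed.


Local Notation V b := (MVar K n b).
Local Notation C0 := (MCst (0 : 'M[K]_n)).
Local Notation Kholds p := (finterp (idfun : {rmorphism K -> K}) (fun=> 0) p).

Lemma mxtrace_mulmxtr (E : rcfType) (z : 'M[E]_n) : z != 0 -> 0 < \tr (z *m z^T).
Proof.
move=> z0; rewrite lt_def sumr_ge0 ?andbT; last by move=> i _; apply: mulmxtr_diag_ge0.
apply: contra z0; rewrite psumr_eq0 => [/allP H|i _]; last exact: mulmxtr_diag_ge0.
apply/eqP/row_matrixP => i; rewrite row0; apply: mulmxtr_diag_eq0.
by apply/eqP; apply: H; rewrite mem_index_enum.
Qed.

(** Closedness in a form that [mform] can express: as it quantifies over matrices only, the radius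
    is represented by the trace of [z *m z^T] with [z] nonzero. For [n = 0] no such [z] exists, and
    the hypothesis that [D] meets [Z] takes over. *)
Lemma closed_approx (D Z : set 'M[K]_n) x : closed Z -> D x ->
  (exists y, (D `&` Z) y) ->
  (forall z : 'M[K]_n, z <> 0 -> exists y, (D `&` Z) y /\
     \tr ((x - y) *m (x - y)^T) < \tr (z *m z^T)) -> (D `&` Z) x.
Proof.
move=> cZ Dx [y0 Uy0] H; split=> //; apply: cZ => B /nbhs_ballP[e /= e0 xB].
have [n0|n0] := posnP n.
  have xy : x = y0 by apply/matrixP => -[i i0]; exfalso; rewrite n0 in i0.
  exists y0; split; [exact: Uy0.2|apply: xB].
  by split=> // i j; rewrite xy /ball /= subrr normr0.
pose i0 := Ordinal n0; pose z : 'M[K]_n := e *: delta_mx i0 i0.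
have zz : \tr (z *m z^T) = e ^+ 2.
  rewrite /z linearZ /= trmx_delta -scalemxAl -scalemxAr mul_delta_mx scalerA.
  by rewrite linearZ /= mxtrace_delta || rewrite mxtraceZ /mxtrace (bigD1 i0) //= mxE !eqxx big1 ?addr0 ?mulr1 ?expr2 // => k ki; rewrite mxE (negPf ki).
have [|y [Uy Hy]] := H z.
  by move=> z0; move: zz; rewrite z0 mul0mx mxtrace0 => /esym/eqP; rewrite sqrf_eq0 gt_eqF.
exists y; split; first exact: Uy.2.
apply: xB; split=> // i j; rewrite /ball /=.
rewrite -ltr_sqr ?nnegrE ?normr_ge0 ?(ltW e0) // -zz.
apply: le_lt_trans Hy; rewrite /mxtrace (bigD1 i) //= mxE (bigD1 j) //= -addrA.
rewrite [in leRHS]mxE !mxE -normrX ger0_norm ?sqr_ge0 // expr2 lerDl addr_ge0 //.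
  by apply: sumr_ge0 => k _; rewrite !mxE -expr2 sqr_ge0.
by apply: sumr_ge0 => k _; apply: mulmxtr_diag_ge0.
Qed.

Lemma points_spec_fun (L : fieldType) (g : {rmorphism K -> L}) (G : seq (MPoly[K]_(n * n)))
    (P : 'M[L]_n) d (D : set L) (phi : L -> L) :
  P \in unitmx -> subgroup (points g G) -> points g G (spec P d) ->
  D 1 -> (forall x y, D x -> D y -> D (x * y)) -> (forall i, D (d 0 i)) ->
  phi 1 = 1 -> (forall x y, D x -> D y -> phi (x * y) = phi x * phi y) ->
  points g G (spec P (map_mx phi d)).
Proof.
move=> Pu [G1 GM _] Gd D1 DM Dd phi1 phiM; rewrite points_zeros.
apply: zeros_multiplicative phi1 phiM _ => // k; rewrite -/(spec P (row_exp d k)) spec_row_exp //.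
by elim: k => [|k IH] //=; apply: GM.
Qed.

Lemma continuous_expR_mul (c : R) : continuous (fun s : R => expR (s * c)).
Proof.
move=> s; apply: (@continuous_comp _ _ _ (fun s : R => s * c) expR); last exact: continuous_expR.
by apply: cvgM; [exact: cvg_id|exact: cvg_cst].
Qed.

Lemma continuous_spec_power (P : 'M[R]_n) (d : 'rV[R]_n) i j :
  continuous (fun s : R => spec P (map_mx (fun c => expR (s * ln c)) d) i j).
Proof.
under eq_fun do rewrite conj_diagE.
apply: continuous_sumr => k s; apply: cvgM; last exact: cvg_cst.
apply: cvgM; first exact: cvg_cst.
under eq_fun do rewrite mxE.
rewrite mxE; exact: continuous_expR_mul.
Qed.

Lemma points_rpow (G : seq (MPoly[K]_(n * n))) (P : 'M[R]_n) (d : 'rV[R]_n) (s : R) :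
  P \in unitmx -> subgroup (points iotaR G) -> (forall i, 0 < d 0 i) ->
  points iotaR G (spec P d) -> points iotaR G (spec P (map_mx (fun c => expR (s * ln c)) d)).
Proof.
move=> Pu Gg d0 Gd; apply: (points_spec_fun (D := [set x | 0 < x])) => //=.
- by move=> x y x0 y0; rewrite mulr_gt0.
- by rewrite ln1 mulr0 expR0.
- by move=> x y x0 y0; rewrite lnM ?posrE // mulrDr expRD.
Qed.

Lemma points_pd (A : 'M[R]_n) : rpd A -> exists (P : 'M[R]_n) (d : 'rV[R]_n), [/\ P \in unitmx, forall i, 0 < d 0 i & A = spec P d].
Proof. by case. Qed.

Definition FClosed (F : sa_formula K n) : mform K n :=
  FAll 0 (FImp (FEx 9 (FAnd (FPoints S (V 9)) (FMEq (V 0) (MMul (V 9) (V 9)))))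
   (FImp (FEx 1 (FSa F (V 1)))
   (FImp (FAll 1 (FImp (FNot (FMEq (V 1) C0)) (FEx 2 (FAnd (FSa F (V 2))
      (FLt (STrace (MMul (MAdd (V 0) (MOpp (V 2))) (MTr (MAdd (V 0) (MOpp (V 2))))))
           (STrace (MMul (V 1) (MTr (V 1)))))))))
     (FSa F (V 0))))).

(** Intervals of [K] may be disconnected and real powers may be missing there, so a point of the
    second piece is transferred to a point [x] over [R]. The real powers of [x] form a path in the
    squares of [S] from the identity, which is in the first piece, to [x]; the two pieces pull back
    to disjoint closed sets covering the real line, which is connected. *)
Lemma squares_connected_half FU FW :
  closed_in (sqset (points idfun S)) (sa_ext idfun FU) ->
  closed_in (sqset (points idfun S)) (sa_ext idfun FW) ->
  sa_ext idfun FU `|` sa_ext idfun FW = sqset (points idfun S) ->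
  sa_ext idfun FU `&` sa_ext idfun FW = set0 ->
  sa_ext idfun FU 1%:M -> sa_ext idfun FU = sqset (points idfun S).
Proof.
move=> clU clW UW dis U1.
have US : sa_ext idfun FU `<=` sqset (points idfun S) by rewrite -UW => x; left.
apply/seteqP; split=> // x0 Dx0; apply: contrapT => nUx0.
have Wx0 : sa_ext idfun FW x0.
  by have : (sa_ext idfun FU `|` sa_ext idfun FW) x0 by [rewrite UW]; case.
have TC F : closed_in (sqset (points idfun S)) (sa_ext idfun F) ->
    finterp iotaR (fun=> 0) (FClosed F).
  move=> [Z cZ FE]; apply/tarski_transfer => /= x [y [Sy xyy]] exF H.
  rewrite FE; apply: (closed_approx cZ).
  - by exists y.
  - by have [z Fz] := exF; exists z; rewrite -FE.
  - move=> z z0; have [|y' [Fy' lt]] := H z; first by rewrite map_mx0.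
    by exists y'; rewrite -FE.
have /(tarski_transfer iotaR) /= TUW : Kholds (FAll 0 (FImp
    (FEx 9 (FAnd (FPoints S (V 9)) (FMEq (V 0) (MMul (V 9) (V 9)))))
    (FOr (FSa FU (V 0)) (FSa FW (V 0))))).
  move=> /= x [y [Sy xyy]].
  by have : (sa_ext idfun FU `|` sa_ext idfun FW) x by [rewrite UW; exists y].
have /(tarski_transfer iotaR) /= Tdis : Kholds (FAll 0 (FNot
    (FAnd (FSa FU (V 0)) (FSa FW (V 0))))).
  by move=> /= x UWx; rewrite -[False]/(set0 x) -dis.
have /(tarski_transfer iotaR) /= TU1 : Kholds (FSa FU (MCst (1%:M : 'M[K]_n))).
  by rewrite /= map_mx1.
have /(tarski_transfer iotaR) /= [x [[y [Sy xyy]] Wx]] : Kholds (FEx 0 (FAnd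
    (FEx 9 (FAnd (FPoints S (V 9)) (FMEq (V 0) (MMul (V 9) (V 9))))) (FSa FW (V 0)))).
  by exists x0; split=> //; have [y Sy ->] := Dx0; exists y.
rewrite map_mx1 in TU1.
have [Sg SSL] := points_group iotaR hS.1.
have ysym := points_sym hSsym Sy.
have xpd : rpd x by rewrite xyy -{2}ysym; apply: rpd_mulmxtr; case: Sg => _ _ /(_ _ Sy)[].
have [P [d [Pu d0 xE]]] := points_pd xpd.
have Sx : points iotaR S x by rewrite xyy; case: Sg => _ SM _; apply: SM.
pose g (s : R) := spec P (map_mx (fun c => expR (s * ln c)) d).
have Dg s : exists X, points iotaR S X /\ g s = X *m X.
  exists (g (s / 2)); split; first by apply: points_rpow => //; rewrite -xE.
  rewrite /g specM //; congr spec; apply/rowP => i; rewrite !mxE -expRD -mulrDl.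
  by rewrite -splitr.
have g0 : g 0 = 1%:M.
  rewrite /g -(spec1 Pu); congr spec; apply/rowP => i.
  by rewrite !mxE mul0r expR0.
have g1 : g 1 = x.
  rewrite xE /g; congr spec; apply/rowP => i.
  by rewrite !mxE mul1r lnK ?posrE.
have clg F : closed_in (sqset (points idfun S)) (sa_ext idfun F) ->
    closed [set s | sa_ext iotaR F (g s)].
  move=> /TC /= HF s0 cls0; apply: HF.
  - exact: Dg.
  - by have [s [Fs _]] := cls0 setT filterT; exists (g s).
  move=> z; rewrite map_mx0 => /eqP z0; have ez := mxtrace_mulmxtr z0.
  pose h (s : R) := \tr ((g s0 - g s) *m (g s0 - g s)^T).
  have hc : continuous h.
    apply: continuous_sumr => i.
    have -> : (fun s => ((g s0 - g s) *m (g s0 - g s)^T) i i) =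
              (fun s => \sum_j (g s0 i j - g s i j) * (g s0 i j - g s i j)).
      by apply: funext => s; rewrite mxE; apply: eq_bigr => j _; rewrite !mxE.
    apply: continuous_sumr => j s.
    by apply: cvgM; (apply: cvgB; [exact: cvg_cst|exact: continuous_spec_power]).
  have hs0 : h s0 < \tr (z *m z^T) by rewrite /h subrr mul0mx mxtrace0.
  have hs0c : h s @[s --> s0] --> h s0 by exact: hc.
  have [s [Fs hs]] := cls0 _ (cvgr_lt (h s0) hs0c _ hs0).
  by exists (g s).
have Rconn : connected [set: R] by apply/connected_intervalP.
have : [set s | sa_ext iotaR FU (g s)] = [set: R].
  apply: Rconn.
  - by exists 0 => /=; rewrite g0.
  - exists [set s | sa_ext iotaR FU (g s)]; last by rewrite setTI.
    have -> : [set s | sa_ext iotaR FU (g s)] = ~` [set s | sa_ext iotaR FW (g s)].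
      apply/seteqP; split=> s /=; first by move=> Us Ws; apply: (Tdis (g s)).
      by have [] := TUW _ (Dg s).
    by rewrite openC; apply: clg.
  - by exists [set s | sa_ext iotaR FU (g s)]; [exact: clg|rewrite setTI].
move=> /seteqP[_ /(_ 1 I)] /=; rewrite g1 => Ux.
exact: (Tdis x).
Qed.

Lemma squares_sub_component A :
  sa_component (points idfun S) 1%:M (sa_ext idfun A) ->
  sqset (points idfun S) `<=` sa_ext idfun A.
Proof.
move=> [A1 AS [_ Aconn] Amax]; have [r [p [Hsq Hnz Hp1]]] := split_torus_squares hS.
have [[G1 GM _] _] := points_group (idfun : {rmorphism K -> K}) hS.1.
have D1 : sqset (points idfun S) 1%:M by exists 1%:M; rewrite ?mulmx1.
apply: Amax => //; first by move=> _ [y Sy ->]; apply: GM.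
split.
  exists [:: (S, [seq p i | i <- enum 'I_r])]; apply/seteqP; split=> x.
    move=> /Hsq[Sx px]; exists (S, [seq p i | i <- enum 'I_r]); split=> //; first exact: mem_head.
    by move=> _ /mapP[i _ ->].
  move=> [c []]; rewrite inE => /eqP -> /= H1 H2; apply/Hsq; split=> // i.
  by apply: H2; apply/mapP; exists i; rewrite ?mem_enum.
move=> U W [FU ->] [FW ->] clU clW UW dis.
have : (sa_ext idfun FU `|` sa_ext idfun FW) 1%:M by rewrite UW.
case=> H1; [left|right]; first exact: (squares_connected_half clU clW).
by apply: (squares_connected_half clW clU) => //; rewrite 1?setUC 1?setIC.
Qed.

(** Being a square of a point of [S] is a first-order condition, so the equality over [K] persists:
    from here on, [A] over any extension is handled through square roots in [S] of its elements. *)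
Lemma component_squares A (E : rcfType) (f : {rmorphism K -> E}) :
  sa_component (points idfun S) 1%:M (sa_ext idfun A) ->
  sa_ext f A = sqset (points f S).
Proof.
move=> hA.
have AE : sa_ext idfun A = sqset (points idfun S).
  by apply/seteqP; split; [exact: component_sub_squares|exact: squares_sub_component].
have /(tarski_transfer f) /= H1 : Kholds (FAll 0 (FImp (FSa A (V 0))
    (FEx 9 (FAnd (FPoints S (V 9)) (FMEq (V 0) (MMul (V 9) (V 9))))))).
  by move=> /= x; rewrite AE => -[y Sy xyy]; exists y.
have /(tarski_transfer f) /= H2 : Kholds (FAll 0 (FImp
    (FEx 9 (FAnd (FPoints S (V 9)) (FMEq (V 0) (MMul (V 9) (V 9))))) (FSa A (V 0)))).
  by move=> /= x [y [Sy xyy]]; rewrite AE; exists y.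
apply/seteqP; split=> x.
  by move=> /H1[y [Sy xyy]]; exists y.
by move=> [y Sy xyy]; apply: H2; exists y.
Qed.

End Component.

(** * Asymptotic expansions and the real torus *)

Section SmallO.
Variables (R : realType) (n : nat).
Implicit Types (f g : R -> 'M[R]_n) (X : 'M[R]_n).

Definition Oh k f := exists2 C, 0 <= C & forall t, 0 <= t <= 1 -> mbound (C * t ^+ k) (f t).

Lemma Oh_ext k f g : (forall t, 0 <= t <= 1 -> f t = g t) -> Oh k f -> Oh k g.
Proof. by move=> fg [C C0 H]; exists C => // t t01; rewrite -fg //; apply: H. Qed.

Lemma OhD k f g : Oh k f -> Oh k g -> Oh k (fun t => f t + g t).
Proof.
move=> [C C0 HC] [D D0 HD]; exists (C + D); first exact: addr_ge0.
move=> t t01 i j; rewrite mxE mulrDl (le_trans (ler_normD _ _)) // lerD //.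
  exact: HC.
exact: HD.
Qed.

Lemma OhN k f : Oh k f -> Oh k (fun t => - f t).
Proof. by move=> [C C0 HC]; exists C => // t t01 i j; rewrite mxE normrN; apply: HC. Qed.

Lemma OhB k f g : Oh k f -> Oh k g -> Oh k (fun t => f t - g t).
Proof. by move=> Hf /OhN; apply: OhD. Qed.

Lemma Oh_tr k f : Oh k f -> Oh k (fun t => (f t)^T).
Proof. by move=> [C C0 HC]; exists C => // t t01 i j; rewrite mxE; apply: HC. Qed.

Lemma OhM k l f g : Oh k f -> Oh l g -> Oh (k + l) (fun t => f t *m g t).
Proof.
move=> [C C0 HC] [D D0 HD]; exists (n%:R * (C * D)); first by rewrite !mulr_ge0.
move=> t t01 i j; apply: le_trans (mbound_mul (HC t t01) (HD t t01) i j) _.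
rewrite exprD le_eqVlt; apply/orP; left; apply/eqP.
by set a := t ^+ k; set b := t ^+ l; set N : R := n%:R; ring.
Qed.

Lemma Oh_cst X : Oh 0 (fun _ => X).
Proof.
have [B B1 HB] := mbound_exists X; exists B; first exact: le_trans B1.
by move=> t _ i j; rewrite expr0 mulr1; apply: HB.
Qed.

Lemma Oh_lin X : Oh 1 (fun t => t *: X).
Proof.
have [B B1 HB] := mbound_exists X; exists B; first exact: le_trans B1.
move=> t /andP[t0 _] i j; rewrite mxE normrM ger0_norm // expr1 mulrC ler_wpM2r //.
Qed.

Lemma Oh_weak k l f : (k <= l)%N -> Oh l f -> Oh k f.
Proof.
move=> kl [C C0 HC]; exists C => // t t01 i j; apply: le_trans (HC t t01 i j) _.
case/andP: t01 => t0 t1; rewrite ler_wpM2l // -(subnK kl) exprD.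
by rewrite ler_piMl ?exprn_ge0 // exprn_ile1.
Qed.

Lemma small_pos (C e : R) : 0 <= C -> 0 < e -> exists t, [/\ 0 < t, t <= 1 & C * t < e].
Proof.
move=> C0 e0; have C1 : 0 < C + 1 by rewrite ltr_wpDl.
pose u := e / (2 * (C + 1)).
have u0 : 0 < u by rewrite divr_gt0 // mulr_gt0.
exists (Num.min 1 u); split; rewrite ?lt_min ?ltr01 ?ge_min ?lexx //.
apply: le_lt_trans (_ : C * u < e); first by rewrite ler_wpM2l // ge_min lexx orbT.
rewrite /u mulrA ltr_pdivrMr ?mulr_gt0 // mulrC; nra.
Qed.

Lemma Oh_zero k X : Oh k.+1 (fun t => t ^+ k *: X) -> X = 0.
Proof.
move=> [C C0 HC]; apply/matrixP => i j; rewrite mxE; apply/eqP; rewrite -normr_le0.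
rewrite leNgt; apply/negP => Xij.
have [t [t0 t1 Ct]] := small_pos C0 Xij.
have := HC t; rewrite (ltW t0) t1 => /(_ isT i j); rewrite mxE normrM normrX.
rewrite (gtr0_norm t0) exprS mulrA [C * t * _]mulrC ler_pM2l ?exprn_gt0 //.
by rewrite leNgt Ct.
Qed.

Lemma expmx_Oh2 X : Oh 2 (fun t => expmx (t *: X) - (1%:M + t *: X)).
Proof. exact: expmx_taylor1. Qed.

End SmallO.

Section RealSide.
Variables (K : rcfType) (R : realType) (iotaR : {rmorphism K -> R}) (n : nat).
Variables (G S : seq (MPoly[K]_(n * n))) (A : sa_formula K n) (a : {vspace 'M[R]_n}).
Hypotheses (hG : alg_subgroup_SL G) (hGT : self_adjoint G).
Hypotheses (hS : split_torus S) (hSsym : forall s, Cpoints S s -> s = s^T).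
Hypothesis hSG : Cpoints S `<=` Cpoints G.
Hypothesis hA : sa_component (points idfun S) 1%:M (sa_ext idfun A).
Hypothesis ha : forall H : 'M[R]_n, H \in a <-> Lie (sa_ext iotaR A) H.
Local Notation AR := (sa_ext iotaR A).
Local Notation GR := (points iotaR G).
Local Notation SR := (points iotaR S).

Lemma AR_squares : AR = sqset SR.
Proof. exact: (component_squares iotaR hS hSsym iotaR hA). Qed.

Lemma AR_rpd x : AR x -> rpd x.
Proof.
rewrite AR_squares => -[y Sy ->]; have [[_ _ SV] _] := points_group iotaR hS.1.
by rewrite -{2}(points_sym hSsym Sy); apply: rpd_mulmxtr; case: (SV _ Sy).
Qed.

Lemma AR_SR x : AR x -> SR x.
Proof.
rewrite AR_squares => -[y Sy ->]; have [[_ SM _] _] := points_group iotaR hS.1.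
exact: SM.
Qed.

Lemma AR_GR x : AR x -> GR x.
Proof. by move=> /AR_SR; apply: points_sub. Qed.

Lemma AR_comm x y : AR x -> AR y -> x *m y = y *m x.
Proof.
move=> /AR_SR Sx /AR_SR Sy; apply: (points_comm _ Sx Sy) => s t Ss St.
apply: (@toCm_inj K); rewrite !map_mxM.
by apply: (split_torus_comm hS); apply/points_KC.
Qed.

Lemma AR_log (P : 'M[R]_n) (d : 'rV[R]_n) : P \in unitmx -> (forall i, 0 < d 0 i) ->
  AR (spec P d) -> spec P (map_mx (@ln R) d) \in a.
Proof.
move=> Pu d0 Ad; apply/ha => t; rewrite expmx_spec //.
have Sg := (points_group iotaR hS.1).1.
have Sd := AR_SR Ad.
rewrite AR_squares; exists (spec P (map_mx (fun c => expR (t / 2 * ln c)) d)).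
  by apply: points_rpow.
rewrite specM //; congr spec; apply/rowP => i; rewrite !mxE -expRD -mulrDl.
by rewrite -splitr.
Qed.

Lemma AR_exp x : AR x -> exists (P : 'M[R]_n) (d : 'rV[R]_n), [/\ P \in unitmx, x = spec P (map_mx expR d),
  spec P d \in a & x = expmx (spec P d)].
Proof.
move=> Ax; have [P [d [Pu d0 xE]]] := points_pd (AR_rpd Ax).
exists P, (map_mx (@ln R) d).
have E : map_mx expR (map_mx (@ln R) d) = d.
  by apply/rowP => i; rewrite !mxE lnK ?posrE.
split=> //; first by rewrite E.
  by apply: AR_log => //; rewrite -xE.
rewrite -[spec _ _]scale1r expmx_spec // xE; congr spec; apply/rowP => i.
by rewrite !mxE mul1r lnK ?posrE.
Qed.

Lemma exp_AR H t : H \in a -> AR (expmx (t *: H)).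
Proof. by move=> /ha. Qed.

Lemma expmx_a H : H \in a -> AR (expmx H).
Proof. by move=> /ha/(_ 1); rewrite scale1r. Qed.

(** The coefficient of [t] in the symmetric matrices [expmx (t *: H)] is symmetric; the coefficient
    of [t ^+ 2] in the commutator of two exponentials gives [a_comm] in the same way. *)
Lemma a_sym H : H \in a -> H^T = H.
Proof.
move=> Ha; apply/eqP; rewrite -subr_eq0; apply/eqP; apply: (@Oh_zero _ _ 1).
have O2 := expmx_Oh2 H.
apply: (Oh_ext _ (OhB O2 (Oh_tr O2))) => t _.
have [sE _] := AR_rpd (exp_AR t Ha).
move: sE; move: (expmx _) => e /matrixP sE; apply/matrixP => i j.
have := sE i j; rewrite !mxE => ->; rewrite expr1 (eq_sym j i).
by ring.
Qed.

Lemma a_comm H H' : H \in a -> H' \in a -> H *m H' = H' *m H.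
Proof.
move=> Ha Ha'; apply/eqP; rewrite -subr_eq0; apply/eqP; apply: (@Oh_zero _ _ 2).
have O2 := expmx_Oh2 H; have O2' := expmx_Oh2 H'.
have L := Oh_lin H; have L' := Oh_lin H'.
pose r t := expmx (t *: H) - (1%:M + t *: H).
pose r' t := expmx (t *: H') - (1%:M + t *: H').
have O3 : Oh 3 (fun t => ((t *: H') *m r t + (r' t *m (t *: H) + r' t *m r t)) -
   ((t *: H) *m r' t + (r t *m (t *: H') + r t *m r' t))).
  by apply: OhB; apply: OhD; [exact: (OhM (k := 1) (l := 2))|
    apply: OhD; [exact: (OhM (k := 2) (l := 1))|exact: (Oh_weak (l := 4) _ (OhM (k := 2) (l := 2) _ _))]
   |exact: (OhM (k := 1) (l := 2))|
    apply: OhD; [exact: (OhM (k := 2) (l := 1))|exact: (Oh_weak (l := 4) _ (OhM (k := 2) (l := 2) _ _))]].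
apply: Oh_ext O3 => t _.
have := AR_comm (exp_AR t Ha) (exp_AR t Ha').
have -> : expmx (t *: H) = 1%:M + (t *: H + r t) by rewrite addrA subrKC.
have -> : expmx (t *: H') = 1%:M + (t *: H' + r' t) by rewrite addrA subrKC.
move: (r t) (r' t) => {}r {}r'.
rewrite !(mulmxDl, mulmxDr) !mul1mx !mulmx1 -!scalemxAl -!scalemxAr !scalerA -expr2 scalerBr.
move: (H *m H') (H' *m H) (H' *m r) (r' *m H) (r' *m r) (H *m r') (r *m H') (r *m r').
move=> m1 m2 m3 m4 m5 m6 m7 m8 /matrixP E; apply/matrixP => i j.
by have := E i j; rewrite !mxE; lra.
Qed.

End RealSide.

(** * Root vectors *)

Lemma codiag_seq (L : fieldType) n (As : seq 'M[L]_n) :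
  (forall X, X \in As -> exists P d, P \in unitmx /\ X = spec P d) ->
  (forall X Y, X \in As -> Y \in As -> X *m Y = Y *m X) ->
  exists2 P, P \in unitmx & forall X, X \in As -> exists d, X = spec P d.
Proof.
move=> HD HC.
have simE (P X : 'M[L]_n) d : P \in unitmx -> similar P X (diag_mx d) <-> X = spec P d.
  move=> Pu; split=> [/(similarP Pu) H|->].
    by rewrite /spec -mulmxA -H mulmxA mulVmx // mul1mx.
  by apply/(similarP Pu); rewrite /spec !mulmxA mulmxV // mul1mx.
have [|P Pu /allP HP] := (codiagonalizableP As).1.
  split=> [X Y XA YA|X XA]; first exact: HC.
  have [P [d [Pu Xd]]] := HD X XA; exists P => //.
  by apply/similar_diagPex; exists d; apply/simE.
exists P => // X /HP/similar_diagPex[d] /(simE _ _ _ Pu) ->.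
by exists d.
Qed.

Lemma dual_of_linear (R : realType) n (a : {vspace 'M[R]_n}) (phi : 'M[R]_n -> R) :
  (forall c x y, phi (c *: x + y) = c * phi x + phi y) ->
  exists al : dual a, forall x, al x = phi (vsval x).
Proof.
move=> H.
have L : linear (fun x : subvs_of a => (phi (vsval x) : R^o)).
  by move=> c x y; rewrite linearP H.
pose f : {linear subvs_of a -> R^o} := HB.pack (fun x : subvs_of a => (phi (vsval x) : R^o))
   (GRing.isLinear.Build R (subvs_of a) R^o *:%R _ L).
by exists (linfun f) => x; rewrite lfunE.
Qed.

Section Generic.
Variables (R : realType).

(** Each pair other than zero excludes at most one value of [e]. *)
Lemma avoid (s : seq (R * R)) :
  exists2 d, 0 < d & forall e, 0 < e < d -> forall ab, ab \in s ->
    ab <> (0, 0) -> ab.1 + e * ab.2 != 0.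
Proof.
elim: s => [|[x y] s [d d0 IH]]; first by exists 1.
have [d' d'0 H] : exists2 d', 0 < d' & forall e, 0 < e < d' -> (x, y) <> (0, 0) -> x + e * y != 0.
  have [x0|x0] := eqVneq x 0.
    exists 1 => // e /andP[e0 _] xy; rewrite x0 add0r mulf_neq0 //; first by rewrite gt_eqF.
    by apply/eqP => y0; apply: xy; rewrite x0 y0.
  exists (`|x| / (`|y| + 1)); first by rewrite divr_gt0 ?normr_gt0 // ltr_wpDl.
  move=> e /andP[e0]; rewrite ltr_pdivlMr ?ltr_wpDl // => H _.
  apply/eqP => xey; have : `|x| = e * `|y|.
    have -> : x = - (e * y) by apply/eqP; rewrite -addr_eq0 xey.
    by rewrite normrN normrM gtr0_norm.
  by move=> xe; move: H; rewrite xe mulrDr mulr1 -subr_lt0 addrAC subrr add0r ltNge ltW.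
exists (Num.min d d'); first by rewrite lt_min d0.
move=> e /andP[e0]; rewrite lt_min => /andP[ed ed'] ab; rewrite inE => /predU1P[->|abs].
  by apply: H; rewrite e0.
by apply: IH => //; rewrite e0.
Qed.

(** A regular vector of [W] is built one form at a time: if [f] is not identically zero on [W], a
    multiple of a vector where it is nonzero is added to [H], with a coefficient from [avoid] that
    makes [f] nonzero and keeps nonzero the forms that were so at [H]. *)
Lemma generic_vec (V : lmodType R) (W : {pred V}) (s : seq (V -> R)) :
  0 \in W -> (forall c x y, x \in W -> y \in W -> c *: x + y \in W) ->
  (forall i c x y, (nth (fun=> 0) s i) (c *: x + y) = c * (nth (fun=> 0) s i) x + (nth (fun=> 0) s i) y) ->
  exists2 H, H \in W & forall i, (nth (fun=> 0) s i) H = 0 ->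
    forall H', H' \in W -> (nth (fun=> 0) s i) H' = 0.
Proof.
move=> W0 Wl; elim: s => [|f s IH] lin; first by exists 0 => // i _ H' _; rewrite nth_nil.
have [H HW Hg] := IH (fun i => lin i.+1).
have [fz|/existsNP[H' /not_implyP[H'W /eqP fH']]] := pselect (forall H', H' \in W -> f H' = 0).
  by exists H => // -[|i] //=; exact: Hg.
have [d d0 Hd] := avoid ([:: (f H, f H')] ++ [seq (g H, g H') | g <- s]).
have e0 : 0 < d / 2 < d by rewrite divr_gt0 //= ltr_pdivrMr // mulr_natr mulr2n ltrDl.
exists (d / 2 *: H' + H); first exact: Wl.
move=> [|i] /=.
  have /= -> := lin 0%N (d / 2) H' H; rewrite addrC => E; exfalso.
  have nz : (f H, f H') <> (0, 0) by case=> _ /eqP; rewrite (negPf fH').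
  by have := Hd _ e0 _ (mem_head _ _) nz; rewrite /= E eqxx.
have /= -> := lin i.+1 (d / 2) H' H; rewrite addrC => E.
have [si|si] := ltnP i (size s); last by move=> X _; rewrite nth_default.
apply: Hg; apply/eqP; apply: contraT => gH.
have nz : (nth (fun=> 0) s i H, nth (fun=> 0) s i H') <> (0, 0).
  by case=> /eqP; rewrite (negPf gH).
have inS : (nth (fun=> 0) s i H, nth (fun=> 0) s i H') \in
    [:: (f H, f H')] ++ [seq (g H, g H') | g <- s].
  rewrite inE; apply/orP; right.
  by rewrite -(nth_map _ (0, 0) (fun g => (g H, g H'))) // mem_nth ?size_map.
by have := Hd _ e0 _ inS nz; rewrite /= E eqxx.
Qed.

End Generic.

(** [lam] is the diagonal of [P X P^-1], taken for all matrices and not only for those of [a], so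
    that linearity holds without side conditions. *)
Lemma codiag_space (R : realType) n (a : {vspace 'M[R]_n}) :
  (forall X, X \in a -> X^T = X) ->
  (forall X X', X \in a -> X' \in a -> X *m X' = X' *m X) ->
  exists P (lam : 'M[R]_n -> 'rV[R]_n), [/\ P \in unitmx,
    forall c X X' i, lam (c *: X + X') 0 i = c * lam X 0 i + lam X' 0 i &
    forall X, X \in a -> X = spec P (lam X)].
Proof.
move=> asym acomm.
have [||P Pu HP] := @codiag_seq R n (vbasis a).
- by move=> X Xb; apply: real_spectral; apply: asym; exact: vbasis_mem.
- by move=> X Y Xb Yb; apply: acomm; apply: vbasis_mem.
pose lam (X : 'M[R]_n) : 'rV[R]_n := \row_i (P *m X *m invmx P) i i.
have lamlin c X X' i : lam (c *: X + X') 0 i = c * lam X 0 i + lam X' 0 i.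
  have lamE Z : lam Z 0 i = (P *m Z *m invmx P) i i by rewrite mxE.
  rewrite !lamE mulmxDr mulmxDl -scalemxAr -scalemxAl.
  by move: (P *m X *m invmx P) (P *m X' *m invmx P) => U V; rewrite !mxE.
exists P, lam; split=> // X Xa.
suff dg i j : i != j -> (P *m X *m invmx P) i j = 0.
    have XE : invmx P *m (P *m X *m invmx P) *m P = X.
      by rewrite !mulmxA mulVmx // mul1mx mulmxKV.
    rewrite -[LHS]XE /spec; congr (_ *m _ *m _); apply/matrixP => i j.
    rewrite [RHS]mxE; have [->|ij] := eqVneq i j; last by rewrite dg // mulr0n.
    by rewrite mulr1n /lam [in RHS]mxE.
  move=> ij; rewrite (coord_vbasis Xa) mulmx_sumr mulmx_suml summxE big1 // => k _.
  rewrite -scalemxAr -scalemxAl mxE.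
  have [|d ->] := HP (vbasis a)`_k; first by rewrite mem_nth // size_tuple.
  by rewrite /spec !mulmxA mulmxV // mul1mx mulmxK // mxE (negPf ij) mulr0n mulr0.
Qed.

Section LieGroup.
Variables (K : rcfType) (R : realType) (iotaR : {rmorphism K -> R}) (n : nat).
Variables (G : seq (MPoly[K]_(n * n))).
Hypotheses (hG : alg_subgroup_SL G).
Local Notation GR := (points iotaR G).
Local Notation L := (Lie (points iotaR G)).

Lemma Lie_scale X (c : R) : L X -> L (c *: X).
Proof. by move=> LX t; rewrite scalerA; apply: LX. Qed.

Lemma Lie_conj X g : GR g -> L X -> L (g *m X *m invmx g).
Proof.
have [[_ GM GV] _] := points_group iotaR hG.
move=> Gg LX t; have [gu Gg'] := GV _ Gg.
rewrite scalemxAl scalemxAr -{1}(invmxK g) expmx_conj ?unitmx_inv // invmxK.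
by apply: (GM) => //; apply: GM.
Qed.

Lemma Lie_log (P : 'M[R]_n) (d : 'rV[R]_n) : P \in unitmx -> (forall i, 0 < d 0 i) ->
  GR (spec P d) -> L (spec P (map_mx (@ln R) d)).
Proof.
move=> Pu d0 Gd t; rewrite expmx_spec // map_map_mx.
by apply: points_rpow => //; have [] := points_group iotaR hG.
Qed.

(** The exponential is Lipschitz on bounded sets and [G] is closed, so [expmx (t *: Y)] is a limit
    of points of [G]. *)
Lemma Lie_limit Y : (forall e, 0 < e -> exists2 Z, L Z & mbound e (Z - Y)) -> L Y.
Proof.
move=> H t p pG.
have cl : closed [set x : 'M[R]_n | mxeval iotaR p x = 0].
  apply: (@closed_comp _ _ (fun x : 'M[R]_n => mxeval iotaR p x) [set 0]).
    by move=> x _; apply: continuous_mxeval.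
  exact: closed_eq.
apply: cl => B /nbhs_ballP[e /= e0 xB].
have [B1 B11 HB1] := mbound_exists Y.
pose B2 := (`|t| + 1) * (B1 + 1).
have B21 : 1 <= B2 by have := normr_ge0 t; rewrite /B2; nra.
have HY : mbound B2 (t *: Y).
  move=> i j; rewrite mxE normrM; have := HB1 i j; have := normr_ge0 t; have := normr_ge0 (Y i j).
  rewrite /B2; nra.
pose c := expR (2 * (n%:R * B2)).
have c0 : 0 < c by exact: expR_gt0.
(* At most 1, so that [B2] bounds [t *: Z] as well as [t *: Y]; the second argument makes the
   Lipschitz bound [|t| e1 c] smaller than [e]. *)
pose e1 := Num.min 1 (e / (2 * c * (`|t| + 1))).
have t1 : 0 < `|t| + 1 by rewrite ltr_wpDl.
have e10 : 0 < e1 by rewrite lt_min ltr01 /= divr_gt0 // !mulr_gt0.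
have [Z LZ HZ] := H e1 e10.
exists (expmx (t *: Z)); split; first exact: (LZ t p pG).
apply: xB; split=> // i j; rewrite /ball /= distrC.
have HZ2 : mbound B2 (t *: Z).
  move=> k l; have := HZ k l; have := HB1 k l; rewrite !mxE normrM => h1 h2.
  have h3 : `|Z k l| <= B1 + 1.
    have -> : Z k l = (Z k l - Y k l) + Y k l by rewrite subrK.
    apply: le_trans (ler_normD _ _) _; rewrite addrC lerD //.
    by apply: le_trans h2 _; rewrite ge_min lexx.
  have := normr_ge0 t; have := normr_ge0 (Z k l); rewrite /B2; nra.
have HZ3 : mbound (`|t| * e1) (t *: Z - t *: Y).
  move=> k l; rewrite -scalerBr mxE normrM ler_wpM2l //; exact: HZ.
have := expmx_lipschitz B21 HZ2 HY HZ3 i j; rewrite -/c.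
rewrite [_ i j]mxE [X in _ + X]mxE => h; apply: le_lt_trans h _.
have h4 : e1 * (2 * c * (`|t| + 1)) <= e.
  by rewrite -ler_pdivlMr ?mulr_gt0 // ge_min lexx orbT.
have := normr_ge0 t; nra.
Qed.


Section Contraction.
Variables (P : 'M[R]_n) (lam : 'rV[R]_n) (Y : 'M[R]_n) (b : R).
Hypothesis Pu : P \in unitmx.
Hypothesis Gexp : forall t : R, GR (expmx (t *: spec P lam)).
Let Y' := P *m Y *m invmx P.
Hypothesis Hb : forall i j, Y' i j != 0 -> lam 0 i - lam 0 j <= b.

Definition top_part : 'M[R]_n :=
  invmx P *m (\matrix_(i, j) (if lam 0 i - lam 0 j == b then (P *m Y *m invmx P) i j else 0)) *m P.

(* Conjugation by exp(s H), rescaled by exp(- s b), kills all the weight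
   components of Y but the top one as s tends to infinity. *)
Lemma Lie_top_part : L Y -> L top_part.
Proof.
move=> LY; apply: Lie_limit => e e0.
have [B B1 HB] := mbound_exists P; have [C C1 HC] := mbound_exists (invmx P).
(* The tolerance in the eigenbasis: returning from it by [P] costs at most the factor in the
   denominator. *)
pose w := e / (n%:R * (n%:R * (C * B)) + 1).
have den0 : 0 < n%:R * (n%:R * (C * B)) + 1.
  by rewrite ltr_wpDl // !mulr_ge0 // ?(le_trans _ C1) // (le_trans _ B1).
have w0 : 0 < w by rewrite divr_gt0.
(* Since [1 + x <= expR x], an entry [(i, j)] of lower weight drops below [w] as soon as
   [s >= s0 i j]. *)
pose s0 i j := if (lam 0 i - lam 0 j < b) then `|Y' i j| / (w * (b - (lam 0 i - lam 0 j))) else 0.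
have s0_ge0 i j : 0 <= s0 i j.
  by rewrite /s0; case: ifP => // h; rewrite divr_ge0 // mulr_ge0 ?(ltW w0) // subr_ge0 ltW.
pose s := \sum_i \sum_j s0 i j.
have s0s i j : s0 i j <= s.
  rewrite /s (bigD1 i) //= (bigD1 j) //= -addrA lerDl addr_ge0 //.
    by apply: sumr_ge0.
  by apply: sumr_ge0 => k _; apply: sumr_ge0.
pose g := expmx (s *: spec P lam).
have gE : g = spec P (map_mx (fun x => expR (s * x)) lam) by rewrite /g expmx_spec.
have gne i : map_mx (fun x => expR (s * x)) lam 0 i != 0 by rewrite mxE gt_eqF // expR_gt0.
exists (expR (- (s * b)) *: (g *m Y *m invmx g)).
  by apply: Lie_scale; apply: Lie_conj => //; exact: Gexp.
rewrite gE spec_inv // /top_part.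
set M2 := \matrix_(i, j) _.
pose M1 := \matrix_(i, j) (expR (s * (lam 0 i - lam 0 j - b)) * Y' i j).
have -> : expR (- (s * b)) *: (spec P (map_mx (fun x => expR (s * x)) lam) *m Y *m
    spec P (map_mx (fun x => x^-1) (map_mx (fun x => expR (s * x)) lam))) = invmx P *m M1 *m P.
  rewrite /spec -!mulmxA.
  rewrite scalemxAr; congr (invmx P *m _); rewrite !mulmxA scalemxAl; congr (_ *m P).
  rewrite -!mulmxA (mulmxA P) (mulmxA (P *m Y)) -/Y' mulmxA.
  rewrite /M1; generalize Y' => Z.
  apply/matrixP => i j; rewrite mxE mul_mx_diag mxE mul_diag_mx !mxE -expRN.
  rewrite mulrA [RHS](_ : _ = expR (- (s * b)) * (expR (s * lam 0 i)) * expR (- (s * lam 0 j)) * Z i j).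
    by ring.
  by rewrite -!expRD; congr (expR _ * _); ring.
rewrite -mulmxBl -mulmxBr.
have HW : mbound w (M1 - M2).
  move=> i j; rewrite /M1 /M2 -/Y'; move: (s0s i j) (@Hb i j); rewrite /s0.
  generalize Y' => Z sZ HbZ; rewrite !mxE; case: eqP => [->|/eqP ne].
    by rewrite subrr mulr0 expR0 mul1r subrr normr0 ltW.
  rewrite subr0; have [->|Yn] := eqVneq (Z i j) 0; first by rewrite mulr0 normr0 ltW.
  have lt : lam 0 i - lam 0 j < b by rewrite lt_neqAle ne HbZ.
  move: sZ; rewrite lt; set dd := b - (lam 0 i - lam 0 j).
  have dd0 : 0 < dd by rewrite subr_gt0.
  rewrite ler_pdivrMr; last exact: mulr_gt0.
  move=> h.
  rewrite normrM (gtr0_norm (expR_gt0 _)).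
  have -> : s * (lam 0 i - lam 0 j - b) = - (s * dd) by rewrite /dd; ring.
  rewrite expRN mulrC ler_pdivrMr ?expR_gt0 //; apply: le_trans h _.
  rewrite mulrCA ler_wpM2l ?(ltW w0) //; apply: le_trans (expR_ge1Dx _).
  by rewrite lerDr.
have := mbound_mul HC (mbound_mul HW HB); rewrite mulmxA => h i j.
apply: le_trans (h i j) _.
have -> : n%:R * (C * (n%:R * (w * B))) = w * (n%:R * (n%:R * (C * B))) by ring.
have : w * (n%:R * (n%:R * (C * B)) + 1) = e by rewrite /w mulrVK ?unitfE ?gt_eqF.
by move=> <-; rewrite ler_wpM2l ?(ltW w0) // lerDl.
Qed.

End Contraction.

(** [Lie] is known to be stable under scaling, conjugation and limits, so a weight component of [Y]
    is not split off by a linear projection. Instead [Lie_top_part] is applied twice: along [H] or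
    its opposite, to keep only weights that are nonzero at [H], then along a generic element of [a],
    which leaves a single weight. *)
Lemma Lie_root_vector (a : {vspace 'M[R]_n}) Y H :
  (forall X, X \in a -> L X) -> (forall X, X \in a -> X^T = X) ->
  (forall X X', X \in a -> X' \in a -> X *m X' = X' *m X) ->
  L Y -> H \in a -> H *m Y <> Y *m H ->
  exists alpha : dual a, is_root L alpha /\ alpha (vsproj a H) <> 0.
Proof.
move=> aL asym acomm LY Ha HY.
have [P [lam [Pu lamlin aspec]]] := codiag_space asym acomm.
pose e (p : 'I_n * 'I_n) X := lam X 0 p.1 - lam X 0 p.2.
have elin p c X X' : e p (c *: X + X') = c * e p X + e p X'.
  by rewrite /e !lamlin; ring.
have ad X Z p : X \in a ->
    (P *m (X *m Z - Z *m X) *m invmx P) p.1 p.2 = e p X * (P *m Z *m invmx P) p.1 p.2.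
  move=> Xa; rewrite {1 2}(aspec X Xa).
  have -> : P *m (spec P (lam X) *m Z - Z *m spec P (lam X)) *m invmx P =
      diag_mx (lam X) *m (P *m Z *m invmx P) - (P *m Z *m invmx P) *m diag_mx (lam X).
    rewrite /spec mulmxBr mulmxBl !mulmxA mulmxV // mul1mx; congr (_ - _).
    by rewrite -!mulmxA mulmxV // mulmx1.
  rewrite mxE [X in _ + X]mxE mul_mx_diag mul_diag_mx mxE [X in _ - X]mxE /e.
  by rewrite [(lam X) 0 p.1 - _]lock; unlock; ring.
have conjI Z : P *m (invmx P *m Z *m P) *m invmx P = Z.
  by rewrite !mulmxA mulmxV // mul1mx mulmxK.
have [p0 Hp0 eH0] : exists2 p0, (P *m Y *m invmx P) p0.1 p0.2 != 0 & e p0 H != 0.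
  apply: contrapT => Hno; apply: HY; apply/eqP; rewrite -subr_eq0; apply/eqP.
  have -> : H *m Y - Y *m H = invmx P *m (P *m (H *m Y - Y *m H) *m invmx P) *m P.
    by rewrite !mulmxA mulVmx // mul1mx mulmxKV.
  suff -> : P *m (H *m Y - Y *m H) *m invmx P = 0 by rewrite mulmx0 mul0mx.
  apply/matrixP => i j; rewrite (ad H Y (i, j)) // [RHS]mxE; apply/eqP; rewrite mulf_eq0.
  apply: contrapT => /negP; rewrite negb_or => /andP[h1 h2]; apply: Hno.
  by exists (i, j).
(* The sign makes some weight occurring in [Y] positive at [H1], hence also the largest one. The
   summand 0 brings [H1] to the shape of [elin]. *)
pose H1 := (if 0 < e p0 H then 1 else -1) *: H + 0.
have H1a : H1 \in a by rewrite /H1 addr0 memvZ.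
have e0 p : e p 0 = 0.
  by have := elin p 1 0 0; rewrite scale1r addr0 mul1r => E; lra.
have eH1 p : e p H1 = (if 0 < e p0 H then 1 else -1) * e p H by rewrite /H1 elin e0 addr0.
have eH1_gt0 : 0 < e p0 H1.
  rewrite eH1; case: ifP => [|/negbT]; first by rewrite mul1r.
  by rewrite -leNgt => h; rewrite mulN1r oppr_gt0 lt_neqAle eH0.
have top (Z X : 'M[R]_n) q0 : L Z -> X \in a -> (P *m Z *m invmx P) q0.1 q0.2 != 0 ->
  exists Z', exists q, [/\ L Z', e q0 X <= e q X, (P *m Z' *m invmx P) q.1 q.2 != 0 &
    forall p, (P *m Z' *m invmx P) p.1 p.2 != 0 ->
      e p X = e q X /\ (P *m Z *m invmx P) p.1 p.2 != 0].
  move=> LZ Xa Z0.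
  pose q := [arg max_(p > q0 | (P *m Z *m invmx P) p.1 p.2 != 0) e p X]%O.
  have [Zq qmax] : (P *m Z *m invmx P) q.1 q.2 != 0 /\
      forall p, (P *m Z *m invmx P) p.1 p.2 != 0 -> e p X <= e q X.
    by rewrite /q; case: arg_maxP.
  exists (top_part P (lam X) Z (e q X)), q.
  have E p : (P *m top_part P (lam X) Z (e q X) *m invmx P) p.1 p.2 =
      if e p X == e q X then (P *m Z *m invmx P) p.1 p.2 else 0.
    by rewrite /top_part conjI mxE.
  clearbody q; split; [ | exact: qmax | by rewrite E eqxx |
    by move=> p; rewrite E; case: (e p X =P e q X) => [->|_]; rewrite ?eqxx].
  have Gexp t : GR (expmx (t *: spec P (lam X))) by rewrite -(aspec X Xa); exact: aL.
  exact: (Lie_top_part Pu Gexp (fun i j => qmax (i, j)) LZ).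
have [Y1 [q1 [LY1 q1p Y1q Y1s]]] := top Y H1 p0 LY H1a Hp0.
(* Differences of weights: two weights that agree at [Hg] agree on all of [a], so the part of
   maximal value at [Hg] has only one weight. *)
pose s := [seq (fun X => e pq.1 X - e pq.2 X) | pq <- enum {: ('I_n * 'I_n) * ('I_n * 'I_n)}].
have [|||Hg Hga Hgg] := @generic_vec R 'M[R]_n (mem a) s.
- exact: mem0v.
- by move=> c X X' Xa X'a; apply: memvD => //; apply: memvZ.
- move=> i c X X'; have [si|si] := ltnP i (size s); last by rewrite !nth_default // mulr0 addr0.
  case: (enum {: ('I_n * 'I_n) * ('I_n * 'I_n)}) @s si => [|d l] s //; rewrite size_map => si.
  by rewrite (nth_map d) // !elin; ring.
have gen p q : e p Hg = e q Hg -> forall X, X \in a -> e p X = e q X.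
  move=> E X Xa; have ins : (p, q) \in enum {: ('I_n * 'I_n) * ('I_n * 'I_n)} by rewrite mem_enum.
  have sE : nth (fun=> 0) s (index (p, q) (enum {: ('I_n * 'I_n) * ('I_n * 'I_n)})) =
      (fun X => e p X - e q X).
    by rewrite /s (nth_map (p, q)) ?index_mem // nth_index.
  have := Hgg (index (p, q) (enum {: ('I_n * 'I_n) * ('I_n * 'I_n)})); rewrite sE.
  by rewrite E subrr => /(_ erefl X Xa) /eqP; rewrite subr_eq0 => /eqP.
have [Y2 [q [LY2 _ Y2q Y2s]]] := top Y1 Hg q1 LY1 Hga Y1q.
have [al alE] := @dual_of_linear R n a (e q) (elin q).
have alH : al (vsproj a H) <> 0.
  rewrite alE vsprojK // => E; have [_ Y1q'] := Y2s q Y2q.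
  have [h _] := Y1s q Y1q'; have := eH1 q; rewrite E mulr0 => E'.
  by move: q1p; rewrite -h E' leNgt eH1_gt0.
exists al; split=> //; split; first by apply/eqP => E; apply: alH; rewrite E lfunE.
exists Y2; split=> //.
  by apply/eqP => E; move: Y2q; rewrite E mulmx0 mul0mx mxE eqxx.
move=> X; rewrite alE.
have Xa : vsval X \in a by exact: subvsP.
suff E : P *m (vsval X *m Y2 - Y2 *m vsval X) *m invmx P = e q (vsval X) *: (P *m Y2 *m invmx P).
  have -> : vsval X *m Y2 - Y2 *m vsval X =
      invmx P *m (P *m (vsval X *m Y2 - Y2 *m vsval X) *m invmx P) *m P.
    by rewrite !mulmxA mulVmx // mul1mx mulmxKV.
  by rewrite E -scalemxAr -scalemxAl !mulmxA mulVmx // mul1mx mulmxKV.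
apply/matrixP => i j; rewrite (ad _ _ (i, j)) // [RHS]mxE.
have [->|Yij] := eqVneq ((P *m Y2 *m invmx P) i j) 0; first by rewrite !mulr0.
have [h _] := Y2s (i, j) Yij.
by rewrite (gen _ _ h).
Qed.


End LieGroup.

(** * Separation of points by the roots *)

Lemma mxtraceB (L : pzRingType) n (x y : 'M[L]_n) : \tr (x - y) = \tr x - \tr y.
Proof. exact: raddfB. Qed.

Section MatrixIdentities.
Variables (L : fieldType) (n : nat).
Implicit Types a b e s w p q M : 'M[L]_n.

Lemma invmxM a b : a \in unitmx -> b \in unitmx -> invmx (a *m b) = invmx b *m invmx a.
Proof.
move=> au bu; have abu : a *m b \in unitmx by rewrite unitmx_mul au.
have H : (invmx b *m invmx a) *m (a *m b) = 1%:M.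
  by rewrite !mulmxA -(mulmxA _ (invmx a) a) mulVmx // mulmx1 mulVmx.
by rewrite -[RHS]mulmx1 -(mulmxV abu) mulmxA H mul1mx.
Qed.

Lemma mean_sqr a s : a \in unitmx ->
  (a *m s *m a) *m invmx (a *m a) *m (a *m s *m a) = a *m (s *m s) *m a.
Proof.
by move=> au; rewrite invmxM // !mulmxA mulmxK // mulmxKV.
Qed.

Lemma mean_cancel a q : a \in unitmx -> a *m (invmx a *m q *m invmx a) *m a = q.
Proof. by move=> au; rewrite !mulmxA mulmxV // mul1mx mulmxKV. Qed.

Lemma mean_flip M p q : M \in unitmx -> p \in unitmx ->
  M *m invmx p *m M = q -> M *m invmx q *m M = p.
Proof.
move=> Mu pu <-; rewrite !invmxM ?unitmx_mul ?unitmx_inv ?Mu ?pu // invmxK.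
by rewrite !mulmxA mulmxV // mul1mx mulmxKV.
Qed.

Lemma mean_conj_sqr b M : b \in unitmx ->
  (invmx b *m M *m invmx b) *m (invmx b *m M *m invmx b) =
  invmx b *m (M *m invmx (b *m b) *m M) *m invmx b.
Proof. by move=> bu; rewrite invmxM // !mulmxA. Qed.

Lemma conj_inj b M N : b \in unitmx ->
  invmx b *m M *m invmx b = invmx b *m N *m invmx b -> M = N.
Proof. by move=> bu H; rewrite -(mean_cancel M bu) H mean_cancel. Qed.

(* If M = B^2 intertwines p^-1 and q, then B^-1 p B^-1 and B^-1 q B^-1 are inverse. *)
Lemma mean_inverse B p q : B \in unitmx -> p \in unitmx ->
  (B *m B) *m invmx p *m (B *m B) = q ->
  invmx B *m q *m invmx B = invmx (invmx B *m p *m invmx B).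
Proof.
move=> Bu pu <-; rewrite !invmxM ?unitmx_mul ?unitmx_inv ?Bu ?pu // invmxK.
by rewrite !mulmxA mulVmx // mul1mx mulmxK.
Qed.

Lemma comm_conj b B p : B \in unitmx -> b *m B = B *m b ->
  b *m (invmx B *m p *m invmx B) = (invmx B *m p *m invmx B) *m b -> b *m p = p *m b.
Proof.
move=> Bu bB H; have -> : p = B *m (invmx B *m p *m invmx B) *m B by rewrite mean_cancel.
move: (invmx B *m p *m invmx B) H => r H.
by rewrite !mulmxA bB -!mulmxA (mulmxA b) H -mulmxA bB.
Qed.

Lemma diag_entryl b (x y : 'rV[L]_n) j :
  (b *m diag_mx x *m b *m diag_mx y) j j = \sum_k b j k * x 0 k * b k j * y 0 j.
Proof.
rewrite mul_mx_diag mxE mxE mulr_suml; apply: eq_bigr => k _.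
by rewrite mul_mx_diag mxE.
Qed.

Lemma diag_entryr b (x y : 'rV[L]_n) j :
  (diag_mx x *m b *m diag_mx y *m b) j j = \sum_k x 0 j * b j k * y 0 k * b k j.
Proof.
by rewrite mxE; apply: eq_bigr => k _; rewrite mul_mx_diag mxE mul_diag_mx mxE.
Qed.

Lemma conj_cancel4 u b (x y : 'M[L]_n) : u \in unitmx ->
  let c Z := invmx u *m Z *m u in
  c b *m (c x *m c b *m c y) = (c x *m c b *m c y) *m c b ->
  b *m x *m b *m y = x *m b *m y *m b.
Proof.
move=> uu c.
have cM Z W : c Z *m c W = c (Z *m W) by rewrite /c !mulmxA mulmxK.
rewrite !cM => /(congr1 (fun Z => u *m Z *m invmx u)).
by rewrite /c !mulmxA mulmxV // !mul1mx !mulmxK.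
Qed.

Lemma conj_comm u b (x : 'M[L]_n) : u \in unitmx -> b *m x = x *m b ->
  (invmx u *m b *m u) *m (invmx u *m x *m u) = (invmx u *m x *m u) *m (invmx u *m b *m u).
Proof.
by move=> uu bx; rewrite !mulmxA !mulmxK // -(mulmxA _ b) bx !mulmxA.
Qed.

Lemma map_spec_inv (f : {rmorphism L -> L}) u (d : 'rV[L]_n) : u \in unitmx ->
  (forall i, d 0 i != 0) -> map_mx f (spec u d) = invmx (spec u d) ->
  spec (map_mx f u) (map_mx f d) = spec u (map_mx (fun x => x^-1) d).
Proof. by move=> uu d0 H; rewrite -map_spec H spec_inv. Qed.

End MatrixIdentities.

(** * From commuting with real positive elements to commuting with complex ones *)

Section Mean.
Variables (K : rcfType) (R : realType) (iotaR : {rmorphism K -> R}) (n : nat).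
Variables (G : seq (MPoly[K]_(n * n))).
Hypotheses (hG : alg_subgroup_SL G) (hGT : self_adjoint G).
Local Notation GR := (points iotaR G).
Local Notation C := (R[i]%C).
Local Notation CE := (points (toC R \o iotaR) G).
Local Notation toCm := (map_mx (toC R)).
Local Notation conjm := (map_mx (@conjc R)).

Lemma hpd_points_fun (u : 'M[C]_n) (d : 'rV[R]_n) (phi : R -> C) : u \in unitmx ->
  CE (spec u (toCm d)) -> (forall i, 0 < d 0 i) -> phi 1 = 1 ->
  (forall x y, 0 < x -> 0 < y -> phi (x * y) = phi x * phi y) ->
  CE (spec u (map_mx phi d)).
Proof.
move=> uu Gd d0 phi1 phiM; have Gg := (Cpoints_group iotaR hG).1.
have := points_spec_fun (D := [set z | 0 < complex.Re z /\ complex.Im z = 0])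
  (phi := fun z => phi (complex.Re z)) uu Gg Gd.
rewrite map_map_mx; apply=> //=.
- move=> [x1 x2] [y1 y2] /= [x0 ->] [y0 ->]; rewrite !mulr0 !mul0r subr0 addr0; split=> //.
  exact: mulr_gt0.
- by move=> i; have := d0 i; rewrite !mxE.
move=> [x1 x2] [y1 y2] /= [x0 ->] [y0 ->]; rewrite mulr0 subr0; exact: phiM.
Qed.

Lemma hpd_points_sqrt p : CE p -> hpd p -> exists a, [/\ CE a, hpd a & a *m a = p].
Proof.
move=> Gp [_ [u [d [uu u1 d0 pE]]]]; rewrite pE in Gp *.
exists (spec u (toCm (map_mx Num.sqrt d))); split.
- rewrite map_map_mx; apply: hpd_points_fun => //; first by rewrite sqrtr1.
  by move=> x y x0 y0; rewrite sqrtrM ?ltW // rmorphM.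
- by apply: hpd_fun => // i; rewrite sqrtr_gt0.
rewrite (specM _ _ uu) -map_had; congr (spec u (toCm _)); apply/rowP => i.
by rewrite !mxE -expr2 sqr_sqrtr // ltW.
Qed.

Lemma hpd_conj (p : 'M[C]_n) : hpd p -> hpd (conjm p).
Proof.
move=> [sp [u [d [uu u1 d0 ->]]]]; split.
  have -> : ctr (conjm (spec u (toCm d))) = conjm (ctr (spec u (toCm d))).
    by rewrite /ctr map_trmx.
  by rewrite (ctr_spec _ u1 uu) conj_toCm.
exists (conjm u), d; split=> //; first by rewrite map_unitmx.
  by rewrite -map_invmx u1 /ctr map_trmx.
by rewrite map_spec conj_toCm.
Qed.

Lemma hpd_real (M : 'M[R]_n) : hpd (toCm M) -> rpd M.
Proof.
move=> [sM [u [d [uu u1 d0 ME]]]].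
have sM' : M^T = M by apply: (@toCm_inj R); rewrite -ctr_toC.
split=> //; have [P [e [Pu Me]]] := real_spectral sM'; exists P, e; split=> // i.
have Pu' : toCm P \in unitmx by rewrite map_unitmx.
(* Computed from [d], the calculus with the indicator of the positive reals gives the identity;
   computed from [e], this says that every [e 0 i] is positive. *)
have := @spec_uniq _ _ _ _ (toCm e) (toCm d) (fun z : C => if 0 < complex.Re z then 1 else 0) Pu' uu.
rewrite -map_spec -Me => /(_ ME).
have -> : map_mx (fun z : C => if 0 < complex.Re z then 1 else 0) (toCm d) = const_mx 1 :> 'rV[C]_n.
  by apply/rowP => j; rewrite !mxE /= d0.
rewrite (spec1 uu) -(spec1 Pu') => /(spec_inj Pu')/rowP/(_ i).
rewrite !mxE /=; case: ifP => // _ /eqP.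
by rewrite eq_sym oner_eq0.
Qed.

Lemma herm_mulmx (e m : 'M[C]_n) : e \in unitmx -> m \in unitmx -> ctr e = e -> ctr m = m ->
  hpd (e *m (m *m m) *m e).
Proof.
move=> eu mu se sm; have := @hpd_mulmxctr R n (e *m m); rewrite unitmx_mul eu mu => /(_ isT).
by rewrite ctrM se sm !mulmxA.
Qed.

(* M is the geometric mean of p and its conjugate; it is real by uniqueness. *)
Lemma hpd_mean p : CE p -> hpd p -> exists M : 'M[R]_n,
  [/\ GR M, rpd M & toCm M *m invmx p *m toCm M = conjm p].
Proof.
move=> Gp hp; have [[_ CM CV] _] := Cpoints_group iotaR hG.
have [a [Ga ha aa]] := hpd_points_sqrt Gp hp.
have au := hpd_unit ha; have pu := hpd_unit hp.
have hb := hpd_conj ha; have bu := hpd_unit hb.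
have qb : conjm a *m conjm a = conjm p by rewrite -map_mxM aa.
have sai : ctr (invmx a) = invmx a by rewrite ctr_inv ha.1.
have aiu : invmx a \in unitmx by rewrite unitmx_inv.
have Gq : CE (conjm p) by apply: points_conj.
pose w := invmx a *m conjm p *m invmx a.
have Gai : CE (invmx a) by have [] := CV _ Ga.
have Gw : CE w by exact: (CM _ _ (CM _ _ Gai Gq) Gai).
have hw : hpd w by rewrite /w -qb; apply: (herm_mulmx aiu bu sai hb.1).
have [s [Gs hs ss]] := hpd_points_sqrt Gw hw.
have [t [Gt ht tt]] := hpd_points_sqrt Gs hs.
(* The formula [p^(1/2) (p^(-1/2) q p^(-1/2))^(1/2) p^(1/2)] for the geometric mean of [p] and its
   conjugate [q]; every factor lies in [G]. *)
pose M := a *m s *m a.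
have GM : CE M by exact: (CM _ _ (CM _ _ Ga Gs) Ga).
have hM : hpd M by rewrite /M -tt; apply: (herm_mulmx au (hpd_unit ht) ha.1 ht.1).
have MpM : M *m invmx p *m M = conjm p.
  by rewrite /M -[X in invmx X]aa (mean_sqr _ au) ss /w (mean_cancel _ au).
clearbody M.
have MqM := mean_flip (hpd_unit hM) pu MpM.
have MqM' : conjm M *m invmx (conjm p) *m conjm M = p.
  have := congr1 conjm MpM; rewrite !map_mxM map_invmx => ->.
  by apply/matrixP => i j; rewrite !mxE conjcK.
have [m [_ hm mm]] := hpd_points_sqrt GM hM.
have [m' [_ hm' mm']] := hpd_points_sqrt (points_conj GM) (hpd_conj hM).
have sbi : ctr (invmx (conjm a)) = invmx (conjm a) by rewrite ctr_inv hb.1.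
have biu : invmx (conjm a) \in unitmx by rewrite unitmx_inv.
(* Both sides solve [X q^-1 X = p] with [q] the conjugate of [p]. Multiplied on both sides by the
   inverse square root of [q], a solution becomes a positive square root of a fixed matrix, which is
   unique. *)
have MM' : M = conjm M.
  apply: (conj_inj bu); apply: hpd_sqr_inj.
  - by rewrite -mm; apply: (herm_mulmx biu (hpd_unit hm) sbi hm.1).
  - by rewrite -mm'; apply: (herm_mulmx biu (hpd_unit hm') sbi hm'.1).
  by rewrite !(mean_conj_sqr _ bu) qb MqM MqM'.
have ME := conj_toCmP (esym MM').
exists (map_mx (@complex.Re R) M); rewrite -ME; split=> //.
  by apply/points_toC; rewrite -ME.
by apply: hpd_real; rewrite -ME.
Qed.


Lemma Im_sum I (r : seq I) (F : I -> C) :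
  complex.Im (\sum_(i <- r) F i) = \sum_(i <- r) complex.Im (F i).
Proof.
elim: r => [|i r IH]; first by rewrite !big_nil.
by rewrite !big_cons -IH; case: (F i) (\sum_(j <- r) F j) => x y [x' y'].
Qed.

(* The weighted sum of the diagonal entries makes the sines come with the sign of their argument. *)
Lemma weight_vanish (b : 'M[C]_n) (l : 'I_n -> R)
    (D := fun t : R => \row_i ((cos (t * l i)) -i* (sin (t * l i)))%C : 'rV[C]_n) :
  ctr b = b ->
  (forall t, b *m diag_mx (D t) *m b *m diag_mx (map_mx (@conjc R) (D t)) =
             diag_mx (D t) *m b *m diag_mx (map_mx (@conjc R) (D t)) *m b) ->
  forall j k, l j <> l k -> b j k = 0.
Proof.
move=> sb H.
pose m j k := complex.Re (b j k) ^+ 2 + complex.Im (b j k) ^+ 2.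
have bs j k : b k j = conjc (b j k) by rewrite -{1}sb !mxE.
have msym j k : m j k = m k j by rewrite /m (bs k j); case: (b k j) => x y /=; rewrite sqrrN.
have Ht t j : \sum_k m j k * sin (t * (l j - l k)) = 0.
  have /matrixP/(_ j j) := H t; rewrite diag_entryl diag_entryr => /(congr1 (@complex.Im R)).
  rewrite !Im_sum => E.
  pose e k := m j k * sin (t * (l j - l k)).
  have E1 : \sum_k e k = \sum_k (- e k).
    have -> : \sum_k e k = \sum_k complex.Im (b j k * D t 0 k * b k j * (map_mx (@conjc R) (D t)) 0 j).
      apply: eq_bigr => k _; rewrite (bs j k) /e /m mulrBr sinB !mxE.
      by case: (b j k) => x y /=; ring.
    rewrite E; apply: eq_bigr => k _; rewrite (bs j k) /e /m mulrBr sinB !mxE.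
    by case: (b j k) => x y /=; ring.
  by move: E1; rewrite sumrN /e; lra.
have Hs t : \sum_j \sum_k m j k * ((l j - l k) * sin (t * (l j - l k))) = 0.
  have A1 : \sum_j \sum_k l j * (m j k * sin (t * (l j - l k))) = 0.
    by rewrite big1 // => j _; rewrite -mulr_sumr Ht mulr0.
  have A2 : \sum_j \sum_k l k * (m j k * sin (t * (l j - l k))) = 0.
    rewrite exchange_big /= -[RHS]oppr0 -[in RHS]A1 -sumrN; apply: eq_bigr => j _.
    rewrite -sumrN; apply: eq_bigr => k _; rewrite (msym k j).
    by rewrite -(opprB (l j)) mulrN sinN !mulrN.
  rewrite -[RHS](subrr 0) -[in X in X - _]A1 -[in X in _ - X]A2 -sumrB; apply: eq_bigr => j _.
  by rewrite -sumrB; apply: eq_bigr => k _; ring.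
(* At time [1 / s] all angles have absolute value below 1, so [y * sin (y / s)] is positive for
   every nonzero difference [y], and the vanishing sum of [Hs] has nonnegative terms. *)
pose s := 1 + \sum_j \sum_k `|l j - l k|.
have s0 : 0 < s by rewrite ltr_pwDl // sumr_ge0 // => j _; rewrite sumr_ge0.
have le_s j k : `|l j - l k| < s.
  rewrite /s (bigD1 j) //= (bigD1 k) //=.
  set B := \sum_(i | i != k) _; set B' := \sum_(i | i != j) _.
  have B0 : 0 <= B by exact: sumr_ge0.
  have B'0 : 0 <= B' by apply: sumr_ge0 => i _; exact: sumr_ge0.
  lra.
have pos j k : 0 <= (l j - l k) * sin (s^-1 * (l j - l k)) ?= iff (l j == l k).
  have := le_s j k; rewrite -[l j == l k]subr_eq0; move: (l j - l k) => x xs.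
  have P y : 0 < y -> y < s -> 0 < y * sin (s^-1 * y).
    move=> y0 ys; rewrite mulr_gt0 // sin_gt0_pi // mulr_gt0 ?invr_gt0 //=.
    by apply: lt_le_trans (pi_ge2 R); rewrite mulrC ltr_pdivrMr //; lra.
  have [->|x0] := eqVneq x 0; first by rewrite mul0r; split; rewrite ?eqxx.
  have xp : 0 < x * sin (s^-1 * x).
    have [xp|xn|/eqP] := ltgtP x 0; last by rewrite (negPf x0).
      rewrite -mulrNN -sinN -mulrN; apply: P; first by rewrite oppr_gt0.
      by rewrite -(ltr0_norm xp).
    by apply: P => //; rewrite -(gtr0_norm xn).
  by split; [exact: ltW|rewrite lt_eqF].
have m0 j k : 0 <= m j k by rewrite addr_ge0 // sqr_ge0.
move=> j k ljk.
have /eqP := Hs s^-1; rewrite psumr_eq0 => [/allP/(_ j (mem_index_enum _))/=|i _]; last first.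
  by rewrite sumr_ge0 // => i' _; rewrite mulr_ge0 // (pos i i').1.
rewrite psumr_eq0 => [/allP/(_ k (mem_index_enum _))/=|i _]; last first.
  by rewrite mulr_ge0 // (pos j i).1.
rewrite mulf_eq0 orbC eq_sym (pos j k).2 => /orP[/eqP//|].
rewrite paddr_eq0 ?sqr_ge0 // !sqrf_eq0; case: (b j k) => x y /= /andP[/eqP-> /eqP->].
by [].
Qed.

(** With [B] the square root of the mean [M], the element [p' = B^-1 p B^-1] has its inverse as
    conjugate, so its imaginary powers are unitary and real, that is, orthogonal elements of [G].
    The conjugates of [b] by them are real and positive, so [b] commutes with these conjugates, and
    [weight_vanish] makes [b] commute with [p']. As [b] also commutes with [B], it commutes with
    [p]. *)
Lemma comm_hpd (b : 'M[R]_n) p : rpd b -> GR b ->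
  (forall M, GR M -> rpd M -> b *m M = M *m b) ->
  CE p -> hpd p -> toCm b *m p = p *m toCm b.
Proof.
move=> rb Gb bcomm Gp hp; have [[_ CM CV] _] := Cpoints_group iotaR hG.
have [[_ GM GV] _] := points_group iotaR hG.
have [M [GMM rM MpM]] := hpd_mean Gp hp.
have [B [rB GB BB]] : exists B, [/\ rpd B, GR B & B *m B = M].
  have [sM [P [d [Pu d0 ME]]]] := rM; rewrite ME in sM GMM *.
  exists (spec P (map_mx Num.sqrt d)); split.
  - by apply: rpd_fun => // i; rewrite sqrtr_gt0.
  - apply: (points_spec_fun (D := [set x | 0 < x])) => //=.
    + by have [] := points_group iotaR hG.
    + by move=> x y x0 y0; rewrite mulr_gt0.
    + exact: sqrtr1.
    + by move=> x y x0 y0; rewrite sqrtrM // ltW.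
  rewrite specM //; congr spec; apply/rowP => i; rewrite !mxE -expr2 sqr_sqrtr //.
  exact: ltW.
have Bu := rpd_unit rB; have BCu : toCm B \in unitmx by rewrite map_unitmx.
have pu := hpd_unit hp.
have bB : toCm b *m toCm B = toCm B *m toCm b by rewrite -!map_mxM bcomm.
apply: (comm_conj BCu bB).
have conj_p' := mean_inverse BCu pu; rewrite -map_mxM BB in conj_p'.
have {conj_p' MpM} cp' := conj_p' _ MpM.
set p' := invmx (toCm B) *m p *m invmx (toCm B) in cp' *.
have cp'' : conjm p' = invmx p'.
  by rewrite -cp' /p' 2!map_mxM map_invmx conj_toCm.
have Gp' : CE p'.
  by have [_ GBi] := CV _ (iffRL (points_toC iotaR G B) GB); apply: (CM) => //; apply: (CM).
have hp' : hpd p'.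
  have [a [_ ha aa]] := hpd_points_sqrt Gp hp; rewrite /p' -aa.
  apply: herm_mulmx; rewrite ?unitmx_inv //; first exact: hpd_unit.
    by rewrite ctr_inv ctr_toC rB.1.
  by case: ha.
clearbody p'; clear cp' hp pu Gp p.
case: hp' => sp' [u [d [uu u1 d0 pE]]]; rewrite pE in Gp' cp'' *.
pose l i := ln (d 0 i).
(* The eigenvalues [exp (- i t ln d)] of the imaginary power of [p'] with exponent [- i t]. *)
pose D t := \row_i ((cos (t * l i)) -i* (sin (t * l i)))%C : 'rV[C]_n.
pose phi t (x : R) := ((cos (t * ln x)) -i* (sin (t * ln x)))%C.
have DE t : D t = map_mx (phi t) d by apply/rowP => i; rewrite !mxE.
have phi1 t : phi t 1 = 1 by rewrite /phi ln1 mulr0 cos0 sin0 oppr0.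
have phiM t x y : 0 < x -> 0 < y -> phi t (x * y) = phi t x * phi t y.
  move=> x0 y0; rewrite /phi lnM ?posrE // mulrDr cosD sinD.
  by apply/eqP; rewrite eq_complex /=; apply/andP; split; apply/eqP; ring.
have phiV t x : 0 < x -> conjc (phi t x) = phi t x^-1.
  by move=> x0; rewrite /phi lnV ?posrE //= mulrN cosN sinN.
have phin0 t x : 0 < x -> phi t x * conjc (phi t x) = 1.
  by move=> x0; rewrite phiV // -phiM ?invr_gt0 // mulfV ?gt_eqF.
have Gr t : CE (spec u (D t)) by rewrite DE; exact: (hpd_points_fun uu Gp' d0 (phi1 t) (phiM t)).
have rr t : spec u (D t) *m spec u (map_mx (@conjc R) (D t)) = 1%:M.
  rewrite (specM _ _ uu) -(spec1 uu); congr (spec u _); apply/rowP => i.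
  by rewrite mxE DE [X in X * _]mxE [X in _ * X]mxE [X in conjc X]mxE [RHS]mxE phin0.
have rc t : conjm (spec u (D t)) = spec u (D t).
  have cuu : conjm u \in unitmx by rewrite map_unitmx.
  have dn0 i : toCm d 0 i != 0 by rewrite mxE fmorph_eq0 gt_eqF.
  have E1 : map_mx (fun x : C => x^-1) (toCm d) = toCm (map_mx (fun x => x^-1) d).
    by apply/rowP => i; rewrite !mxE fmorphV.
  have hyp : spec (conjm u) (map_mx (@conjc R) (toCm d)) = spec u (toCm (map_mx (fun x => x^-1) d)).
    rewrite -E1; exact: (map_spec_inv uu dn0 cp'').
  have := @spec_uniq _ _ (conjm u) u (map_mx (@conjc R) (toCm d)) (toCm (map_mx (fun x => x^-1) d))
    (fun z : C => phi t (complex.Re z)^-1) cuu uu hyp.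
  rewrite map_spec.
  have -> : map_mx (@conjc R) (D t) = map_mx (fun z : C => phi t (complex.Re z)^-1) (map_mx (@conjc R) (toCm d)).
    by rewrite DE; apply/rowP => i; rewrite !mxE phiV.
  have -> : map_mx (fun z : C => phi t (complex.Re z)^-1) (toCm (map_mx (fun x => x^-1) d)) = D t.
    by rewrite DE; apply/rowP => i; rewrite !mxE /= invrK.
  by [].
have key t : toCm b *m (spec u (D t) *m toCm b *m spec u (map_mx (@conjc R) (D t))) =
   (spec u (D t) *m toCm b *m spec u (map_mx (@conjc R) (D t))) *m toCm b.
  have rE := conj_toCmP (rc t); move: (Gr t) (rr t).
  have -> : spec u (map_mx (@conjc R) (D t)) = ctr (spec u (D t)) by exact: (esym (ctr_spec (D t) u1 uu)).
  rewrite rE; set rho := map_mx _ (spec u (D t)); move/points_toC => Grho.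
  rewrite ctr_toC -!map_mxM => rho1; congr toCm; apply: bcomm.
    have rhou : rho *m rho^T = 1%:M.
      by apply: (@toCm_inj R); rewrite rho1 map_mx1.
    have [ru Gri] := GV _ Grho.
    have -> : rho^T = invmx rho by rewrite -[LHS]mul1mx -(mulVmx ru) -mulmxA rhou mulmx1.
    by apply: (GM) => //; apply: (GM).
  have [ru _] := GV _ Grho.
  have [c [rc' cc _]] := rpd_sqrt rb.
  rewrite -cc -{2}rc'.1 !mulmxA -(mulmxA (rho *m c)) -trmx_mul.
  by apply: rpd_mulmxtr; rewrite unitmx_mul ru (rpd_unit rc').
pose b' := u *m toCm b *m ctr u.
have sb' : ctr b' = b'.
  by rewrite /b' ctrM ctrM ctrK ctr_toC rb.1 mulmxA.
have bE : toCm b = invmx u *m b' *m u.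
  by rewrite /b' -u1 !mulmxA (mulVmx uu) mul1mx (mulmxKV uu).
have W := weight_vanish (l := l) sb'.
have {W} W : forall j k, l j <> l k -> b' j k = 0.
  apply: W => t; have := key t; rewrite bE /spec -/(D t).
  move: (diag_mx (D t)) (diag_mx (map_mx _ (D t))) => x y.
  by apply: conj_cancel4.
rewrite bE /spec; apply: (conj_comm uu); clearbody b'; apply/matrixP => i j.
rewrite mul_mx_diag mul_diag_mx !mxE.
have [lij|/eqP/W ->] := eqVneq (l i) (l j); last by rewrite mulr0 mul0r.
suff -> : d 0 i = d 0 j by rewrite mulrC.
by apply: ln_inj; rewrite ?posrE.
Qed.

End Mean.

(** * A nontrivial element of [A] commuting with all positive elements of [G] *)

Section CentralElement.
Variables (K : rcfType) (R : realType) (iotaR : {rmorphism K -> R}) (n : nat).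
Variables (G S : seq (MPoly[K]_(n * n))) (A : sa_formula K n) (a : {vspace 'M[R]_n}).
Hypotheses (hG : alg_subgroup_SL G) (hGT : self_adjoint G).
Hypotheses (hS : split_torus S) (hSsym : forall s, Cpoints S s -> s = s^T).
Hypothesis hSG : Cpoints S `<=` Cpoints G.
Hypothesis hA : sa_component (points idfun S) 1%:M (sa_ext idfun A).
Hypothesis ha : forall H : 'M[R]_n, H \in a <-> Lie (sa_ext iotaR A) H.
Local Notation GR := (points iotaR G).
Local Notation V b := (MVar K n b).

Lemma expmx_pd (H : 'M[R]_n) : H^T = H -> exists (P : 'M[R]_n) (d : 'rV[R]_n),
  [/\ P \in unitmx, H = spec P d & expmx H = spec P (map_mx expR d)].
Proof.
move=> /real_spectral[P [d [Pu ->]]]; exists P, d; split=> //.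
rewrite -{1}[spec P d]scale1r expmx_spec //; congr spec; apply/rowP => i.
by rewrite !mxE mul1r.
Qed.

(** Otherwise [H] would not commute with the logarithm of [M], an element of [Lie], and
    [Lie_root_vector] would produce a root nonzero at [H]. *)
Lemma root_kernel_comm H : H \in a ->
  (forall alpha : dual a, is_root (Lie GR) alpha -> alpha (vsproj a H) = 0) ->
  forall M, GR M -> rpd M -> expmx H *m M = M *m expmx H.
Proof.
move=> Ha H0 M GM /points_pd[P [d [Pu d0 ME]]].
have sH := a_sym hS hSsym hA ha Ha.
have [Q [e [Qu HE eE]]] := expmx_pd sH.
have HM : H *m spec P (map_mx (@ln R) d) = spec P (map_mx (@ln R) d) *m H.
  apply: contrapT => /(Lie_root_vector hG) HH.
  have h1 X : X \in a -> Lie GR X by move=> /ha LX t; exact: (AR_GR hS hSsym hSG hA).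
  have h2 X : X \in a -> X^T = X by apply: (a_sym hS hSsym hA ha).
  have h3 X X' : X \in a -> X' \in a -> X *m X' = X' *m X by apply: (a_comm hS hSsym hA ha).
  have h4 : Lie GR (spec P (map_mx (@ln R) d)) by apply: Lie_log => //; rewrite -ME.
  by have [alpha [ra]] := HH iotaR a h1 h2 h3 h4 Ha; rewrite H0.
have {HM} HM : H *m M = M *m H.
  have := spec_comm expR Pu HM; rewrite map_map_mx ME.
  suff -> : map_mx (fun x => expR (ln x)) d = d by [].
  by apply/rowP => i; rewrite mxE lnK // posrE.
by rewrite eE; symmetry; apply: spec_comm => //; rewrite -HE.
Qed.

Lemma sym_mulmx_real (E : rcfType) (z : 'M[E[i]%C]_n) :
  z *m ctr z = let x := map_mx (@complex.Re E) z in let y := map_mx (@complex.Im E) z in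
    complexmx (x *m x^T + y *m y^T) (y *m x^T - x *m y^T).
Proof.
rewrite /= {1 2}[z]complexmxE complexmx_ctr complexmxM !mulmxN opprK addrC.
by congr complexmx; rewrite addrC.
Qed.

(** [H] lives over [R] and cannot be brought to [K]; what transfers is the existence of [b], with
    [expmx H] as witness over [R]. The condition [b *m b <> 1%:M] remembers that [H] is nonzero, and
    [b *m b] is the element later shown to be central. *)
Lemma exists_central H : H \in a -> H != 0 ->
  (forall alpha : dual a, is_root (Lie GR) alpha -> alpha (vsproj a H) = 0) ->
  exists b : 'M[K]_n, [/\ sa_ext idfun A b, b *m b <> 1%:M &
    forall z, Cpoints G z -> map_mx (toC K) b *m (z *m ctr z) = (z *m ctr z) *m map_mx (toC K) b].
Proof.
move=> Ha Hn0 H0.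
pose p : mform K n := (FEx 0 (FAnd (FSa A (V 0)) (FAnd
  (FNot (FMEq (MMul (V 0) (V 0)) (MCst 1%:M)))
  (FAll 1 (FAll 2 (FImp (FCPoints G (V 1) (V 2)) (FAnd
    (FMEq (MMul (V 0) (MAdd (MMul (V 1) (MTr (V 1))) (MMul (V 2) (MTr (V 2)))))
          (MMul (MAdd (MMul (V 1) (MTr (V 1))) (MMul (V 2) (MTr (V 2)))) (V 0)))
    (FMEq (MMul (V 0) (MAdd (MMul (V 2) (MTr (V 1))) (MOpp (MMul (V 1) (MTr (V 2))))))
          (MMul (MAdd (MMul (V 2) (MTr (V 1))) (MOpp (MMul (V 1) (MTr (V 2))))) (V 0)))))))))).
have /= [|b [Ab [bb bcomm]]] := (tarski_transfer iotaR p).2.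
  have sH := a_sym hS hSsym hA ha Ha.
  have Ab := expmx_a ha Ha.
  exists (expmx H) => /=; split=> //; split.
    rewrite map_mx1; have [P [d [Pu HE ->]]] := expmx_pd sH.
    rewrite specM // -(spec1 Pu) => E; move/negP: Hn0; apply; apply/eqP.
    have := spec_uniq (fun x => ln x / 2) Pu Pu E.
    have -> : map_mx (fun x => ln x / 2) (had (map_mx expR d) (map_mx expR d)) = d.
      apply/rowP => i; rewrite !mxE -expRD expRK; lra.
    rewrite -HE => ->.
    have -> : map_mx (fun x => ln x / 2) (const_mx 1) = 0 :> 'rV[R]_n.
      by apply/rowP => i; rewrite !mxE ln1 mul0r.
    by rewrite /spec raddf0 mulmx0 mul0mx.
  move=> x y; rewrite /= => Gxy.
  have Gg := Cpoints_group iotaR hG.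
  have zu : complexmx x y \in unitmx by have [[_ _ CV] _] := Gg; have [] := CV _ Gxy.
  have hz := hpd_mulmxctr zu.
  have Gz : points (toC R \o iotaR) G (complexmx x y *m ctr (complexmx x y)).
    by have [[_ CM _] _] := Gg; apply: (CM) => //; apply: Cpoints_ctr.
  have := comm_hpd hG (AR_rpd hS hSsym hA Ab) (AR_GR hS hSsym hSG hA Ab)
    (root_kernel_comm Ha H0) Gz hz.
  rewrite complexmx_ctr complexmxM -complexmx_real !complexmxM !mulmxN !mul0mx !mulmx0.
  rewrite !opprK !subr0 !addr0 !add0r => /complexmx_inj[e1 e2]; split=> //.
  by rewrite [_ - _]addrC.
exists b; split=> //; first by move: bb => /=; rewrite map_mx1.
move=> z Gz; have /= := bcomm (map_mx (@complex.Re K) z) (map_mx (@complex.Im K) z).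
rewrite /= -complexmxE => /(_ Gz)[e1 e2].
rewrite sym_mulmx_real /= -complexmx_real !complexmxM !mul0mx !mulmx0 !subr0 !addr0 !add0r.
by rewrite e1 e2.
Qed.

End CentralElement.

(** * Exponential sums with positive bases *)

Section ExponentialSums.
Variable (K : rcfType).
Local Notation C := (K[i]%C).

Lemma expsum_group (I : eqType) (r : seq I) (lam : I -> K) (c : I -> C) :
  exists s D, [/\ uniq s, forall x, x \in s -> D x != 0, {subset s <= map lam r} &
    forall k, \sum_(i <- r) c i * toC K (lam i) ^+ k = \sum_(x <- s) D x * toC K x ^+ k].
Proof.
pose D x := \sum_(i <- r | lam i == x) c i.
exists (seq.filter (fun x => D x != 0) (undup (map lam r))), D; split.
- by rewrite filter_uniq // undup_uniq.
- by move=> x; rewrite mem_filter => /andP[].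
- by move=> x; rewrite mem_filter mem_undup => /andP[].
move=> k; rewrite big_filter [RHS]big_mkcond /=.
rewrite (eq_bigr (fun x => \sum_(i <- r | lam i == x) c i * toC K x ^+ k)) => [|x _]; last first.
  by rewrite -mulr_suml -/(D x); case: eqP => [->|]; rewrite ?mul0r.
rewrite (exchange_big_dep xpredT) //= big_seq [RHS]big_seq; apply: eq_bigr => i ir.
rewrite big_mkcond (bigD1_seq (lam i)) ?undup_uniq ?mem_undup ?map_f //= eqxx big1 ?addr0 // => x xi.
by rewrite eq_sym (negPf xi).
Qed.

Lemma seq_max (s : seq K) : s != [::] -> exists2 x, x \in s & forall y, y \in s -> y <= x.
Proof.
elim: s => // x [_ _|y s IH _]; first by exists x; rewrite ?inE // => y; rewrite inE => /eqP->.
have [z zs zmax] := IH isT; have [xz|zx] := leP x z.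
  exists z; rewrite ?inE in zs *; first by rewrite zs orbT.
  by move=> w; rewrite inE => /predU1P[->|/zmax].
exists x; first exact: mem_head.
move=> w; rewrite inE => /predU1P[->|/zmax/le_trans]; rewrite ?lexx //; apply.
exact: ltW.
Qed.

(* The product of the terms of largest growth is not cancelled. *)
Lemma expsum_prod (s t : seq K) (c d : K -> C) : s != [::] -> t != [::] -> uniq s -> uniq t ->
  (forall x, x \in s -> 0 < x) -> (forall x, x \in t -> 0 < x) ->
  (forall x, x \in s -> c x != 0) -> (forall x, x \in t -> d x != 0) ->
  exists k, (\sum_(x <- s) c x * toC K x ^+ k) * (\sum_(x <- t) d x * toC K x ^+ k) != 0.
Proof.
move=> s0 t0 us ut sp tp sc td; apply: contrapT => /forallNP H.
have [x xs xmax] := seq_max s0; have [y yt ymax] := seq_max t0.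
pose chi (p : K * K) k := toC K (p.1 * p.2) ^+ k.
(* The indicator of the largest product of bases. Substituted for the characters, by [dedekind], in
   the product of sums assumed to vanish, it leaves only [c x * d y], which is nonzero. *)
pose psi (p : K * K) : C := if p.1 * p.2 == x * y then 1 else 0.
have := @dedekind _ _ _ setT addn 0%N chi psi (fun p => c p.1 * d p.2)
  [seq (u, v) | u <- s, v <- t] I (fun _ _ _ _ => I) (fun _ => erefl)
  (fun _ _ _ _ _ => exprD _ _ _).
have psiE i j : (forall k, setT k -> chi i k = chi j k) -> psi i = psi j.
  by move=> /(_ 1%N I); rewrite /chi !expr1 => /complexI E; rewrite /psi E.
have sum0 k : setT k -> \sum_(p <- [seq (u, v) | u <- s, v <- t]) c p.1 * d p.2 * chi p k = 0.
  move=> _; rewrite big_allpairs /=.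
  have /negP := H k; rewrite negbK => /eqP E; rewrite -[RHS]E mulr_suml; apply: eq_bigr => u _.
  rewrite mulr_sumr; apply: eq_bigr => v _; rewrite /chi /= rmorphM exprMn.
  by rewrite mulrACA.
move=> /(_ psiE sum0) /eqP; rewrite big_allpairs /=; apply/negP.
rewrite (bigD1_seq x) //= [X in _ + X]big1_seq => [|u /andP[ux us']]; last first.
  rewrite big1_seq // => v /andP[_ vt]; rewrite /psi /= ifN ?mulr0 //.
  rewrite lt_eqF // (le_lt_trans (y := u * y)) //.
    by rewrite ler_wpM2l ?ymax // ltW // sp.
  by rewrite ltr_pM2r ?tp // lt_neqAle ux xmax.
rewrite addr0 (bigD1_seq y) //= [X in _ + X]big1_seq => [|v /andP[vy vt]]; last first.
  rewrite /psi /= ifN ?mulr0 // lt_eqF //.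
  by rewrite ltr_pM2l ?sp // lt_neqAle vy ymax.
by rewrite addr0 /psi eqxx mulr1 mulf_neq0 ?sc ?td.
Qed.

End ExponentialSums.

Definition mxpoly (L : comNzRingType) n (F : 'M[L]_n -> L) := polyfun (fun v => F (vec_mx v)).

Section MxPoly.
Variables (L : comNzRingType) (n : nat).
Implicit Types F : 'M[L]_n -> L.

Lemma mxpolyP F : mxpoly F -> exists p, forall x, mxeval idfun p x = F x.
Proof. by move=> [Q HQ]; exists Q => x; rewrite -[in RHS](mxvecK x) -HQ. Qed.

Lemma mxpoly_ext F F' : F =1 F' -> mxpoly F -> mxpoly F'.
Proof. by move=> FF'; apply: polyfun_ext => v. Qed.

Lemma mxpolyC c : mxpoly (fun _ : 'M[L]_n => c).
Proof. exact: polyfunC. Qed.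

Lemma mxpolyX i j : mxpoly (fun x : 'M[L]_n => x i j).
Proof. by apply: polyfun_ext (polyfunX _ (mxvec_index i j)) => v; rewrite mxE. Qed.

Lemma mxpolyD F F' : mxpoly F -> mxpoly F' -> mxpoly (fun x => F x + F' x).
Proof. exact: polyfunD. Qed.

Lemma mxpolyM F F' : mxpoly F -> mxpoly F' -> mxpoly (fun x => F x * F' x).
Proof. exact: polyfunM. Qed.

Lemma mxpolyN F : mxpoly F -> mxpoly (fun x => - F x).
Proof.
by move=> HF; apply: mxpoly_ext (mxpolyM (mxpolyC (-1)) HF) => x; rewrite mulN1r.
Qed.

Lemma mxpolyB F F' : mxpoly F -> mxpoly F' -> mxpoly (fun x => F x - F' x).
Proof. by move=> HF /mxpolyN; apply: mxpolyD. Qed.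

Lemma mxpoly_sum I (r : seq I) (F : I -> 'M[L]_n -> L) :
  (forall i, mxpoly (F i)) -> mxpoly (fun x => \sum_(i <- r) F i x).
Proof. by move=> HF; apply: polyfun_sum. Qed.

Lemma mxpoly_prod I (r : seq I) (F : I -> 'M[L]_n -> L) :
  (forall i, mxpoly (F i)) -> mxpoly (fun x => \prod_(i <- r) F i x).
Proof. by move=> HF; apply: polyfun_prod. Qed.

Lemma mxpoly_mxeval (K : comNzRingType) (f : {rmorphism K -> L}) m (p : MPoly[K]_(m * m))
    (X : 'M[L]_n -> 'M[L]_m) :
  (forall i j, mxpoly (fun x => X x i j)) -> mxpoly (fun x => mxeval f p (X x)).
Proof. by move=> HX; apply: polyfun_mxeval => i j; exact: HX. Qed.

Lemma mxpoly_mulmx m (X Y : 'M[L]_n -> 'M[L]_m) :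
  (forall i j, mxpoly (fun x => X x i j)) -> (forall i j, mxpoly (fun x => Y x i j)) ->
  forall i j, mxpoly (fun x => (X x *m Y x) i j).
Proof.
move=> HX HY i j; apply: mxpoly_ext (fun x => esym (mxE _ _ _ _)) _.
by apply: mxpoly_sum => k; apply: mxpolyM.
Qed.

Lemma mxpoly_det m (X : 'M[L]_n -> 'M[L]_m) :
  (forall i j, mxpoly (fun x => X x i j)) -> mxpoly (fun x => \det (X x)).
Proof.
move=> HX; apply: mxpoly_sum => s; apply: mxpolyM; first exact: mxpolyC.
exact: mxpoly_prod.
Qed.

Lemma mxpoly_adj m (X : 'M[L]_n -> 'M[L]_m) :
  (forall i j, mxpoly (fun x => X x i j)) ->
  forall i j, mxpoly (fun x => (\adj (X x)) i j).
Proof.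
move=> HX i j; apply: mxpoly_ext (fun x => esym (mxE _ _ _ _)) _.
apply: mxpolyM; first exact: mxpolyC.
apply: mxpoly_det => k l; apply: mxpoly_ext (HX (lift j k) (lift i l)) => x.
by rewrite !mxE.
Qed.

Lemma mxpoly_trace m (X : 'M[L]_n -> 'M[L]_m) :
  (forall i j, mxpoly (fun x => X x i j)) -> mxpoly (fun x => \tr (X x)).
Proof. by move=> HX; apply: mxpoly_sum => i; apply: HX. Qed.

Lemma mxpoly_cst m (c : 'M[L]_m) i j : mxpoly (fun _ : 'M[L]_n => c i j).
Proof. exact: mxpolyC. Qed.

End MxPoly.

Lemma zariski_closed_zero (L : fieldType) n (F : 'M[L]_n -> L) : mxpoly F ->
  zariski_closed [set x | F x = 0].
Proof.
move=> /mxpolyP[p Hp]; exists [set p]; apply/seteqP; split=> x /=.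
  by move=> Fx q ->; rewrite Hp.
by move=> /(_ p erefl); rewrite Hp.
Qed.

Lemma ctrB (E : rcfType) m n (A B : 'M[E[i]%C]_(m, n)) : ctr (A - B) = ctr A - ctr B.
Proof. by rewrite /ctr linearB map_mxB. Qed.

Lemma mulmxctr_tr_eq0 (E : rcfType) n (X : 'M[E[i]%C]_n) : \tr (X *m ctr X) = 0 -> X = 0.
Proof.
move=> /eqP; rewrite /mxtrace psumr_eq0; last first.
  by move=> i _; rewrite mxE sumr_ge0 // => j _; rewrite !mxE mulcJ_ge0.
move=> /allP H; apply/matrixP => i j; have := H i (mem_index_enum _); rewrite /= mxE.
rewrite psumr_eq0; last by move=> k _; rewrite !mxE mulcJ_ge0.
move=> /allP/(_ j (mem_index_enum _)); rewrite /= !mxE mulf_eq0 conjc_eq0 orbb.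
by move/eqP.
Qed.

(* As a finite set of values of the trace is constant on a connected set, commuting
   conjugates of h have constant trace product with h. *)
Section FiniteTraces.
Variables (L : fieldType) (n : nat).

(** In a common eigenbasis, two commuting matrices with eigenvalues among the entries of [d] are
    given by two maps into the indices of [d], so this finite list contains every possible trace of
    their product. *)
Definition trace_values (d : 'rV[L]_n) : seq L :=
  map (fun xy : {ffun 'I_n -> 'I_n} * {ffun 'I_n -> 'I_n} => \sum_i d 0 (xy.1 i) * d 0 (xy.2 i))
    (enum {: {ffun 'I_n -> 'I_n} * {ffun 'I_n -> 'I_n}}).

Lemma spec_eigen (P Q : 'M[L]_n) (d e : 'rV[L]_n) : P \in unitmx -> Q \in unitmx ->
  spec P d = spec Q e -> forall i, exists j, e 0 i = d 0 j.
Proof.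
move=> Pu Qu H i; have := spec_uniq (fun x => \prod_j (x - d 0 j)) Pu Qu H.
have -> : map_mx (fun x => \prod_j (x - d 0 j)) d = 0.
  by apply/rowP => k; rewrite !mxE (bigD1 k) //= subrr mul0r.
rewrite {1}/spec raddf0 mulmx0 mul0mx => /(congr1 (fun X => Q *m X *m invmx Q)).
rewrite /spec mulmx0 mul0mx !mulmxA mulmxV // mul1mx mulmxK // => /matrixP/(_ i i).
rewrite !mxE eqxx mulr1n => /esym/eqP; rewrite prodf_seq_eq0 => /hasP[j _ /=].
by rewrite subr_eq0 => /eqP ->; exists j.
Qed.

Lemma tr_in_values (P Q : 'M[L]_n) (d : 'rV[L]_n) : P \in unitmx -> Q \in unitmx ->
  spec P d *m spec Q d = spec Q d *m spec P d ->
  \tr (spec P d *m spec Q d) \in trace_values d.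
Proof.
move=> Pu Qu H.
have [||T Tu HT] := @codiag_seq L n [:: spec P d; spec Q d].
- move=> X; rewrite !inE => /orP[]/eqP->; first by exists P, d.
  by exists Q, d.
- by move=> X Y; rewrite !inE => /orP[]/eqP-> /orP[]/eqP->.
have [x Hx] := HT _ (mem_head _ _).
have [|y Hy] := HT (spec Q d); first by rewrite !inE eqxx orbT.
have /choice[f Hf] := spec_eigen Pu Tu Hx; have /choice[g Hg] := spec_eigen Qu Tu Hy.
rewrite Hx Hy specM // spec_trace //; apply/mapP; exists (finfun f, finfun g).
  by rewrite mem_enum.
by apply: eq_bigr => i _; rewrite /= !ffunE mxE Hf Hg.
Qed.

End FiniteTraces.

Section ConjIdentities.
Variables (L : fieldType) (n : nat).
Implicit Types c g h : 'M[L]_n.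

(** For [g'] the conjugate transpose of [g] and [c] Hermitian, the right-hand side is [z] times its
    conjugate transpose, with [z = g c g^-1]. The conjugate of the square of [c] thus takes the form
    with which [b] is known to commute. *)
Lemma conj_square c g g' : g \in unitmx -> g' \in unitmx ->
  c *m (g' *m g) = (g' *m g) *m c ->
  g *m (c *m c) *m invmx g = (g *m c *m invmx g) *m (invmx g' *m (c *m g')).
Proof.
move=> gu gu' H.
have -> : g *m c *m invmx g *m (invmx g' *m (c *m g')) =
    g *m c *m (invmx (g' *m g) *m c *m (g' *m g)) *m invmx g.
  by rewrite invmxM // !mulmxA mulmxK.
have -> : invmx (g' *m g) *m c *m (g' *m g) = c.
  by rewrite -mulmxA H mulmxA mulVmx ?mul1mx // unitmx_mul gu'.
by rewrite !mulmxA.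
Qed.

Lemma comm_sqr c h : c *m h = h *m c -> (c *m c) *m h = h *m (c *m c).
Proof. by move=> H; rewrite -mulmxA H !mulmxA H. Qed.

Lemma tr_conj_sqr g h : g \in unitmx ->
  \tr ((g *m h *m invmx g) *m (g *m h *m invmx g)) = \tr (h *m h).
Proof.
by move=> gu; rewrite !mulmxA mulmxKV // mxtrace_mulC !mulmxA mulVmx // mul1mx.
Qed.

Lemma spec_conj g (P : 'M[L]_n) d : g \in unitmx -> P \in unitmx ->
  g *m spec P d *m invmx g = spec (P *m invmx g) d.
Proof. by move=> gu Pu; rewrite /spec invmxM ?unitmx_inv // invmxK !mulmxA. Qed.

End ConjIdentities.

(** * Centrality by Zariski connectedness *)

Section Center.
Variables (K : rcfType) (n : nat) (G : seq (MPoly[K]_(n * n))).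
Hypotheses (hG : alg_subgroup_SL G) (hGT : self_adjoint G).
Hypothesis hconn : zariski_connected (Cpoints G).
Local Notation C := (K[i]%C).
Local Notation CG := (Cpoints G).
Local Notation toCm := (map_mx (toC K)).

Section Conj.
Variables (b : 'M[K]_n) (P : 'M[K]_n) (d : 'rV[K]_n).
Hypotheses (Gb : points idfun G b) (sb : b^T = b) (Pu : P \in unitmx) (hE : b *m b = spec P d).
Hypothesis bcomm : forall z, CG z -> toCm b *m (z *m ctr z) = (z *m ctr z) *m toCm b.
Let h := toCm (b *m b).

Lemma ctr_h : ctr h = h.
Proof. by rewrite /h ctr_toC trmx_mul sb. Qed.

Lemma conj_hE g : CG g ->
  g *m h *m invmx g = (g *m toCm b *m invmx g) *m ctr (g *m toCm b *m invmx g).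
Proof.
have [[_ CM CV] _] := hG; move=> Gg; have [gu _] := CV _ Gg.
have Gg' : CG (ctr g) by apply: (@points_conj K K idfun); apply: hGT.
have := bcomm Gg'; rewrite ctrK => H.
rewrite !ctrM ctr_inv ctr_toC sb /h map_mxM.
move: (toCm b) (ctr g) H gu (ctr_unit g) => c g' H gu; rewrite gu => g'u.
by apply: (conj_square gu g'u).
Qed.

Lemma conj_h_comm g : CG g -> h *m (g *m h *m invmx g) = (g *m h *m invmx g) *m h.
Proof.
have [[_ CM CV] _] := hG; move=> Gg; have [gu Gg'] := CV _ Gg.
have GbC : CG (toCm b) by apply/points_KC.
have Gz : CG (g *m toCm b *m invmx g) by exact: (CM _ _ (CM _ _ Gg GbC) Gg').
have := bcomm Gz; rewrite -(conj_hE Gg) /h map_mxM => H.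
exact: comm_sqr.
Qed.

(** [h] and its conjugate are Hermitian and their squares have the same trace, so the hypothesis
    says that their difference has norm zero. *)
Lemma tr_conj_h g : CG g -> \tr (h *m (g *m h *m invmx g)) = \tr (h *m h) -> g *m h *m invmx g = h.
Proof.
have [[_ CM CV] _] := hG; move=> Gg; have [gu Gg'] := CV _ Gg => E.
have sg : ctr (g *m h *m invmx g) = g *m h *m invmx g by rewrite (conj_hE Gg) ctrM ctrK.
apply/eqP; rewrite -subr_eq0; apply/eqP; apply: mulmxctr_tr_eq0.
have -> : ctr (g *m h *m invmx g - h) = g *m h *m invmx g - h.
  by rewrite ctrB sg ctr_h.
have E2 : \tr ((g *m h *m invmx g) *m (g *m h *m invmx g)) = \tr (h *m h).
  exact: tr_conj_sqr.
move: E E2; move: (g *m h *m invmx g) => k E E2.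
by rewrite mulmxBl !mulmxBr (mxtraceB _ _) (mxtraceB _ _) (mxtraceB _ _) E E2 [\tr (k *m h)]mxtrace_mulC E !subrr.
Qed.

Lemma conj_h_central g : CG g -> g *m h = h *m g.
Proof.
have [[C1 CM CV] CS] := hG.
(* The adjugate replaces the inverse, with which it agrees on determinant 1, to make [tau]
   polynomial in [x]. *)
pose tau (x : 'M[C]_n) := \tr (h *m (x *m h *m \adj x)).
have adjE g0 : CG g0 -> \adj g0 = invmx g0.
  move=> Gg0; have [g0u _] := CV _ Gg0; rewrite /invmx g0u.
  by have := CS _ Gg0; rewrite /SL /= => ->; rewrite invr1 scale1r.
have tauE g0 : CG g0 -> tau g0 = \tr (h *m (g0 *m h *m invmx g0)).
  by move=> Gg0; rewrite /tau adjE.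
have Ptau : mxpoly tau.
  apply: mxpoly_trace; apply: mxpoly_mulmx; first by move=> i j; apply: mxpoly_cst.
  apply: mxpoly_mulmx.
    apply: mxpoly_mulmx => i j; [exact: mxpolyX|exact: mxpoly_cst].
  by apply: mxpoly_adj => i j; apply: mxpolyX.
pose t0 := \tr (h *m h).
pose V := trace_values (map_mx (toC K) d).
have hP : h = spec (toCm P) (toCm d) by rewrite /h hE map_spec.
have PuC : toCm P \in unitmx by rewrite map_unitmx.
have inV g0 : CG g0 -> tau g0 \in V.
  move=> Gg0; rewrite (tauE g0 Gg0); have [g0u _] := CV _ Gg0.
  have := conj_h_comm Gg0; rewrite hP.
  have -> : g0 *m spec (toCm P) (toCm d) *m invmx g0 = spec (toCm P *m invmx g0) (toCm d).
    exact: spec_conj.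
  by apply: tr_in_values; rewrite ?unitmx_mul ?unitmx_inv ?PuC.
(* On [G] this product vanishes where [tau] takes a value other than [t0]. The zeros of [tau - t0]
   and of [W] thus cut [G] into two disjoint closed pieces, and the identity lies in the first. *)
pose W (x : 'M[C]_n) := \prod_(v <- seq.filter (fun v => v != t0) V) (tau x - v).
have PW : mxpoly W.
  apply: mxpoly_prod => v; apply: mxpolyB => //; exact: mxpolyC.
have PU : mxpoly (fun x => tau x - t0) by apply: mxpolyB => //; apply: mxpolyC.
have [|||] := hconn (zariski_closed_zero PU) (zariski_closed_zero PW).
- move=> g0 Gg0; have [E|E] := eqVneq (tau g0) t0; [left|right]; first by rewrite /= E subrr.
  rewrite /= /W; apply/eqP; rewrite prodf_seq_eq0; apply/hasP; exists (tau g0).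
    by rewrite mem_filter E inV.
  by rewrite /= subrr.
- apply/seteqP; split=> // g0 [[Gg0 /= /eqP]]; rewrite subr_eq0 => /eqP E.
  rewrite /W => /eqP; rewrite prodf_seq_eq0 => /hasP[v].
  by rewrite mem_filter => /andP[vt _] /=; rewrite E subr_eq0 eq_sym (negPf vt).
- move=> HU Gg; have [gu _] := CV _ Gg.
  have /eqP := HU _ Gg; rewrite subr_eq0 tauE // => /eqP /(tr_conj_h Gg) E.
  by rewrite -[in RHS]E mulmxKV.
move=> /(_ _ C1) /= E; exfalso; move: E; rewrite /W => /eqP.
rewrite prodf_seq_eq0 => /hasP[v]; rewrite mem_filter => /andP[vt _] /=.
by rewrite tauE // invmx1 mulmx1 mul1mx subr_eq0 eq_sym (negPf vt).
Qed.

End Conj.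
End Center.

(* Positivity of the eigenvalues makes the Zariski closure of the powers connected. *)
Section PowerClosure.
Variables (K : rcfType) (n : nat).
Local Notation C := (K[i]%C).
Variables (P : 'M[C]_n) (d : 'rV[K]_n).
Hypotheses (Pu : P \in unitmx) (d0 : forall i, 0 < d 0 i) (ddet : \prod_i d 0 i = 1).
Local Notation dC := (map_mx (toC K) d).
Local Notation pw k := (spec P (row_exp dC k)).

Definition pwclosure : set 'M[C]_n :=
  [set x | forall p, (forall k, mxeval idfun p (pw k) = 0) -> mxeval idfun p x = 0].
Local Notation N := pwclosure.

Lemma pwclosure_ind F : mxpoly F -> (forall k, F (pw k) = 0) -> forall x, N x -> F x = 0.
Proof.
by move=> /mxpolyP[p Hp] H x Nx; rewrite -Hp Nx // => k; rewrite Hp.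
Qed.

Lemma pwclosure_eq (X Y : 'M[C]_n -> 'M[C]_n) :
  (forall i j, mxpoly (fun x => X x i j)) -> (forall i j, mxpoly (fun x => Y x i j)) ->
  (forall k, X (pw k) = Y (pw k)) -> forall x, N x -> X x = Y x.
Proof.
move=> HX HY H x Nx; apply/matrixP => i j; apply/eqP; rewrite -subr_eq0; apply/eqP.
apply: (pwclosure_ind (F := fun x => X x i j - Y x i j)) => //.
  by apply: mxpolyB.
by move=> k; rewrite H subrr.
Qed.

Lemma mxpoly_Mr (c : 'M[C]_n) i j : mxpoly (fun x => (c *m x) i j).
Proof. by apply: mxpoly_mulmx => k l; [exact: mxpoly_cst|exact: mxpolyX]. Qed.

Lemma mxpoly_Ml (c : 'M[C]_n) i j : mxpoly (fun x => (x *m c) i j).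
Proof. by apply: mxpoly_mulmx => k l; [exact: mxpolyX|exact: mxpoly_cst]. Qed.

Lemma pw_closure k : N (pw k).
Proof. by move=> p; apply. Qed.

Lemma pwM k l : pw k *m pw l = pw (k + l).
Proof.
rewrite (specM _ _ Pu); congr (spec P _); apply/rowP => i; rewrite !mxE.
by rewrite exprD.
Qed.

Lemma pwclosureM x y : N x -> N y -> N (x *m y).
Proof.
have step k z : N z -> N (pw k *m z).
  move=> Nz p Hp; apply: (pwclosure_ind (F := fun z => mxeval idfun p (pw k *m z))) Nz.
    by apply: mxpoly_mxeval => i j; apply: mxpoly_Mr.
  by move=> l; rewrite pwM.
move=> Nx Ny p Hp; apply: (pwclosure_ind (F := fun x => mxeval idfun p (x *m y))) Nx.
  by apply: mxpoly_mxeval => i j; apply: mxpoly_Ml.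
move=> k; have /step := Ny; apply; exact: Hp.
Qed.

Lemma pwS k : pw k.+1 = pw k *m pw 1.
Proof. by rewrite pwM addn1. Qed.

Lemma pw0 : pw 0 = 1%:M.
Proof. by rewrite -(spec1 Pu); congr (spec P _); apply/rowP => i; rewrite !mxE. Qed.

(** [pwclosure] starts from the powers with nonnegative exponents; inversion is multiplicative on
    the eigenvalues, so [zeros_multiplicative] adds the inverse. *)
Lemma pwclosure_inv1 : N (spec P (map_mx (fun c => c^-1) dC)).
Proof.
move=> p Hp.
have := @zeros_multiplicative C C idfun n [set p] P (invmx P) dC [set x | x != 0] (fun c => c^-1).
apply=> //=.
- by move=> x y x0 y0; rewrite mulf_neq0.
- by move=> i; rewrite mxE fmorph_eq0 gt_eqF.
- exact: invr1.
- by move=> x y _ _; rewrite invfM.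
by move=> k q ->; apply: Hp.
Qed.

Lemma pwclosure_det x : N x -> \det x = 1.
Proof.
move=> Nx; apply/eqP; rewrite -subr_eq0; apply/eqP.
apply: (pwclosure_ind (F := fun x => \det x - 1)) Nx.
  by apply: mxpolyB; [apply: mxpoly_det => i j; exact: mxpolyX|exact: mxpolyC].
move=> k; rewrite (spec_det _ Pu); apply/eqP; rewrite subr_eq0; apply/eqP.
rewrite (eq_bigr (fun i => toC K (d 0 i) ^+ k)) => [|i _]; last by rewrite !mxE.
by rewrite prodrXl -rmorph_prod ddet rmorph1 expr1n.
Qed.

Lemma pwclosure_inv x : N x -> x \in unitmx /\ N (invmx x).
Proof.
move=> Nx; have xd := pwclosure_det Nx.
have xu : x \in unitmx by rewrite unitmxE xd unitr1.
split=> //; have adjE (y : 'M[C]_n) : \det y = 1 -> invmx y = \adj y.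
  by move=> yd; rewrite /invmx unitmxE yd unitr1 invr1 scale1r.
rewrite (adjE _ xd) => p Hp.
apply: (pwclosure_ind (F := fun x => mxeval idfun p (\adj x))) Nx.
  by apply: mxpoly_mxeval; apply: mxpoly_adj => i j; exact: mxpolyX.
move=> k; rewrite -(adjE _ (pwclosure_det (pw_closure k))).
suff : N (invmx (pw k)) by apply.
elim: k => [|k IH]; first by rewrite pw0 invmx1 -pw0; apply: pw_closure.
have pu l : pw l \in unitmx.
  by rewrite unitmxE (pwclosure_det (pw_closure l)) unitr1.
rewrite pwS (invmxM (pu _) (pu _)); apply: pwclosureM; last exact: IH.
have -> : pw 1 = spec P dC by congr (spec P _); apply/rowP => i; rewrite !mxE.
have dn0 i : dC 0 i != 0 by rewrite mxE fmorph_eq0 gt_eqF.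
by rewrite (spec_inv Pu dn0); exact: pwclosure_inv1.
Qed.

Lemma pwclosure_comm g x : g *m pw 1 = pw 1 *m g -> N x -> g *m x = x *m g.
Proof.
move=> H; apply: (pwclosure_eq (X := fun x => g *m x) (Y := fun x => x *m g)).
- by move=> i j; apply: mxpoly_Mr.
- by move=> i j; apply: mxpoly_Ml.
elim=> [|k IH]; first by rewrite pw0 mulmx1 mul1mx.
by rewrite pwS mulmxA IH -mulmxA H mulmxA.
Qed.

Lemma pwclosure_abelian x y : N x -> N y -> x *m y = y *m x.
Proof.
move=> Nx; apply: pwclosure_comm; symmetry; apply: pwclosure_comm Nx => //.
Qed.

Lemma pwclosure_group : subgroup N.
Proof.
by split; [rewrite -pw0; apply: pw_closure|exact: pwclosureM|exact: pwclosure_inv].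
Qed.

Lemma pwclosure_solvable : solvable_set N.
Proof.
exists 1%N; apply/seteqP; split=> z /=.
  move=> /(_ [set 1%:M]); apply=> [|x y Nx Ny].
    split=> // [x y -> ->|x ->]; first by rewrite mulmx1.
    by rewrite unitmx1 invmx1.
  have [xu _] := pwclosure_inv Nx; have [yu _] := pwclosure_inv Ny.
  by rewrite /= (pwclosure_abelian Nx Ny) mulmxK // mulmxV.
by move=> -> D [].
Qed.

Lemma pwclosure_closed : zariski_closed N.
Proof.
exists [set p | forall k, mxeval idfun p (pw k) = 0].
by apply/seteqP; split=> x Nx p; apply: Nx.
Qed.

Lemma mxeval_pw p : exists (s : seq K) (c : K -> C), [/\ uniq s, forall x, x \in s -> 0 < x,
  forall x, x \in s -> c x != 0 &
  forall k, mxeval idfun p (pw k) = \sum_(x <- s) c x * toC K x ^+ k].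
Proof.
have [Q HQ] : polyfun (fun v : 'rV[C]_n => mxeval idfun p (spec P v)).
  by apply: polyfun_mxeval => i j; apply: polyfun_conj_diag.
have [s [c [us sc ss E]]] := expsum_group (msupp Q) (fun m => mon m d) (fun m => mcoeff m Q).
exists s, c; split=> // [x /ss/mapP[m _ ->]|k].
  by apply: prodr_gt0 => i _; rewrite exprn_gt0.
rewrite -HQ mevalE_mon -E; apply: eq_bigr => m _; congr (_ * _).
rewrite /mon -rmorphXn -prodrXl rmorph_prod; apply: eq_bigr => i _.
by rewrite !mxE rmorphXn rmorphXn -!exprM mulnC.
Qed.

Lemma pwclosure_connected : zariski_connected N.
Proof.
move=> U W [p ->] [q ->] NUW _.
apply: contrapT => /not_orP[/existsNP[x /not_implyP[Nx /existsNP[u /not_implyP[pu ux]]]]].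
move=> /existsNP[y /not_implyP[Ny /existsNP[w /not_implyP[qw wy]]]].
have [s [c [us sp sc su]]] := mxeval_pw u; have [t [e [ut tp te tw]]] := mxeval_pw w.
have s0 : s != [::].
  by apply/eqP => s0; apply: ux; apply: Nx => k; rewrite su s0 big_nil.
have t0 : t != [::].
  by apply/eqP => t0; apply: wy; apply: Ny => k; rewrite tw t0 big_nil.
have [k] := expsum_prod s0 t0 us ut sp tp sc te; rewrite -su -tw.
by have [/(_ u pu)|/(_ w qw)] := NUW _ (pw_closure k) => ->; rewrite ?mul0r ?mulr0 eqxx.
Qed.

End PowerClosure.

(** * Contradiction with the triviality of the radical *)

Section Semisimple.
Variables (K : rcfType) (R : realType) (iotaR : {rmorphism K -> R}) (n : nat).
Variables (G S : seq (MPoly[K]_(n * n))) (A : sa_formula K n) (a : {vspace 'M[R]_n}).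
Hypotheses (hG : connected_semisimple G) (hGT : self_adjoint G).
Hypotheses (hS : split_torus S) (hSsym : forall s, Cpoints S s -> s = s^T).
Hypothesis hSG : Cpoints S `<=` Cpoints G.
Hypothesis hA : sa_component (points idfun S) 1%:M (sa_ext idfun A).
Hypothesis ha : forall H : 'M[R]_n, H \in a <-> Lie (sa_ext iotaR A) H.

Theorem roots_separate H : H \in a ->
  (forall alpha : dual a, is_root (Lie (points iotaR G)) alpha -> alpha (vsproj a H) = 0) -> H = 0.
Proof.
case: hG => hGa hconn hrad.
move=> Ha H0; apply/eqP; apply: contrapT => /negP Hn0.
have [b [Ab bb bcomm]] := exists_central hGa hGT hS hSsym hSG hA ha Ha Hn0 H0.
move: Ab; rewrite (component_squares iotaR hS hSsym idfun hA) => -[y Sy bE].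
have sy : y^T = y by apply: (points_sym (f := idfun) hSsym).
have Gy : points idfun G y by apply: points_sub Sy.
have [[_ GM GV] GS] := points_group idfun hGa.
have Gb : points idfun G b by rewrite bE; apply: (GM).
have yu : y \in unitmx by case: (GV _ Gy).
have sb : b^T = b by rewrite bE trmx_mul sy.
have : rpd (b *m b).
  by rewrite -{2}sb; apply: rpd_mulmxtr; rewrite bE unitmx_mul yu.
move=> [sbb [P [d [Pu d0 hE]]]].
have central := conj_h_central hGa hGT hconn Gb sb Pu hE bcomm.
have PuC : map_mx (toC K) P \in unitmx by rewrite map_unitmx.
have ddet : \prod_i d 0 i = 1.
  by rewrite -(spec_det _ Pu) -hE; apply: GS; apply: (GM).
have hC : map_mx (toC K) (b *m b) = spec (map_mx (toC K) P) (row_exp (map_mx (toC K) d) 1).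
  by rewrite hE map_spec; congr (spec _ _); apply/rowP => i; rewrite !mxE.
have := hrad _ (pwclosure_closed (map_mx (toC K) P) d) (@pwclosure_connected _ _ (map_mx (toC K) P) d d0)
  (pwclosure_solvable PuC d0 ddet).
(* The elements of the closure inherit from [b *m b] the commutation with all of [G], so conjugation
   fixes them. *)
have NG : normal_in (pwclosure (map_mx (toC K) P) d) (Cpoints G).
  have [[C1 CM CV] _] := hGa.
  have Nsub x : pwclosure (map_mx (toC K) P) d x -> Cpoints G x.
    move=> Nx p pG; apply: (pwclosure_ind (F := fun x => mxeval (toC K) p x)) Nx.
      by apply: mxpoly_mxeval => i j; apply: mxpolyX.
    move=> k; apply: (_ : Cpoints G _) => //; rewrite (spec_row_exp _ _ PuC) -map_spec -hE.
    elim: k => [|k IH]; first exact: C1.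
    by apply: (CM _ _ _ IH); apply/points_KC; apply: (GM).
  split; [exact: (pwclosure_group PuC d0 ddet)|exact: Nsub|].
  move=> g x Gg Nx; have [gu _] := CV _ Gg.
  rewrite (pwclosure_comm PuC _ Nx) ?mulmxK //.
  by rewrite -hC; apply: central.
move=> /(_ NG) NE; apply: bb; apply: (@toCm_inj K); rewrite hC map_mx1.
by have := @pw_closure _ _ (map_mx (toC K) P) d 1; rewrite NE.
Qed.

End Semisimple.

(** * Bounds in terms of characters *)

Section CharacterBounds.
Variables (K : rcfType) (R : realType) (iotaR : {rmorphism K -> R}) (n : nat).
Variables (G S : seq (MPoly[K]_(n * n))) (A : sa_formula K n) (a : {vspace 'M[R]_n}).
Hypotheses (hG : connected_semisimple G) (hGT : self_adjoint G).
Hypotheses (hS : split_torus S) (hSsym : forall s, Cpoints S s -> s = s^T).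
Hypothesis hSG : Cpoints S `<=` Cpoints G.
Hypothesis hA : sa_component (points idfun S) 1%:M (sa_ext idfun A).
Hypothesis ha : forall H : 'M[R]_n, H \in a <-> Lie (sa_ext iotaR A) H.
Variables (Sigma : seq (dual a)) (chi : dual a -> MPoly[K]_(n * n)).
Hypothesis hSigma : forall alpha : dual a,
  alpha \in Sigma <-> is_root (Lie (points iotaR G)) alpha.
Hypothesis hchiexp : forall alpha, alpha \in Sigma -> forall H : subvs_of a,
  mxeval iotaR (chi alpha) (expmx (vsval H)) = expR (alpha H).
Local Notation AR := (sa_ext iotaR A).
Local Notation chiE f alpha x := (mxeval f (chi alpha) x).
Local Notation V b := (MVar K n b).

(** By [roots_separate] the values of the roots embed [a] linearly in a coordinate space; [C] comes
    from the entries of a linear left inverse of this embedding. *)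
Lemma roots_bound : exists2 C : R, 0 <= C & forall H, H \in a ->
  mbound (C * \sum_(al <- Sigma) `|al (vsproj a H)|) H.
Proof.
pose N := size Sigma.
pose ph (u : subvs_of a) : 'rV[R]_N := \row_i (nth 0 Sigma i u : R).
have L : linear ph.
  by move=> c x y; apply/rowP => i; rewrite !mxE linearP.
pose phL : {linear subvs_of a -> 'rV[R]_N} := HB.pack ph
  (GRing.isLinear.Build R (subvs_of a) 'rV[R]_N *:%R ph L).
have phE u i : phL u 0 i = nth 0 Sigma i u by rewrite [LHS]mxE.
have ker0 : lker (linfun phL) == 0%VS.
  rewrite -subv0; apply/subvP => u; rewrite memv_ker lfunE memv0 => /eqP/rowP u0.
  suff -> : u = 0 by [].
  have Hu : vsval u = 0.
    apply: (roots_separate hG hGT hS hSsym hSG hA ha (subvsP u)) => al /hSigma als.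
    rewrite vsvalK; have iN : (index al Sigma < N)%N by rewrite index_mem.
    by have := u0 (Ordinal iN); rewrite phE mxE nth_index.
  by apply: val_inj; rewrite /= Hu; exact: (esym (raddf0 (@vsval _ _ a))).
have /choice[B HB] : forall i : 'I_N, exists B, mbound B (vsval ((linfun phL)^-1%VF (delta_mx 0 i))).
  by move=> i; have [B _ HB] := mbound_exists (vsval ((linfun phL)^-1%VF (delta_mx 0 i))); exists B.
exists (\sum_i `|B i|); first exact: sumr_ge0.
move=> H Ha k l; have HE : H = vsval (vsproj a H) by rewrite vsprojK.
rewrite [in X in X <= _]HE; move: (vsproj a H) => u.
have -> : vsval u = \sum_(i < N) nth 0 Sigma i u *: vsval ((linfun phL)^-1%VF (delta_mx 0 i)).
  have rowE : phL u = \sum_i phL u 0 i *: delta_mx 0 i by exact: row_sum_delta.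
  rewrite -{1}(lker0_lfunK ker0 u) lfunE rowE 2!linear_sum.
  by apply: eq_bigr => i _; rewrite -phE 2!linearZ.
rewrite summxE; apply: le_trans (ler_norm_sum _ _ _) _.
rewrite (big_nth 0) big_mkord mulr_sumr; apply: ler_sum => i _.
rewrite mxE normrM mulrC ler_wpM2r //; apply: le_trans (HB i k l) _.
apply: le_trans (ler_norm _) _.
by rewrite (bigD1 i) //= lerDl; apply: sumr_ge0.
Qed.

Lemma AR_log_char x : AR x -> exists (P : 'M[R]_n) (d : 'rV[R]_n),
  [/\ P \in unitmx, spec P d \in a, x = spec P (map_mx expR d), (spec P d)^T = spec P d &
    forall al, al \in Sigma -> chiE iotaR al x = expR (al (vsproj a (spec P d))) /\
      chiE iotaR al (invmx x) = expR (- al (vsproj a (spec P d)))].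
Proof.
move=> Ax; have [P [d [Pu xE Hd xexp]]] := AR_exp hS hSsym hA ha Ax.
exists P, d; split=> //; first exact: (a_sym hS hSsym hA ha).
move=> al als; split; first by rewrite xexp -{1}(vsprojK Hd) hchiexp.
rewrite -linearN /= -hchiexp //; congr mxeval.
rewrite linearN /= vsprojK // -scaleN1r expmx_spec // xE spec_inv //; last first.
  by move=> i; rewrite mxE gt_eqF // expR_gt0.
by congr spec; apply/rowP => i; rewrite !mxE mulN1r expRN.
Qed.

(** Over [R] both claims are read off the exponential. The matrix [y] stands for the inverse of [x],
    which [mterm] cannot express. *)
Lemma char_pos (E : rcfType) (f : {rmorphism K -> E}) al : al \in Sigma ->
  forall x y, sa_ext f A x -> x *m y = 1%:M ->
  0 < chiE f al x /\ chiE f al x * chiE f al y = 1.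
Proof.
move=> als; pose p : mform K n := FAll 0 (FAll 1 (FImp (FSa A (V 0)) (FImp
   (FMEq (MMul (V 0) (V 1)) (MCst 1%:M)) (FAnd (FLt (SNat K n 0) (SPoly (chi al) (V 0)))
   (FEq (SMul (SPoly (chi al) (V 0)) (SPoly (chi al) (V 1))) (SNat K n 1)))))).
have : finterp iotaR (fun=> 0) p.
  move=> x y /= Ax; rewrite map_mx1 => xy.
  have [P [d [Pu _ xE _ Hch]]] := AR_log_char Ax.
  have yE : y = invmx x.
    have xu := (mulmx1_unit xy).1.
    by rewrite -[RHS]mulmx1 -xy mulmxA mulVmx // mul1mx.
  have [-> yc] := Hch _ als; rewrite yE yc -expRD subrr expR0; split=> //.
  exact: expR_gt0.
move=> /(tarski_transfer iotaR p)/(tarski_transfer f p) H x y Ax xy.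
by have /= := H x y; rewrite map_mx1; apply.
Qed.

Lemma tr_bound_exists : exists m : nat, forall x, AR x ->
  \tr (x *m x^T) <= n%:R * (1 + \sum_(al <- Sigma) (chiE iotaR al x + chiE iotaR al (invmx x))) ^+ m.
Proof.
have [C C0 HC] := roots_bound.
(* An integer exponent keeps the inequality expressible in [mform]; it depends only on [n] and [C],
   not on [x]. *)
pose m := Num.bound (n%:R * C : R).
have mC : n%:R * C <= m%:R.
  by apply/ltW/archi_boundP; rewrite mulr_ge0.
(* [T ^+ size Sigma] bounds [expR s], the factor [m] passes from the roots to the eigenvalues, and 2
   accounts for the squares in the trace. *)
exists (2 * m * size Sigma)%N => x Ax.
have [P [d [Pu Hd xE sd Hch]]] := AR_log_char Ax.
set H := spec P d in Hd sd Hch.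
pose u := vsproj a H; rewrite -/u in Hch.
pose s := \sum_(al <- Sigma) `|al u|.
have s0 : 0 <= s by exact: sumr_ge0.
(* As [P] is merely invertible, the eigenvalues [d] are bounded through the sum of their squares,
   which is this trace. *)
have tr2 : \tr (H *m H^T) <= (n%:R * C * s) ^+ 2.
  rewrite /mxtrace; apply: (@le_trans _ _ (\sum_(i < n) \sum_(j < n) (C * s) ^+ 2)).
    apply: ler_sum => i _; rewrite [_ i i]mxE; apply: ler_sum => j _; rewrite [H^T j i]mxE -expr2.
    by rewrite -[X in X <= _]real_normK ?num_real // ler_sqr ?nnegrE ?mulr_ge0 // HC.
  rewrite !sumr_const !card_ord -[X in X <= _]mulr_natl -[X in _ * X <= _]mulr_natl; move: (n%:R : R) => N.
  by rewrite le_eqVlt; apply/orP; left; apply/eqP; ring.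
have dle i : `|d 0 i| <= m%:R * s.
  apply: (@le_trans _ _ (n%:R * C * s)); last by rewrite ler_wpM2r.
  rewrite -ler_sqr ?nnegrE ?mulr_ge0 //; apply: le_trans tr2.
  rewrite sd specM // spec_trace // (bigD1 i) //= mxE -expr2 real_normK ?num_real // lerDl.
  by apply: sumr_ge0 => j _; rewrite mxE -expr2 sqr_ge0.
set T := 1 + _.
have chi0 al : al \in Sigma -> 0 <= chiE iotaR al x + chiE iotaR al (invmx x).
  by move=> /Hch[-> ->]; rewrite addr_ge0 // expR_ge0.
have sum0 (r : seq (dual a)) : {subset r <= Sigma} ->
    0 <= \sum_(al <- r) (chiE iotaR al x + chiE iotaR al (invmx x)).
  by move=> rS; rewrite big_seq sumr_ge0 // => al /rS/chi0.
have leT al : al \in Sigma -> expR `|al u| <= T.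
  move=> als; apply: (@le_trans _ _ (chiE iotaR al x + chiE iotaR al (invmx x))).
    have [-> ->] := Hch _ als; have [h|h] := leP 0 (al u).
      by rewrite ger0_norm // lerDl expR_ge0.
    by rewrite ltr0_norm // lerDr expR_ge0.
  rewrite /T (big_rem al) //= addrCA lerDl addr_ge0 // sum0 //.
  by move=> be; apply: mem_rem.
have T1 : 1 <= T by rewrite lerDl sum0.
have expS : expR s <= T ^+ size Sigma.
  rewrite /s; move: leT; elim: (Sigma) => [|al r IH] leT; first by rewrite big_nil expR0.
  rewrite big_cons expRD exprS; apply: ler_pM; [exact: expR_ge0..|exact: leT (mem_head _ _)|].
  by apply: IH => be ber; rewrite leT // inE ber orbT.
have -> : \tr (x *m x^T) = \sum_i expR (d 0 i) ^+ 2.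
  have sx : x^T = x by rewrite xE; apply: spec_sym.
  rewrite sx xE specM // spec_trace //; apply: eq_bigr => i _.
  by rewrite !mxE expr2.
rewrite -[n in n%:R]card_ord mulr_natl -sumr_const; apply: ler_sum => i _.
rewrite mulnC exprM [(2 * m)%N]mulnC [X in _ <= X]exprM.
rewrite ler_sqr ?nnegrE ?exprn_ge0 ?expR_ge0 //; last by rewrite (le_trans ler01 T1).
apply: (@le_trans _ _ (expR (s * m%:R))).
  by rewrite ler_expR mulrC; apply: le_trans (ler_norm _) (dle i).
by rewrite expRM_natr lerXn2r ?nnegrE ?expR_ge0 // exprn_ge0 // (le_trans ler01 T1).
Qed.

Lemma tr_bound (E : rcfType) (f : {rmorphism K -> E}) : exists m : nat,
  forall x y, sa_ext f A x -> x *m y = 1%:M ->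
  \tr (x *m x^T) <= n%:R * (1 + \sum_(al <- Sigma) (chiE f al x + chiE f al y)) ^+ m.
Proof.
have [m Hm] := tr_bound_exists; exists m.
pose t := foldr (fun al t => SAdd (SAdd (SPoly (chi al) (V 0)) (SPoly (chi al) (V 1))) t) (SNat K n 0) Sigma.
have tE (E' : rcfType) (g : {rmorphism K -> E'}) rho : sinterp g rho t =
    \sum_(al <- Sigma) (chiE g al (rho 0%N) + chiE g al (rho 1%N)).
  rewrite /t; elim: (Sigma) => [|al r IH] /=; first by rewrite big_nil.
  by rewrite big_cons IH.
pose p : mform K n := FAll 0 (FAll 1 (FImp (FSa A (V 0)) (FImp
   (FMEq (MMul (V 0) (V 1)) (MCst 1%:M))
   (FNot (FLt (SMul (SNat K n n) (SExp (SAdd (SNat K n 1) t) m)) (STrace (MMul (V 0) (MTr (V 0))))))))).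
have : finterp iotaR (fun=> 0) p.
  move=> x y /= Ax; rewrite map_mx1 tE => xy.
  have yE : y = invmx x.
    have xu := (mulmx1_unit xy).1.
    by rewrite -[RHS]mulmx1 -xy mulmxA mulVmx // mul1mx.
  by rewrite /= yE; apply/negP; rewrite -leNgt; apply: Hm.
move=> /(tarski_transfer iotaR p)/(tarski_transfer f p) H x y Ax xy.
by have /= := H x y; rewrite map_mx1 tE => /(_ Ax xy) /negP; rewrite -leNgt.
Qed.

End CharacterBounds.

(** * Split tori from lattices of relations *)

Section IntegerMonomials.
Variable (L : fieldType).

Definition zmon n (m : 'rV[int]_n) (x : 'rV[L]_n) : L := \prod_i x 0 i ^ m 0 i.

Definition nz n (x : 'rV[L]_n) := forall i, x 0 i != 0.

Lemma zmon_neq0 n (m : 'rV[int]_n) x : nz x -> zmon m x != 0.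
Proof. by move=> x0; apply/prodf_neq0 => i _; rewrite expfz_neq0. Qed.

Lemma zmon0 n (x : 'rV[L]_n) : zmon 0 x = 1.
Proof. by rewrite /zmon big1 // => i _; rewrite mxE expr0z. Qed.

Lemma zmonD n (m m' : 'rV[int]_n) x : nz x -> zmon (m + m') x = zmon m x * zmon m' x.
Proof.
by move=> x0; rewrite /zmon -big_split; apply: eq_bigr => i _; rewrite mxE expfzDr.
Qed.

Lemma zmonZ n (c : int) (m : 'rV[int]_n) x : zmon (c *: m) x = zmon m x ^ c.
Proof.
rewrite /zmon; elim/big_ind2: _ => [|u v u' v' -> ->|i _]; first by rewrite exp1rz.
  by rewrite expfzMl.
by rewrite mxE mulrC exprz_exp.
Qed.

Lemma zmonM n (m : 'rV[int]_n) x y : zmon m (had x y) = zmon m x * zmon m y.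
Proof. by rewrite /zmon -big_split; apply: eq_bigr => i _; rewrite mxE expfzMl. Qed.

Lemma zmon_cst1 n (m : 'rV[int]_n) : zmon m (const_mx 1) = 1.
Proof. by rewrite /zmon big1 // => i _; rewrite mxE exp1rz. Qed.

Lemma zmon_delta n (x : 'rV[L]_n) i : zmon (delta_mx 0 i) x = x 0 i.
Proof.
rewrite /zmon (bigD1 i) //= mxE !eqxx expr1z big1 ?mulr1 // => j ji.
by rewrite mxE (negPf ji) andbF expr0z.
Qed.

Lemma zmon_sum n I (r : seq I) (m : I -> 'rV[int]_n) x : nz x ->
  zmon (\sum_(i <- r) m i) x = \prod_(i <- r) zmon (m i) x.
Proof.
by move=> x0; elim: r => [|i r IH]; rewrite ?big_nil ?zmon0 // !big_cons zmonD ?IH.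
Qed.

Lemma zmon_mulmx n k (m : 'rV[int]_k) (B : 'M[int]_(k, n)) x : nz x ->
  zmon (m *m B) x = zmon m (\row_i zmon (row i B) x).
Proof.
move=> x0; rewrite mulmx_sum_row zmon_sum //; apply: eq_bigr => i _.
by rewrite zmonZ mxE.
Qed.

Lemma mon_zmon n (m : multinom n) (x : 'rV[L]_n) : mon m x = zmon (\row_i (m i)%:Z) x.
Proof. by apply: eq_bigr => i _; rewrite mxE. Qed.

Definition pospart (z : int) : nat := if z is Posz k then k else 0.
Definition negpart (z : int) : nat := if z is Negz k then k.+1 else 0.

Lemma exprz_parts (x : L) z : x ^ z = x ^+ pospart z * x^-1 ^+ negpart z.
Proof. by case: z => k /=; rewrite ?mulr1 // mul1r exprVn. Qed.

Lemma exprz_parts_eq (x : L) z : x != 0 -> x ^ z * x ^+ negpart z = x ^+ pospart z.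
Proof.
by move=> x0; rewrite exprz_parts -mulrA -exprMn mulVf // expr1n mulr1.
Qed.

End IntegerMonomials.

Lemma zmon_map (L M : fieldType) (f : {rmorphism L -> M}) n (m : 'rV[int]_n) (x : 'rV[L]_n) :
  zmon m (map_mx f x) = f (zmon m x).
Proof. by rewrite rmorph_prod; apply: eq_bigr => i _; rewrite mxE fmorphXz. Qed.

Section RationalFunctions.
Variables (K E : comNzRingType) (f : {rmorphism K -> E}).

(** Unlike in [polyfun], the coefficients come from [K]: the torus under construction has to be
    defined and split over [K]. *)
Definition kfun m (F : 'rV[E]_m -> E) := exists p : MPoly[K]_m, forall v, evalp f p v = F v.

Lemma kfun_ext m (F F' : 'rV[E]_m -> E) : F =1 F' -> kfun F -> kfun F'.
Proof. by move=> FF' [p Hp]; exists p => v; rewrite Hp. Qed.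

Lemma kfunC m c : kfun (fun _ : 'rV[E]_m => f c).
Proof. by exists (mpolyC m c) => v; rewrite /evalp mmapC. Qed.

Lemma kfunX m i : kfun (fun v : 'rV[E]_m => v 0 i).
Proof. by exists (mpolyX K (mnm1 i)) => v; rewrite /evalp mmapX mmap1U. Qed.

Lemma evalp_is_rmorphism m (v : 'rV[E]_m) :
  exists g : {rmorphism MPoly[K]_m -> E}, forall p, g p = evalp f p v.
Proof. by exists (mmap f (v 0)). Qed.

Lemma kfunD m (F F' : 'rV[E]_m -> E) : kfun F -> kfun F' -> kfun (fun v => F v + F' v).
Proof.
move=> [p Hp] [q Hq]; exists (p + q) => v; have [g Hg] := evalp_is_rmorphism v.
by rewrite -Hg rmorphD !Hg Hp Hq.
Qed.

Lemma kfunM m (F F' : 'rV[E]_m -> E) : kfun F -> kfun F' -> kfun (fun v => F v * F' v).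
Proof.
move=> [p Hp] [q Hq]; exists (p * q) => v; have [g Hg] := evalp_is_rmorphism v.
by rewrite -Hg rmorphM !Hg Hp Hq.
Qed.

Lemma kfun1 m : kfun (fun _ : 'rV[E]_m => 1).
Proof. by apply: kfun_ext (kfunC m 1) => v; rewrite rmorph1. Qed.

Lemma kfunB m (F F' : 'rV[E]_m -> E) : kfun F -> kfun F' -> kfun (fun v => F v - F' v).
Proof.
move=> [p Hp] [q Hq]; exists (p - q) => v; have [g Hg] := evalp_is_rmorphism v.
by rewrite -Hg rmorphB !Hg Hp Hq.
Qed.

Lemma kfunXn m (F : 'rV[E]_m -> E) k : kfun F -> kfun (fun v => F v ^+ k).
Proof.
move=> HF; elim: k => [|k IH]; first exact: kfun1.
by apply: kfun_ext (kfunM HF IH) => v; rewrite exprS.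
Qed.

Lemma kfun_sum m I (r : seq I) (P : pred I) (F : I -> 'rV[E]_m -> E) :
  (forall i, kfun (F i)) -> kfun (fun v => \sum_(i <- r | P i) F i v).
Proof.
move=> HF; elim: r => [|i r IH].
  by apply: kfun_ext (kfunC m 0) => v; rewrite big_nil rmorph0.
case Pi: (P i); last by apply: kfun_ext IH => v; rewrite big_cons Pi.
by apply: kfun_ext (kfunD (HF i) IH) => v; rewrite big_cons Pi.
Qed.

Lemma kfun_prod m I (r : seq I) (P : pred I) (F : I -> 'rV[E]_m -> E) :
  (forall i, kfun (F i)) -> kfun (fun v => \prod_(i <- r | P i) F i v).
Proof.
move=> HF; elim: r => [|i r IH]; first by apply: kfun_ext (kfun1 m) => v; rewrite big_nil.
case Pi: (P i); last by apply: kfun_ext IH => v; rewrite big_cons Pi.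
by apply: kfun_ext (kfunM (HF i) IH) => v; rewrite big_cons Pi.
Qed.

Lemma kfun_conj m n (P Q : 'M[K]_n) (X : 'rV[E]_m -> 'M[E]_n) :
  (forall i j, kfun (fun v => X v i j)) ->
  forall i j, kfun (fun v => (map_mx f P *m X v *m map_mx f Q) i j).
Proof.
move=> HX i j; apply: kfun_ext (fun v => esym (mxE _ _ _ _)) _.
apply: kfun_sum => k; apply: kfunM; last by apply: kfun_ext (kfunC m (Q k j)) => v; rewrite mxE.
apply: kfun_ext (fun v => esym (mxE _ _ _ _)) _.
by apply: kfun_sum => l; apply: kfunM => //; apply: kfun_ext (kfunC m (P i l)) => v; rewrite mxE.
Qed.

Lemma kfun_mxP n (F : 'M[E]_n -> E) : kfun (fun v => F (vec_mx v)) ->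
  exists p : MPoly[K]_(n * n), forall x, mxeval f p x = F x.
Proof. by move=> [p Hp]; exists p => x; rewrite /mxeval Hp mxvecK. Qed.

Lemma kfun_vecmx n i j : kfun (fun v : 'rV[E]_(n * n) => vec_mx v i j).
Proof. by apply: kfun_ext (kfunX (mxvec_index i j)) => v; rewrite mxE. Qed.

End RationalFunctions.

(** * The split torus defined by a lattice of relations *)

Section DiagonalTorus.
Variables (K : rcfType) (n r : nat) (P : 'M[K]_n) (B : 'M[int]_(n, r)) (B' : 'M[int]_(r, n)).
Hypotheses (Pu : P \in unitmx) (BB : B' *m B = 1%:M).
Hypothesis Bdet : const_mx 1 *m B = 0 :> 'rV[int]_r.
Local Notation C := (K[i]%C).
Local Notation toCm := (map_mx (toC K)).
Local Notation PC := (toCm P).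

Let PuC : PC \in unitmx.
Proof. by rewrite map_unitmx. Qed.

Definition dcoord (x : 'M[C]_n) : 'rV[C]_n := \row_i (PC *m x *m toCm (invmx P)) i i.

(** The lattice of relations is the kernel of [B], and the section [B'] makes the quotient of Z^n by
    it free. [B] gives the parametrization [torus_coord] and [B'] its inverse [torus_proj]; [Bdet]
    says that the relation of determinant 1 is in the lattice. *)
Definition torus_rel (y : 'rV[C]_n) := nz y /\ forall m : 'rV[int]_n, m *m B = 0 -> zmon m y = 1.

Lemma dcoordE x i : dcoord x 0 i = (PC *m x *m toCm (invmx P)) i i.
Proof. by rewrite [LHS]mxE. Qed.

Lemma dcoord_spec y : dcoord (spec PC y) = y.
Proof.
apply/rowP => i; rewrite mxE map_invmx.
move: (toCm P) PuC => Q Qu; rewrite /spec !mulmxA (mulmxV Qu) mul1mx (mulmxK Qu).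
by rewrite mxE eqxx mulr1n.
Qed.

(** The rows of [1%:M - B *m B'] generate the kernel of [B], so finitely many relations suffice;
    moving negative exponents to the other side makes them polynomial. *)
Lemma torus_equations : exists T : seq (MPoly[K]_(n * n)), forall x,
  Cpoints T x <-> [/\ forall i j, i != j -> (PC *m x *m toCm (invmx P)) i j = 0,
    forall j, \prod_i dcoord x 0 i ^+ pospart (row j (1%:M - B *m B') 0 i) =
       \prod_i dcoord x 0 i ^+ negpart (row j (1%:M - B *m B') 0 i) & \det x = 1].
Proof.
have Hc i j : kfun (toC K) (fun v => (PC *m vec_mx v *m toCm (invmx P)) i j).
  by apply: kfun_conj => k l; exact: kfun_vecmx.
have Hd i : kfun (toC K) (fun v => dcoord (vec_mx v) 0 i).
  by apply: kfun_ext (Hc i i) => v; rewrite dcoordE.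
have /choice[p Hp] : forall ij : 'I_n * 'I_n, exists p : MPoly[K]_(n * n), forall x,
    mxeval (toC K) p x = if ij.1 != ij.2 then (PC *m x *m toCm (invmx P)) ij.1 ij.2 else 0.
  move=> [i j] /=; apply: (kfun_mxP (F := fun x => if i != j then (PC *m x *m toCm (invmx P)) i j else 0)).
  by case: (i != j); [exact: Hc|apply: kfun_ext (kfunC (toC K) _ 0) => v; rewrite rmorph0].
have /choice[q Hq] : forall j, exists p : MPoly[K]_(n * n), forall x,
    mxeval (toC K) p x = \prod_i dcoord x 0 i ^+ pospart (row j (1%:M - B *m B') 0 i) -
       \prod_i dcoord x 0 i ^+ negpart (row j (1%:M - B *m B') 0 i).
  move=> j; apply: (kfun_mxP (F := fun x => \prod_i dcoord x 0 i ^+ pospart (row j (1%:M - B *m B') 0 i) -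
       \prod_i dcoord x 0 i ^+ negpart (row j (1%:M - B *m B') 0 i))).
  by apply: kfunB; apply: kfun_prod => i; apply: kfunXn.
exists (map p (enum {: 'I_n * 'I_n}) ++ map q (enum 'I_n) ++ [:: detp K n - 1]) => x.
have detE : mxeval (toC K) (detp K n - 1) x = \det x - 1.
  have [g Hg] := mxeval_is_rmorphism (toC K) x.
  by rewrite -Hg rmorphB rmorph1 Hg mxeval_detp.
split=> [H|[H1 H2 H3] s].
  split=> [i j ij|j|].
  - have := H (p (i, j)); rewrite Hp /= ij; apply.
    by rewrite mem_cat map_f ?mem_enum.
  - apply/eqP; rewrite -subr_eq0 -Hq; apply/eqP; apply: H.
    by rewrite !mem_cat map_f ?orbT ?mem_enum.
  - apply/eqP; rewrite -subr_eq0 -detE; apply/eqP; apply: H.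
    by rewrite !mem_cat mem_seq1 eqxx !orbT.
rewrite !mem_cat => /or3P[/mapP[ij _ ->]|/mapP[j _ ->]|].
- by rewrite Hp; case: ifP => // /H1.
- by rewrite Hq H2 subrr.
by rewrite mem_seq1 => /eqP ->; rewrite detE H3 subrr.
Qed.

Lemma rel_project (y : 'rV[C]_n) : nz y -> (forall m : 'rV[int]_n, m *m B = 0 -> zmon m y = 1) <->
  (forall j, zmon (row j (1%:M - B *m B')) y = 1).
Proof.
move=> y0; split=> [H j|H m mB].
  by apply: H; rewrite -row_mul mulmxBl mul1mx -mulmxA BB mulmx1 subrr row0.
have -> : m = m *m (1%:M - B *m B').
  by rewrite mulmxBr mulmx1 mulmxA mB mul0mx subr0.
rewrite zmon_mulmx //; have -> : \row_i zmon (row i (1%:M - B *m B')) y = const_mx 1.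
  by apply/rowP => i; rewrite !mxE H.
exact: zmon_cst1.
Qed.

Lemma zmon_parts (m : 'rV[int]_n) (y : 'rV[C]_n) : nz y ->
  \prod_i y 0 i ^+ pospart (m 0 i) = \prod_i y 0 i ^+ negpart (m 0 i) <-> zmon m y = 1.
Proof.
move=> y0.
have E : zmon m y * \prod_i y 0 i ^+ negpart (m 0 i) = \prod_i y 0 i ^+ pospart (m 0 i).
  by rewrite -big_split; apply: eq_bigr => i _; rewrite /= exprz_parts_eq.
have nn : \prod_i y 0 i ^+ negpart (m 0 i) != 0.
  by apply/prodf_neq0 => i _; rewrite expf_neq0.
split=> [H|H]; last by rewrite -E H mul1r.
by apply: (mulIf nn); rewrite mul1r E.
Qed.

Lemma torus_points : exists T : seq (MPoly[K]_(n * n)), forall x,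
  Cpoints T x <-> exists2 y, torus_rel y & x = spec PC y.
Proof.
have [T HT] := torus_equations; exists T => x; rewrite HT; split.
  move=> [H1 H2 H3].
  have xE : x = spec PC (dcoord x).
    have e : PC *m x *m toCm (invmx P) = diag_mx (dcoord x).
      apply/matrixP => i j; rewrite [RHS]mxE; have [->|ij] := eqVneq i j.
        by rewrite mulr1n dcoordE.
      by rewrite mulr0n H1.
    rewrite /spec -e map_invmx; move: (toCm P) PuC => Q Qu.
    by rewrite !mulmxA (mulVmx Qu) mul1mx (mulmxKV Qu).
  exists (dcoord x) => //.
  have y0 : nz (dcoord x).
    have := H3; rewrite {1}xE (spec_det _ PuC) => d1 i.
    by apply: contraTneq isT => y0; have := oner_neq0 C; rewrite -d1 (bigD1 i) //= y0 mul0r eqxx.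
  split=> //; apply/(rel_project y0) => j; apply/(zmon_parts _ y0).
  exact: H2.
move=> [y [y0 yrel] ->]; split.
- move=> i j ij; rewrite map_invmx; move: (toCm P) PuC => Q Qu.
  by rewrite /spec !mulmxA (mulmxV Qu) mul1mx (mulmxK Qu) mxE (negPf ij) mulr0n.
- move=> j; rewrite dcoord_spec; have := iffLR (rel_project y0) yrel j.
  by move=> /(zmon_parts _ y0).
rewrite (spec_det _ PuC); have := yrel _ Bdet; rewrite /zmon => E; rewrite -[RHS]E.
by apply: eq_bigr => i _; rewrite mxE expr1z.
Qed.

Lemma torus_relM y z : torus_rel y -> torus_rel z -> torus_rel (had y z).
Proof.
move=> [y0 Hy] [z0 Hz]; split; first by move=> i; rewrite mxE mulf_neq0.
by move=> m mB; rewrite zmonM Hy // Hz // mulr1.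
Qed.

Lemma torus_rel_prod y : torus_rel y -> \prod_i y 0 i = 1.
Proof.
move=> [y0 /(_ _ Bdet) E]; rewrite -[RHS]E; apply: eq_bigr => i _.
by rewrite mxE expr1z.
Qed.

Lemma torus_group T : (forall x, Cpoints T x <-> exists2 y, torus_rel y & x = spec PC y) ->
  alg_subgroup_SL T.
Proof.
move=> HT; split; [split|].
- apply/HT; exists (const_mx 1); last by rewrite (spec1 PuC).
  by split=> [i|m _]; rewrite ?mxE ?oner_neq0 ?zmon_cst1.
- move=> x z /HT[y Hy ->] /HT[w Hw ->]; apply/HT; exists (had y w); first exact: torus_relM.
  by rewrite (specM _ _ PuC).
- move=> x /HT[y [y0 Hy] ->]; split; first exact: (spec_unit PuC).
  apply/HT; exists (map_mx (fun c => c^-1) y); last by rewrite (spec_inv PuC y0).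
  split=> [i|m mB]; first by rewrite mxE invr_eq0.
  have E : zmon m y * zmon m (map_mx (fun c => c^-1) y) = 1.
    by rewrite -zmonM -[RHS](zmon_cst1 _ m); congr zmon; apply/rowP => i; rewrite !mxE mulfV.
  by move: E; rewrite (Hy m mB) mul1r.
by move=> x /HT[y Hy ->]; rewrite /SL /= (spec_det _ PuC) torus_rel_prod.
Qed.

Definition torus_coord (t : 'rV[C]_r) : 'rV[C]_n := \row_i zmon (row i B) t.

Lemma torus_coord_rel t : nz t -> torus_rel (torus_coord t).
Proof.
move=> t0; split=> [i|m mB]; first by rewrite mxE zmon_neq0.
by rewrite -zmon_mulmx // mB zmon0.
Qed.

Definition torus_proj (y : 'rV[C]_n) : 'rV[C]_r := \row_j zmon (row j B') y.

Lemma torus_coordK t : nz t -> torus_proj (torus_coord t) = t.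
Proof.
move=> t0; apply/rowP => j; rewrite mxE -zmon_mulmx // -row_mul BB row1.
exact: zmon_delta.
Qed.

Lemma torus_projK y : torus_rel y -> torus_coord (torus_proj y) = y.
Proof.
move=> [y0 Hy]; apply/rowP => i; rewrite mxE -zmon_mulmx // -row_mul.
have E := iffLR (rel_project y0) Hy i.
rewrite -[LHS]mul1r -E -zmonD // -linearD /= subrK row1; exact: zmon_delta.
Qed.

Theorem diagonal_torus : exists T : seq (MPoly[K]_(n * n)),
  split_torus T /\ forall x, Cpoints T x <-> exists2 y, torus_rel y & x = spec PC y.
Proof.
have [T HT] := torus_points; exists T; split=> //; split; first exact: torus_group.
have /choice[f' Hf'] : forall ij : 'I_n * 'I_n, exists p : MPoly[K]_(r + r), forall v,
    evalp (toC K) p v = (toCm (invmx P) *m diag_mx (\row_i \prod_j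
      (v 0 (lshift r j) ^+ pospart (B i j) * v 0 (rshift r j) ^+ negpart (B i j))) *m PC) ij.1 ij.2.
  move=> [i j]; apply: kfun_conj => k l; case: (eqVneq k l) => [<-|kl].
    apply: kfun_ext (_ : kfun (toC K) (fun v : 'rV[C]_(r + r) => \prod_j
      (v 0 (lshift r j) ^+ pospart (B k j) * v 0 (rshift r j) ^+ negpart (B k j)))).
      by move=> v; rewrite !mxE eqxx mulr1n.
    by apply: kfun_prod => m; apply: kfunM; apply: kfunXn; apply: kfunX.
  apply: kfun_ext (kfunC (toC K) _ 0) => v.
  by rewrite rmorph0 [RHS]mxE (negPf kl) mulr0n.
(* On the torus the product of all coordinates is 1, so the inverse of a coordinate is the product
   of the others; this makes the inverse of the parametrization polynomial in the matrix entries. *)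
have /choice[p Hp] : forall j, exists p : MPoly[K]_(n * n), forall x,
    mxeval (toC K) p x = \prod_i (dcoord x 0 i ^+ pospart (B' j i) *
       (\prod_(k | k != i) dcoord x 0 k) ^+ negpart (B' j i)).
  move=> j; apply: (kfun_mxP (F := fun x => \prod_i (dcoord x 0 i ^+ pospart (B' j i) *
       (\prod_(k | k != i) dcoord x 0 k) ^+ negpart (B' j i)))).
  have Hd i : kfun (toC K) (fun v => dcoord (vec_mx v) 0 i).
    apply: kfun_ext (fun v => esym (dcoordE _ i)) _.
    by apply: kfun_conj => k l; exact: kfun_vecmx.
  by apply: kfun_prod => i; apply: kfunM; apply: kfunXn => //; apply: kfun_prod.
exists r, (\matrix_(i, j) f' (i, j)), p; move=> Gm phi psi.
have phiE t : Gm t -> phi t = spec PC (torus_coord t).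
  move=> t0; have cE : \row_i \prod_(j < r)
      (row_mx t (map_mx (fun c => c^-1) t) 0 (lshift r j) ^+ pospart (B i j) *
       row_mx t (map_mx (fun c => c^-1) t) 0 (rshift r j) ^+ negpart (B i j)) = torus_coord t.
    apply/rowP => k; rewrite [LHS]mxE [RHS]mxE /zmon.
    by apply: eq_bigr => l _; rewrite row_mxEl row_mxEr !mxE -exprz_parts.
  by apply/matrixP => i j; rewrite mxE mxE Hf' cE map_invmx.
have psiE y : torus_rel y -> psi (spec PC y) = torus_proj y.
  move=> Hy; apply/rowP => j; rewrite mxE Hp dcoord_spec mxE; apply: eq_bigr => i _.
  rewrite mxE exprz_parts; congr (_ * _ ^+ _).
  have := torus_rel_prod Hy; rewrite (bigD1 i) //= => E.
  by apply: (mulfI (Hy.1 i)); rewrite E mulfV //; exact: Hy.1.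
split.
- by move=> t t0; apply/HT; exists (torus_coord t); [exact: torus_coord_rel|exact: phiE].
- move=> t u t0 u0; have tu0 : Gm (had t u) by move=> i; rewrite mxE mulf_neq0.
  have -> : phi (\row_i (t 0 i * u 0 i)) = phi (had t u) by [].
  rewrite (phiE _ tu0) (phiE _ t0) (phiE _ u0) (specM _ _ PuC); congr (spec PC _); apply/rowP => i.
  by rewrite [LHS]mxE zmonM !mxE.
- by move=> t t0; rewrite phiE // psiE ?torus_coordK //; apply: torus_coord_rel.
move=> x /HT[y Hy ->]; rewrite psiE //.
have p0 : Gm (torus_proj y) by move=> j; rewrite mxE zmon_neq0 //; exact: Hy.1.
split; first exact: p0.
by rewrite (phiE _ p0) (torus_projK Hy); exact: erefl.
Qed.

End DiagonalTorus.

(** * Saturated sublattices of Z^n *)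

Section Lattice.
Variables (n : nat) (M : set 'rV[int]_n).
Hypotheses (M0 : M 0) (Mlin : forall c m m', M m -> M m' -> M (c *: m + m')).
Hypothesis Msat : forall c m, c != 0 -> M (c *: m) -> M m.
Local Notation toQ := (map_mx (intr : int -> rat)).

Lemma lattice_sum I (r : seq I) (F : I -> 'rV[int]_n) (c : I -> int) :
  (forall i, c i != 0 -> M (F i)) -> M (\sum_(i <- r) c i *: F i).
Proof.
move=> HF; elim/big_rec: _ => // i m _ Mm.
by have [->|ci] := eqVneq (c i) 0; rewrite ?scale0r ?add0r //; apply: Mlin => //; apply: HF.
Qed.

(** Among finite families in [M], one of maximal rank spans [M] over the rationals. *)
Lemma lattice_rank : exists k (N : 'M[int]_(k, n)), (forall i, M (row i N)) /\
  forall m, M m -> (toQ m <= toQ N)%MS.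
Proof.
pose Q r := exists k (N : 'M[int]_(k, n)), (forall i, M (row i N)) /\ \rank (toQ N) = r.
have exQ : exists r, `[< Q r >].
  by exists (\rank (toQ (0 : 'M[int]_(0, n)))); apply/asboolP; exists 0%N, 0; split=> // -[].
have bound r : `[< Q r >] -> (r <= n)%N by move=> /asboolP[k [N [_ <-]]]; apply: rank_leq_col.
case: (ex_maxnP exQ bound) => r /asboolP[k [N [MN rN]]] rmax; exists k, N; split=> // m Mm.
have Qr : `[< Q (\rank (toQ (col_mx N m))) >].
  apply/asboolP; exists (k + 1)%N, (col_mx N m); split=> // i.
  case: (split_ordP i) => j ->; first by rewrite rowKu.
  by rewrite rowKd; rewrite (_ : row j m = m) //; apply/rowP => l; rewrite !mxE ord1.
have := rmax _ Qr; rewrite -rN => le.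
have sub : (toQ N <= toQ (col_mx N m))%MS by rewrite map_col_mx -addsmxE addsmxSl.
have := mxrank_leqif_sup sub; move=> /geq_leqif; rewrite le => /esym sub'.
apply: submx_trans (_ : toQ m <= toQ (col_mx N m))%MS sub'.
by rewrite map_col_mx -addsmxE addsmxSr.
Qed.

(** In the Smith form [N = L D R] the rows of [R] are a basis of Z^n. Those facing a nonzero
    diagonal entry have a multiple in [M], hence lie in [M] by saturation; [B] records the
    coordinates along the rows outside [M]. *)
Theorem saturated_lattice : exists r (B : 'M[int]_(n, r)) (B' : 'M[int]_(r, n)),
  B' *m B = 1%:M /\ forall m, M m <-> m *m B = 0.
Proof.
have [k [N [MN HN]]] := lattice_rank.
have [L Lu [R Ru [d _ NE]]] := int_Smith_normal_form N.
set D := \matrix_(i, j) _ in NE.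
have MR j i : D i j != 0 -> M (row j R).
  rewrite mxE; have [ij|] := eqVneq (i : nat) j; last by rewrite mulr0n eqxx.
  rewrite mulr1n => di; apply: (Msat di).
  have -> : d`_i *: row j R = row i (D *m R).
    apply/rowP => l; rewrite !mxE (bigD1 j) //= !mxE ij eqxx mulr1n big1 ?addr0 // => h hj.
    by rewrite !mxE ij (_ : (j == h :> nat) = false) ?mulr0n ?mul0r //; apply/negbTE; rewrite eq_sym.
  have -> : D *m R = invmx L *m N by rewrite NE !mulmxA mulVmx // mul1mx.
  by rewrite row_mul mulmx_sum_row; apply: lattice_sum => h _; apply: MN.
pose J := [set j | `[< ~ M (row j R) >]]%SET.
pose C : 'M[int]_(n, #|J|) := \matrix_(i, k) (i == enum_val k)%:R.
have CC : C^T *m C = 1%:M.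
  apply/matrixP => x y; rewrite !mxE (bigD1 (enum_val x)) //= !mxE eqxx mul1r big1 ?addr0.
    by rewrite (inj_eq enum_val_inj).
  by move=> i ix; rewrite !mxE (negPf ix) mul0r.
exists #|J|, (invmx R *m C), (C^T *m R); split; first by rewrite !mulmxA mulmxK.
move=> m; have mC (c : 'rV[int]_n) y : (c *m C) 0 y = c 0 (enum_val y).
  rewrite mxE (bigD1 (enum_val y)) //= mxE eqxx mulr1 big1 ?addr0 // => i iy.
  by rewrite mxE (negPf iy) mulr0.
have [c cE mE] : exists2 c, c = m *m invmx R & m = c *m R.
  by exists (m *m invmx R); rewrite ?mulmxKV.
have RR : toQ R *m toQ (invmx R) = 1%:M by rewrite -map_mxM mulmxV // map_mx1.
rewrite mulmxA -cE; split=> [Mm|cC].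
  apply/rowP => y; rewrite mC [RHS]mxE; have := enum_valP y; rewrite inE => /asboolP nM.
  have D0 i : D i (enum_val y) = 0 by apply/eqP; apply: contrapT => /negP/MR.
  have /submxP[X HX] := HN m Mm.
  apply/eqP; rewrite -(intr_eq0 rat); apply/eqP.
  have cQ : toQ c = X *m toQ L *m toQ D.
    have := congr1 (fun Z => Z *m toQ (invmx R)) HX.
    by rewrite {1}mE NE !map_mxM -!mulmxA RR !mulmx1.
  have := congr1 (fun Z : 'rV[rat]_n => Z 0 (enum_val y)) cQ; rewrite mxE => ->.
  by rewrite mxE big1 // => i _; rewrite [toQ D _ _]mxE D0 mulr0.
rewrite mE mulmx_sum_row; apply: lattice_sum => j cj.
apply: contrapT => nM; have jJ : j \in J by rewrite inE; apply/asboolP.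
move: cj; rewrite -(enum_rankK_in jJ jJ) -mC cC mxE eqxx //.
Qed.

End Lattice.

(** * Positive elements commuting with a regular element of [A] *)

Section MaximalTorus.
Variables (K : rcfType) (n : nat).
Local Notation C := (K[i]%C).
Local Notation toCm := (map_mx (toC K)).

(** Vectors with positive entries are Zariski dense in the torus over [K[i]]: by [monoid_closure] it
    is enough that Laurent monomials equal on them are equal everywhere. *)
Lemma laurent_vanish r (F : 'rV[C]_(r + r) -> C) : polyfun F ->
  (forall t : 'rV[K]_r, (forall i, 0 < t 0 i) ->
     F (row_mx (toCm t) (map_mx (fun c => c^-1) (toCm t))) = 0) ->
  forall t : 'rV[C]_r, nz t -> F (row_mx t (map_mx (fun c => c^-1) t)) = 0.
Proof.
move=> [Q HQ] HF t t0; rewrite -HQ.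
pose G := [set y : 'rV[C]_(r + r) | exists2 t : 'rV[K]_r, (forall i, 0 < t 0 i) &
  y = row_mx (toCm t) (map_mx (fun c => c^-1) (toCm t))].
have monE (m : multinom (r + r)) (u : 'rV[C]_r) : mon m (row_mx u (map_mx (fun c => c^-1) u)) =
    \prod_i (u 0 i ^+ m (lshift r i) * (u 0 i)^-1 ^+ m (rshift r i)).
  rewrite /mon big_split_ord big_split /=; congr (_ * _); apply: eq_bigr => i _.
    by rewrite row_mxEl.
  by rewrite row_mxEr mxE.
apply: (@monoid_closure _ _ G).
- exists (const_mx 1); first by move=> i; rewrite mxE.
  by apply/rowP => i; case: (split_ordP i) => j ->; rewrite ?row_mxEl ?row_mxEr !mxE ?rmorph1 ?invr1.
- move=> y z [u u0 ->] [w w0 ->]; exists (had u w); first by move=> i; rewrite mxE mulr_gt0.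
  apply/rowP => i; rewrite mxE; case: (split_ordP i) => j ->; rewrite ?row_mxEl ?row_mxEr !mxE rmorphM //.
  by rewrite invfM.
- by move=> y [u u0 ->]; rewrite HQ HF.
move=> m m' H; rewrite !monE; apply: eq_bigr => i _.
(* Evaluation at the vector with 2 at place [i] and 1 elsewhere reads off the exponent at [i], as
   the powers of 2 are distinct. *)
have pr (k : multinom (r + r)) : \prod_j (toCm (\row_j (if j == i then 2 else 1)) 0 j ^+ k (lshift r j) *
    (toCm (\row_j (if j == i then 2 else 1)) 0 j)^-1 ^+ k (rshift r j)) =
    toC K (2 ^+ k (lshift r i) / 2 ^+ k (rshift r i)).
  rewrite (bigD1 i) //= !mxE eqxx big1 => [|j ji]; last first.
    by rewrite !mxE (negPf ji) rmorph1 invr1 !expr1n mulr1.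
  by rewrite mulr1 -exprVn rmorphM !rmorphXn /= fmorphV.
have GG : G (row_mx (toCm (\row_j (if j == i then 2 else 1)))
  (map_mx (fun c => c^-1) (toCm (\row_j (if j == i then 2 else 1))))).
  by exists (\row_j (if j == i then 2 else 1)) => // j; rewrite mxE; case: ifP.
have := H _ GG; rewrite !monE !pr => /complexI E.
have two0 k : 2 ^+ k != 0 :> K by rewrite expf_neq0 // pnatr_eq0.
have {}E : 2 ^+ (m (lshift r i) + m' (rshift r i)) = 2 ^+ (m' (lshift r i) + m (rshift r i)) :> K.
  rewrite !exprD; move: E => /(congr1 (fun x => x * (2 ^+ m (rshift r i) * 2 ^+ m' (rshift r i)))).
  by rewrite mulrA mulfVK // => ->; rewrite [X in _ * X]mulrC mulrA mulfVK.
have {}E : (m (lshift r i) + m' (rshift r i) = m' (lshift r i) + m (rshift r i))%N.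
  by apply: (ieexprIn _ _ E); rewrite ?ltr0n // pnatr_eq1.
have u0 := t0 i; have un k : t 0 i ^+ k != 0 by rewrite expf_neq0.
apply: (mulIf (un (m (rshift r i)))); apply: (mulIf (un (m' (rshift r i)))).
rewrite !exprVn mulfVK // -exprD E exprD -!mulrA; congr (_ * _).
by rewrite mulrCA mulVf ?mulr1.
Qed.

Lemma zmon_row_exp (L : fieldType) (m : 'rV[int]_n) (y : 'rV[L]_n) k :
  zmon m (row_exp y k) = zmon m y ^+ k.
Proof.
elim: k => [|k IH].
  by rewrite expr0 -[RHS](zmon_cst1 _ m); congr zmon; apply/rowP => i; rewrite !mxE.
by rewrite exprS -IH -zmonM; congr zmon; apply/rowP => i; rewrite !mxE exprS.
Qed.

Lemma zmon_gt0 (m : 'rV[int]_n) (d : 'rV[K]_n) : (forall i, 0 < d 0 i) -> 0 < zmon m d.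
Proof. by move=> d0; apply: prodr_gt0 => i _; rewrite exprz_gt0. Qed.

Lemma exprz_natabs (L : fieldType) (x : L) (c : int) : x ^ c = 1 -> x ^+ `|c|%N = 1.
Proof.
case: c => k // H; have : (x ^+ k.+1)^-1 = 1 by exact: H.
by move=> /(congr1 (fun y => y^-1)); rewrite invrK invr1.
Qed.

Variables (G S : seq (MPoly[K]_(n * n))) (A : sa_formula K n).
Hypotheses (hG : alg_subgroup_SL G) (hS : maximal_split_torus G S).
Hypothesis hSsym : forall s, Cpoints S s -> s = s^T.
Hypothesis AE : sa_ext idfun A = sqset (points idfun S).

(** The coordinates of a point have roots in the algebraically closed field [K[i]]; this
    divisibility makes the lattice of relations saturated. *)
Lemma torus_root s N : (0 < N)%N -> Cpoints S s -> exists2 w, Cpoints S w & s = iter N (mulmx w) 1%:M.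
Proof.
move=> N0 Ss; case: hS => hSt _ _.
have [r [f [p [H1 H2 H3 H4]]]] := torus_paramC_inv hSt.
have [psi0 <-] := H4 _ Ss; set t := \row_i _.
have t0 : nz t by move=> i; rewrite mxE.
clearbody t; pose u : 'rV[C]_r := \row_i N.-root (t 0 i).
have u0 : nz u by move=> i; rewrite mxE rootC_eq0 //; apply: t0.
exists (torus_paramC f u); first exact: H1.
have -> : t = row_exp u N by apply/rowP => i; rewrite !mxE rootCK.
have ue k : nz (row_exp u k) by move=> i; rewrite mxE expf_neq0 //; apply: u0.
have one : torus_paramC f (const_mx 1) = 1%:M.
  have c0 : nz (const_mx 1 : 'rV[C]_r) by move=> i; rewrite mxE oner_neq0.
  have := H2 _ _ c0 c0; have -> : had (const_mx 1) (const_mx 1) = const_mx 1 :> 'rV[C]_r.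
    by apply/rowP => i; rewrite !mxE mulr1.
  have [[_ _ SV] _] := hSt.1; have [xu _] := SV _ (H1 _ c0).
  by move=> /(congr1 (mulmx (invmx (torus_paramC f (const_mx 1))))); rewrite mulKmx // mulVmx.
suff : forall k, torus_paramC f (row_exp u k) = iter k (mulmx (torus_paramC f u)) 1%:M by apply.
elim=> [|k IH] /=.
  by rewrite -one; congr torus_paramC; apply/rowP => i; rewrite !mxE.
rewrite -IH -(H2 _ _ u0 (ue k)); congr torus_paramC.
by apply/rowP => i; rewrite !mxE exprS.
Qed.

Section Diagonal.
Variables (P : 'M[K]_n).
Hypothesis Pu : P \in unitmx.
Hypothesis AP : forall s, sa_ext idfun A s -> exists y, s = spec P y.
Local Notation PC := (toCm P).

Let PCu : PC \in unitmx.
Proof. by rewrite map_unitmx. Qed.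

(** [AP] speaks only of [A]. An off-diagonal entry is a Laurent polynomial in the torus coordinates,
    zero where these are positive because such points are squares; [laurent_vanish] extends this to
    all points over [K[i]]. *)
Lemma torus_diag s : Cpoints S s -> exists2 y, nz y & s = spec PC y.
Proof.
move=> Ss; case: hS => hSt _ _; have [[_ _ SV] _] := hSt.1.
have [su _] := SV _ Ss.
suff offd i j : i != j -> (PC *m s *m toCm (invmx P)) i j = 0.
  have sE : s = spec PC (dcoord P s).
    have e : PC *m s *m toCm (invmx P) = diag_mx (dcoord P s).
      apply/matrixP => i j; rewrite [RHS]mxE; have [->|ij] := eqVneq i j.
        by rewrite mulr1n dcoordE.
      by rewrite mulr0n offd.
    rewrite /spec -e map_invmx; move: (toCm P) PCu => Q Qu.
    by rewrite !mulmxA (mulVmx Qu) mul1mx (mulmxKV Qu).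
  exists (dcoord P s) => // i.
  move: su; rewrite unitmxE {1}sE (spec_det _ PCu) unitfE => /prodf_neq0; exact.
move=> ij; have [r [f [p [H1 H2 H3 H4]]]] := torus_paramC_inv hSt.
have [psi0 <-] := H4 _ Ss.
pose F (v : 'rV[C]_(r + r)) := (PC *m (\matrix_(k, l) evalp (toC K) (f k l) v) *m toCm (invmx P)) i j.
have PF : polyfun F.
  apply: polyfun_ext (fun v => esym (mxE _ _ _ _)) _; apply: polyfun_sum => k.
  apply: polyfunM; last exact: polyfunC.
  apply: polyfun_ext (fun v => esym (mxE _ _ _ _)) _; apply: polyfun_sum => l.
  apply: polyfunM; first exact: polyfunC.
  apply: polyfun_ext (fun v => esym (mxE _ _ _ _)) _.
  by apply: polyfun_evalp => m; exact: polyfunX.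
apply: (laurent_vanish PF); last by move=> k; rewrite mxE.
move=> t t0; pose u := map_mx Num.sqrt t.
have u0 : nz (toCm u) by move=> k; rewrite !mxE fmorph_eq0 gt_eqF // sqrtr_gt0.
have tE : toCm t = had (toCm u) (toCm u).
  by rewrite -map_had; congr (toCm _); apply/rowP => k; rewrite !mxE -expr2 sqr_sqrtr // ltW.
have Au : sa_ext idfun A (torus_param f idfun t).
  rewrite AE; exists (torus_param f idfun u).
    by apply/points_KC; rewrite -torus_param_toC; apply: H1.
  by apply: (@toCm_inj K); rewrite map_mxM -!torus_param_toC tE; apply: H2.
have [y yE] := AP Au.
rewrite /F -/(torus_paramC f (toCm t)) torus_param_toC yE map_spec map_invmx.
move: (toCm P) PCu => Q Qu; rewrite /spec !mulmxA (mulmxV Qu) mul1mx (mulmxK Qu) mxE (negPf ij).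
by rewrite mulr0n.
Qed.

Variable (d : 'rV[K]_n).
Hypotheses (d0 : forall i, 0 < d 0 i) (Gd : points idfun G (spec P d)).

Definition rel_lattice : set 'rV[int]_n :=
  [set m | (forall z, Cpoints S (spec PC z) -> zmon m z = 1) /\ zmon m d = 1].

Let S_nz z : Cpoints S (spec PC z) -> nz z.
Proof.
move=> /torus_diag[y y0 E]; suff -> : z = y by [].
by rewrite -(dcoord_spec Pu z) E (dcoord_spec Pu).
Qed.

Let d_nz : nz d.
Proof. by move=> i; rewrite gt_eqF. Qed.

Lemma rel_lattice_lin c m m' : rel_lattice m -> rel_lattice m' -> rel_lattice (c *: m + m').
Proof.
move=> [H1 H2] [H1' H2']; split=> [z Sz|]; rewrite zmonD ?zmonZ.
- by rewrite H1 // H1' // exp1rz mulr1.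
- exact: S_nz.
- by rewrite H2 H2' exp1rz mulr1.
exact: d_nz.
Qed.

(** For [S] by the divisibility of [torus_root]; for [d] because a positive root of unity in [K]
    equals 1. *)
Lemma rel_lattice_sat c m : c != 0 -> rel_lattice (c *: m) -> rel_lattice m.
Proof.
move=> c0 [H1 H2]; have N0 : (0 < `|c|)%N by rewrite absz_gt0.
split=> [z Sz|]; last first.
  move: H2; rewrite zmonZ => /exprz_natabs /eqP; rewrite pexpr_eq1 //; last first.
    by rewrite ltW // zmon_gt0.
  by move/eqP.
have [w Sw zE] := torus_root N0 Sz; have [y _ wE] := torus_diag Sw.
move: zE; rewrite wE -(spec_row_exp _ _ PCu) => /(spec_inj PCu) ->;
  rewrite zmon_row_exp; apply: exprz_natabs.
by rewrite wE in Sw; have := H1 _ Sw; rewrite zmonZ.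
Qed.

Lemma mon_rel (L : fieldType) (m m' : multinom n) (y : 'rV[L]_n) : nz y ->
  mon m y = mon m' y <-> zmon (\row_i (m i)%:Z - \row_i (m' i)%:Z) y = 1.
Proof.
move=> y0; have e := zmonD (\row_i (m i)%:Z - \row_i (m' i)%:Z) (\row_i (m' i)%:Z) y0.
rewrite subrK in e; rewrite !mon_zmon e; split=> [|->]; last by rewrite mul1r.
by rewrite -[RHS]mul1r => /(mulIf (zmon_neq0 _ y0)).
Qed.

(** The torus [T] defined by the relations common to [S] and [d] contains [S], lies in [G] and is
    split over [K], so it equals [S]. A relation on the positive vector [d] also holds for its
    square root, which therefore lies in [T] too. *)
Lemma spec_in_torus : exists2 w, points idfun S w & spec P d = w *m w.
Proof.
case: (hS) => hSt hSG hmax.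
have M0 : rel_lattice 0 by split=> [z _|]; rewrite zmon0.
have [r [B [B' [BB HB]]]] := saturated_lattice M0 rel_lattice_lin rel_lattice_sat.
have prod1 (L : fieldType) (z : 'rV[L]_n) : zmon (const_mx 1) z = \prod_i z 0 i.
  by apply: eq_bigr => i _; rewrite mxE expr1z.
have Bdet : const_mx 1 *m B = 0 :> 'rV[int]_r.
  apply/HB; split=> [z Sz|]; rewrite prod1.
    by rewrite -(spec_det _ PCu); have [_] := hSt.1; apply.
  by rewrite -(spec_det _ Pu); have [_] := points_group idfun hG; apply.
have [T [hT TE]] := diagonal_torus Pu BB Bdet.
have TS : Cpoints T = Cpoints S.
  apply: hmax => // x.
    move=> /TE[y [y0 Hy] ->].
    (* The monoid generated by [S] and [spec P d]: it lies in [G], and the elements of [T] satisfy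
       its equalities of monomials, so they belong to its Zariski closure. *)
    pose Gm := [set y : 'rV[C]_n | exists z k, Cpoints S (spec PC z) /\ y = had z (row_exp (toCm d) k)].
    have [[S1 SM _] _] := hSt.1; have [[C1 CM _] _] := hG.
    have S1' : Cpoints S (spec PC (const_mx 1)) by rewrite (spec1 PCu).
    have nzd k : nz (row_exp (toCm d) k).
      by move=> i; rewrite !mxE expf_neq0 // fmorph_eq0; exact: d_nz.
    rewrite /Cpoints points_zeros; apply: (zeros_monoid_closure (G := Gm)).
    - exists (const_mx 1), 0%N; split=> //.
      by apply/rowP => i; rewrite !mxE mulr1.
    - move=> u v [z [k [Sz ->]]] [z' [k' [Sz' ->]]]; exists (had z z'), (k + k')%N; split.
        by have := SM _ _ Sz Sz'; rewrite (specM _ _ PCu).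
      by apply/rowP => i; rewrite !mxE exprD mulrACA.
    - move=> u [z [k [Sz ->]]]; apply: (_ : Cpoints G _).
      rewrite -/(spec _ _) -(specM _ _ PCu); apply: (CM); first exact: hSG.
      rewrite (spec_row_exp _ _ PCu) -map_spec; elim: k => [|k IH] //=.
      by apply: (CM) => //; apply/points_KC.
    move=> m m' Hm; apply/(mon_rel _ _ y0); apply: Hy; apply/HB; split=> [z Sz|].
      apply/(mon_rel _ _ (S_nz Sz)); apply: Hm; exists z, 0%N; split=> //.
      by apply/rowP => i; rewrite !mxE mulr1.
    apply/(mon_rel _ _ d_nz); apply: (@complexI K).
    have := Hm (toCm d); rewrite /= !mon_zmon !zmon_map; apply.
    exists (const_mx 1), 1%N; split=> //.
    by apply/rowP => i; rewrite !mxE mul1r.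
  move=> Sx; have [y y0 E] := torus_diag Sx; apply/TE; exists y => //.
  by split=> // m /HB[H _]; apply: H; rewrite -E.
exists (spec P (map_mx Num.sqrt d)).
  apply/points_KC; rewrite -/(Cpoints S _) -TS map_spec; apply/TE.
  exists (toCm (map_mx Num.sqrt d)) => //; split=> [i|m /HB[_ H]].
    by rewrite !mxE fmorph_eq0 gt_eqF // sqrtr_gt0.
  rewrite zmon_map; apply/eqP; rewrite fmorph_eq1; apply/eqP.
  have s0 : 0 < zmon m (map_mx Num.sqrt d) by apply: zmon_gt0 => i; rewrite mxE sqrtr_gt0.
  apply/eqP; rewrite -(pexpr_eq1 (n := 2)) // ?ltW // expr2 -zmonM.
  apply/eqP; rewrite -[RHS]H; congr zmon; apply/rowP => i.
  by rewrite !mxE -expr2 sqr_sqrtr // ltW.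
rewrite specM //; congr spec; apply/rowP => i; rewrite !mxE -expr2 sqr_sqrtr //.
exact: ltW.
Qed.

End Diagonal.

Lemma diag_of_comm (P q s : 'M[K]_n) e : P \in unitmx -> q = spec P e ->
  (forall x, x *m q = q *m x -> x *m s = s *m x) -> exists y, s = spec P y.
Proof.
move=> Pu qE H; exists (\row_i (P *m s *m invmx P) i i).
(* The test matrix has the distinct eigenvalues 0, ..., n - 1 in the eigenbasis of [q]; whatever
   commutes with it is diagonal there. *)
have := H (spec P (\row_i (i%:R))); rewrite qE !specM // => H'.
have {H'} /H' : spec P (had (\row_i i%:R) e) = spec P (had e (\row_i i%:R)).
  by congr spec; apply/rowP => i; rewrite !mxE mulrC.
have sE : s = invmx P *m (P *m s *m invmx P) *m P.
  by rewrite !mulmxA mulVmx // mul1mx mulmxKV.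
rewrite {1 2}sE; move: (P *m s *m invmx P) sE => y -> E.
rewrite /spec; congr (_ *m _ *m _); apply/matrixP => i j.
have {}E : diag_mx (\row_i i%:R) *m y = y *m diag_mx (\row_i i%:R).
  have := congr1 (fun X => P *m X *m invmx P) E; rewrite /spec !mulmxA mulmxV // !mul1mx.
  by rewrite !mulmxK // !mulmxA !mulmxK.
have := congr1 (fun X : 'M[K]_n => X i j) E; rewrite mul_diag_mx mul_mx_diag !mxE mulrC => /eqP.
rewrite -subr_eq0 -mulrBr mulf_eq0 subr_eq0 eqr_nat => /orP[yij|/eqP/val_inj->]; last first.
  by rewrite eqxx mulr1n.
have [ij|_] := eqVneq i j; first by rewrite ij mulr1n.
by rewrite mulr0n (eqP yij).
Qed.

(** A common eigenbasis of [h] and [q] diagonalizes [A] as well, by [diag_of_comm], even where [q]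
    has repeated eigenvalues. *)
Theorem central_pd_in_A q h : q^T = q ->
  (forall x, x *m q = q *m x -> forall s, sa_ext idfun A s -> x *m s = s *m x) ->
  points idfun G h -> rpd h -> h *m q = q *m h -> sa_ext idfun A h.
Proof.
move=> sq Hq Gh [sh [P0 [d0 [P0u d00 hE]]]] hq.
have [||P Pu HP] := @codiag_seq K n [:: h; q].
- move=> X; rewrite !inE => /orP[]/eqP->; exact: real_spectral.
- by move=> X Y; rewrite !inE => /orP[]/eqP-> /orP[]/eqP->.
have [d hd] := HP _ (mem_head _ _).
have [|e qe] := HP q; first by rewrite !inE eqxx orbT.
have dpos i : 0 < d 0 i.
  by have [j ->] := spec_eigen P0u Pu (etrans (esym hE) hd) i.
have AP s : sa_ext idfun A s -> exists y, s = spec P y.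
  by move=> As; apply: (diag_of_comm Pu qe) => x xq; apply: Hq.
have [|w Sw hw] := spec_in_torus Pu AP dpos; first by rewrite -hd.
by rewrite AE hd; exists w.
Qed.

End MaximalTorus.

(** * The Cartan decomposition *)

Section Polar.
Variables (E : rcfType) (n : nat).
Implicit Types y u z q h : 'M[E]_n.

Lemma mxtrace_mulmxtr_ge0 z : 0 <= \tr (z *m z^T).
Proof. by apply: sumr_ge0 => i _; apply: mulmxtr_diag_ge0. Qed.

(* The trace of y - y u is half the squared norm of (1 - u) times the square root of y. *)
Lemma tr_polar y u : rpd y -> u *m u^T = 1%:M ->
  \tr (y *m u) <= \tr y /\ (\tr y <= \tr (y *m u) -> u = 1%:M).
Proof.
move=> ry uu; have [z [rz zz _]] := rpd_sqrt ry; have zu := rpd_unit rz.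
have E1 : \tr ((z - u *m z) *m (z - u *m z)^T) = 2 * (\tr y - \tr (y *m u)).
  rewrite [(z - _)^T]raddfB /= trmx_mul rz.1 mulmxBl !mulmxBr (mxtraceB _ _) (mxtraceB _ _) (mxtraceB _ _) zz.
  have -> : \tr (z *m (z *m u^T)) = \tr (y *m u).
    by rewrite mulmxA zz -mxtrace_tr trmx_mul trmxK ry.1 mxtrace_mulC.
  have -> : \tr (u *m z *m z) = \tr (y *m u) by rewrite -mulmxA zz mxtrace_mulC.
  have -> : \tr (u *m z *m (z *m u^T)) = \tr y.
    by rewrite !mulmxA -(mulmxA u) zz mxtrace_mulC mulmxA (mulmx1C uu) mul1mx.
  by ring.
split; first by have := mxtrace_mulmxtr_ge0 (z - u *m z); rewrite E1; lra.
move=> le; have [W0|W0] := eqVneq (z - u *m z) 0; last first.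
  by exfalso; have := mxtrace_mulmxtr W0; rewrite E1; lra.
have uz : z = u *m z by apply/eqP; rewrite -subr_eq0 W0.
by rewrite -[u]mulmx1 -(mulmxV zu) mulmxA -uz mulmxV.
Qed.

Lemma rpd_mul y z : rpd y -> rpd z -> y *m z = z *m y -> rpd (y *m z).
Proof.
move=> ry rz yz; have [p [rp pp pc]] := rpd_sqrt ry; have [q [rq qq qc]] := rpd_sqrt rz.
have pz : z *m p = p *m z by apply: pc.
have pq : p *m q = q *m p by apply: qc.
have -> : y *m z = (p *m q) *m (p *m q)^T.
  by rewrite trmx_mul rp.1 rq.1 !mulmxA -(mulmxA p) qq -mulmxA pz mulmxA pp.
by apply: rpd_mulmxtr; rewrite unitmx_mul !rpd_unit.
Qed.

Lemma rpd_comm_sqr q h : rpd q -> h *m (q *m q) = (q *m q) *m h -> h *m q = q *m h.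
Proof.
move=> rq H; have rqq : rpd (q *m q) by apply: rpd_mul.
have [p [rp pp pc]] := rpd_sqrt rqq.
have pq : p = q by apply: rpd_sqr_inj.
by rewrite -pq; exact: pc.
Qed.

(** Symmetry of the two products gives [h q^2 = q h^T q = q^2 h], and [q] is a function of [q^2]. *)
Lemma rpd_of_products q h : rpd q -> rpd (h *m q) -> rpd (q *m h) -> rpd h /\ h *m q = q *m h.
Proof.
move=> rq rhq rqh.
have e1 : q *m h^T = h *m q by have := rhq.1; rewrite trmx_mul rq.1.
have e2 : h^T *m q = q *m h by have := rqh.1; rewrite trmx_mul rq.1.
have hq : h *m q = q *m h.
  apply: rpd_comm_sqr => //.
  by rewrite mulmxA -e1 -mulmxA e2 mulmxA.
split=> //; have -> : h = (h *m q) *m invmx q by rewrite mulmxK ?rpd_unit.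
apply: rpd_mul => //; first exact: rpd_inv.
have qu := rpd_unit rq.
by rewrite mulmxK // hq mulKmx.
Qed.

End Polar.

Section PolarGroup.
Variables (K E : rcfType) (f : {rmorphism K -> E}) (n : nat) (G : seq (MPoly[K]_(n * n))).
Hypotheses (hG : alg_subgroup_SL G) (hGT : self_adjoint G).
Local Notation GE := (points f G).

Lemma points_rpd_sqrt M : GE M -> rpd M -> exists B, [/\ rpd B, GE B & B *m B = M].
Proof.
move=> GM rM; have [sM [P [d [Pu d0 ME]]]] := rM; rewrite ME in sM GM *.
exists (spec P (map_mx Num.sqrt d)); split.
- by apply: rpd_fun => // i; rewrite sqrtr_gt0.
- apply: (points_spec_fun (D := [set x | 0 < x])) => //=.
  + by have [] := points_group f hG.
  + by move=> x y x0 y0; rewrite mulr_gt0.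
  + exact: sqrtr1.
  + by move=> x y x0 y0; rewrite sqrtrM // ltW.
rewrite specM //; congr spec; apply/rowP => i; rewrite !mxE -expr2 sqr_sqrtr //.
exact: ltW.
Qed.

Lemma points_polar M : GE M -> exists y u, [/\ rpd y, GE y, GE u, u *m u^T = 1%:M & M = y *m u].
Proof.
move=> GM; have [[_ GMul GV] _] := points_group f hG.
have [Mu _] := GV _ GM.
have [|y [ry Gy yy]] := @points_rpd_sqrt (M *m M^T) _ (rpd_mulmxtr Mu).
  by apply: (GMul) => //; apply: points_tr.
have yu := rpd_unit ry; have [_ Gyi] := GV _ Gy.
exists y, (invmx y *m M); split=> //; first exact: GMul.
  rewrite trmx_mul trmx_inv ry.1 mulmxA -(mulmxA (invmx y)) -yy.
  by rewrite !mulmxA mulVmx // mul1mx mulmxV.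
by rewrite mulmxA mulmxV // mul1mx.
Qed.

(** In the polar form [M = y u], the orthogonal factor [u^T] raises the trace to that of [y]; by the
    equality case of [tr_polar] a maximum has [u = 1]. *)
Lemma rpd_of_max M : GE M ->
  (forall k, GE k -> k *m k^T = 1%:M -> \tr (k *m M) <= \tr M) -> rpd M.
Proof.
move=> GM Hmax; have [y [u [ry Gy Gu uu ME]]] := points_polar GM.
have := Hmax u^T (points_tr hGT Gu); rewrite trmxK (mulmx1C uu) => /(_ erefl).
rewrite {1}ME mxtrace_mulC -mulmxA uu mulmx1 ME => /(tr_polar ry uu).2 ->.
by rewrite mulmx1.
Qed.

End PolarGroup.

(** * Maximizing the trace over a double coset *)

Section Compactness.
Variables (K : rcfType) (R : realType) (iotaR : {rmorphism K -> R}) (n : nat).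
Variables (G : seq (MPoly[K]_(n * n))).
Hypotheses (hG : alg_subgroup_SL G) (hGT : self_adjoint G).
Local Notation GR := (points iotaR G).
Let KR : set 'M[R]_n := [set k | GR k /\ k *m k^T = 1%:M].

Lemma orth_entry (E : rcfType) (k : 'M[E]_n) i j : k *m k^T = 1%:M -> `|k i j| <= 1.
Proof.
move=> /matrixP/(_ i i); rewrite !mxE eqxx => /= E1.
rewrite -(@ler_pXn2r _ 2) ?nnegrE // expr1n real_normK ?num_real //.
rewrite -[X in _ <= X]E1 (bigD1 j) //= mxE -expr2 lerDl; apply: sumr_ge0 => l _.
by rewrite mxE -expr2 sqr_ge0.
Qed.

Lemma closed_zeros (T : topologicalType) I (D : set I) (F : I -> T -> R) :
  (forall i, continuous (F i)) -> closed [set x | forall i, D i -> F i x = 0].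
Proof.
move=> Fc x clx i Di.
have cl : closed [set x | F i x = 0].
  apply: (@closed_comp _ _ (F i) [set 0]); first by move=> y _; apply: Fc.
  exact: closed_eq.
by apply: cl; apply: closure_subset clx => y /= H; apply: H.
Qed.

Lemma compact_orth : compact [set v : 'rV[R]_(n * n) | KR (vec_mx v)].
Proof.
have vc i j : continuous (fun v : 'rV[R]_(n * n) => vec_mx v i j).
  by move=> v; under eq_fun do rewrite mxE; exact: coord_continuous.
have cl1 : closed [set v : 'rV[R]_(n * n) | forall p, p \in G -> mxeval iotaR p (vec_mx v) = 0].
  by apply: closed_zeros => p; apply: continuous_mxeval_comp.
have cl2 : closed [set v : 'rV[R]_(n * n) | forall ij : 'I_n * 'I_n, setT ij ->
    (\sum_k vec_mx v ij.1 k * vec_mx v ij.2 k) - (ij.1 == ij.2)%:R = 0].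
  apply: closed_zeros => ij.
  have C : continuous (fun v : 'rV[R]_(n * n) => \sum_k vec_mx v ij.1 k * vec_mx v ij.2 k).
    by apply: continuous_sumr => k w; exact: (cvgM (vc _ _ w) (vc _ _ w)).
  by move=> v; apply: (cvgB (C v)); apply: cvg_cst.
have cub : compact [set v : 'rV[R]_(n * n) | forall i, `[-1, 1]%classic (v ord0 i)].
  by apply: (@rV_compact R _ (fun _ => `[-1, 1]%classic)) => i; exact: segment_compact.
apply: (subclosed_compact _ cub); last first.
  move=> v [_ vv] i /=; case/mxvec_indexP: i => i j.
  have := orth_entry i j vv; rewrite mxE ler_norml => H; rewrite in_itv /=.
  by move: H.
have -> : [set v : 'rV[R]_(n * n) | KR (vec_mx v)] =
   [set v : 'rV[R]_(n * n) | forall p, p \in G -> mxeval iotaR p (vec_mx v) = 0] `&`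
   [set v : 'rV[R]_(n * n) | forall ij : 'I_n * 'I_n, setT ij ->
    (\sum_k vec_mx v ij.1 k * vec_mx v ij.2 k) - (ij.1 == ij.2)%:R = 0].
  apply/seteqP; split=> v [H1 H2]; split=> //.
    move=> [i j] _; move/matrixP/(_ i j): H2; rewrite mxE [RHS]mxE => <-.
    by apply/eqP; rewrite subr_eq0; apply/eqP; apply: eq_bigr => k _; rewrite [(vec_mx v)^T k j]mxE.
  apply/matrixP => i j; rewrite mxE [RHS]mxE; have := H2 (i, j) I => /eqP; rewrite subr_eq0 => /eqP <-.
  by apply: eq_bigr => k _; rewrite [(vec_mx v)^T k j]mxE.
exact: closedI.
Qed.

Lemma max_double_coset g q : exists k l, [/\ KR k, KR l & forall k' l', KR k' -> KR l' ->
  \tr (k' *m g *m l' *m q) <= \tr (k *m g *m l *m q)].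
Proof.
have [[G1 _ _] _] := points_group iotaR hG.
pose KK := [set v : 'rV[R]_(n * n) | KR (vec_mx v)].
pose F (p : 'rV[R]_(n * n) * 'rV[R]_(n * n)) := \tr (vec_mx p.1 *m g *m vec_mx p.2 *m q).
have FE p : F p = \sum_i \sum_j (\sum_k (\sum_l vec_mx p.1 i l * g l k) * vec_mx p.2 k j) * q j i.
  rewrite /F /mxtrace; apply: eq_bigr => i _; rewrite mxE; apply: eq_bigr => j _.
  by congr (_ * _); rewrite mxE; apply: eq_bigr => k _; congr (_ * _); rewrite mxE.
have vc i j : continuous (fun v : 'rV[R]_(n * n) => vec_mx v i j).
  by move=> v; under eq_fun do rewrite mxE; exact: coord_continuous.
have Fc : continuous F.
  rewrite (_ : F = fun p => \sum_i \sum_j (\sum_k (\sum_l vec_mx p.1 i l * g l k) * vec_mx p.2 k j) * q j i); last exact/funext.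
  apply: continuous_sumr => i; apply: continuous_sumr => j p.
  apply: cvgM; last exact: cvg_cst.
  apply: (@continuous_sumr R _ _ _ (fun k (p : 'rV[R]_(n * n) * 'rV[R]_(n * n)) =>
     (\sum_l vec_mx p.1 i l * g l k) * vec_mx p.2 k j)) => k p'; apply: cvgM; last first.
    apply: (@continuous_comp _ _ _ snd (fun v : 'rV[R]_(n * n) => vec_mx v k j)); last exact: vc.
    exact: cvg_snd.
  apply: (@continuous_sumr R _ _ _ (fun l (p : 'rV[R]_(n * n) * 'rV[R]_(n * n)) => vec_mx p.1 i l * g l k)) => l p''.
  apply: cvgM; last exact: cvg_cst.
  apply: (@continuous_comp _ _ _ fst (fun v : 'rV[R]_(n * n) => vec_mx v i l)); last exact: vc.
  exact: cvg_fst.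
have K1 : KK (mxvec 1%:M) by rewrite /KK /= mxvecK; split=> //; rewrite trmx1 mulmx1.
have ne : KK `*` KK !=set0 by exists (mxvec 1%:M, mxvec 1%:M).
have cKK : compact (KK `*` KK) by apply: compact_setX; exact: compact_orth.
have [|[c1 c2]] := compact_EVT_max ne cKK (_ : {within _, continuous F}).
  exact: continuous_subspaceT.
rewrite inE => -[/= Kc1 Kc2] Hmax.
exists (vec_mx c1), (vec_mx c2); split=> // k' l' Kk' Kl'.
have := Hmax (mxvec k', mxvec l'); rewrite /F /= !mxvecK; apply.
by rewrite inE; split; rewrite /KK /= mxvecK.
Qed.

(** Let [h = k g l]. Varying only the left factor shows that [h q] is positive, varying only the
    right one that [q h] is, and [rpd_of_products] applies. *)
Lemma cartan_max q g : rpd q -> GR q -> GR g -> exists k l, [/\ KR k, KR l,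
  rpd (k *m g *m l), k *m g *m l *m q = q *m (k *m g *m l) &
  forall k' l', KR k' -> KR l' ->
    \tr (k' *m (k *m g *m l) *m l' *m q) <= \tr (k *m g *m l *m q)].
Proof.
move=> rq Gq Gg; have [k [l [Kk Kl Hmax]]] := max_double_coset g q.
have [[G1 GM GV] _] := points_group iotaR hG.
have KM x y : KR x -> KR y -> KR (x *m y).
  move=> [Gx xx] [Gy yy]; split; first exact: GM.
  by rewrite trmx_mul mulmxA -(mulmxA x) yy mulmx1.
have H k' l' : KR k' -> KR l' ->
    \tr (k' *m (k *m g *m l) *m l' *m q) <= \tr (k *m g *m l *m q).
  move=> Kk' Kl'; have := Hmax (k' *m k) (l *m l'); rewrite !mulmxA; apply; exact: KM.
have K1 : KR 1%:M by split=> //; rewrite trmx1 mulmx1.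
have Gh : GR (k *m g *m l) by case: Kk Kl => ? _ [? _]; apply: (GM) => //; apply: (GM).
exists k, l; move: (k *m g *m l) H Gh => h H Gh.
have [rh hq] : rpd h /\ h *m q = q *m h; last by split.
apply: rpd_of_products => //.
  apply: (rpd_of_max hG hGT); first exact: (GM).
  by move=> k' Gk' kk'; have := H k' 1%:M (conj Gk' kk') K1; rewrite mulmx1 mulmxA.
apply: (rpd_of_max hG hGT); first exact: (GM).
move=> k' Gk' kk'; have := H 1%:M k' K1 (conj Gk' kk'); rewrite mul1mx => le.
by rewrite mulmxA mxtrace_mulC mulmxA [\tr (q *m h)]mxtrace_mulC.
Qed.

End Compactness.

(** * The gain of the trace under a rotation *)

Section TraceGain.
Variables (E : rcfType) (n : nat).
Implicit Types h q N X : 'M[E]_n.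

(** Orthogonality of [1%:M + N] gives [N + N^T = - N N^T], which turns the linear terms into
    quadratic ones. The gain is exactly a quadratic form in [N], so a first-order expansion of [N]
    determines its leading term. *)
Lemma gain_exact h q N : h *m q = q *m h -> (1%:M + N) *m (1%:M + N)^T = 1%:M ->
  \tr ((1%:M + N) *m h *m (1%:M + N)^T *m q) - \tr (h *m q) =
  \tr (N *m h *m N^T *m q - N *m N^T *m h *m q).
Proof.
move=> hq; have tE : (1%:M + N)^T = 1%:M + N^T by rewrite linearD /= trmx1.
rewrite tE !(mulmxDl, mulmxDr) !mul1mx !mulmx1 => H.
have NN : N *m N^T = - (N^T + N).
  move: H; move: (N *m N^T) => M /matrixP H; apply/matrixP => i j.
  by have := H i j; rewrite !mxE => {}H; lra.
have e1 : \tr (h *m N^T *m q) = \tr (N^T *m h *m q).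
  by rewrite -mulmxA mxtrace_mulC -!mulmxA hq.
rewrite NN mulNmx mulNmx opprK !mulmxDl !linearD /= e1.
by ring.
Qed.

Lemma tr_expand (a b h a' b' q : 'M[E]_n) :
  \tr ((a - b) *m h *m (a' - b') *m q - (a - b) *m (a' - b') *m h *m q) =
  \tr (a *m h *m a' *m q) - \tr (a *m h *m b' *m q)
  - (\tr (b *m h *m a' *m q) - \tr (b *m h *m b' *m q))
  - (\tr (a *m a' *m h *m q) - \tr (a *m b' *m h *m q)
     - (\tr (b *m a' *m h *m q) - \tr (b *m b' *m h *m q))).
Proof.
have trB (A B : 'M[E]_n) : \tr (A - B) = \tr A - \tr B by exact: raddfB.
have e (B g g' : 'M[E]_n) : (a - b) *m B *m g *m g' = a *m B *m g *m g' - b *m B *m g *m g'.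
  by rewrite !mulmxBl.
rewrite trB !e !mulmxBr !mulmxBl !trB.
by ring.
Qed.

Variables (X h q : 'M[E]_n) (c d : E).
Hypotheses (sh : h^T = h) (sq : q^T = q) (hq : h *m q = q *m h).
Hypotheses (hX : h *m X = c *: (X *m h)) (qX : q *m X = d *: (X *m q)).
Hypotheses (c0 : 0 < c) (c1 : c < 1) (d1 : 1 < d).

Let A1 := \tr (X *m X^T *m h *m q).
Let A2 := \tr (X^T *m X *m h *m q).

Let hXt : h *m X^T = c^-1 *: (X^T *m h).
Proof.
have : X^T *m h = c *: (h *m X^T) by rewrite -{1}sh -trmx_mul hX linearZ /= trmx_mul sh.
by move=> ->; rewrite scalerA mulVf ?scale1r // gt_eqF.
Qed.

Let Xtq : X^T *m q = d *: (q *m X^T).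
Proof. by rewrite -{1}sq -trmx_mul qX linearZ /= trmx_mul sq. Qed.

Lemma weight_trace_eq0 (Y : 'M[E]_n) e : e != 1 -> h *m Y = e *: (Y *m h) -> \tr (Y *m h *m q) = 0.
Proof.
move=> e1 hY; have : \tr (Y *m h *m q) = e * \tr (Y *m h *m q).
  rewrite -mxtraceZ scalemxAl -hY -[RHS]mxtrace_tr -[h *m Y *m q]mulmxA mxtrace_tr.
  by rewrite [RHS]mxtrace_mulC -!mulmxA hq.
move=> /eqP; rewrite -subr_eq0 -[X in X - _]mul1r -mulrBl mulf_eq0 subr_eq0 eq_sym (negPf e1).
by move=> /eqP.
Qed.

Let cX : c ^+ 2 != 1.
Proof. by rewrite lt_eqF // expr_lt1 // ltW. Qed.

Let tXX : \tr (X *m X *m h *m q) = 0.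
Proof.
apply: (weight_trace_eq0 cX).
by rewrite mulmxA hX -scalemxAl -mulmxA hX -scalemxAr scalerA mulmxA.
Qed.

Let tXtXt : \tr (X^T *m X^T *m h *m q) = 0.
Proof.
have c2 : c^-1 ^+ 2 != 1 by rewrite exprVn invr_eq1.
apply: (weight_trace_eq0 c2).
by rewrite mulmxA hXt -scalemxAl -mulmxA hXt -scalemxAr scalerA mulmxA.
Qed.

Let A2E : A2 = A1 / (c * d).
Proof.
have e1 : \tr (X *m h *m X^T *m q) = c^-1 * A1.
  by rewrite -[X *m h *m X^T]mulmxA hXt -scalemxAr -scalemxAl mxtraceZ mulmxA.
have e2 : \tr (X *m h *m X^T *m q) = d * A2.
  rewrite -mulmxA Xtq -scalemxAr mxtraceZ; congr (_ * _).
  by rewrite mulmxA mxtrace_mulC !mulmxA.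
have d0 : d != 0 by rewrite gt_eqF // (lt_trans ltr01).
have cn0 : c != 0 by rewrite gt_eqF.
by apply: (mulfI d0); rewrite -e2 e1 invfM; field; apply/andP.
Qed.

(* Leading coefficient of the gain along the rotation generated by X - X^T. *)
Lemma gain_leading : \tr ((X - X^T) *m h *m (X - X^T)^T *m q - (X - X^T) *m (X - X^T)^T *m h *m q) =
  A1 * (c^-1 - 1) * (1 - d^-1).
Proof.
have tE : (X - X^T)^T = X^T - X by rewrite linearB /= trmxK.
rewrite tE tr_expand.
have e1 : \tr (X *m h *m X^T *m q) = c^-1 * A1.
  by rewrite -[X *m h *m X^T]mulmxA hXt -scalemxAr -scalemxAl mxtraceZ mulmxA.
have e2 : \tr (X^T *m h *m X *m q) = c * A2.
  by rewrite -[X^T *m h *m X]mulmxA hX -scalemxAr -scalemxAl mxtraceZ mulmxA.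
have e3 : \tr (X *m h *m X *m q) = 0.
  by rewrite -[X *m h *m X]mulmxA hX -scalemxAr -scalemxAl mxtraceZ mulmxA tXX mulr0.
have e4 : \tr (X^T *m h *m X^T *m q) = 0.
  by rewrite -[X^T *m h *m X^T]mulmxA hXt -scalemxAr -scalemxAl mxtraceZ mulmxA tXtXt mulr0.
rewrite e1 e2 e3 e4 tXX tXtXt -/A1 -/A2 A2E.
have d0 : d != 0 by rewrite gt_eqF // (lt_trans ltr01).
have cn0 : c != 0 by rewrite gt_eqF.
by field; apply/andP.
Qed.

(** In the application [c] and [d] are the values at [h] and [q] of the character of a root with
    root vector [X]. [A1] is the squared norm of [z *m X], where [z] is the square root of
    [h *m q]. *)
Lemma gain_positive : X != 0 -> rpd (h *m q) ->
  0 < \tr ((X - X^T) *m h *m (X - X^T)^T *m q - (X - X^T) *m (X - X^T)^T *m h *m q).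
Proof.
move=> X0 rhq; rewrite gain_leading; have [z [rz zz _]] := rpd_sqrt rhq.
have A1p : 0 < A1.
  rewrite /A1 -mulmxA -zz mxtrace_mulC.
  have -> : z *m z *m (X *m X^T) = z *m ((z *m X) *m X^T) by rewrite !mulmxA.
  rewrite mxtrace_mulC -(mulmxA (z *m X)).
  have -> : X^T *m z = (z *m X)^T by rewrite trmx_mul rz.1.
  apply: mxtrace_mulmxtr.
  by apply: contraNneq X0 => E0; rewrite -[X](mulKmx (rpd_unit rz)) E0 mulmx0.
by rewrite !mulr_gt0 // subr_gt0 ?invf_lt1 ?invf_gt1 // (lt_trans ltr01).
Qed.

End TraceGain.

Section GainForm.
Variables (E : rcfType) (n : nat) (h q : 'M[E]_n).

(** The polarization of the quadratic form in [gain_exact], for substituting an expansion of [N]. *)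
Definition gainB (a b : 'M[E]_n) := a *m h *m b^T *m q - a *m b^T *m h *m q.

Lemma gainBDl a a' b : gainB (a + a') b = gainB a b + gainB a' b.
Proof. by rewrite /gainB !mulmxDl opprD addrACA. Qed.

Lemma gainBDr a b b' : gainB a (b + b') = gainB a b + gainB a b'.
Proof.
have -> : gainB a (b + b') = a *m h *m (b^T + b'^T) *m q - a *m (b^T + b'^T) *m h *m q.
  by rewrite -linearD.
by rewrite /gainB !mulmxDr !mulmxDl opprD addrACA.
Qed.

Lemma gainBZ u v a b : gainB (u *: a) (v *: b) = (u * v) *: gainB a b.
Proof.
have -> : gainB (u *: a) (v *: b) = (u *: a) *m h *m (v *: b^T) *m q - (u *: a) *m (v *: b^T) *m h *m q.
  by rewrite -linearZ.
rewrite /gainB scalerBr; congr (_ - _).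
  by rewrite -!scalemxAl -scalemxAr -scalemxAl scalerA.
by rewrite -!scalemxAl -scalemxAr -!scalemxAl scalerA.
Qed.

Lemma gainB_split u a b : gainB (u *: a + b) (u *: a + b) - (u * u) *: gainB a a =
  gainB (u *: a) b + gainB b (u *: a) + gainB b b.
Proof.
rewrite gainBDl !gainBDr gainBZ; move: (gainB a a) (gainB _ b) (gainB b _) (gainB b b) => A B C D.
by apply/matrixP => i j; rewrite !mxE; ring.
Qed.

End GainForm.

Section Improve.
Variables (K : rcfType) (R : realType) (iotaR : {rmorphism K -> R}) (n : nat).
Variables (G : seq (MPoly[K]_(n * n))).
Hypotheses (hG : alg_subgroup_SL G) (hGT : self_adjoint G).
Local Notation GR := (points iotaR G).

Lemma trace_bound (Z : 'M[R]_n) B : mbound B Z -> `|\tr Z| <= n%:R * B.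
Proof.
move=> H; apply: le_trans (ler_norm_sum _ _ _) _.
rewrite -[n in n%:R]card_ord mulr_natl -sumr_const; apply: ler_sum => i _; exact: H.
Qed.

(** The bound is independent of [p], as is needed to estimate [p - 1] by [p^2 - 1]. Since [P] is
    merely invertible, the entries of [w] are bounded through the trace of [w *m w^T], at most [n]
    because the eigenvalues of [w] lie between 0 and 1. *)
Lemma rpd_resolvent_bound (p : 'M[R]_n) : rpd p -> exists2 w, (p + 1%:M) *m w = 1%:M & mbound n.+1%:R w.
Proof.
move=> [sp [P [d [Pu d0 pE]]]].
have e : spec P (map_mx (fun x => x + 1) d) = p + 1%:M.
  rewrite pE -(spec1 Pu) /spec -mulmxDl -mulmxDr -raddfD /=; congr (_ *m diag_mx _ *m _).
  by apply/rowP => i; rewrite !mxE.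
have s1 : (spec P (map_mx (fun x => (x + 1)^-1) d))^T = spec P (map_mx (fun x => (x + 1)^-1) d).
  by apply: spec_sym => //; rewrite -pE.
exists (spec P (map_mx (fun x => (x + 1)^-1) d)).
  rewrite -e specM // -(spec1 Pu); congr spec; apply/rowP => i.
  by rewrite !mxE mulfV // gt_eqF // ltr_wpDl // ltW.
move=> i j; move: s1; set w := spec _ _ => s1.
have le1 : \tr (w *m w^T) <= n%:R.
  rewrite s1 specM // spec_trace // -[n in n%:R]card_ord -sumr_const; apply: ler_sum => k _.
  rewrite !mxE -expr2 exprVn invf_le1 ?exprn_gt0 //; last by rewrite ltr_wpDl // ltW.
  by rewrite exprn_ege1 // lerDr ltW.
have le2 : w i j ^+ 2 <= n%:R.
  apply: le_trans le1; rewrite /mxtrace (bigD1 i) //= [X in X + _]mxE (bigD1 j) //= [w^T j i]mxE -expr2.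
  rewrite -addrA lerDl addr_ge0 //; first by apply: sumr_ge0 => k _; rewrite [w^T k i]mxE -expr2 sqr_ge0.
  by apply: sumr_ge0 => k _; apply: mulmxtr_diag_ge0.
rewrite -(@ler_pXn2r _ 2) ?nnegrE // real_normK ?num_real //; apply: le_trans le2 _.
by rewrite -natrX ler_nat; nia.
Qed.

(* The polar part of exp (tX) is a rotation tangent to (X - X^T) / 2 at t = 0. *)
Lemma polar_expansion X : Lie GR X -> exists N : R -> 'M[R]_n,
  [/\ forall t, GR (1%:M + N t), forall t, (1%:M + N t) *m (1%:M + N t)^T = 1%:M &
      Oh 2 (fun t => N t - (t / 2) *: (X - X^T))].
Proof.
move=> LX.
have /choice[p Hp] : forall t, exists p, rpd p /\ exists u, [/\ GR u, u *m u^T = 1%:M & expmx (t *: X) = p *m u].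
  by move=> t; have [p [u [rp _ Gu uu xE]]] := points_polar hG hGT (LX t); exists p; split=> //; exists u.
have /choice[u Hu] : forall t, exists u, [/\ GR u, u *m u^T = 1%:M & expmx (t *: X) = p t *m u].
  by move=> t; have [] := Hp t.
have rp t : rpd (p t) by have [] := Hp t.
exists (fun t => u t - 1%:M).
have uE t : 1%:M + (u t - 1%:M) = u t by rewrite addrC subrK.
split=> [t|t|]; rewrite ?uE; [by have [] := Hu t|by have [] := Hu t|].
pose x t := expmx (t *: X).
have Ox2 : Oh 2 (fun t => x t - (1%:M + t *: X)) by exact: expmx_Oh2.
have Ox1 : Oh 1 (fun t => x t - 1%:M).
  apply: Oh_ext (OhD (Oh_weak (isT : (1 <= 2)%N) Ox2) (Oh_lin X)) => t _.
  by rewrite opprD addrA subrK.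
have Oxx2 : Oh 2 (fun t => x t *m (x t)^T - 1%:M - t *: (X + X^T)).
  have O11 := OhM Ox1 (Oh_tr Ox1).
  apply: Oh_ext (OhD O11 (OhD Ox2 (Oh_tr Ox2))) => t _.
  move: (x t) => y; rewrite !linearB !linearD /= !linearZ /= !trmx1 !(mulmxBl, mulmxBr) !mul1mx !mulmx1.
  move: (y *m y^T) y^T X^T => m1 m2 m3.
  by apply/matrixP => i j; rewrite !mxE; ring.
have Oxx1 : Oh 1 (fun t => x t *m (x t)^T - 1%:M).
  apply: Oh_ext (OhD (Oh_weak (isT : (1 <= 2)%N) Oxx2) (Oh_lin (X + X^T))) => t _.
  by rewrite subrK.
have pp t : p t *m p t = x t *m (x t)^T.
  have [_ uu xE] := Hu t; rewrite /x xE trmx_mul (rp t).1 mulmxA -(mulmxA (p t)) uu.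
  by rewrite mulmx1.
have /choice[w Hw] : forall t, exists w, (p t + 1%:M) *m w = 1%:M /\ mbound n.+1%:R w.
  by move=> t; have [w ? ?] := rpd_resolvent_bound (rp t); exists w.
have Ow : Oh 0 w.
  by exists n.+1%:R => // t _; rewrite expr0 mulr1; have [] := Hw t.
have Op1 : Oh 1 (fun t => p t - 1%:M).
  apply: Oh_ext (OhM Oxx1 Ow) => t _; rewrite -pp.
  have -> : p t *m p t - 1%:M = (p t - 1%:M) *m (p t + 1%:M).
    by rewrite mulmxBl !mulmxDr !mul1mx !mulmx1 addrKA.
  by have [w1 _] := Hw t; rewrite -mulmxA w1 mulmx1.
have Op2 : Oh 2 (fun t => p t - 1%:M - (t / 2) *: (X + X^T)).
  have Opp := OhM Op1 Op1.
  apply: Oh_ext (OhM (Oh_cst ((2^-1)%:M)) (OhB Oxx2 Opp)) => t _; rewrite -pp mul_scalar_mx.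
  rewrite !(mulmxBl, mulmxBr) !mul1mx !mulmx1; move: (p t *m p t) (p t) X^T => m1 m2 m3.
  by apply/matrixP => i j; rewrite !mxE; field.
have Ou0 : Oh 0 u.
  by exists 1 => // t _ i j; rewrite expr0 mulr1; apply: orth_entry; have [] := Hu t.
(* The orthogonal part is at first only bounded; the identity [NE] raises the estimate of
   [u t - 1%:M] to order 1, and a second use of it gives the expansion up to order 2. *)
have ON0 : Oh 0 (fun t => u t - 1%:M) by apply: OhB => //; exact: Oh_cst.
have NE t : u t - 1%:M = (x t - 1%:M) - (p t - 1%:M) - (p t - 1%:M) *m (u t - 1%:M).
  have [_ _ xE] := Hu t; rewrite /x xE !(mulmxBl, mulmxBr) !mul1mx !mulmx1.
  move: (p t *m u t) (p t) (u t) => m1 m2 m3; apply/matrixP => i j; rewrite !mxE.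
  by ring.
have ON1 : Oh 1 (fun t => u t - 1%:M).
  apply: Oh_ext (OhB (OhB Ox1 Op1) (OhM Op1 ON0)) => t _; exact: esym (NE t).
apply: Oh_ext (OhB (OhB Ox2 Op2) (OhM Op1 ON1)) => t _; rewrite [in RHS]NE.
move: ((p t - 1%:M) *m (u t - 1%:M)) (x t) (p t) X^T => m1 m2 m3 m4.
by apply/matrixP => i j; rewrite !mxE; field.
Qed.

(** With [N = (t / 2) Y + O(t^2)] the gain is [(t / 2)^2 kap + O(t^3)] with [kap] positive; [t] is
    chosen so small that the error is below the main term. *)
Lemma improve X h q c d : Lie GR X -> X != 0 -> rpd h -> rpd q -> h *m q = q *m h ->
  h *m X = c *: (X *m h) -> q *m X = d *: (X *m q) -> 0 < c -> c < 1 -> 1 < d ->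
  exists l, [/\ GR l, l *m l^T = 1%:M & \tr (h *m q) < \tr (l *m h *m l^T *m q)].
Proof.
move=> LX X0 rh rq hq hX qX c0 c1 d1; have [N [GN N1 ON]] := polar_expansion LX.
pose Y := X - X^T; pose kap := \tr (Y *m h *m Y^T *m q - Y *m Y^T *m h *m q).
have kap0 : 0 < kap.
  by apply: (gain_positive rh.1 rq.1 hq hX qX c0 c1 d1 X0); apply: rpd_mul.
have [C C0 HC] : Oh 3 (fun t => gainB h q (N t) (N t) - (t / 2 * (t / 2)) *: gainB h q Y Y).
  have [r NE Or] : exists2 r : R -> 'M[R]_n, (forall t, N t = (t / 2) *: Y + r t) & Oh 2 r.
    by exists (fun t => N t - (t / 2) *: Y) => // t; rewrite addrC subrK.
  have OY : Oh 1 (fun t => (t / 2) *: Y).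
    by apply: Oh_ext (Oh_lin (2^-1 *: Y)) => t _; rewrite scalerA.
  have B (f g : R -> 'M[R]_n) k l : Oh k f -> Oh l g -> Oh (k + l) (fun t => gainB h q (f t) (g t)).
    move=> Of Og; have Ogt := Oh_tr Og; apply: OhB.
      have := OhM (OhM (OhM Of (Oh_cst h)) Ogt) (Oh_cst q).
      by rewrite !addn0.
    have := OhM (OhM (OhM Of Ogt) (Oh_cst h)) (Oh_cst q).
    by rewrite !addn0.
  apply: Oh_ext (OhD (OhD (B _ _ _ _ OY Or) (B _ _ _ _ Or OY)) (Oh_weak (isT : (3 <= 4)%N) (B _ _ _ _ Or Or))) => t _.
  by rewrite NE -gainB_split.
have [t [t0 t1 Ct]] := small_pos (mulr_ge0 (ler0n R n) C0) (divr_gt0 kap0 (ltr0n R 4)).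
exists (1%:M + N t); split=> //; rewrite -subr_gt0 (gain_exact hq (N1 t)).
have := trace_bound (HC t _); rewrite (ltW t0) t1 => /(_ isT).
rewrite -/(gainB h q (N t) (N t)); move: (gainB h q (N t) (N t)) => W; rewrite linearB linearZ /= -/kap => le.
have t2 : 0 < t ^+ 2 by rewrite exprn_gt0.
have : n%:R * (C * t ^+ 3) < t ^+ 2 * (kap / 4).
  rewrite exprS; have -> : n%:R * (C * (t * t ^+ 2)) = t ^+ 2 * (n%:R * C * t) by ring.
  by rewrite ltr_pM2l.
move: le; rewrite ler_norml => /andP[le _] lt'; have e : t / 2 * (t / 2) * kap = t ^+ 2 * (kap / 4) by field.
by rewrite e in le; lra.
Qed.

End Improve.

Lemma comm_spec_coarser (L : fieldType) n (P x : 'M[L]_n) (a b : 'rV[L]_n) : P \in unitmx ->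
  (forall i j, (P *m x *m invmx P) i j != 0 -> a 0 i = a 0 j -> b 0 i = b 0 j) ->
  x *m spec P a = spec P a *m x -> x *m spec P b = spec P b *m x.
Proof.
move=> Pu H xa.
have [y yE xE] : exists2 y, y = P *m x *m invmx P & x = invmx P *m y *m P.
  by exists (P *m x *m invmx P) => //; rewrite !mulmxA mulVmx // mul1mx mulmxKV.
rewrite -yE in H; rewrite xE in xa *; clear x xE yE.
have ab (c : 'rV[L]_n) : (invmx P *m y *m P) *m spec P c = spec P c *m (invmx P *m y *m P) <->
    y *m diag_mx c = diag_mx c *m y.
  rewrite /spec; split=> [/(congr1 (fun Z => P *m Z *m invmx P))|E].
    by rewrite !mulmxA mulmxV // !mul1mx !mulmxK.
  by rewrite !mulmxA !mulmxK // -!(mulmxA (invmx P)) E.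
move/ab: xa => xa; apply/ab.
apply/matrixP => i j; have /matrixP/(_ i j) := xa.
rewrite !mul_mx_diag !mul_diag_mx !mxE.
have [->|y0] := eqVneq (y i j) 0; first by rewrite !mulr0 !mul0r.
by rewrite mulrC => /(mulIf y0) E; rewrite (H i j y0 (esym E)) mulrC.
Qed.

(** A point inside the open Weyl chamber: by independence the matrix of the values of [Delta] on a
    basis has full column rank, so these values can be prescribed. *)
Lemma free_dual_point (R : realType) n (a : {vspace 'M[R]_n}) (Delta : seq (dual a)) :
  free Delta -> exists u : subvs_of a, forall al, al \in Delta -> al u = 1.
Proof.
move=> fD; pose X := vbasis (fullv : {vspace subvs_of a}).
pose M : 'M[R]_(\dim (fullv : {vspace subvs_of a}), size Delta) :=
  \matrix_(i, j) ((nth 0 Delta j) X`_i : R).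
have free_tr : row_free M^T.
  rewrite -kermx_eq0; apply/rowV0P => v /sub_kermxP vM; apply/rowP => j; rewrite [RHS]mxE.
  have /freeP := fD : free (in_tuple Delta); apply.
  apply/lfunP => u; rewrite [RHS]lfunE /= (coord_vbasis (memvf u)) linear_sum /= big1 // => i _.
  rewrite linearZ /= sum_lfunE; apply/eqP; rewrite scaler_eq0; apply/orP; right; apply/eqP.
  have E0 := congr1 (fun Z : 'rV[R]__ => Z 0 i) vM; rewrite mxE [RHS]mxE in E0.
  by apply: etrans E0; apply: eq_bigr => k _; rewrite scale_lfunE !mxE.
have fullM : row_full M.
  by move: free_tr; rewrite /row_free /row_full mxrank_tr.
have /submxP[D DE] : ((const_mx 1 : 'rV[R]_(size Delta)) <= M)%MS by apply: submx_full.
exists (\sum_i D 0 i *: X`_i) => al alD; rewrite linear_sum /=.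
have jD : (index al Delta < size Delta)%N by rewrite index_mem.
have := congr1 (fun Z : 'rV[R]__ => Z 0 (Ordinal jD)) DE; rewrite mxE [RHS]mxE => ->.
by apply: eq_bigr => i _; rewrite linearZ /= mxE nth_index.
Qed.

(** * The decomposition over [K] and over its extensions *)

Section Cartan.
Variables (K : rcfType) (R : realType) (iotaR : {rmorphism K -> R}) (n : nat).
Variables (G S : seq (MPoly[K]_(n * n))) (A : sa_formula K n) (a : {vspace 'M[R]_n}).
Hypotheses (hG : alg_subgroup_SL G) (hGT : self_adjoint G).
Hypotheses (hS : maximal_split_torus G S) (hSsym : forall s, Cpoints S s -> s = s^T).
Hypothesis hA : sa_component (points idfun S) 1%:M (sa_ext idfun A).
Hypothesis ha : forall H : 'M[R]_n, H \in a <-> Lie (sa_ext iotaR A) H.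
Variables (Sigma Delta : seq (dual a)) (chi : dual a -> MPoly[K]_(n * n)).
Hypothesis hSigma : forall alpha : dual a,
  alpha \in Sigma <-> is_root (Lie (points iotaR G)) alpha.
Hypothesis DS : {subset Delta <= Sigma}.
Hypothesis freeD : free Delta.
Hypothesis hchiexp : forall alpha, alpha \in Sigma -> forall H : subvs_of a,
  mxeval iotaR (chi alpha) (expmx (vsval H)) = expR (alpha H).
Local Notation AR := (sa_ext iotaR A).
Local Notation V b := (MVar K n b).
Local Notation chiE f alpha x := (mxeval f (chi alpha) x).

Let hSt : split_torus S. Proof. by case: hS. Qed.
Let hSG : Cpoints S `<=` Cpoints G. Proof. by case: hS. Qed.

Lemma expmx_spec1 (P : 'M[R]_n) (d : 'rV[R]_n) : P \in unitmx ->
  expmx (spec P d) = spec P (map_mx expR d).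
Proof.
move=> Pu; rewrite -[spec P d]scale1r expmx_spec //; congr spec; apply/rowP => i.
by rewrite !mxE mul1r.
Qed.

(** The point [u0] of the chamber may annihilate a difference of eigenvalues that is nonzero on [a];
    moving it slightly towards the generic [Hg] gives its exponential the centralizer of all of
    [A]. *)
Lemma regular_element_real : exists q, [/\ AR q, forall al, al \in Delta -> 1 < chiE iotaR al q &
  forall x, x *m q = q *m x -> forall s, AR s -> x *m s = s *m x].
Proof.
have asym X : X \in a -> X^T = X by apply: (a_sym hSt hSsym hA ha).
have acomm X X' : X \in a -> X' \in a -> X *m X' = X' *m X by apply: (a_comm hSt hSsym hA ha).
have [P [lam [Pu lamlin aspec]]] := codiag_space asym acomm.
have [u0 Hu0] := free_dual_point freeD.
pose e (p : 'I_n * 'I_n) X := lam X 0 p.1 - lam X 0 p.2.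
have elin p c X X' : e p (c *: X + X') = c * e p X + e p X'.
  by rewrite /e !lamlin; ring.
pose s := [seq e p | p <- enum {: 'I_n * 'I_n}].
have [|||Hg Hga Hgg] := @generic_vec R 'M[R]_n (mem a) s.
- exact: mem0v.
- by move=> c X X' Xa X'a; apply: memvD => //; apply: memvZ.
- move=> i c X X'; have [si|si] := ltnP i (size s); last by rewrite !nth_default // mulr0 addr0.
  case: (enum {: 'I_n * 'I_n}) @s si => [|d l] s //; rewrite size_map => si.
  by rewrite (nth_map d) // elin.
have gen p : e p Hg = 0 -> forall X, X \in a -> e p X = 0.
  move=> E X Xa; have ins : p \in enum {: 'I_n * 'I_n} by rewrite mem_enum.
  have sE : nth (fun=> 0) s (index p (enum {: 'I_n * 'I_n})) = e p.
    by rewrite /s (nth_map p) ?index_mem // nth_index.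
  by have := Hgg (index p (enum {: 'I_n * 'I_n})); rewrite sE => /(_ E X Xa).
have [d d0 Hd] := avoid [seq (e p (vsval u0), e p Hg) | p <- enum {: 'I_n * 'I_n}].
pose T := \sum_(al <- Delta) `|al (vsproj a Hg)|.
have T0 : 0 <= T by exact: sumr_ge0.
(* Below [d], for generic position; and with [ep * T < 1], to keep every simple root positive at
   [U], where [u0] contributes 1. *)
pose ep := Num.min (d / 2) (1 + T)^-1.
have ep0 : 0 < ep by rewrite lt_min divr_gt0 //= invr_gt0 ltr_pwDl.
have epd : ep < d by rewrite gt_min ltr_pdivrMr // mulr_natr mulr2n ltrDl d0.
have epT : ep * T < 1.
  have le : ep <= (1 + T)^-1 by rewrite ge_min lexx orbT.
  apply: le_lt_trans (ler_wpM2r T0 le) _.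
  by rewrite mulrC ltr_pdivrMr ?ltr_pwDl // mul1r ltr_pwDl.
pose U := ep *: vsproj a Hg + u0.
have UE : vsval U = ep *: Hg + vsval u0 by rewrite linearP /= vsprojK.
have Ua : vsval U \in a by exact: subvsP.
exists (expmx (vsval U)); split; first exact: (expmx_a ha).
  move=> al alD; rewrite hchiexp ?DS // expR_gt1 /U linearP /= Hu0 //.
  have le : `|al (vsproj a Hg)| <= T.
    by rewrite /T (big_rem al) //= lerDl; apply: sumr_ge0.
  have : - (ep * T) <= ep * al (vsproj a Hg).
    rewrite -mulrN ler_wpM2l ?(ltW ep0) // lerNl; apply: le_trans le.
    by rewrite -normrN ler_norm.
  rewrite -[_ *: _]/(ep * al (vsproj a Hg)).
  by move: epT; set w := ep * T; set z := ep * _; lra.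
move=> x xq y Ay; have [P' [d' [P'u _ Xa yE]]] := AR_exp hSt hSsym hA ha Ay.
move: (spec P' d') Xa yE => X Xa ->.
move: xq; rewrite (aspec _ Ua) (aspec _ Xa) !expmx_spec1 //.
apply: comm_spec_coarser => // i j _; rewrite !mxE => /expR_inj E; congr expR.
have e0 : e (i, j) (vsval U) = 0 by rewrite /e /= E subrr.
suff : e (i, j) X = 0 by move=> /eqP; rewrite subr_eq0 => /eqP.
apply: gen Xa; move: e0; rewrite UE elin addrC => e0.
apply/eqP; apply: contraT => eg.
have inS : (e (i, j) (vsval u0), e (i, j) Hg) \in
    [seq (e p (vsval u0), e p Hg) | p <- enum {: 'I_n * 'I_n}].
  by apply/mapP; exists (i, j); rewrite ?mem_enum.
have := Hd ep _ _ inS; rewrite ep0 epd => /(_ isT); rewrite /= e0 eqxx.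
suff nn : (e (i, j) (vsval u0), e (i, j) Hg) <> (0, 0) by move/(_ nn).
by case=> _ /eqP; rewrite (negPf eg).
Qed.

Definition FAnds (s : seq (mform K n)) := foldr (@FAnd K n) (@FTrue K n) s.

Lemma finterp_FAnds (I : eqType) (s : seq I) (F : I -> mform K n) (E : rcfType)
    (f : {rmorphism K -> E}) rho :
  finterp f rho (FAnds (map F s)) <-> forall i, i \in s -> finterp f rho (F i).
Proof.
elim: s => [|i s IH] /=; first by split.
split=> [[Hi /IH Hs] j|H]; first by rewrite inE => /predU1P[->|/Hs].
by split; [apply: H; rewrite mem_head|apply/IH => j js; apply: H; rewrite inE js orbT].
Qed.

(** Required over [K], because maximality of [S] is tested on tori over [K]. *)
Lemma regular_element : exists q : 'M[K]_n, [/\ sa_ext idfun A q,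
  forall al, al \in Delta -> 1 < chiE idfun al q &
  forall x, x *m q = q *m x -> forall s, sa_ext idfun A s -> x *m s = s *m x].
Proof.
pose p : mform K n := FEx 0 (FAnd (FSa A (V 0)) (FAnd
  (FAnds [seq FLt (SNat K n 1) (SPoly (chi al) (V 0)) | al <- Delta])
  (FAll 1 (FImp (FMEq (MMul (V 1) (V 0)) (MMul (V 0) (V 1)))
    (FAll 2 (FImp (FSa A (V 2)) (FMEq (MMul (V 1) (V 2)) (MMul (V 2) (V 1))))))))).
have : finterp iotaR (fun=> 0) p.
  have [q [Aq q1 qc]] := regular_element_real; exists q; split=> //; split; last first.
    by move=> x xq s As; apply: qc.
  by apply/finterp_FAnds => al alD; apply: q1.
move=> /(tarski_transfer iotaR p)[q [Aq [q1 qc]]]; exists q; split=> //.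
  by move=> al alD; have := iffLR (finterp_FAnds _ _ _ _) q1 al alD.
Qed.

(** The root vector exists over [R] only, so the transferred sentence mentions the orthogonal matrix
    that it yields and not the vector. *)
Lemma improve_char (al : dual a) : al \in Sigma -> forall q h : 'M[K]_n,
  sa_ext idfun A q -> sa_ext idfun A h -> 1 < chiE idfun al q -> chiE idfun al h < 1 ->
  exists l, [/\ points idfun G l, l *m l^T = 1%:M &
    \tr (h *m q) < \tr (l *m h *m l^T *m q)].
Proof.
move=> als; pose p : mform K n := FAll 0 (FAll 1 (FImp (FSa A (V 0)) (FImp (FSa A (V 1))
  (FImp (FLt (SNat K n 1) (SPoly (chi al) (V 0))) (FImp (FLt (SPoly (chi al) (V 1)) (SNat K n 1))
  (FEx 2 (FAnd (FPoints G (V 2)) (FAnd (FMEq (MMul (V 2) (MTr (V 2))) (MCst 1%:M))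
    (FLt (STrace (MMul (V 1) (V 0)))
      (STrace (MMul (MMul (MMul (V 2) (V 1)) (MTr (V 2))) (V 0)))))))))))).
have : finterp iotaR (fun=> 0) p.
  move=> q h /= Aq Ah q1 h1; have [al0 [X [X0 LX HX]]] := iffLR (hSigma al) als.
  (* The exponential form of [[H, X] = al(H) X]: the calculus with [expR] is applied to
     [X H = (H - al(H)) X]. *)
  have wt y : AR y -> y *m X = chiE iotaR al y *: (X *m y).
    move=> Ay; have [P [d [Pu yE Xa yexp]]] := AR_exp hSt hSsym hA ha Ay.
    have := HX (vsproj a (spec P d)); rewrite vsprojK //.
    have -> : chiE iotaR al y = expR (al (vsproj a (spec P d))).
      by rewrite -hchiexp // vsprojK // -yexp.
    move: (al (vsproj a (spec P d))) => c E.
    have E2 : X *m spec P d = spec P (map_mx (fun x => x - c) d) *m X.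
      have -> : spec P (map_mx (fun x => x - c) d) = spec P d - c%:M.
        have -> : c%:M = spec P (const_mx c) by rewrite /spec diag_const_mx mul_mx_scalar -scalemxAl mulVmx // scalemx1.
        rewrite /spec -mulmxBl -mulmxBr -raddfB /=; congr (_ *m diag_mx _ *m _).
        by apply/rowP => i; rewrite !mxE.
      by rewrite mulmxBl mul_scalar_mx -E opprB addrC subrK.
    have := spec_intertwine expR Pu Pu E2; rewrite -yE => ->.
    rewrite map_map_mx scalemxAl; congr (_ *m _).
    have -> : map_mx (fun x => expR (x - c)) d = expR (- c) *: map_mx expR d.
      by apply/rowP => i; rewrite !mxE expRD mulrC.
    rewrite yE /spec linearZ /= -scalemxAr -scalemxAl scalerA -expRD subrr expR0.
    by rewrite scale1r.
  have rq := AR_rpd hSt hSsym hA Aq; have rh := AR_rpd hSt hSsym hA Ah.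
  have hq := AR_comm hSt hSsym hA Ah Aq.
  have c0 : 0 < chiE iotaR al h.
    have [P [d [Pu yE Xa ->]]] := AR_exp hSt hSsym hA ha Ah.
    by rewrite -(vsprojK Xa) hchiexp // expR_gt0.
  have [l [Gl ll lt]] := improve hG hGT LX X0 rh rq hq (wt _ Ah) (wt _ Aq) c0 h1 q1.
  by exists l; rewrite /= map_mx1.
move=> /(tarski_transfer iotaR p) H q h Aq Ah q1 h1.
by have [l /= [Gl [ll lt]]] := H q h Aq Ah q1 h1; exists l; split=> //; rewrite ll map_mx1.
Qed.

(** The positivity of [k g l] is transferred through the witness [y]; the maximality, obtained over
    [R] by compactness, is itself first-order. *)
Lemma maximal_coset (q g : 'M[K]_n) : points idfun G q -> rpd q -> points idfun G g ->
  exists (k l y : 'M[K]_n), [/\ points idfun G k /\ k *m k^T = 1%:M, points idfun G l /\ l *m l^T = 1%:M,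
    k *m g *m l = y *m y^T, k *m g *m l *m q = q *m (k *m g *m l) &
    forall k' l', points idfun G k' -> k' *m k'^T = 1%:M -> points idfun G l' -> l' *m l'^T = 1%:M ->
      \tr (k' *m (k *m g *m l) *m l' *m q) <= \tr (k *m g *m l *m q)].
Proof.
move=> Gq rq Gg.
pose hm : mterm K n := MMul (MMul (V 1) (V 0)) (V 2).
pose orth b : mform K n := FMEq (MMul (V b) (MTr (V b))) (MCst 1%:M).
pose p : mform K n := FAll 0 (FImp (FPoints G (V 0)) (FEx 1 (FEx 2 (FEx 3
  (FAnd (FAnd (FPoints G (V 1)) (orth 1)) (FAnd (FAnd (FPoints G (V 2)) (orth 2))
  (FAnd (FMEq hm (MMul (V 3) (MTr (V 3)))) (FAnd (FMEq (MMul hm (MCst q)) (MMul (MCst q) hm))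
  (FAll 4 (FAll 5 (FImp (FPoints G (V 4)) (FImp (orth 4) (FImp (FPoints G (V 5)) (FImp (orth 5)
  (FNot (FLt (STrace (MMul hm (MCst q))) (STrace (MMul (MMul (MMul (V 4) hm) (V 5)) (MCst q))))))))))))))))))).
have : finterp iotaR (fun=> 0) p.
  move=> x Gx; rewrite /= in Gx.
  have Gq' := points_from_K iotaR Gq.
  have rq' : rpd (map_mx iotaR q).
    have [z [rz zz _]] := rpd_sqrt rq.
    have -> : map_mx iotaR q = map_mx iotaR z *m (map_mx iotaR z)^T.
      by rewrite map_trmx -map_mxM rz.1 zz.
    by apply: rpd_mulmxtr; rewrite map_unitmx rpd_unit.
  have [k [l [[Gk kk] [Gl ll] rh hq Hmax]]] := cartan_max hG hGT rq' Gq' Gx.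
  have [y [ry yy _]] := rpd_sqrt rh.
  exists k, l, y; rewrite /= map_mx1; split=> //; split=> //; split; first by rewrite ry.1 yy.
  split=> // k' l'; rewrite /= => Gk' kk' Gl' ll'; apply/negP; rewrite -leNgt.
  exact: (Hmax k' l').
move=> /(tarski_transfer iotaR p) H; have [k [l [y /=]]] := H g Gg.
rewrite !map_mx1 !map_mx_id // => -[Hk [Hl [hy [hq Hmax]]]]; exists k, l, y; split=> //.
move=> k' l' Gk' kk' Gl' ll'; have := Hmax k' l'; rewrite /= => /(_ Gk' kk' Gl' ll') /negP.
by rewrite -leNgt.
Qed.

Lemma cartan_K g : points idfun G g -> exists (k l : 'M[K]_n),
  [/\ points idfun G k /\ k *m k^T = 1%:M, points idfun G l /\ l *m l^T = 1%:M,
    sa_ext idfun A (k *m g *m l) & forall al, al \in Delta -> 1 <= chiE idfun al (k *m g *m l)].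
Proof.
move=> Gg; have [q [Aq q1 qc]] := regular_element.
have AE := component_squares iotaR hSt hSsym idfun hA.
have [[_ GM GV] _] := points_group idfun hG; have [[_ SM SV] _] := points_group idfun hSt.1.
have Gq : points idfun G q.
  by apply: (points_sub hSG); move: Aq; rewrite AE => -[y Sy ->]; apply: (SM).
have rq : rpd q.
  move: (Aq); rewrite AE => -[y Sy qE]; rewrite qE.
  by rewrite -{2}(points_sym hSsym Sy); apply: rpd_mulmxtr; case: (SV _ Sy).
have [k [l [y [[Gk kk] [Gl ll] hy hq Hmax]]]] := maximal_coset Gq rq Gg.
have Gh : points idfun G (k *m g *m l) by apply: (GM) => //; apply: (GM).
have rh : rpd (k *m g *m l).
  have [hu _] := GV _ Gh; move: hu; rewrite hy unitmx_mul => /andP[yu _].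
  exact: rpd_mulmxtr.
exists k, l; move: (k *m g *m l) Gh rh hq Hmax => h Gh rh hq Hmax.
have Ah : sa_ext idfun A h by apply: (central_pd_in_A hG hS AE rq.1 qc).
split=> // al alD; rewrite leNgt; apply/negP => lt1.
have [m [Gm mm]] := improve_char (DS alD) Aq Ah (q1 al alD) lt1.
apply/negP; rewrite -leNgt; apply: Hmax => //.
  exact: points_tr.
by rewrite trmxK; apply: mulmx1C.
Qed.

Theorem cartan_decomposition (F : rcfType) (f : {rmorphism K -> F}) g : points f G g ->
  exists (k l : 'M[F]_n), [/\ points f G k /\ k *m k^T = 1%:M, points f G l /\ l *m l^T = 1%:M,
    sa_ext f A (k *m g *m l) & forall al, al \in Delta -> 1 <= chiE f al (k *m g *m l)].
Proof.
pose hm : mterm K n := MMul (MMul (V 1) (V 0)) (V 2).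
pose orth b : mform K n := FMEq (MMul (V b) (MTr (V b))) (MCst 1%:M).
pose p : mform K n := FAll 0 (FImp (FPoints G (V 0)) (FEx 1 (FEx 2
  (FAnd (FAnd (FPoints G (V 1)) (orth 1)) (FAnd (FAnd (FPoints G (V 2)) (orth 2))
  (FAnd (FSa A hm) (FAnds [seq FNot (FLt (SPoly (chi al) hm) (SNat K n 1)) | al <- Delta]))))))).
have : finterp (idfun : {rmorphism K -> K}) (fun=> 0) p.
  move=> x Gx; rewrite /= in Gx; have [k [l [Hk Hl Ah Hch]]] := cartan_K Gx.
  exists k, l; rewrite /= map_mx1; split=> //; split=> //; split=> //.
  apply/finterp_FAnds => al alD /=; apply/negP; rewrite -leNgt; exact: Hch.
move=> /(tarski_transfer f p) H Gg; have [k [l /=]] := H g Gg.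
rewrite map_mx1 => -[Hk [Hl [Ah /finterp_FAnds Hch]]]; exists k, l; split=> // al alD.
by have /= := Hch al alD => /negP; rewrite -leNgt.
Qed.

End Cartan.

(** * Convex subrings and the stabilizer *)

Section ConvexSubring.
Variables (F : rcfType) (O : set F).
Hypotheses (hO : subring_of O) (hOconvex : order_convex O).

Lemma convex0 : O 0.
Proof. by case: hO => O1 OB _; rewrite -(subrr 1); exact: OB. Qed.

Lemma convexN x : O x -> O (- x).
Proof. by case: hO => _ OB _ Ox; rewrite -sub0r; apply: OB => //; exact: convex0. Qed.

Lemma convexD x y : O x -> O y -> O (x + y).
Proof. by case: hO => _ OB _ Ox Oy; rewrite -[y]opprK; apply: OB => //; exact: convexN. Qed.

Lemma convexM x y : O x -> O y -> O (x * y).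
Proof. by case: hO => _ _; exact. Qed.

Lemma convex_nat m : O m%:R.
Proof.
case: (hO) => O1 _ _; elim: m => [|m IH]; first exact: convex0.
by rewrite -addn1 natrD; exact: convexD.
Qed.

Lemma convex_sum (I : Type) (r : seq I) (P : pred I) (E : I -> F) :
  (forall i, P i -> O (E i)) -> O (\sum_(i <- r | P i) E i).
Proof. by move=> H; elim/big_ind: _ => //; [exact: convex0|exact: convexD]. Qed.

Lemma convex_prod (I : Type) (r : seq I) (P : pred I) (E : I -> F) :
  (forall i, P i -> O (E i)) -> O (\prod_(i <- r | P i) E i).
Proof. by move=> H; elim/big_ind: _ => //; [exact: (convex_nat 1)|exact: convexM]. Qed.

Lemma convexX x m : O x -> O (x ^+ m).
Proof.
by move=> Ox; elim: m => [|m IH]; [exact: (convex_nat 1)|rewrite exprS; exact: convexM].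
Qed.

Lemma convex_norm x y : O y -> `|x| <= y -> O x.
Proof. by move=> Oy; rewrite ler_norml => /andP[]; apply: hOconvex => //; exact: convexN. Qed.

Definition Omx m n : set 'M[F]_(m, n) := [set x | forall i j, O (x i j)].

Lemma Omx_mul m n p (x : 'M[F]_(m, n)) (y : 'M[F]_(n, p)) : Omx x -> Omx y -> Omx (x *m y).
Proof. by move=> Ox Oy i j; rewrite mxE; apply: convex_sum => k _; exact: convexM. Qed.

Lemma Omx_tr m n (x : 'M[F]_(m, n)) : Omx x -> Omx x^T.
Proof. by move=> Ox i j; rewrite mxE. Qed.

Lemma Omx_orth n (x : 'M[F]_n) : x *m x^T = 1%:M -> Omx x.
Proof. by move=> xx i j; apply: (convex_norm (convex_nat 1)); exact: orth_entry. Qed.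

Lemma Omx_det n (x : 'M[F]_n) : Omx x -> O (\det x).
Proof.
move=> Ox; apply: convex_sum => s _; apply: convexM; last exact: convex_prod.
by apply: convexX; apply: convexN; exact: (convex_nat 1).
Qed.

Lemma Omx_inv n (x : 'M[F]_n) : \det x = 1 -> Omx x -> Omx (invmx x).
Proof.
move=> x1 Ox i j; rewrite /invmx unitmxE x1 unitr1 invr1 scale1r mxE.
apply: convexM; first by apply: convexX; apply: convexN; exact: (convex_nat 1).
by apply: Omx_det => k l; rewrite !mxE.
Qed.

Lemma Omx_orthM n (p x q : 'M[F]_n) : p *m p^T = 1%:M -> q *m q^T = 1%:M ->
  Omx (p *m x *m q) <-> Omx x.
Proof.
move=> pp qq; have [Op Oq] := (Omx_orth pp, Omx_orth qq); split=> Ox.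
  have -> : x = p^T *m (p *m x *m q) *m q^T.
    by rewrite -!mulmxA qq mulmx1 mulmxA (mulmx1C pp) mul1mx.
  by apply: Omx_mul; [apply: Omx_mul|]; rewrite //; exact: Omx_tr.
by apply: Omx_mul => //; exact: Omx_mul.
Qed.

Lemma convex_archi (K : rcfType) (R : realType) (iotaR : {rmorphism K -> R})
    (f : {rmorphism K -> F}) (c : K) : O (f c).
Proof.
apply: (convex_norm (convex_nat (Num.bound `|iotaR c|))); rewrite ler_norml.
rewrite -(rmorph_nat f) -rmorphN !rmorph_rcf_le -!(rmorph_rcf_le iotaR) rmorphN rmorph_nat.
by rewrite -ler_norml ltW // archi_boundP.
Qed.

Lemma Omx_trace n (x : 'M[F]_n) c : \tr (x *m x^T) <= c -> O c -> Omx x.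
Proof.
(* The bound [1 + c] avoids a square root: [u ^+ 2 <= c] implies [u <= 1 + c]. *)
move=> le Oc i j; apply: (convex_norm (convexD (convex_nat 1) Oc)).
have sq : x i j ^+ 2 <= c.
  apply: le_trans le; rewrite /mxtrace (bigD1 i) //= mxE (bigD1 j) //= mxE -expr2 -addrA lerDl.
  apply: addr_ge0; apply: sumr_ge0 => k _; first by rewrite mxE -expr2 sqr_ge0.
  by rewrite mxE; apply: sumr_ge0 => l _; rewrite mxE -expr2 sqr_ge0.
have c0 : 0 <= c by apply: le_trans sq; exact: sqr_ge0.
rewrite -real_normK ?num_real // in sq; move: sq (normr_ge0 (x i j)); set u := `|_|.
by move=> sq u0; have := sqr_ge0 (u - 1); lra.
Qed.

Lemma convex_mxeval (K : rcfType) (f : {rmorphism K -> F}) n (p : MPoly[K]_(n * n)) (x : 'M[F]_n) :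
  (forall c, O (f c)) -> Omx x -> O (mxeval f p x).
Proof.
move=> Of Ox; apply: convex_sum => m _; apply: convexM => //.
apply: convex_prod => i _; apply: convexX; case/mxvec_indexP: i => i j.
by rewrite mxvecE.
Qed.

(** For [x >= 1] convexity puts [x^-1] in [O], so [x] is a unit of [O] exactly when it lies in
    [O]. *)
Lemma negval_val0 x : 1 <= x -> negval O x = val0 O <-> O x.
Proof.
move=> x1; have x0 : 0 < x by apply: lt_le_trans x1.
have Ov : O x^-1.
  apply: (convex_norm (convex_nat 1)).
  by rewrite ger0_norm ?invr_ge0 ?(ltW x0) // invf_le1.
have O1 : O 1 by exact: (convex_nat 1).
split=> [E|Ox].
  have : val0 O x^-1.
    by rewrite -E; exists 1; [split; rewrite ?invr1 // oner_eq0|rewrite mulr1].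
  by case=> _ _; rewrite invrK.
apply/seteqP; split=> [_ [u [u0 Ou Ouv] <-]|u [u0 Ou Ouv]].
  split; first exact: mulf_neq0 (invr_neq0 (lt0r_neq0 x0)) u0.
    exact: convexM.
  by rewrite invfM invrK; exact: convexM.
exists (x * u); last by rewrite mulKf ?gt_eqF.
split; first exact: mulf_neq0 (lt0r_neq0 x0) u0.
  exact: convexM.
by rewrite invfM; exact: convexM.
Qed.

Lemma max_inv_ge1 (x : F) : 0 < x -> 1 <= Num.max x x^-1.
Proof.
move=> x0; rewrite le_max; have [//|x1] := leP 1 x.
by rewrite invf_ge1 // ltW.
Qed.

(** Every factor is at least 1, hence at most the product, so convexity passes membership in [O]
    from the product to each maximum, and from there to both its arguments. *)
Lemma mult_norm_convex n (I : eqType) (Sigma : seq I) (chi : I -> 'M[F]_n -> F) x :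
  (forall al, al \in Sigma -> 0 < chi al x) ->
  1 <= mult_norm Sigma chi x /\
  (O (mult_norm Sigma chi x) <->
   forall al, al \in Sigma -> O (chi al x) /\ O (chi al x)^-1).
Proof.
rewrite /mult_norm; elim: Sigma => [|al s IH] pos.
  by rewrite big_nil; split=> //; split=> // _; exact: (convex_nat 1).
have [|h1 hs] := IH; first by move=> be bs; apply: pos; rewrite inE bs orbT.
have c0 : 0 < chi al x by apply: pos; rewrite mem_head.
have m1 := max_inv_ge1 c0; rewrite big_cons.
have m0 : 0 <= Num.max (chi al x) (chi al x)^-1 by apply: le_trans m1.
have p0 : 0 <= \prod_(j <- s) Num.max (chi j x) (chi j x)^-1 by apply: le_trans h1.
split; first exact: mulr_ege1.
split=> [Op be|H].
  have Om : O (Num.max (chi al x) (chi al x)^-1).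
    by apply: (hOconvex convex0 Op) => //; rewrite ler_peMr.
  have Or : O (\prod_(j <- s) Num.max (chi j x) (chi j x)^-1).
    by apply: (hOconvex convex0 Op) => //; rewrite ler_peMl.
  rewrite inE => /predU1P[->|]; last by move: be; apply/hs.
  split; apply: (hOconvex convex0 Om); rewrite ?invr_ge0 ?(ltW c0) // le_max lexx ?orbT //.
apply: convexM; last first.
  by apply/hs => be bs; apply: H; rewrite inE bs orbT.
have [] := H al (mem_head _ _); rewrite /Num.max /Order.max; by case: ifP.
Qed.

End ConvexSubring.

(** * The stabilizer, from a Cartan decomposition and bounds on [A] *)

Section Stabilizer.
Variables (F : rcfType) (O : set F) (n : nat) (G A : set 'M[F]_n).
Variables (I : eqType) (Sigma Delta : seq I) (chi : I -> 'M[F]_n -> F).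
Hypotheses (hO : subring_of O) (hOconvex : order_convex O).
Hypotheses (Ggrp : subgroup G) (GSL : G `<=` @SL F n).
Hypothesis chipos : forall x al, A x -> al \in Sigma -> 0 < chi al x.
Hypothesis AO : forall x, A x ->
  Omx O x <-> forall al, al \in Sigma -> O (chi al x) /\ O (chi al x)^-1.
Hypothesis cartan : forall g, G g -> exists k l,
  [/\ G k /\ k *m k^T = 1%:M, G l /\ l *m l^T = 1%:M, A (k *m g *m l) &
    forall al, al \in Delta -> 1 <= chi al (k *m g *m l)].

Lemma orth_SO k : G k -> k *m k^T = 1%:M -> Kgroup G k.
Proof. by move=> Gk kk; split=> //; split=> //; exact: GSL. Qed.

(** Whichever value [xget] picks satisfies [delta_spec]. Its [g] and [h0] represent the same points
    as [1%:M] and [h], so they differ from these by orthogonal factors, which are absorbed in [p]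
    and [q]. *)
Lemma delta_orth h : G h -> let d := delta G A Delta chi 1%:M (act h 1%:M) in
  A d /\ exists p q, [/\ p *m p^T = 1%:M, q *m q^T = 1%:M & h = p *m d *m q].
Proof.
case: Ggrp => G1 GM GV Gh d.
have dP : delta_spec G A Delta chi 1%:M (act h 1%:M) d.
  apply: (xgetPex 1%:M); have [k [l [[Gk kk] [Gl ll] Ah Dh]]] := cartan Gh.
  have oV (z : 'M[F]_n) : G z -> z *m z^T = 1%:M -> Kgroup G z^T.
    move=> Gz zz; have [zu Gzv] := GV _ Gz; have E : invmx z = z^T.
      by rewrite -[LHS]mulmx1 -zz mulKmx.
    by apply: orth_SO; rewrite -?E // E trmxK; exact: mulmx1C.
  exists (k *m h *m l); split=> //; exists 1%:M, h; split=> //.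
    by rewrite /act trmx1 !mulmx1.
  exists k^T, l^T; split; [exact: oV|exact: oV|].
  rewrite invmx1 mul1mx -!mulmxA ll mulmx1 mulmxA.
  by rewrite (mulmx1C kk) mul1mx.
move: dP; move: d => d [[Ad _] [g [h0 [Gg Gh0 gE hE [k [l [[_ [kk _]] [_ [ll _]] E]]]]]]].
split=> //; rewrite /act !mulmx1 in gE hE.
have [gu _] := GV _ Gg; have [hu _] := GV _ Gh0.
have orthM (x y : 'M[F]_n) : x *m x^T = 1%:M -> y *m y^T = 1%:M -> (x *m y) *m (x *m y)^T = 1%:M.
  by move=> xx yy; rewrite trmx_mul mulmxA -(mulmxA x) yy mulmx1.
exists (g *m k), (l *m (invmx h0 *m h)); split.
- exact: orthM.
- apply: orthM => //; rewrite trmx_mul mulmxA -(mulmxA _ h) hE mulmxA mulVmx // mul1mx.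
  by rewrite -trmx_mul mulVmx // trmx1.
- rewrite -!mulmxA (mulmxA d) (mulmxA k) (mulmxA k) -E.
  by rewrite !mulmxA mulmxV // mul1mx mulmxV // mul1mx.
Qed.

Lemma bdist_entries h : G h ->
  bdist O G A Sigma Delta chi 1%:M (act h 1%:M) = val0 O <-> Omx O h.
Proof.
move=> Gh; have [Ad [p [q [pp qq hE]]]] := delta_orth Gh; rewrite /bdist.
move: (delta _ _ _ _ _ _) Ad hE => d Ad ->; rewrite (Omx_orthM hO hOconvex _ pp qq) AO //.
have [N1 NO] := mult_norm_convex hO hOconvex (fun al als => chipos Ad als).
by rewrite negval_val0.
Qed.

(** By [bdist_entries] the class of the identity is its orbit under the matrices of [G] with entries
    in [O]. These form a group, inverses having entries in [O] because the determinant is 1. *)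
Theorem stabilizer_entries :
  stabilizer G (bclass O G A Sigma Delta chi 1%:M) = [set g | G g /\ Omx O g].
Proof.
case: (Ggrp) => G1 GM GV.
have oP y : bclass O G A Sigma Delta chi 1%:M y <-> exists h, [/\ G h, Omx O h & y = act h 1%:M].
  split=> [[[h Gh <-] /(bdist_entries Gh) Oh]|[h [Gh Oh ->]]]; first by exists h.
  by split; [exists h|apply/bdist_entries].
have act1 (g h : 'M[F]_n) : act g (act h 1%:M) = act (g *m h) 1%:M.
  by rewrite /act !mulmx1 trmx_mul !mulmxA.
apply/seteqP; split=> g [Gg H]; split=> //.
  have O1 : Omx O (1%:M : 'M[F]_n) by apply: (Omx_orth hO hOconvex); rewrite trmx1 mulmx1.
  have : bclass O G A Sigma Delta chi 1%:M (act g 1%:M).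
    by rewrite -H; exists 1%:M => //; apply/oP; exists 1%:M; split; rewrite // /act trmx1 !mulmx1.
  by case=> _ /(bdist_entries Gg).
have [gu Ggv] := GV _ Gg; have Ogv := Omx_inv hO (GSL Gg) H.
apply/seteqP; split=> [_ [y /oP[h [Gh Oh ->]] <-]|y /oP[h [Gh Oh ->]]].
  by apply/oP; exists (g *m h); split; [exact: GM|exact: Omx_mul|exact: act1].
exists (act (invmx g *m h) 1%:M); last by rewrite act1 mulmxA mulmxV // mul1mx.
by apply/oP; exists (invmx g *m h); split=> //; [exact: GM|exact: Omx_mul].
Qed.

End Stabilizer.

Theorem theorem4p19
    (R : realType) (K F : rcfType)
    (iotaR : {rmorphism K -> R}) (iotaF : {rmorphism K -> F})
    (O : set F)
    (hO : subring_of O) (hOconvex : order_convex O) (hOproper : O != setT)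
    (n : nat)
    (G : seq (MPoly[K]_(n * n)))
    (hG : connected_semisimple G) (hGsa : self_adjoint G)
    (S : seq (MPoly[K]_(n * n)))
    (hS : maximal_split_torus G S)
    (hSsym : forall s, Cpoints S s -> s = s^T)
    (A : sa_formula K n)
    (hA : sa_component (points idfun S) 1%:M (sa_ext idfun A))
    (a : {vspace 'M[R]_n})
    (ha : forall H : 'M[R]_n, H \in a <-> Lie (sa_ext iotaR A) H)
    (Sigma : seq (dual a))
    (hSigmauniq : uniq Sigma)
    (hSigma : forall alpha : dual a,
       alpha \in Sigma <-> is_root (Lie (points iotaR G)) alpha)
    (Delta : seq (dual a))
    (hDelta : root_basis Sigma Delta)
    (chi : dual a -> MPoly[K]_(n * n))
    (hchi : forall alpha, alpha \in Sigma -> alg_character S (chi alpha))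
    (hchiexp : forall alpha, alpha \in Sigma -> forall H : subvs_of a,
       mxeval iotaR (chi alpha) (expmx (vsval H)) = expR (alpha H)) :
  let GF := points iotaF G in
  let AF := sa_ext iotaF A in
  let chiF := fun alpha x => mxeval iotaF (chi alpha) x in
  let o := bclass O GF AF Sigma Delta chiF 1%:M in
  stabilizer GF o = [set g | GF g /\ forall i j, O (g i j)].
Proof.
move=> GF AF chiF o; case: (hG) => hGsl _ _; case: (hS) => hSt hSG _; case: hDelta => DS freeD _.
have [Ggrp GSL] := points_group iotaF hGsl.
have AG x : AF x -> GF x.
  rewrite /AF (component_squares iotaR hSt hSsym iotaF hA) => -[y Sy ->].
  have [[_ SM _] _] := points_group iotaF hSt.1.
  by apply: (points_sub hSG); exact: SM.
have Ainv x : AF x -> x *m invmx x = 1%:M.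
  by move=> Ax; have [_ _ GV] := Ggrp; have [xu _] := GV _ (AG _ Ax); rewrite mulmxV.
have cpos := char_pos hSt hSsym hA ha hchiexp.
apply: stabilizer_entries => //.
- by move=> x al Ax als; have [] := cpos _ iotaF al als x _ Ax (Ainv _ Ax).
- move=> x Ax; split=> [Ox al als|H].
    have Of := convex_archi hO hOconvex iotaR iotaF.
    have [c0 cV] := cpos _ iotaF al als x _ Ax (Ainv _ Ax).
    split; first exact: convex_mxeval.
    have -> : (chiF al x)^-1 = chiF al (invmx x).
      by apply: (mulfI (lt0r_neq0 c0)); rewrite mulfV ?lt0r_neq0.
    by apply: convex_mxeval => //; apply: Omx_inv => //; exact: (GSL _ (AG _ Ax)).
  have [m Hm] := tr_bound hG hGsa hSt hSsym hSG hA ha hSigma hchiexp iotaF.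
  have := Hm x _ Ax (Ainv _ Ax); set B := _ * _ => HB.
  have OB : O B.
    apply: convexM => //; first exact: convex_nat.
    apply: convexX => //; apply: convexD => //; first exact: (convex_nat hO 1).
    rewrite big_seq; apply: convex_sum => // al als; have [Oc OcV] := H al als.
    have [c0 cV] := cpos _ iotaF al als x _ Ax (Ainv _ Ax).
    have -> : mxeval iotaF (chi al) (invmx x) = (chiF al x)^-1.
      by apply: (mulfI (lt0r_neq0 c0)); rewrite [RHS]mulfV ?lt0r_neq0.
    exact: convexD.
  exact: Omx_trace HB OB.
- move=> g Gg; exact: (cartan_decomposition hGsl hGsa hS hSsym hA ha hSigma DS freeD hchiexp Gg).
Qed.
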